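(* For any integer $d\geq 2$, there exists a constant $W_d>0$ such that for any $t\in\mathbb N_+$ and any real $W\geq W_dt^{d-1}$, there exists a weighted $t$-design curve on $S^d$ of length $W$ with weight function which is strictly positive at all but finitely many points. For example, fix any $t\in\mathbb N_+$. Define $\alpha=(\alpha_1,\alpha_2,\alpha_3):[0,1]\to S^2$ by $$\alpha_1(s)=\sqrt{1-\alpha_3(s)^2}\cos\left(\frac{\pi\lfloor 2ts\rfloor}{t}+\frac{\pi}{2t}\right),\quad \alpha_2(s)=\sqrt{1-\alpha_3(s)^2}\sin\left(\frac{\pi\lfloor 2ts\rfloor}{t}+\frac{\pi}{2t}\right),$$ $$\alpha_3(s)=(-1)^{\lfloor 2ts\rfloor}\left(4ts-2\lfloor 2ts\rfloor-1\right).$$ Then $\alpha$, paired with the weight function $1/|\alpha'|$, is a weighted $(2t-1)$-design curve on $S^2$ of length $2\pi t$. Moreover, for any continuous map $\theta:[0,1]\to\mathbb R$ which is smooth on the complement of a finite subset of $[0,1]$, whose derivative is $L^1$-integrable, and which satisfies $\theta(1)-\theta(0)\in 2\pi\mathbb Z$, define $\gamma:[0,1]\to S^3\subset\mathbb C^2$ by $$\gamma(s)=\frac{1}{\sqrt 2}\left(\sqrt{1+\alpha_1(r)},\ \frac{\alpha_2(r)-i\alpha_3(r)}{\sqrt{1+\alpha_1(r)}}\right)e^{2\pi i s(2t+1)+i\theta(r)},\qquad r:=4ts-\lfloor 4ts\rfloor.$$ Then $\gamma$, paired with the weight function $1/|\gamma'|$, is a weighted $(4t-1)$-design curve on $S^3\subset\mathbb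 C^2$ of length at least $2\pi\sqrt{4t^4+1}$, with equality for some such $\theta$.
   Context: $\mathbb N_+=\{1,2,\dots\}$. $S^d\subset\mathbb R^{d+1}$ is the unit sphere. $P_t(S^d)$ is the space of restrictions to $S^d$ of real-valued polynomials on $\mathbb R^{d+1}$ of degree at most $t$. $\sigma$ is the uniform measure on $S^d$, normalized so that $\sigma(S^d)=1$. The length of a curve $\gamma:[0,1]\to S^d$ is $\ell(\gamma)=\int_0^1|\gamma'(s)|\,ds$. For a continuous, piecewise smooth, closed curve $\gamma:[0,1]\to S^d$ with finitely many self-intersections and a function $w:[0,1]\to\mathbb R$ (the weight function), the pair $(\gamma,w)$ is a weighted $t$-design curve on $S^d$ if $$\int_0^1 f(\gamma(s))\,w(s)\,|\gamma'(s)|\,ds=\int_{S^d}f\,d\sigma\quad\text{for all } f\in P_t(S^d).$$ Convention: a pair $(\gamma,w)$ for which the speed $|\gamma'|$ is unbounded (so that $\gamma$ need not be piecewise smooth in the given parameterization) is also called a weighted $t$-design curve if it can be reparameterized to produce a pair $(\widetilde\gamma,\widetilde w)$ consisting of a continuous, piecewise smooth, closed curve $\widetilde\gamma:[0,1]\to S^d$ with finitely many self-intersections and a function $\widetilde w:[0,1]\to\mathbb R$ such that $\int_0^1 f(\widetilde\gamma(s))\,\widetilde w(s)\,|\widetilde\gamma'(s)|\,ds=\int_{S^d}f\,d\sigma$ for all $f\in P_t(S^d)$. *)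

(* Defs.v *)
From HB Require Import structures.
From mathcomp Require Import all_boot all_order all_algebra complex.
From mathcomp Require Import all_classical all_reals all_analysis.
From mathcomp Require Import -(notations) mpoly.
Import Order.TTheory GRing.Theory Num.Theory.
Import numFieldNormedType.Exports.

Set Implicit Arguments.
Unset Strict Implicit.
Unset Printing Implicit Defensive.

Local Open Scope classical_set_scope.
Local Open Scope ring_scope.

(* The library norm on row vectors is the sup norm. *)
Definition euclid {R : realType} {n : nat} (v : 'rV[R]_n) : R :=
  Num.sqrt (\sum_i v 0 i ^+ 2).

Definition sphere {R : realType} (d : nat) : set 'rV[R]_d.+1 :=
  [set x | euclid x = 1].
Arguments sphere {R} d _.

Definition borelRn (R : realType) (n : nat) :=
  g_sigma_algebraType (@open 'rV[R]_n).

(* The uniform measure on the sphere is the unique Borel probability measure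
   carried by the sphere and invariant under all orthogonal maps. *)
Definition uniform_on_sphere {R : realType} {d : nat}
    (sigma : probability (borelRn R d.+1) R) : Prop :=
  sigma (sphere d) = 1%E /\
  forall (U : 'M[R]_d.+1) (A : set (borelRn R d.+1)),
    U *m U^T = 1%:M -> measurable A ->
    sigma ((fun x : 'rV[R]_d.+1 => x *m U) @^-1` A) = sigma A.

Definition polyfun {R : realType} {n : nat} (p : mpoly n R)
    (x : 'rV[R]_n) : R :=
  meval (fun i => x 0 i) p.

Section Curves.
Context {R : realType}.

Local Notation I01 := (`[0, 1]%classic : set R).
Local Notation lambda := (@lebesgue_measure R).

(* Curves and weights are total functions on R; only their restrictions to
   [0, 1] matter, since derivatives are only taken inside ]0, 1[ or almost
   everywhere. *)
Definition smooth_off {V : normedModType R} (F : set R) (f : R -> V) : Prop :=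
  forall s : R, 0 < s < 1 -> ~ F s -> forall n : nat, derivable (derive1n n f) s 1.

Definition smooth_off_finite {V : normedModType R} (f : R -> V) : Prop :=
  exists2 F : set R, finite_set F & smooth_off F f.

Definition speed {n : nat} (g : R -> 'rV[R]_n.+1) (s : R) : R :=
  euclid (derive1 g s).

Definition curve_length {n : nat} (g : R -> 'rV[R]_n.+1) : \bar R :=
  (\int[lambda]_(s in I01) (speed g s)%:E)%E.

Definition bounded_speed {n : nat} (g : R -> 'rV[R]_n.+1) : Prop :=
  exists M : R, forall s : R, 0 < s < 1 -> derivable g s 1 -> speed g s <= M.

(* One-sided limits of the derivatives at the breakpoints are not required:
   the curves built below from an angle function that is merely smooth off a
   finite set need not have such limits in any parameterization. *)
Definition piecewise_smooth {n : nat} (g : R -> 'rV[R]_n.+1) : Prop :=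
  [/\ {within I01, continuous g}, smooth_off_finite g & bounded_speed g].

(* The pair (0, 1), at which a closed curve closes up, is not counted. *)
Definition self_intersections {n : nat} (g : R -> 'rV[R]_n.+1) : set (R * R) :=
  [set p | [/\ 0 <= p.1, p.1 < p.2, p.2 <= 1, p <> (0, 1) & g p.1 = g p.2]].

Definition strict_weighted_design_curve {d : nat}
    (sigma : probability (borelRn R d.+1) R) (t : nat)
    (g : R -> 'rV[R]_d.+1) (w : R -> R) : Prop :=
  [/\ forall s, 0 <= s <= 1 -> sphere d (g s),
      piecewise_smooth g,
      g 0 = g 1,
      finite_set (self_intersections g)
    & forall p : mpoly d.+1 R, (msize p <= t.+1)%N ->
        lambda.-integrable I01
          (fun s => (polyfun p (g s) * w s * speed g s)%:E) /\
        (\int[lambda]_(s in I01) (polyfun p (g s) * w s * speed g s)%:E =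
         \int[sigma]_(x in sphere d) (polyfun p x)%:E)%E].

Definition reparameterization (phi : R -> R) : Prop :=
  [/\ {within I01, continuous phi}, phi 0 = 0, phi 1 = 1,
      forall x y, 0 <= x -> x < y -> y <= 1 -> phi x < phi y
    & exists F : set R, [/\ finite_set F, smooth_off F phi
        & forall s, 0 < s < 1 -> ~ F s -> 0 < derive1 phi s]].

Definition weighted_design_curve {d : nat}
    (sigma : probability (borelRn R d.+1) R) (t : nat)
    (g : R -> 'rV[R]_d.+1) (w : R -> R) : Prop :=
  strict_weighted_design_curve sigma t g w \/
  [/\ forall s, 0 <= s <= 1 -> sphere d (g s),
      ~ bounded_speed g
    & exists2 phi : R -> R, reparameterization phi
        & strict_weighted_design_curve sigma t (g \o phi) (w \o phi)].

Definition alpha3 (t : nat) (s : R) : R :=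
  let k := Num.floor (2 * t%:R * s) in
  (-1) ^ k * (4 * t%:R * s - 2 * k%:~R - 1).

Definition alpha_longitude (t : nat) (s : R) : R :=
  pi * (Num.floor (2 * t%:R * s))%:~R / t%:R + pi / (2 * t%:R).

Definition alpha1 (t : nat) (s : R) : R :=
  Num.sqrt (1 - alpha3 t s ^+ 2) * cos (alpha_longitude t s).

Definition alpha2 (t : nat) (s : R) : R :=
  Num.sqrt (1 - alpha3 t s ^+ 2) * sin (alpha_longitude t s).

Definition alpha (t : nat) (s : R) : 'rV[R]_3 :=
  \row_j [:: alpha1 t s; alpha2 t s; alpha3 t s]`_j.

Local Open Scope complex_scope.

Definition expi (x : R) : R[i] := cos x +i* sin x.

Definition real_of_C2 (z : R[i] * R[i]) : 'rV[R]_4 :=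
  \row_j [:: complex.Re z.1; complex.Im z.1; complex.Re z.2; complex.Im z.2]`_j.

Definition gammaC2 (t : nat) (theta : R -> R) (s : R) : R[i] * R[i] :=
  let r := 4 * t%:R * s - (Num.floor (4 * t%:R * s))%:~R in
  let q := Num.sqrt (1 + alpha1 t r) in
  let u := expi (2 * pi * s * (2 * t%:R + 1) + theta r) in
  (((Num.sqrt 2)^-1)%:C * q%:C * u,
   ((Num.sqrt 2)^-1)%:C * ((alpha2 t r -i* alpha3 t r) / q%:C) * u).

Definition gamma (t : nat) (theta : R -> R) (s : R) : 'rV[R]_4 :=
  real_of_C2 (gammaC2 t theta s).

Definition admissible_angle (theta : R -> R) : Prop :=
  [/\ {within I01, continuous theta},
      smooth_off_finite theta,
      lambda.-integrable I01 (fun s => (derive1 theta s)%:E)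
    & exists k : int, theta 1 - theta 0 = 2 * pi * k%:~R].

End Curves.

(* Main.v *)
Require Import Defs.
From HB Require Import structures.
From mathcomp Require Import all_boot all_order all_algebra complex.
From mathcomp Require Import all_classical all_reals all_analysis.
From mathcomp Require Import measurable_realfun ring lra.
From mathcomp Require Import -(notations) mpoly.
Import Order.TTheory GRing.Theory Num.Theory.
Import numFieldNormedType.Exports.
Set Implicit Arguments.
Unset Strict Implicit.
Unset Printing Implicit Defensive.
Local Open Scope classical_set_scope.
Local Open Scope ring_scope.

(* First claim: an integral over the sphere splits into an integral over the latitude and one
   over the equator.  By Tchakaloff's theorem the equator carries at most [(2 t + 1) ^ (d - 1) + 1]
   antipodal pairs of positively weighted nodes that are exact in degree [2 t].  Run from pole to
   pole along the meridians through the nodes, alternately up and down, with a weight that is the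
   density of the latitude times the weight of the node.  Rotating the point at polar angle [psi]
   by [a psi] in the plane of the first two coordinates only rotates the nodes at each latitude,
   so the design property persists, while the length grows continuously from [pi] times the number
   of meridians to infinity with [a].

   Second claim: by Archimedes the height of a uniform point of [S^2] is uniform, and [2 t] equally
   spaced meridians are exact for trigonometric polynomials of degree less than [2 t].

   Third claim: the curve runs [4 t] times through a Hopf lift of [alpha], with phases that are
   equally spaced over each point of the base.  Averaging over these phases leaves the invariants
   of the circle action, which are polynomials of degree at most [2 t - 1] on [S^2].  The projection to
   the base has length [4 pi t^2] in the metric of the quotient and the rotation along the fibres
   adds up to [2 pi], so the length is at least [sqrt ((4 pi t^2)^2 + (2 pi)^2)], with equality when
   the two speeds are proportional.

   Uniform weights on curves of unbounded speed are dealt with by the arclength parameterization. *)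

(** * The fundamental theorem of calculus off a finite set *)

(** The uniform measure is given only by its invariance, so nothing is integrated in coordinates on
    the sphere. All integrals are reduced to moments of monomials, and [moments_unique] shows that
    rotations in the planes through one fixed axis, together with [|x|^2 = 1], determine these. The
    same criterion serves the sphere itself, equally spaced points on the circle and the image of
    the sphere under the Hopf map; the splitting into latitude and equator becomes an identity
    between closed formulas.

    The prescribed parameterizations have speeds that blow up at the poles. Hence a calculus of
    continuous functions that are differentiable off a finite list, in which integrability of an
    unbounded derivative is deduced from its sign.

    Antipodal pairs give an even number of pieces from pole to pole, so that the curve closes, and
    they kill the odd moments. The number of pieces is at most [2 ((2 t + 1) ^ (d - 1) + 1)], hence
    at most [2 (3 ^ (d - 1) + 1) t ^ (d - 1)], which gives the constant. In [gamma] the winding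
    number [2 t + 1] is coprime to [4 t]; this is why the phases of the pieces exhaust the roots of
    unity. *)

Lemma in_itvoo (R : realType) (a b x : R) : (x \in `]a, b[) = (a < x < b).
Proof. by rewrite in_itv. Qed.

Lemma in_itvcc (R : realType) (a b x : R) : (x \in `[a, b]) = (a <= x <= b).
Proof. by rewrite in_itv. Qed.

Lemma measurable_set_seq (R : realType) (l : seq R) :
  measurable ([set` l] : set R).
Proof.
elim: l => [|x l IH]; first by rewrite set_nil.
have -> : [set` x :: l] = x |` [set` l] :> set R.
  by apply/seteqP; split => y /=; rewrite inE => /predU1P.
exact: measurableU.
Qed.

Lemma measurable_fun_seq (R : realType) (l : seq R) (f : R -> R) :
  measurable_fun ([set` l] : set R) f.
Proof.
elim: l => [|x l IH]; first by rewrite set_nil; exact: measurable_fun_set0.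
have -> : [set` x :: l] = x |` [set` l] :> set R.
  by apply/seteqP; split => y /=; rewrite inE => /predU1P.
apply/measurable_funU => //.
  exact: measurable_set_seq.
by split => //; exact: measurable_fun_set1.
Qed.

Lemma measurable_fun_off_seq (R : realType) (a b : R) (l : seq R) (f : R -> R) :
  (forall x, x \in `]a, b[%R -> x \notin l -> {for x, continuous f}) ->
  measurable_fun `[a, b] f.
Proof.
move=> cf.
set D := `]a, b[%classic `&` ~` [set` l].
have oD : open D.
  apply: openI; first exact: interval_open.
  apply: closed_openC; apply: compact_closed; first exact: Rhausdorff.
  apply: finite_compact; exact: finite_seq.
have mD : measurable D by exact: open_measurable.
apply: (@measurable_funS _ _ _ _ (D `|` [set` [:: a, b & l]])).
- apply: measurableU => //; exact: measurable_set_seq.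
- move=> x /=; rewrite in_itv /= => /andP[ax xb].
  have [xl|xl] := boolP (x \in [:: a, b & l]); first by right.
  left; split; rewrite /= ?in_itv /=.
    move: xl; rewrite !inE !negb_or => /and3P[xa xb' _].
    by rewrite !lt_neqAle ax xb eq_sym xa xb'.
  by apply/negP; move: xl; rewrite !inE !negb_or => /and3P[].
apply/measurable_funU => //; first exact: measurable_set_seq.
split; last exact: measurable_fun_seq.
apply: subspace_continuous_measurable_fun => //.
apply: continuous_in_subspaceT => x; rewrite inE => -[xab /negP xl].
exact: cf.
Qed.

Lemma within_continuousW (R : realType) (a b c d : R) (f : R -> R) : a <= c -> d <= b ->
  {within `[a, b], continuous f} -> {within `[c, d], continuous f}.
Proof.
move=> ac db; apply: continuous_subspaceW => x /=; rewrite !in_itv /=.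
by move=> /andP[cx xd]; rewrite (le_trans ac) //= (le_trans xd).
Qed.

Lemma within_continuous_compW (U W : topologicalType) (V : topologicalType) (A : set U) (B : set W)
    (h : U -> W) (f : W -> V) :
  (forall x, A x -> B (h x)) ->
  {within A, continuous h} -> {within B, continuous f} ->
  {within A, continuous (f \o h)}.
Proof.
move=> AB /subspace_continuousP ch /subspace_continuousP cf.
apply/subspace_continuousP => x Ax.
apply: (@cvg_comp _ _ _ h f _ (within B (nbhs (h x)))); last exact: cf (AB _ Ax).
move=> S /= hS; have := ch x Ax _ hS.
by rewrite /nbhs /= => h1; near=> z; apply: (near h1 z) => //; apply: AB; near: z; exact: near_withinT.
Unshelve. all: by end_near.
Qed.

(** Induction on the list of exceptional points: a point inside the interval splits it, and
    continuity of [F] there joins the two halves; a point outside is dropped. *)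
Lemma eq_ends_derive0_off_seq (R : realType) (l : seq R) (a b : R) (F : R -> R) :
  a <= b -> {within `[a, b], continuous F} ->
  (forall x, x \in `]a, b[%R -> x \notin l -> is_derive x 1 F 0) -> F b = F a.
Proof.
elim: l a b => [|e l IH] a b ab cF dF.
  have [//|c _ /eqP] := @MVT_segment R F (fun=> 0) a b ab _ cF.
    by move=> x xab; apply: dF.
  by rewrite mul0r subr_eq0 => /eqP.
have [eab|eab] := boolP (e \in `]a, b[%R).
  move: (eab); rewrite in_itvoo => /andP[ae eb].
  have lae := ltW ae; have leb := ltW eb.
  have cl := within_continuousW (lexx a) leb cF.
  have cr := within_continuousW lae (lexx b) cF.
  have dr x : x \in `]e, b[%R -> x \notin l -> is_derive x 1 F 0.
    rewrite in_itvoo => /andP[ex xb] xl; apply: dF.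
      by rewrite in_itvoo (lt_trans ae ex).
    by rewrite inE negb_or xl andbT gt_eqF.
  have dl x : x \in `]a, e[%R -> x \notin l -> is_derive x 1 F 0.
    rewrite in_itvoo => /andP[ax xe] xl; apply: dF.
      by rewrite in_itvoo ax (lt_trans xe eb).
    by rewrite inE negb_or xl andbT lt_eqF.
  by rewrite (IH e b leb cr dr) (IH a e lae cl dl).
have d' x : x \in `]a, b[%R -> x \notin l -> is_derive x 1 F 0.
  move=> xab xl; apply: dF => //; rewrite inE negb_or xl andbT.
  by apply: contraNneq eab => <-.
exact: (IH a b ab cF d').
Qed.

(** [F] minus the indefinite integral of [f] is continuous with zero derivative off the list. Near
    the exceptional points only integrability of [f] is asked, so [f] may be unbounded there. *)
Lemma FTC2_off_seq (R : realType) (l : seq R) (a b : R) (f F : R -> R) :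
  a <= b -> (@lebesgue_measure R).-integrable `[a, b] (EFin \o f) ->
  {within `[a, b], continuous F} ->
  (forall x, x \in `]a, b[%R -> x \notin l -> {for x, continuous f}) ->
  (forall x, x \in `]a, b[%R -> x \notin l -> is_derive x 1 F (f x)) ->
  (\int[@lebesgue_measure R]_(x in `[a, b]) (f x)%:E = (F b - F a)%:E)%E.
Proof.
move=> ab intf cF cf dF.
set G := fun x : R => (\int[@lebesgue_measure R]_(t in `[a, x]) f t)%R.
have cG : {within `[a, b], continuous G}.
  exact: parameterized_integral_continuous.
have Ga : G a = 0 by rewrite /G set_itv1 Rintegral_set1.
have : (F - G) b = (F - G) a.
  apply: (@eq_ends_derive0_off_seq R l a b) => //.
    by move=> x; apply: (@continuousB _ R^o (subspace `[a, b]) F G); [exact: cF|exact: cG].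
  move=> x xab xl; have := xab; rewrite in_itvoo => /andP[ax xb].
  have [dG GE] := @continuous_FTC1_closed R f a x b xb intf ax (cf _ xab xl).
  have dG' : is_derive x 1 G (f x).
    by apply: DeriveDef; [exact: dG|rewrite -derive1E].
  have dF' := dF _ xab xl.
  have := @is_deriveB _ _ _ F G x 1 _ _ dF' dG'; rewrite subrr; exact.
rewrite /= => /eqP; rewrite !fctE Ga subr0 => /eqP <-.
rewrite opprB addrC subrK /G /Rintegral fineK //.
apply: integrable_fin_num => //.
Qed.

Lemma integrable_itv_cat (R : realType) (a e b : R) (f : R -> R) :
  a <= e -> e <= b ->
  (@lebesgue_measure R).-integrable `[a, e] (EFin \o f) ->
  (@lebesgue_measure R).-integrable `[e, b] (EFin \o f) ->
  (@lebesgue_measure R).-integrable `[a, b] (EFin \o f).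
Proof.
move=> ae eb i1 i2.
have U : `[a, b]%classic = `[a, e]%classic `|` `]e, b]%classic :> set R.
  by rewrite -itv_bndbnd_setU // bnd_simp.
have i3 : (@lebesgue_measure R).-integrable `]e, b] (EFin \o f).
  by apply: integrableS i2 => //; exact: subset_itv_oc_cc.
move/integrableP : i1 => [m1 f1]; move/integrableP : i3 => [m2 f2].
rewrite U; apply/integrableP; split; first exact/measurable_funU.
rewrite ge0_integral_setU //.
- exact: lte_add_pinfty.
- by apply: measurableT_comp => //; apply/measurable_funU.
- rewrite disj_set2E; apply/eqP/seteqP; split => x //= [].
  rewrite !in_itv /= => /andP[_ xe] /andP[ex _].
  by have := le_lt_trans xe ex; rewrite ltxx.
Qed.

(** Monotone convergence along closed intervals that exhaust the open one: on each of them the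
    integral is a difference of values of [F], at most [F b - F a] because [F] increases. This is
    the source of integrability for derivatives that are unbounded at the ends. *)
Lemma ge0_FTC2_oo (R : realType) (a b : R) (f F : R -> R) :
  a < b ->
  {within `[a, b], continuous F} ->
  (forall x, x \in `]a, b[%R -> 0 <= f x) ->
  (forall x, x \in `]a, b[%R -> {for x, continuous f}) ->
  (forall x, x \in `]a, b[%R -> is_derive x 1 F (f x)) ->
  (@lebesgue_measure R).-integrable `[a, b] (EFin \o f).
Proof.
move=> ab cF f0 cf dF.
have mf : measurable_fun `[a, b] f.
  by apply: (@measurable_fun_off_seq R a b [::]) => x xab _; exact: cf.
have mfE : measurable_fun (`]a, b[%classic : set R) f.
  by apply: measurable_funS mf => //; exact: subset_itv_oo_cc.
(* The denominator starts at 3 so that [2 * e i < b - a] and every interval of the exhaustion is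
   nondegenerate. *)
set e := fun i : nat => (b - a) / i.+3%:R.
have e0 i : 0 < e i by rewrite divr_gt0 // subr_gt0.
have e2 i : 2 * e i < b - a.
  rewrite /e mulrA ltr_pdivrMr // mulrC ltr_pM2l ?subr_gt0 //.
  by rewrite ltr_nat.
set D := fun i : nat => `[a + e i, b - e i]%classic : set R.
have subD i : D i `<=` `]a, b[.
  move=> x; rewrite /D /= in_itvoo in_itvcc => /andP[h1 h2].
  have := e0 i; move=> h3; apply/andP; split; lra.
have UD : \bigcup_i D i = `]a, b[%classic.
  apply/seteqP; split=> [x [i _]|x /=]; first exact: subD.
  rewrite in_itvoo => /andP[ax xb].
  have m0 : 0 < Num.min (x - a) (b - x) by rewrite lt_min !subr_gt0 ax xb.
  have [n nP] : exists n : nat, (b - a) / Num.min (x - a) (b - x) < n%:R.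
    exists (Num.truncn ((b - a) / Num.min (x - a) (b - x))).+1.
    exact: truncnS_gt.
  exists n; first by []; rewrite /D /= in_itvcc.
  have : e n < Num.min (x - a) (b - x).
    rewrite /e ltr_pdivrMr // mulrC -ltr_pdivrMr // (lt_trans nP) // ltr_nat.
    by rewrite !ltnS leqW // leqW.
  rewrite lt_min => /andP[h1 h2]; apply/andP; split; lra.
have intD i : (\int[@lebesgue_measure R]_(x in D i) (f x)%:E =
    (F (b - e i))%:E - (F (a + e i))%:E)%E.
  have lei : a + e i < b - e i by have := e2 i; lra.
  apply: continuous_FTC2 => //.
  - apply: continuous_in_subspaceT => x; rewrite inE => /subD /= xab.
    exact: cf.
  - have sub : forall x, a + e i <= x <= b - e i -> x \in `]a, b[%R.
      by move=> x xi; apply: (subD i); rewrite /D /= in_itvcc.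
    split.
    + move=> x; rewrite in_itvoo => /andP[h1 h2].
      have /dF h : x \in `]a, b[%R by apply: sub; rewrite !ltW.
      exact: (@ex_derive _ _ _ _ _ _ _ h).
    + have /dF h : a + e i \in `]a, b[%R by apply: sub; rewrite lexx ltW.
      apply: cvg_at_right_filter; apply: differentiable_continuous.
      apply/derivable1_diffP; exact: (@ex_derive _ _ _ _ _ _ _ h).
    + have /dF h : b - e i \in `]a, b[%R by apply: sub; rewrite lexx ltW.
      apply: cvg_at_left_filter; apply: differentiable_continuous.
      apply/derivable1_diffP; exact: (@ex_derive _ _ _ _ _ _ _ h).
  - move=> x xi; have /dF h : x \in `]a, b[%R.
      apply: (subD i); move: xi; rewrite /D /= in_itvoo in_itvcc => /andP[h1 h2].
      by rewrite !ltW.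
    by rewrite derive1E derive_val.
have monoF x y : a <= x -> x <= y -> y <= b -> F x <= F y.
  move=> ax xy yb; move: xy; rewrite le_eqVlt => /predU1P[->//|xy].
  have sub z : z \in `]x, y[%R -> z \in `]a, b[%R.
    rewrite !in_itvoo => /andP[h1 h2]; apply/andP; split; lra.
  have cxy := within_continuousW ax yb cF.
  have dxy z : z \in `]x, y[%R -> is_derive z 1 F (f z) by move=> /sub; exact: dF.
  have [c {}cxy] := MVT xy dxy cxy.
  move=> h; rewrite -subr_ge0 h mulr_ge0 ?subr_ge0 ?(ltW xy) //.
  exact/f0/sub.
have bnd i : (\int[@lebesgue_measure R]_(x in D i) (f x)%:E <= (F b - F a)%:E)%E.
  rewrite intD -EFinB lee_fin; have h0 := e0 i; have h2 := e2 i.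
  by apply: lerB; apply: monoF; lra.
have : (\int[@lebesgue_measure R]_(x in `]a, b[) (f x)%:E <= (F b - F a)%:E)%E.
  have := @ge0_nondecreasing_set_cvg_integral _ (measurableTypeR R) R D (EFin \o f) (@lebesgue_measure R).
  rewrite UD => h.
  have {}h := h _ _ _ _.
  apply: (@closed_cvg _ _ \oo _ (fun i => \int[@lebesgue_measure R]_(x in D i) (f x)%:E)%E
    (fun y : \bar R => (y <= (F b - F a)%:E)%E)).
  - exact: closed_ereal_ge_ereal.
  - by apply: nearW => i; exact: bnd.
  - apply: h.
    + apply/nondecreasing_seqP => i; rewrite subsetEset => x; rewrite /D /= !in_itvcc.
      have : e i.+1 <= e i.
        by rewrite /e ler_pM2l ?subr_gt0 // lef_pV2 ?posrE // ler_nat.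
      move=> ? /andP[? ?]; apply/andP; split; lra.
    + by move=> i; exact: measurable_itv.
    + move=> i; apply/measurable_EFinP.
      by apply: measurable_funS mfE; [exact: measurable_itv|exact: subD].
    + by move=> i x /subD xab; rewrite lee_fin; exact: f0.
move=> le1; apply/integrableP; split; first exact/measurable_EFinP.
under eq_integral do rewrite -[(_ \o _) _]/((f _)%:E).
rewrite (@integral_itv_bndoo R a b (fun x => `|(f x)%:E|%E) true false); last first.
  by apply: measurableT_comp => //; exact/measurable_EFinP.
apply: le_lt_trans (ltry (F b - F a)); apply: le_trans le1.
rewrite le_eqVlt; apply/orP; left; apply/eqP; apply: eq_integral => x.
by rewrite inE => /= xab; rewrite ger0_norm // f0.
Qed.

Lemma ge0_FTC2_off_seq (R : realType) (l : seq R) (a b : R) (f F : R -> R) :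
  a <= b ->
  {within `[a, b], continuous F} ->
  (forall x, x \in `]a, b[%R -> x \notin l -> 0 <= f x) ->
  (forall x, x \in `]a, b[%R -> x \notin l -> {for x, continuous f}) ->
  (forall x, x \in `]a, b[%R -> x \notin l -> is_derive x 1 F (f x)) ->
  (@lebesgue_measure R).-integrable `[a, b] (EFin \o f).
Proof.
elim: l a b => [|e l IH] a b ab cF f0 cf dF.
  move: ab; rewrite le_eqVlt => /predU1P[->|ab].
    rewrite set_itv1; apply/integrableP; split; first exact: measurable_fun_set1.
    by rewrite integral_set1.
  exact: (ge0_FTC2_oo ab cF (fun x h => f0 x h isT) (fun x h => cf x h isT)
    (fun x h => dF x h isT)).
have [eab|eab] := boolP (e \in `]a, b[%R).
  move: (eab); rewrite in_itvoo => /andP[ae eb].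
  have lae := ltW ae; have leb := ltW eb.
  have cl := within_continuousW (lexx a) leb cF.
  have cr := within_continuousW lae (lexx b) cF.
  apply: (@integrable_itv_cat R a e b f lae leb).
  - have dl x : x \in `]a, e[%R -> x \notin l ->
        [/\ x \in `]a, b[%R & x \notin e :: l].
      rewrite !in_itvoo => /andP[ax xe] xl.
      by rewrite ax (lt_trans xe eb) inE negb_or xl andbT lt_eqF.
    have d0 x xae xl := let: conj h1 h2 := dl x xae xl in f0 x h1 h2.
    have d1 x xae xl := let: conj h1 h2 := dl x xae xl in cf x h1 h2.
    have d2 x xae xl := let: conj h1 h2 := dl x xae xl in dF x h1 h2.
    exact: (IH a e lae cl d0 d1 d2).
  - have dr x : x \in `]e, b[%R -> x \notin l ->
        [/\ x \in `]a, b[%R & x \notin e :: l].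
      rewrite !in_itvoo => /andP[ex xb] xl.
      by rewrite (lt_trans ae ex) xb inE negb_or xl andbT gt_eqF.
    have d0 x xae xl := let: conj h1 h2 := dr x xae xl in f0 x h1 h2.
    have d1 x xae xl := let: conj h1 h2 := dr x xae xl in cf x h1 h2.
    have d2 x xae xl := let: conj h1 h2 := dr x xae xl in dF x h1 h2.
    exact: (IH e b leb cr d0 d1 d2).
have ne x : x \in `]a, b[%R -> x \notin l -> x \notin e :: l.
  move=> xab xl; rewrite inE negb_or xl andbT.
  by apply: contraNneq eab => <-.
exact: (IH a b ab cF (fun x h1 h2 => f0 x h1 (ne x h1 h2))
  (fun x h1 h2 => cf x h1 (ne x h1 h2)) (fun x h1 h2 => dF x h1 (ne x h1 h2))).
Qed.

Lemma integral_EFin_Rintegral (R : realType) (D : set R) (f : R -> R) :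
  measurable D -> (@lebesgue_measure R).-integrable D (EFin \o f) ->
  (\int[@lebesgue_measure R]_(x in D) (f x)%:E)%E =
  (\int[@lebesgue_measure R]_(x in D) f x)%:E.
Proof. by move=> mD intf; rewrite fineK //; exact: integrable_fin_num. Qed.

Lemma RFTC2_off_seq (R : realType) (l : seq R) (a b : R) (f F : R -> R) :
  a <= b -> (@lebesgue_measure R).-integrable `[a, b] (EFin \o f) ->
  {within `[a, b], continuous F} ->
  (forall x, x \in `]a, b[%R -> x \notin l -> {for x, continuous f}) ->
  (forall x, x \in `]a, b[%R -> x \notin l -> is_derive x 1 F (f x)) ->
  \int[@lebesgue_measure R]_(x in `[a, b]) f x = F b - F a.
Proof.
by move=> ab intf cF cf dF; rewrite /Rintegral (FTC2_off_seq ab intf cF cf dF).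
Qed.

Lemma parameterized_integral_off_seq (R : realType) (l : seq R) (a b : R)
    (f : R -> R) : a <= b ->
  (@lebesgue_measure R).-integrable `[a, b] (EFin \o f) ->
  (forall x, x \in `]a, b[%R -> x \notin l -> {for x, continuous f}) ->
  exists F : R -> R, [/\ {within `[a, b], continuous F}, F a = 0,
    F b = \int[@lebesgue_measure R]_(x in `[a, b]) f x,
    (forall x, F x = \int[@lebesgue_measure R]_(t in `[a, x]) f t) &
    forall x, x \in `]a, b[%R -> x \notin l -> is_derive x 1 F (f x)].
Proof.
move=> ab intf cf.
exists (fun x : R => \int[@lebesgue_measure R]_(t in `[a, x]) f t); split => //.
- exact: parameterized_integral_continuous.
- by rewrite set_itv1 Rintegral_set1.
- move=> x xab xl; have := xab; rewrite in_itvoo => /andP[ax xb].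
  have [dG GE] := @continuous_FTC1_closed R f a x b xb intf ax (cf _ xab xl).
  by apply: DeriveDef; [exact: dG|rewrite -derive1E].
Qed.

Lemma is_derive_affine (R : realType) (c d x : R) :
  is_derive x 1 (fun y : R => c * y + d) c.
Proof.
have h : is_derive x 1 (fun y : R => c *: y + d) (c *: 1 + 0).
  by apply: is_deriveD; exact: is_deriveZ.
by move: h; rewrite addr0 /GRing.scale /= mulr1.
Qed.

Lemma is_derive_comp_affine (R : realType) (c d x df : R) (f : R -> R) :
  is_derive (c * x + d) 1 f df -> is_derive x 1 (fun y : R => f (c * y + d)) (df * c).
Proof.
move=> hf; have h := @is_derive1_comp R f (fun y : R => c * y + d) x df c hf (is_derive_affine c d x).
exact: h.
Qed.

Lemma within_continuous_affine (R : realType) (a b a' b' c d : R) (f : R -> R) :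
  0 < c -> c * a' + d = a -> c * b' + d = b ->
  {within `[a, b], continuous f} ->
  {within `[a', b'], continuous (fun x => f (c * x + d))}.
Proof.
move=> c0 ea eb cf.
apply: (@within_continuous_compW _ _ _ `[a', b'] `[a, b] (fun x : R => c * x + d) f) => //.
  move=> x /=; rewrite !in_itvcc => /andP[ax xb].
  by rewrite -ea -eb !lerD2r !ler_pM2l // ax xb.
apply: continuous_in_subspaceT => x _.
apply: differentiable_continuous; apply/derivable1_diffP.
exact: (@ex_derive _ _ _ _ _ _ _ (is_derive_affine c d x)).
Qed.

Lemma within_continuousZl (R : realType) (A : set R) (k : R) (f : R -> R) :
  {within A, continuous f} -> {within A, continuous (fun x => k * f x)}.
Proof.
move=> cf x; apply: (@continuousM R (subspace A) (fun=> k) f); last exact: cf.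
exact: cst_continuous.
Qed.

Lemma continuous_comp_affine (R : realType) (c d x : R) (f : R -> R) :
  {for c * x + d, continuous f} -> {for x, continuous (fun y => f (c * y + d))}.
Proof.
move=> cf; apply: (@continuous_comp _ _ _ (fun y : R => c * y + d) f) => //.
apply: differentiable_continuous; apply/derivable1_diffP.
exact: (@ex_derive _ _ _ _ _ _ _ (is_derive_affine c d x)).
Qed.

(** The substitution is carried out on primitives, [G] becoming [c^-1 * G (c * x + d)].
    Integrability is first obtained for nonnegative functions, where a primitive suffices, and then
    for [f] by domination. *)
Lemma integrable_affine_off_seq (R : realType) (l : seq R) (a b a' b' c d : R)
    (f : R -> R) :
  a' <= b' -> 0 < c -> c * a' + d = a -> c * b' + d = b ->
  (@lebesgue_measure R).-integrable `[a, b] (EFin \o f) ->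
  (forall x, x \in `]a, b[%R -> x \notin l -> {for x, continuous f}) ->
  (@lebesgue_measure R).-integrable `[a', b'] (EFin \o (fun x => f (c * x + d))) /\
  \int[@lebesgue_measure R]_(x in `[a', b']) f (c * x + d) =
  c^-1 * \int[@lebesgue_measure R]_(x in `[a, b]) f x.
Proof.
move=> ab' c0 ea eb intf cf.
have ab : a <= b by rewrite -ea -eb lerD2r ler_pM2l.
have cN0 : c != 0 by rewrite gt_eqF.
set l' := [seq c^-1 * (x - d) | x <- l].
have inl x : x \notin l' -> c * x + d \notin l.
  apply: contraNN => cl; apply/mapP; exists (c * x + d) => //.
  by rewrite addrK mulKf.
have inab x : x \in `]a', b'[%R -> c * x + d \in `]a, b[%R.
  rewrite !in_itvoo => /andP[h1 h2].
  by rewrite -ea -eb !ltrD2r !ltr_pM2l // h1 h2.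
have int' (g : R -> R) : (forall x, 0 <= g x) ->
    (@lebesgue_measure R).-integrable `[a, b] (EFin \o g) ->
    (forall x, x \in `]a, b[%R -> x \notin l -> {for x, continuous g}) ->
    (@lebesgue_measure R).-integrable `[a', b'] (EFin \o (fun x => g (c * x + d))).
  move=> g0 intg cg.
  have [G [cG Ga Gb _ dG]] := parameterized_integral_off_seq ab intg cg.
  have cG' : {within `[a', b'], continuous (fun x => c^-1 * G (c * x + d))}.
    exact: within_continuousZl (within_continuous_affine c0 ea eb cG).
  have d0 x : x \in `]a', b'[%R -> x \notin l' -> 0 <= g (c * x + d) by [].
  have d1 x : x \in `]a', b'[%R -> x \notin l' ->
      {for x, continuous (fun x => g (c * x + d))}.
    by move=> xab xl; apply: continuous_comp_affine; apply: cg; auto.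
  have d2 x : x \in `]a', b'[%R -> x \notin l' ->
      is_derive x 1 (fun x => c^-1 * G (c * x + d)) (g (c * x + d)).
    move=> xab xl.
    have h := is_derive_comp_affine (dG _ (inab _ xab) (inl _ xl)).
    have := @is_deriveZ _ _ _ (fun x => G (c * x + d)) c^-1 x 1 _ h.
    by rewrite /GRing.scale /= mulrC mulfK.
  exact: (ge0_FTC2_off_seq ab' cG' d0 d1 d2).
have int1 : (@lebesgue_measure R).-integrable `[a', b']
    (EFin \o (fun x => f (c * x + d))).
  have h : (@lebesgue_measure R).-integrable `[a', b']
      (EFin \o (fun x => `|f (c * x + d)|)).
    apply: (int' (fun x => `|f x|)) => //.
      by have := integrable_norm intf.
    move=> x xab xl; apply: (@continuous_comp _ _ _ f (fun y => `|y|)).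
      exact: cf.
    exact: norm_continuous.
  apply: le_integrable h => //.
    apply/measurable_EFinP; apply: (@measurable_fun_off_seq R a' b' l') => x xab xl.
    by apply: continuous_comp_affine; apply: cf; auto.
  by move=> x _ /=; rewrite lee_fin normr_id.
split=> //.
have [G [cG Ga Gb _ dG]] := parameterized_integral_off_seq ab intf cf.
have cG' : {within `[a', b'], continuous (fun x => c^-1 * G (c * x + d))}.
  exact: within_continuousZl (within_continuous_affine c0 ea eb cG).
have d1 x : x \in `]a', b'[%R -> x \notin l' ->
    {for x, continuous (fun x => f (c * x + d))}.
  by move=> xab xl; apply: continuous_comp_affine; apply: cf; auto.
have d2 x : x \in `]a', b'[%R -> x \notin l' ->
    is_derive x 1 (fun x => c^-1 * G (c * x + d)) (f (c * x + d)).
  move=> xab xl.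
  have h := is_derive_comp_affine (dG _ (inab _ xab) (inl _ xl)).
  have := @is_deriveZ _ _ _ (fun x => G (c * x + d)) c^-1 x 1 _ h.
  by rewrite /GRing.scale /= mulrC mulfK.
by rewrite (RFTC2_off_seq ab' int1 cG' d1 d2) ea eb Ga Gb mulr0 subr0.
Qed.

(** A primitive of [f] telescopes over the [N] subintervals. *)
Lemma Rintegral_split (R : realType) (l : seq R) (N : nat) (f : R -> R) :
  (0 < N)%N ->
  (@lebesgue_measure R).-integrable `[0, 1] (EFin \o f) ->
  (forall x : R, x \in `]0, 1[%R -> x \notin l -> {for x, continuous f}) ->
  \int[@lebesgue_measure R]_(x in `[0, 1]) f x =
  N%:R^-1 * \sum_(j < N) \int[@lebesgue_measure R]_(r in `[0, 1])
    f (N%:R^-1 * r + N%:R^-1 * j%:R).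
Proof.
move=> N0 intf cf.
have [G [cG G0 G1 _ dG]] := parameterized_integral_off_seq ler01 intf cf.
have h0 : 0 < N%:R^-1 :> R by rewrite invr_gt0 ltr0n.
have NK : N%:R^-1 * N%:R = 1 :> R by rewrite mulVf // pnatr_eq0 -lt0n.
rewrite -G1 -(subr0 (G 1)) -[X in _ - X]G0.
have -> : G 1 - G 0 = G (N%:R^-1 * N%:R) - G (N%:R^-1 * 0%:R) by rewrite NK mulr0.
rewrite -(@telescope_sumr _ 0 N (fun j => G (N%:R^-1 * j%:R)) (leq0n N)).
rewrite big_mkord mulr_sumr; apply: eq_bigr => -[j jN] _ /=.
have le1 : 0 <= N%:R^-1 * j%:R :> R by rewrite mulr_ge0 // ltW.
have le2 : N%:R^-1 * j%:R <= N%:R^-1 * j.+1%:R :> R.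
  by rewrite ler_pM2l // ler_nat.
have le3 : N%:R^-1 * j.+1%:R <= 1 :> R by rewrite -[leRHS]NK ler_pM2l // ler_nat.
have cG' := within_continuousW le1 le3 cG.
have sub x : x \in `]N%:R^-1 * j%:R, N%:R^-1 * j.+1%:R[%R -> x \in `]0 : R, 1[%R.
  rewrite !in_itvoo => /andP[h1 h2].
  by rewrite (le_lt_trans le1 h1) (lt_le_trans h2 le3).
have int' : (@lebesgue_measure R).-integrable
    `[N%:R^-1 * j%:R, N%:R^-1 * j.+1%:R] (EFin \o f).
  apply: integrableS intf => // x /=; rewrite !in_itvcc => /andP[h1 h2].
  by rewrite (le_trans le1 h1) (le_trans h2 le3).
rewrite -(RFTC2_off_seq le2 int' cG' (fun x h => cf x (sub x h))
  (fun x h => dG x (sub x h))).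
have e1 : N%:R^-1 * 0 + N%:R^-1 * j%:R = N%:R^-1 * j%:R :> R by rewrite mulr0 add0r.
have e2 : N%:R^-1 * 1 + N%:R^-1 * j%:R = N%:R^-1 * j.+1%:R :> R.
  by rewrite -mulrDr -natr1 addrC.
have [_ ->] := integrable_affine_off_seq ler01 h0 e1 e2 int'
  (fun x h => cf x (sub x h)).
by rewrite invrK mulrA NK mul1r.
Qed.

Lemma integrable_split (R : realType) (l : seq R) (N : nat) (f : R -> R) :
  (0 < N)%N ->
  (forall x : R, x \in `]0, 1[%R -> x \notin l -> {for x, continuous f}) ->
  (forall j : nat, (j < N)%N -> (@lebesgue_measure R).-integrable `[0, 1]
    (EFin \o (fun r => f (N%:R^-1 * r + N%:R^-1 * j%:R)))) ->
  (@lebesgue_measure R).-integrable `[0, 1] (EFin \o f).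
Proof.
move=> N0 cf intf.
have NR0 : 0 < N%:R :> R by rewrite ltr0n.
have h0 : 0 < N%:R^-1 :> R by rewrite invr_gt0.
have NK : N%:R^-1 * N%:R = 1 :> R by rewrite mulVf // pnatr_eq0 -lt0n.
suff H k : (k <= N)%N ->
    (@lebesgue_measure R).-integrable `[0, N%:R^-1 * k%:R] (EFin \o f).
  by have := H N (leqnn N); rewrite NK.
elim: k => [_|k IH kN].
  rewrite mulr0 set_itv1; apply/integrableP; split; first exact: measurable_fun_set1.
  by rewrite integral_set1.
have le1 : 0 <= N%:R^-1 * k%:R :> R by rewrite mulr_ge0 // ltW.
have le2 : N%:R^-1 * k%:R <= N%:R^-1 * k.+1%:R :> R.
  by rewrite ler_pM2l // ler_nat.
have le3 : N%:R^-1 * k.+1%:R <= 1 :> R by rewrite -[leRHS]NK ler_pM2l // ler_nat.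
apply: (integrable_itv_cat le1 le2); first by apply: IH; exact: ltnW.
have e1 : N%:R * (N%:R^-1 * k%:R) + - k%:R = 0 :> R.
  by rewrite mulrA [_ * _^-1]mulrC NK mul1r subrr.
have e2 : N%:R * (N%:R^-1 * k.+1%:R) + - k%:R = 1 :> R.
  by rewrite mulrA [_ * _^-1]mulrC NK mul1r -natr1 addrC addKr.
set l' : seq R := [seq N%:R * x - k%:R | x <- l].
have cf' (x : R) : x \in `]0, 1[%R -> x \notin l' ->
    {for x, continuous (fun r : R => f (N%:R^-1 * r + N%:R^-1 * k%:R))}.
  rewrite in_itvoo => /andP[x0 x1] xl; apply: continuous_comp_affine; apply: cf.
    rewrite in_itvoo; apply/andP; split.
      by rewrite ltr_pwDl // mulr_gt0.
    apply: lt_le_trans le3; rewrite -mulrDr ltr_pM2l // -natr1 addrC ltrD2l //.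
  apply: contraNN xl => xl; apply/mapP; eexists; first exact: xl.
  by rewrite mulrDr !mulrA [_ * _^-1]mulrC NK !mul1r addrK.
have [+ _] := integrable_affine_off_seq le2 NR0 e1 e2 (intf k kN) cf'.
apply: eq_integrable => // x _ /=; congr (f _)%:E.
by rewrite -mulrDr subrK mulrA NK mul1r.
Qed.

(** * Functions that are smooth on an open set *)

(** Derivatives are exhibited as witnesses on [U] instead of being iterated through [derive1]: the
    calculus rules then follow by induction on [n], with no control of values outside [U]. *)
Fixpoint nder (R : realType) (V : normedModType R) (n : nat) (U : set R)
    (f : R -> V) : Prop :=
  if n is n'.+1 then
    exists f' : R -> V, (forall x, U x -> is_derive x 1 f (f' x)) /\ nder n' U f'
  else True.

Definition smooth_on (R : realType) (V : normedModType R) (U : set R) (f : R -> V) :=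
  forall n, nder n U f.

Lemma is_derive_eq_on (R : realType) (V : normedModType R) (U : set R)
    (f g : R -> V) (x : R) (df : V) :
  open U -> U x -> (forall y, U y -> f y = g y) ->
  is_derive x 1 f df -> is_derive x 1 g df.
Proof.
move=> oU Ux fg hf.
apply: (near_eq_is_derive _ hf).
have : \forall y \near x, U y by apply: open_nbhs_nbhs; split.
by apply: filterS => y /fg ->.
Qed.

Lemma nder_eq_on (R : realType) (V : normedModType R) n (U : set R)
    (f g : R -> V) :
  open U -> (forall y, U y -> f y = g y) -> nder n U f -> nder n U g.
Proof.
case: n => [//|n] oU fg [f' [hf nf]]; exists f'; split => // x Ux.
exact: is_derive_eq_on fg (hf x Ux).
Qed.

Lemma nderW (R : realType) (V : normedModType R) n (U : set R) (f : R -> V) :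
  nder n.+1 U f -> nder n U f.
Proof.
elim: n f => [//|n IH] f [f' [hf nf]]; exists f'; split => //; exact: IH.
Qed.

Lemma nderS (R : realType) (V : normedModType R) n (U W : set R) (f : R -> V) :
  W `<=` U -> nder n U f -> nder n W f.
Proof.
move=> WU; elim: n f => [//|n IH] f [f' [hf nf]]; exists f'; split; last exact: IH.
by move=> x /WU; exact: hf.
Qed.

Lemma nder_derive1 (R : realType) (V : normedModType R) n (U : set R) (f : R -> V) :
  open U -> nder n.+1 U f -> nder n U (derive1 f).
Proof.
move=> oU [f' [hf nf]]; apply: nder_eq_on nf => // x /hf hx.
by rewrite derive1E derive_val.
Qed.

Lemma smooth_on_derive1 (R : realType) (V : normedModType R) (U : set R) (f : R -> V) :
  open U -> smooth_on U f -> smooth_on U (derive1 f).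
Proof. by move=> oU sf n; apply: nder_derive1. Qed.

Lemma derive1Sn (R : realType) (V : normedModType R) n (f : R -> V) :
  derive1n n.+1 f = derive1n n (derive1 f).
Proof. by rewrite /derive1n iterSr. Qed.

Lemma smooth_on_derivable (R : realType) (V : normedModType R) (U : set R) (f : R -> V) :
  open U -> smooth_on U f -> forall n x, U x -> derivable (derive1n n f) x 1.
Proof.
move=> oU sf n; elim: n f sf => [|n IH] f sf x Ux.
  have [f' [hf _]] := sf 1; exact: (@ex_derive _ _ _ _ _ _ _ (hf x Ux)).
by rewrite derive1Sn; apply: IH => //; exact: smooth_on_derive1.
Qed.

Lemma derivable_smooth_on (R : realType) (V : normedModType R) (U : set R) (f : R -> V) :
  (forall n x, U x -> derivable (derive1n n f) x 1) -> smooth_on U f.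
Proof.
move=> df n; elim: n f df => [//|n IH] f df.
exists (derive1 f); split.
  move=> x Ux; rewrite derive1E; apply: DeriveDef => //.
  exact: (df 0%N x Ux).
by apply: IH => m x Ux; rewrite -derive1Sn; exact: df.
Qed.

Lemma nder_cst (R : realType) (V : normedModType R) n (U : set R) (a : V) :
  nder n U (fun _ : R => a).
Proof.
elim: n a => [//|n IH] a; exists (fun=> 0); split => // x _.
exact: is_derive_cst.
Qed.

Lemma nder_id (R : realType) n (U : set R) : nder n U (fun x : R => x).
Proof.
case: n => [//|n]; exists (fun=> 1); split; last exact: nder_cst.
by move=> x _; exact: is_derive_id.
Qed.

Lemma nderD (R : realType) (V : normedModType R) n (U : set R) (f g : R -> V) :
  nder n U f -> nder n U g -> nder n U (fun x => f x + g x).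
Proof.
elim: n f g => [//|n IH] f g [f' [hf nf]] [g' [hg ng]].
exists (fun x => f' x + g' x); split; last exact: IH.
by move=> x Ux; exact: (is_deriveD (hf x Ux) (hg x Ux)).
Qed.

Lemma nderM (R : realType) n (U : set R) (f g : R -> R) :
  nder n U f -> nder n U g -> nder n U (fun x => f x * g x).
Proof.
elim: n f g => [//|n IH] f g nf ng.
have := nf; have := ng; move=> [g' [hg ng']] [f' [hf nf']].
exists (fun x => f x * g' x + g x * f' x); split.
  by move=> x Ux; exact: (is_deriveM (hf x Ux) (hg x Ux)).
by apply: nderD; apply: IH => //; exact: nderW.
Qed.

Lemma nderN (R : realType) n (U : set R) (f : R -> R) :
  nder n U f -> nder n U (fun x => - f x).
Proof.
move=> nf; have -> : (fun x => - f x) = (fun x => -1 * f x).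
  by apply/funext => x; rewrite mulN1r.
by apply: nderM => //; exact: nder_cst.
Qed.

Lemma nder_sum (R : realType) n (U : set R) (I : Type) (s : seq I) (f : I -> R -> R) :
  (forall i, nder n U (f i)) -> nder n U (fun x => \sum_(i <- s) f i x).
Proof.
move=> nf; elim: s => [|i s IH].
  have -> : (fun x => \sum_(i <- [::]) f i x) = (fun=> 0).
    by apply/funext => x; rewrite big_nil.
  exact: nder_cst.
have -> : (fun x => \sum_(j <- i :: s) f j x) = (fun x => f i x + \sum_(j <- s) f j x).
  by apply/funext => x; rewrite big_cons.
exact: nderD.
Qed.

Lemma nder_comp (R : realType) n (U W : set R) (f h : R -> R) :
  (forall x, U x -> W (h x)) -> nder n W f -> nder n U h ->
  nder n U (fun x => f (h x)).
Proof.
move=> UW; elim: n f => [//|n IH] f [f' [hf nf]] nh.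
have [h' [hh nh']] := nh.
exists (fun x => f' (h x) * h' x); split.
  move=> x Ux; exact: (is_derive1_comp (hf _ (UW _ Ux)) (hh _ Ux)).
by apply: nderM => //; apply: IH => //; exact: nderW.
Qed.

Lemma nder_cos_sin (R : realType) n (U : set R) :
  nder n U (@cos R) /\ nder n U (@sin R).
Proof.
elim: n => [//|n [IHc IHs]]; split.
  exists (fun x => - sin x); split; last exact: nderN.
  by move=> x _; exact: is_derive_cos.
exists cos; split => //.
by move=> x _; exact: is_derive_sin.
Qed.

Lemma nder_inv (R : realType) n : nder n [set x : R | x != 0] (fun x => x^-1).
Proof.
elim: n => [//|n IH].
exists (fun x => - (x^-1 * x^-1)); split; last by apply: nderN; apply: nderM.
move=> x /= x0.
have := @is_deriveV R (fun x => x) x 1 1 x0 (is_derive_id _ _).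
by have -> : - (x^-1 / x) = (- x ^- 2)%:A by rewrite [RHS]mulr1 expr2 invfM.
Qed.

Lemma nder_sqrt (R : realType) n : nder n [set x : R | 0 < x] (@Num.sqrt R).
Proof.
elim: n => [//|n IH].
exists (fun x => (2 * Num.sqrt x)^-1); split.
  by move=> x /= x0; exact: is_derive1_sqrt.
apply: (@nder_comp _ _ _ [set x : R | x != 0] (fun x => x^-1)).
- by move=> x /= x0; rewrite mulf_neq0 // ?pnatr_eq0 // gt_eqF // sqrtr_gt0.
- exact: nder_inv.
- by apply: nderM => //; exact: nder_cst.
Qed.

Lemma smooth_onS (R : realType) (V : normedModType R) (U W : set R) (f : R -> V) :
  W `<=` U -> smooth_on U f -> smooth_on W f.
Proof. by move=> WU sf n; apply: nderS WU (sf n). Qed.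

Lemma smooth_on_eq (R : realType) (V : normedModType R) (U : set R) (f g : R -> V) :
  open U -> (forall y, U y -> f y = g y) -> smooth_on U f -> smooth_on U g.
Proof. by move=> oU fg sf n; apply: nder_eq_on fg (sf n). Qed.

Lemma smooth_on_cst (R : realType) (V : normedModType R) (U : set R) (a : V) :
  smooth_on U (fun _ : R => a).
Proof. by move=> n; exact: nder_cst. Qed.

Lemma smooth_on_id (R : realType) (U : set R) : smooth_on U (fun x : R => x).
Proof. by move=> n; exact: nder_id. Qed.

Lemma smooth_onD (R : realType) (V : normedModType R) (U : set R) (f g : R -> V) :
  smooth_on U f -> smooth_on U g -> smooth_on U (fun x => f x + g x).
Proof. by move=> sf sg n; exact: nderD. Qed.

Lemma smooth_onN (R : realType) (U : set R) (f : R -> R) :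
  smooth_on U f -> smooth_on U (fun x => - f x).
Proof. by move=> sf n; exact: nderN. Qed.

Lemma smooth_onM (R : realType) (U : set R) (f g : R -> R) :
  smooth_on U f -> smooth_on U g -> smooth_on U (fun x => f x * g x).
Proof. by move=> sf sg n; exact: nderM. Qed.

Lemma smooth_onX (R : realType) (U : set R) (f : R -> R) k :
  smooth_on U f -> smooth_on U (fun x => f x ^+ k).
Proof.
move=> sf; elim: k => [|k IH].
  by under eq_fun do rewrite expr0; exact: smooth_on_cst.
by under eq_fun do rewrite exprS; exact: smooth_onM.
Qed.

Lemma smooth_on_comp (R : realType) (U W : set R) (f h : R -> R) :
  (forall x, U x -> W (h x)) -> smooth_on W f -> smooth_on U h ->
  smooth_on U (fun x => f (h x)).
Proof. by move=> UW sf sh n; exact: nder_comp UW (sf n) (sh n). Qed.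

Lemma smooth_on_cos (R : realType) (U : set R) (f : R -> R) :
  smooth_on U f -> smooth_on U (fun x => cos (f x)).
Proof.
move=> sf; apply: (@smooth_on_comp _ _ setT) => // n.
by have [] := @nder_cos_sin R n setT.
Qed.

Lemma smooth_on_sin (R : realType) (U : set R) (f : R -> R) :
  smooth_on U f -> smooth_on U (fun x => sin (f x)).
Proof.
move=> sf; apply: (@smooth_on_comp _ _ setT) => // n.
by have [] := @nder_cos_sin R n setT.
Qed.

Lemma smooth_on_inv (R : realType) (U : set R) (f : R -> R) :
  (forall x, U x -> f x != 0) -> smooth_on U f -> smooth_on U (fun x => (f x)^-1).
Proof.
move=> f0 sf; apply: (@smooth_on_comp _ _ [set x | x != 0] (fun x => x^-1)) => //.
exact: nder_inv.
Qed.

Lemma smooth_on_sqrt (R : realType) (U : set R) (f : R -> R) :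
  (forall x, U x -> 0 < f x) -> smooth_on U f ->
  smooth_on U (fun x => Num.sqrt (f x)).
Proof.
move=> f0 sf; apply: (@smooth_on_comp _ _ [set x | 0 < x] (@Num.sqrt R)) => //.
exact: nder_sqrt.
Qed.

Lemma smooth_on_continuous (R : realType) (V : normedModType R) (U : set R)
    (f : R -> V) x :
  smooth_on U f -> U x -> {for x, continuous f}.
Proof.
move=> sf Ux; have [f' [hf _]] := sf 1.
apply: differentiable_continuous; apply/derivable1_diffP.
exact: (@ex_derive _ _ _ _ _ _ _ (hf x Ux)).
Qed.

Lemma smooth_on_is_derive (R : realType) (V : normedModType R) (U : set R)
    (f : R -> V) x :
  smooth_on U f -> U x -> is_derive x 1 f (derive1 f x).
Proof.
move=> sf Ux; have [f' [hf _]] := sf 1.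
by rewrite derive1E; apply: DeriveDef => //; exact: (@ex_derive _ _ _ _ _ _ _ (hf x Ux)).
Qed.

Lemma is_derive_rowP (R : realType) n (g : R -> 'rV[R]_n.+1) (x : R) (dg : 'rV[R]_n.+1) :
  is_derive x 1 g dg <-> forall j, is_derive x 1 (fun s => g s 0 j) (dg 0 j).
Proof.
split => [[dg1 dg2] j|h].
  have d := (@derivable_mxP _ _ _ _ g x 1).1 dg1.
  by apply: DeriveDef => //; rewrite -dg2 derive_mx // mxE.
have d : derivable g x 1.
  apply/derivable_mxP => i j; rewrite (ord1 i).
  exact: (@ex_derive _ _ _ _ _ _ _ (h j)).
apply: DeriveDef => //; apply/rowP => j; rewrite derive_mx // mxE.
exact: (@derive_val _ _ _ _ _ _ _ (h j)).
Qed.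

Lemma nder_rowP (R : realType) n m (U : set R) (g : R -> 'rV[R]_n.+1) :
  open U -> nder m U g <-> forall j, nder m U (fun s => g s 0 j).
Proof.
move=> oU; elim: m g => [//|m IH] g; split.
  move=> [g' [hg ng]] j; exists (fun s => g' s 0 j); split.
    by move=> x Ux; exact: ((is_derive_rowP g x (g' x)).1 (hg x Ux) j).
  exact: ((IH g').1 ng j).
move=> h; exists (fun s => \row_j derive1 (fun s => g s 0 j) s); split.
  move=> x Ux; apply/is_derive_rowP => j; rewrite mxE.
  have [f' [hf _]] := h j.
  by rewrite derive1E; apply: DeriveDef => //; exact: (@ex_derive _ _ _ _ _ _ _ (hf x Ux)).
apply/IH => j; have := nder_derive1 oU (h j).
by apply: nder_eq_on => // y _; rewrite mxE.
Qed.

Lemma smooth_on_rowP (R : realType) n (U : set R) (g : R -> 'rV[R]_n.+1) :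
  open U -> smooth_on U g <-> forall j, smooth_on U (fun s => g s 0 j).
Proof.
move=> oU; split=> [sg j m|sg m]; first exact: ((nder_rowP m g oU).1 (sg m) j).
by apply/nder_rowP => // j; exact: sg.
Qed.

Lemma derive1_row (R : realType) n (g : R -> 'rV[R]_n.+1) (x : R) (dg : 'rV[R]_n.+1) :
  (forall j, is_derive x 1 (fun s => g s 0 j) (dg 0 j)) -> derive1 g x = dg.
Proof. by move=> /is_derive_rowP h; rewrite derive1E derive_val. Qed.

Definition off (R : realType) (l : seq R) : set R :=
  [set s : R | s \in `]0, 1[%R /\ s \notin l].

Lemma open_off (R : realType) (l : seq R) : open (off l).
Proof.
have -> : off l = `]0, 1[%classic `&` ~` [set` l].
  by apply/seteqP; split => x /= [h1 h2]; split => //; apply/negP.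
apply: openI; first exact: interval_open.
apply: closed_openC; apply: compact_closed; first exact: Rhausdorff.
apply: finite_compact; exact: finite_seq.
Qed.

Lemma smooth_off_finiteP (R : realType) (V : normedModType R) (f : R -> V) :
  smooth_off_finite f <-> exists l : seq R, smooth_on (off l) f.
Proof.
split=> [[F /finite_seqP[l ->] sf]|[l sl]].
  exists l; apply: derivable_smooth_on => n x [x01 xl]; apply: sf.
    by move: x01; rewrite in_itvoo.
  by move=> /= xl'; rewrite xl' in xl.
exists [set` l]; first exact: finite_seq.
move=> s s01 sl' n; apply: (smooth_on_derivable (@open_off R l) sl).
by split; [rewrite in_itvoo|apply/negP].
Qed.

Lemma offS (R : realType) (l l' : seq R) : {subset l <= l'} -> off l' `<=` off l.
Proof. by move=> ll x [x01 xl]; split => //; apply: contra xl => /ll. Qed.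

(** Positivity is what keeps the argument of the square root away from 0, where the root is not
    smooth. *)
Lemma smooth_on_speed (R : realType) n (U : set R) (g : R -> 'rV[R]_n.+1) :
  open U -> smooth_on U g -> (forall s, U s -> 0 < speed g s) ->
  smooth_on U (speed g).
Proof.
move=> oU sg g0; apply: smooth_on_sqrt.
  by move=> x /g0; rewrite /speed /euclid sqrtr_gt0.
move=> m; apply: nder_sum => j.
exact: (smooth_onX 2 ((smooth_on_rowP _ oU).1 (smooth_on_derive1 oU sg) j) m).
Qed.

(** * Polynomial functions and the arclength parameterization *)

Definition mono (R : realType) n (e : 'I_n -> nat) (x : 'rV[R]_n) : R :=
  \prod_i x 0 i ^+ e i.

Lemma polyfunE (R : realType) n (p : mpoly n R) (x : 'rV[R]_n) :
  polyfun p x = \sum_(m <- msupp p) mcoeff m p * mono m x.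
Proof. by rewrite /polyfun mevalE. Qed.

Lemma continuous_bigsum (R : realType) (T : topologicalType) (I : Type) (s : seq I)
    (f : I -> T -> R) (x : T) :
  (forall i, {for x, continuous (f i)}) ->
  {for x, continuous (fun y => \sum_(i <- s) f i y)}.
Proof.
move=> cf; elim: s => [|i s IH].
  have -> : (fun y : T => \sum_(i <- [::]) f i y) = (fun=> 0).
    by apply/funext => y; rewrite big_nil.
  exact: cst_continuous.
have -> : (fun y : T => \sum_(j <- i :: s) f j y) = (fun y => f i y + \sum_(j <- s) f j y).
  by apply/funext => y; rewrite big_cons.
exact: continuousD.
Qed.

Lemma continuous_bigprod (R : realType) (T : topologicalType) (I : Type) (s : seq I)
    (f : I -> T -> R) (x : T) :
  (forall i, {for x, continuous (f i)}) ->
  {for x, continuous (fun y => \prod_(i <- s) f i y)}.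
Proof.
move=> cf; elim: s => [|i s IH].
  have -> : (fun y : T => \prod_(i <- [::]) f i y) = (fun=> 1).
    by apply/funext => y; rewrite big_nil.
  exact: cst_continuous.
have -> : (fun y : T => \prod_(j <- i :: s) f j y) = (fun y => f i y * \prod_(j <- s) f j y).
  by apply/funext => y; rewrite big_cons.
exact: continuousM.
Qed.

Lemma continuous_exprn (R : realType) (T : topologicalType) (f : T -> R) (x : T) k :
  {for x, continuous f} -> {for x, continuous (fun y => f y ^+ k)}.
Proof.
move=> cf; elim: k => [|k IH].
  have -> : (fun y : T => f y ^+ 0) = (fun=> 1) by apply/funext => y; rewrite expr0.
  exact: cst_continuous.
have -> : (fun y : T => f y ^+ k.+1) = (fun y => f y * f y ^+ k).
  by apply/funext => y; rewrite exprS.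
exact: continuousM.
Qed.

Lemma continuous_mono (R : realType) n (e : 'I_n -> nat) (x : 'rV[R]_n) :
  {for x, continuous (mono e)}.
Proof.
apply: continuous_bigprod => i; apply: continuous_exprn.
exact: coord_continuous.
Qed.

Lemma continuous_polyfun (R : realType) n (p : mpoly n R) (x : 'rV[R]_n) :
  {for x, continuous (polyfun p)}.
Proof.
have -> : polyfun p = fun x => \sum_(m <- msupp p) mcoeff m p * mono m x.
  by apply/funext => y; exact: polyfunE.
apply: continuous_bigsum => m; apply: continuousM; first exact: cst_continuous.
exact: continuous_mono.
Qed.

Lemma within_continuous_compT (U V W : topologicalType) (A : set U)
    (h : U -> W) (f : W -> V) :
  continuous f -> {within A, continuous h} -> {within A, continuous (f \o h)}.
Proof. move=> cf ch; apply: (@within_continuous_compW _ _ _ A setT h f) => //.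
by apply: continuous_subspaceT. Qed.

Lemma le_ends_off_seq (R : realType) (l : seq R) (a b : R) (F f : R -> R) :
  a <= b -> {within `[a, b], continuous F} ->
  (forall x, x \in `]a, b[%R -> x \notin l -> 0 <= f x) ->
  (forall x, x \in `]a, b[%R -> x \notin l -> is_derive x 1 F (f x)) -> F a <= F b.
Proof.
elim: l a b => [|e l IH] a b ab cF f0 dF.
  move: ab; rewrite le_eqVlt => /predU1P[->//|ab].
  have [c cab h] := MVT ab (fun x xab => dF x xab isT) cF.
  by rewrite -subr_ge0 h mulr_ge0 ?subr_ge0 ?(ltW ab) // f0.
have [eab|eab] := boolP (e \in `]a, b[%R).
  move: (eab); rewrite in_itvoo => /andP[ae eb].
  have lae := ltW ae; have leb := ltW eb.
  have cl := within_continuousW (lexx a) leb cF.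
  have cr := within_continuousW lae (lexx b) cF.
  have dl x : x \in `]a, e[%R -> x \notin l ->
      [/\ x \in `]a, b[%R & x \notin e :: l].
    rewrite !in_itvoo => /andP[ax xe] xl.
    by rewrite ax (lt_trans xe eb) inE negb_or xl andbT lt_eqF.
  have dr x : x \in `]e, b[%R -> x \notin l ->
      [/\ x \in `]a, b[%R & x \notin e :: l].
    rewrite !in_itvoo => /andP[ex xb] xl.
    by rewrite (lt_trans ae ex) xb inE negb_or xl andbT gt_eqF.
  apply: (@le_trans _ _ (F e)).
    exact: (IH a e lae cl (fun x xae xl => let: conj h1 h2 := dl x xae xl in f0 x h1 h2)
      (fun x xae xl => let: conj h1 h2 := dl x xae xl in dF x h1 h2)).
  exact: (IH e b leb cr (fun x xae xl => let: conj h1 h2 := dr x xae xl in f0 x h1 h2)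
      (fun x xae xl => let: conj h1 h2 := dr x xae xl in dF x h1 h2)).
have ne x : x \in `]a, b[%R -> x \notin l -> x \notin e :: l.
  move=> xab xl; rewrite inE negb_or xl andbT.
  by apply: contraNneq eab => <-.
exact: (IH a b ab cF (fun x h1 h2 => f0 x h1 (ne x h1 h2))
  (fun x h1 h2 => dF x h1 (ne x h1 h2))).
Qed.

Lemma integrable_bounded_off_seq (R : realType) (l : seq R) (M : R) (f : R -> R) :
  (forall x, off l x -> {for x, continuous f}) ->
  (forall x, off l x -> `|f x| <= M) ->
  (@lebesgue_measure R).-integrable `[0, 1] (EFin \o f).
Proof.
move=> cf fM.
have mf : measurable_fun (`[0 : R, 1]%classic) f.
  apply: (@measurable_fun_off_seq R 0 1 l) => x x01 xl; exact: cf.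
(* The values of [f] at the ends and at the listed points are arbitrary, so they are added to the
   bound. *)
pose K : R := `|M| + \sum_(x <- [:: 0, 1 & l]) `|f x|.
have fK (x : R) : 0 <= x <= 1 -> `|f x| <= K.
  move=> x01; have [xl|xl] := boolP (x \in [:: 0, 1 & l]).
    rewrite /K (big_rem x) //= addrCA lerDl addr_ge0 // sumr_ge0 //.
  move: xl; rewrite !inE !negb_or => /and3P[x0 x1 xl].
  apply: (@le_trans _ _ M).
    apply: fM; split => //.
    by move: x01; rewrite in_itvoo !lt_neqAle eq_sym x0 x1.
  by rewrite (le_trans (ler_norm M)) // lerDl sumr_ge0.
apply: measurable_bounded_integrable => //.
  have e := @lebesgue_measure_itv R `[(0 : R), 1]%R.
  by apply: (@eq_ind_r _ _ (fun y => y < +oo)%E _ _ e); rewrite /= lte_fin ltr01 sube0 ltry.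
exists K; split; first exact: num_real.
move=> B KB x /= x01; apply: le_trans (ltW KB); apply: fK.
by rewrite -in_itvcc.
Qed.

Lemma bounded_within01 (R : realType) (f : R -> R) :
  {within `[0, 1], continuous f} ->
  exists M : R, forall x : R, 0 <= x <= 1 -> `|f x| <= M.
Proof.
move=> cf.
have cnf : {within `[0, 1], continuous (fun x => `|f x|)}.
  exact: (within_continuous_compT (@norm_continuous _ _) cf).
have [c _ hc] := EVT_max ler01 cnf.
by exists `|f c| => x x01; apply: hc; rewrite in_itvcc.
Qed.

Lemma integrable_within01 (R : realType) (f : R -> R) :
  {within `[0, 1], continuous f} ->
  (@lebesgue_measure R).-integrable `[0, 1] (EFin \o f).
Proof.
by move=> cf; apply: continuous_compact_integrable => //; exact: segment_compact.
Qed.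

Lemma within01_continuous (R : realType) (V : normedModType R) (f : R -> V) (x : R) :
  {within `[0, 1], continuous f} -> x \in `]0, 1[%R -> {for x, continuous f}.
Proof.
move=> cf x01; apply: (within_continuous_continuous (ltr01 : 0 < 1 :> R)) => //.
Qed.

Lemma euclid_ge0 (R : realType) n (v : 'rV[R]_n) : 0 <= euclid v.
Proof. exact: sqrtr_ge0. Qed.

Lemma speed_ge0 (R : realType) n (g : R -> 'rV[R]_n.+1) s : 0 <= speed g s.
Proof. exact: euclid_ge0. Qed.

Lemma euclidZ (R : realType) n (k : R) (v : 'rV[R]_n) :
  euclid (k *: v) = `|k| * euclid v.
Proof.
rewrite /euclid; under eq_bigr do rewrite mxE exprMn.
by rewrite -mulr_sumr sqrtrM ?sqr_ge0 // sqrtr_sqr.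
Qed.

(** [phi] inverts the normalized arclength [h = S / L], where [S] is the integral of [v] and
    [L = S 1]. The bound [c <= v] makes [S] strictly increasing and bounds the derivative
    [L / v (phi s)]. The left inverse [h] of [phi] is exported in order to carry self-intersections
    back. *)
Lemma reparam_exists (R : realType) (l : seq R) (c : R) (v : R -> R) :
  0 < c -> smooth_on (off l) v -> (forall s, off l s -> c <= v s) ->
  (@lebesgue_measure R).-integrable `[0, 1] (EFin \o v) ->
  exists (phi : R -> R) (L : R) (l' : seq R),
    [/\ reparameterization phi, 0 < L, smooth_on (off l') phi,
      forall s, off l' s -> off l (phi s) /\ is_derive s 1 phi (L / v (phi s))
    & exists h : R -> R, [/\ h 0 = 0, h 1 = 1 & forall s, 0 <= s <= 1 ->
        0 <= phi s <= 1 /\ h (phi s) = s]].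
Proof.
move=> c0 sv cv intv.
have cvo (s : R) : s \in `]0, 1[%R -> s \notin l -> {for s, continuous v}.
  by move=> s01 sl; apply: (smooth_on_continuous sv).
have [S [cS S0 S1 _ dS]] := parameterized_integral_off_seq ler01 intv cvo.
have S_lt (x y : R) : 0 <= x -> x < y -> y <= 1 -> c * (y - x) <= S y - S x.
  move=> x0 xy y1; have lxy := ltW xy.
  have cS' := within_continuousW x0 y1 cS.
  have cT : {within `[x, y], continuous (fun z => S z - c * z)}.
    move=> z; apply: (@continuousB _ R (subspace `[x, y]) S (fun z => c * z)).
      exact: cS'.
    apply: (@within_continuousZl R `[x, y] c (fun z => z)).
    by apply: continuous_in_subspaceT => ? _; exact: cvg_id.
  have sub z : z \in `]x, y[%R -> z \in `]0 : R, 1[%R.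
    rewrite !in_itvoo => /andP[h1 h2].
    by rewrite (le_lt_trans x0 h1) (lt_le_trans h2 y1).
  have d0 z : z \in `]x, y[%R -> z \notin l -> 0 <= v z - c.
    by move=> /sub z01 zl; rewrite subr_ge0; apply: cv.
  have d1 z : z \in `]x, y[%R -> z \notin l ->
      is_derive z 1 (fun z => S z - c * z) (v z - c).
    move=> /sub z01 zl; apply: is_deriveB; first exact: dS.
    by have := is_derive_affine c 0 z; under eq_fun do rewrite addr0.
  have := le_ends_off_seq lxy cT d0 d1.
  by rewrite lerBrDr => h; rewrite mulrBr; lra.
have L0 : 0 < S 1.
  by have := S_lt 0 1 (lexx _) ltr01 (lexx _); rewrite S0 !subr0 mulr1; exact: lt_le_trans.
set L := S 1 in L0 *.
have LN0 : L != 0 by rewrite gt_eqF.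
pose h := fun x => S x / L.
have h0 : h 0 = 0 by rewrite /h S0 mul0r.
have h1 : h 1 = 1 by rewrite /h divff.
have h_lt (x y : R) : 0 <= x -> x < y -> y <= 1 -> h x < h y.
  move=> x0 xy y1; rewrite /h ltr_pM2r ?invr_gt0 // -subr_gt0.
  by apply: lt_le_trans (S_lt x y x0 xy y1); rewrite mulr_gt0 // subr_gt0.
have h_le (x y : R) : 0 <= x -> x <= y -> y <= 1 -> h x <= h y.
  move=> x0; rewrite le_eqVlt => /predU1P[->//|xy] y1; exact/ltW/h_lt.
have h_lt2 (x y : R) : 0 <= x <= 1 -> 0 <= y <= 1 -> h x < h y -> x < y.
  move=> /andP[x0 x1] /andP[y0 y1] hxy; rewrite ltNge; apply/negP => yx.
  by have := le_lt_trans (h_le y x y0 yx x1) hxy; rewrite ltxx.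
have h_inj (x y : R) : 0 <= x <= 1 -> 0 <= y <= 1 -> h x = h y -> x = y.
  move=> /andP[x0 x1] /andP[y0 y1] hxy.
  have [xy|yx|//] := ltgtP x y.
    by have := h_lt x y x0 xy y1; rewrite hxy ltxx.
  by have := h_lt y x y0 yx x1; rewrite hxy ltxx.
have ch : {within `[0, 1], continuous h}.
  have := @within_continuousZl R `[0, 1] L^-1 S cS.
  have -> : h = (fun x => L^-1 * S x) by apply/funext => x; exact: mulrC.
  exact.
(* The preimage exists by the intermediate value theorem and is unique since [h] is injective on
   [[0, 1]]; the default 0 is taken only outside [[0, 1]]. *)
pose phi : R -> R := fun u => xget 0 [set x : R | 0 <= x <= 1 /\ h x = u].
have phiP (u : R) : 0 <= u <= 1 -> 0 <= phi u <= 1 /\ h (phi u) = u.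
  move=> u01; have [|x xab xu] := @IVT R h 0 1 u ler01 ch.
    by rewrite h0 h1 min_l // max_r.
  move: xab; rewrite in_itvcc => xab.
  by rewrite /phi; case: xgetP => [y -> //|/(_ x) []].
have phih (x : R) : 0 <= x <= 1 -> phi (h x) = x.
  move=> x01; have hx : 0 <= h x <= 1.
    by move: x01 => /andP[x0 x1]; rewrite -{1}h0 -h1 !h_le.
  have [p1 p2] := phiP _ hx; exact: h_inj.
have phi0 : phi 0 = 0 by rewrite -[in LHS]h0 phih // lexx ler01.
have phi1 : phi 1 = 1 by rewrite -[in LHS]h1 phih // lexx ler01.
have phi_lt (x y : R) : 0 <= x -> x < y -> y <= 1 -> phi x < phi y.
  move=> x0 xy y1.
  have [a1 a2] : 0 <= phi x <= 1 /\ h (phi x) = x.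
    by apply: phiP; rewrite x0 (le_trans (ltW xy)).
  have [b1 b2] : 0 <= phi y <= 1 /\ h (phi y) = y.
    by apply: phiP; rewrite y1 (le_trans x0) // ltW.
  by apply: h_lt2 => //; rewrite a2 b2.
have cphi : {within `[0, 1], continuous phi}.
  have := @segment_can_le_continuous R 0 1 h phi ler01 ch.
  rewrite h0 h1; apply => x; rewrite in_itvcc; exact: phih.
pose l' := map h l.
have offphi s : off l' s -> off l (phi s).
  move=> [s01 sl]; move: s01; rewrite in_itvoo => /andP[s0 s1].
  split.
    have := phi_lt 0 s (lexx _) s0 (ltW s1); have := phi_lt s 1 (ltW s0) s1 (lexx _).
    by rewrite phi0 phi1 in_itvoo => -> ->.
  apply: contra sl => sl; apply/mapP; exists (phi s) => //.
  have s01 : 0 <= s <= 1 by rewrite !ltW.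
  by have [_ ->] := phiP s s01.
have dphi s : off l' s -> is_derive s 1 phi (L / v (phi s)).
  move=> os; have [p01 pl] := offphi s os.
  have [_ hs] : 0 <= phi s <= 1 /\ h (phi s) = s.
    by apply: phiP; move: os => [+ _]; rewrite in_itvoo => /andP[s0 s1]; rewrite !ltW.
  have dh : is_derive (phi s) 1 h (v (phi s) / L).
    have := is_deriveZ L^-1 (dS _ p01 pl).
    rewrite /GRing.scale /= mulrC.
    have -> : h = (fun x => L^-1 * S x) by apply/funext => x; exact: mulrC.
    exact.
  have v0 : v (phi s) / L != 0.
    by rewrite gt_eqF // divr_gt0 // (lt_le_trans c0) // cv.
  have near01 : \forall x \near phi s, x \in `]0 : R, 1[%R.
    by apply: open_nbhs_nbhs; split; [exact: interval_open|].
  rewrite -[in X in is_derive X]hs -invf_div; apply: is_derive_inverse => //.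
    near=> x; apply: phih.
    have : x \in `]0 : R, 1[%R by near: x.
    by rewrite in_itvoo => /andP[? ?]; rewrite !ltW.
  near=> x; apply: (within01_continuous ch).
  by near: x.
(* Bootstrap: the derivative of [phi] is a smooth function of [phi], so each order of
   differentiability gives the next. *)
have sphi : smooth_on (off l') phi.
  elim => [//|n IH]; exists (fun s => L / v (phi s)); split; first exact: dphi.
  apply: nderM; first exact: nder_cst.
  apply: (@nder_comp _ _ _ [set x : R | x != 0] (fun x => x^-1)).
  - move=> s /offphi os /=; rewrite gt_eqF // (lt_le_trans c0) //; exact: cv.
  - exact: nder_inv.
  - exact: nder_comp offphi (sv n) IH.
exists phi, L, l'; split; [|exact: L0|exact: sphi| |by exists h]; last first.
  by move=> s os; split; [exact: offphi|exact: dphi].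
split => //; exists [set` l']; split; first exact: finite_seq.
  move=> s s01 sl' n; apply: (smooth_on_derivable (@open_off R l') sphi).
  by split; [rewrite in_itvoo|apply/negP].
move=> s s01 sl'; have os : off l' s by split; [rewrite in_itvoo|apply/negP].
have := dphi s os => ds; rewrite derive1E derive_val.
by rewrite divr_gt0 // (lt_le_trans c0) //; apply: cv; exact: offphi.
Unshelve. all: by end_near.
Qed.

(** After reparameterization the speed is the constant [L] off a finite set, and the weight
    [1 / |g'|] at [phi] times [L] is the derivative of [phi]. The weighted integral along [g \o phi]
    is therefore the plain integral of [p (g s)] over [[0, 1]], by the substitution [phi]. *)
Lemma weighted_design_curve_arclength (R : realType) (d : nat)
    (sigma : probability (borelRn R d.+1) R) (t : nat) (l : seq R) (c : R)
    (g : R -> 'rV[R]_d.+1) :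
  (forall s : R, 0 <= s <= 1 -> sphere d (g s)) ->
  {within `[0, 1], continuous g} ->
  smooth_on (off l) g ->
  0 < c -> (forall s, off l s -> c <= speed g s) ->
  (@lebesgue_measure R).-integrable `[0, 1] (EFin \o speed g) ->
  g 0 = g 1 -> finite_set (self_intersections g) -> ~ bounded_speed g ->
  (forall p : mpoly d.+1 R, (msize p <= t.+1)%N ->
    (\int[@lebesgue_measure R]_(s in `[0, 1]) polyfun p (g s))%:E =
    (\int[sigma]_(x in sphere d) (polyfun p x)%:E)%E) ->
  weighted_design_curve sigma t g (fun s => (speed g s)^-1).
Proof.
move=> gS cg sg c0 cs ints g01 fin unb des.
have oU := @open_off R l.
have s0 s : off l s -> 0 < speed g s by move=> /cs; exact: lt_le_trans.
have ss := smooth_on_speed oU sg s0.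
have [phi [L [l' [rphi L0 sphi dphi [h [h0 h1 hphi]]]]]] :=
  reparam_exists c0 ss cs ints.
right; split; [exact: gS|exact: unb|exists phi; first exact: rphi].
have [cphi phi0 phi1 phi_lt _] := rphi.
have phi01 s : 0 <= s <= 1 -> 0 <= phi s <= 1 by move=> /hphi[].
have oU' := @open_off R l'.
have sgj j : smooth_on (off l) (fun s => g s 0 j).
  exact: ((smooth_on_rowP g oU).1 sg j).
have sgphi : smooth_on (off l') (g \o phi).
  apply/smooth_on_rowP => // j.
  apply: (smooth_on_comp _ (sgj j) sphi) => s os.
  by have [] := dphi s os.
have spd s : off l' s -> speed (g \o phi) s = L.
  move=> os; have [op dp] := dphi s os.
  have -> : speed (g \o phi) s = euclid ((L / speed g (phi s)) *: derive1 g (phi s)).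
    rewrite /speed; congr euclid; apply: derive1_row => j.
    have := is_derive1_comp ((is_derive_rowP g _ _).1 (smooth_on_is_derive sg op) j) dp.
    by rewrite !mxE mulrC.
  rewrite euclidZ ger0_norm; last by rewrite divr_ge0 ?ltW // s0.
  by rewrite -[euclid _]/(speed g (phi s)) divfK // gt_eqF // s0.
have cgphi : {within `[0, 1], continuous (g \o phi)}.
  refine (within_continuous_compW (B := `[0 : R, 1]%classic) _ cphi cg).
  by move=> x /=; rewrite !in_itvcc; exact: phi01.
split.
- by move=> s /phi01; exact: gS.
- split => //.
    by apply/smooth_off_finiteP; exists l'.
  (* At the exceptional points the speed is whatever [derive1] returns, so these values are added to
     the bound. *)
  exists (L + \sum_(x <- l') speed (g \o phi) x) => s s01 _.
  have [sl|sl] := boolP (s \in l').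
    rewrite (big_rem s) //= addrCA lerDl addr_ge0 ?(ltW L0) //.
    by apply: sumr_ge0 => x _; exact: speed_ge0.
  rewrite spd; last by split; rewrite ?in_itvoo.
  by rewrite lerDl; apply: sumr_ge0 => x _; exact: speed_ge0.
- by rewrite /= phi0 phi1.
(* [phi] sends self-intersections to self-intersections and [h] recovers the parameters; [h 0 = 0]
   and [h 1 = 1] keep the closing pair excluded. *)
- have sub : self_intersections (g \o phi) `<=`
      (fun p : R * R => (h p.1, h p.2)) @` self_intersections g.
    move=> [x y] [/= x0 xy y1 pn gxy].
    have x01 : 0 <= x <= 1 by rewrite x0 (le_trans (ltW xy)).
    have y01 : 0 <= y <= 1 by rewrite y1 (le_trans x0 (ltW xy)).
    have [px hx] := hphi x x01; have [py hy] := hphi y y01.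
    exists (phi x, phi y); last by rewrite /= hx hy.
    split => //=.
    + by move: px => /andP[].
    + exact: phi_lt.
    + by move: py => /andP[].
    + by move=> [ex ey]; apply: pn; rewrite -hx -hy ex ey h0 h1.
  exact: (sub_finite_set sub (finite_image _ fin)).
move=> p pt.
pose f s := polyfun p (g s).
have cf : {within `[0, 1], continuous f}.
  exact: (within_continuous_compT (@continuous_polyfun _ _ p) cg).
have [F [cF F0 F1 _ dF]] := @parameterized_integral_off_seq R [::] 0 1 f ler01
  (integrable_within01 cf) (fun x x01 _ => within01_continuous cf x01).
have [M Mf] := bounded_within01 cf.
pose k s := polyfun p ((g \o phi) s) * ((fun s => (speed g s)^-1) \o phi) s * speed (g \o phi) s.
have kE s : off l' s -> k s = f (phi s) * (L / speed g (phi s)).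
  by move=> os; rewrite /k spd // -mulrA [_^-1 * L]mulrC.
have ck s : off l' s -> {for s, continuous k}.
  move=> os.
  have c1 : {for s, continuous (fun s => f (phi s) * (L / speed g (phi s)))}.
    have s01 : s \in `]0 : R, 1[%R by case: os.
    apply: continuousM.
      apply: (@continuous_comp _ _ _ phi f); first exact: (within01_continuous cphi).
      apply: (within01_continuous cf); by have [[]] := dphi s os.
    apply: (@smooth_on_continuous R _ (off l')) => //.
    apply: smooth_onM; first exact: smooth_on_cst.
    apply: smooth_on_inv.
      by move=> x ox; rewrite gt_eqF // s0 //; have [] := dphi x ox.
    by apply: (smooth_on_comp _ ss sphi) => x ox; have [] := dphi x ox.
  have nk : \forall x \near s, f (phi x) * (L / speed g (phi x)) = k x.
    have : \forall x \near s, off l' x by apply: open_nbhs_nbhs; split.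
    by apply: filterS => x ox; rewrite kE.
  rewrite /prop_for /continuous_at -(nbhs_singleton nk).
  by apply: cvg_trans c1; apply: near_eq_cvg.
have intk : (@lebesgue_measure R).-integrable `[0, 1] (EFin \o k).
  apply: (@integrable_bounded_off_seq R l' (M * (L / c)) k) => // s os.
  have [op _] := dphi s os.
  have s01 : 0 <= s <= 1 by case: os; rewrite in_itvoo => /andP[? ?] _; rewrite !ltW.
  rewrite kE // normrM ler_pM //; first exact: Mf (phi01 _ s01).
  rewrite ger0_norm ?divr_ge0 ?(ltW L0) ?speed_ge0 //.
  by rewrite ler_pM2l // lef_pV2 ?posrE ?cs // s0.
split; first exact: intk.
rewrite -(des p pt) integral_EFin_Rintegral //; congr EFin.
have cH : {within `[0, 1], continuous (F \o phi)}.
  refine (within_continuous_compW (B := `[0 : R, 1]%classic) _ cphi cF).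
  by move=> x /=; rewrite !in_itvcc; exact: phi01.
have dH x : x \in `]0, 1[%R -> x \notin l' -> is_derive x 1 (F \o phi) (k x).
  move=> x01 xl; have os : off l' x by [].
  have [[p01 pl] dp] := dphi x os.
  by rewrite kE //; exact: (is_derive1_comp (dF _ p01 isT) dp).
rewrite (RFTC2_off_seq ler01 intk cH (fun x h1 h2 => ck x (conj h1 h2)) dH) /=.
by rewrite phi0 phi1 F0 F1 subr0.
Qed.

(** * Moments of the uniform measure on the sphere *)

(* Moments of a standard Gaussian variable. *)
Fixpoint gauss_moment (k : nat) : nat :=
  match k with 0 => 1 | 1 => 0 | (k'.+1 as k1).+1 => k1 * gauss_moment k' end.

(* [rho n (2 m)] is [n (n + 2) ... (n + 2 m - 2)]. *)
Fixpoint rho (n p : nat) : nat :=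
  match p with 0 => 1 | 1 => 1 | (p'.+1).+1 => (n + p') * rho n p' end.

(** A standard Gaussian vector is a radius times an independent uniform point, so the moment is the
    Gaussian one divided by the moment of the radius, which is [rho]. The dimension [m] is kept
    apart from the number [n] of variables, so that a sphere of lower dimension can be described by
    exponents that vanish at the remaining index. *)
Definition sphere_moment (R : realType) n m (e : 'I_n -> nat) : R :=
  (\prod_i gauss_moment (e i))%:R / (rho m (\sum_i e i))%:R.

Lemma gauss_momentSS k : gauss_moment k.+2 = (k.+1 * gauss_moment k)%N.
Proof. by []. Qed.

Lemma rhoSS n p : rho n p.+2 = ((n + p) * rho n p)%N.
Proof. by []. Qed.

Lemma gauss_moment_odd k : odd k -> gauss_moment k = 0%N.
Proof.
suff H j : gauss_moment j.*2.+1 = 0%N.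
  by move=> ok; rewrite -(odd_double_half k) ok add1n H.
elim: j => [//|j IH]; by rewrite doubleS gauss_momentSS IH muln0.
Qed.

Lemma gauss_moment_gt0 j : (0 < gauss_moment j.*2)%N.
Proof. by elim: j => [//|j IH]; rewrite doubleS gauss_momentSS muln_gt0. Qed.

Lemma rho_gt0 n p : (0 < n)%N -> (0 < rho n p)%N.
Proof.
move=> n0; suff: (0 < rho n p)%N && (0 < rho n p.+1)%N by case/andP.
elim: p => [//|p /andP[h1 h2]]; rewrite h2 rhoSS muln_gt0 h1 andbT.
by rewrite addn_gt0 n0.
Qed.

Definition upd n (e : 'I_n -> nat) (c j : 'I_n) (a b : nat) (i : 'I_n) : nat :=
  if i == c then a else if i == j then b else e i.

Lemma sum_upd n (e : 'I_n -> nat) c j a b : c != j ->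
  (\sum_i upd e c j a b i = a + b + \sum_(i | (i != c) && (i != j)) e i)%N.
Proof.
move=> cj; rewrite (bigD1 c) //= (bigD1 j) /=; last by rewrite eq_sym.
rewrite {1}/upd eqxx {1}/upd eq_sym (negbTE cj) eqxx addnA; congr addn.
by apply: eq_bigr => i /andP[/negbTE ic /negbTE ij]; rewrite /upd ic ij.
Qed.

Lemma upd_id n (e : 'I_n -> nat) c j : upd e c j (e c) (e j) = e.
Proof.
by apply/funext => i; rewrite /upd; case: eqP => [->//|_]; case: eqP => [->|].
Qed.

(* What the invariance of a measure under rotations of the plane of the variables [c] and [j]
   says about its moments. *)
Definition rot_inv (R : realType) n (T : nat) (mu : ('I_n -> nat) -> R) (c j : 'I_n) :=
  forall (e : 'I_n -> nat) k, (\sum_i upd e c j k 0 i <= T)%N ->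
  forall u v : R, u ^+ 2 + v ^+ 2 = 1 ->
  \sum_(a < k.+1) 'C(k, a)%:R * u ^+ (k - a) * v ^+ a * mu (upd e c j (k - a)%N a) =
  mu (upd e c j k 0%N).

Lemma poly_eq_horner (R : realType) (p q : {poly R}) :
  (forall v, p.[v] = q.[v]) -> p = q.
Proof.
move=> pq; apply/eqP; rewrite -subr_eq0; apply/eqP; set P := (X in X = 0).
have P0 v : P.[v] = 0 by rewrite /P hornerD hornerN pq subrr.
apply/eqP; apply: contraT => PN0.
have := max_poly_roots PN0 (rs := [seq i%:R | i <- iota 0 (size P)]).
rewrite size_map size_iota ltnn => -> //.
  by apply/allP => x _; rewrite /root P0.
by rewrite map_inj_uniq ?iota_uniq // => x y /eqP; rewrite eqr_nat => /eqP.
Qed.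

(** The vector [(1, v)] divided by its length [w] is a unit vector; by homogeneity the invariance
    turns into an identity for a polynomial in [v], with [w ^ k] times the pure moment on the
    right. *)
Lemma rot_inv_horner (R : realType) n T (mu : ('I_n -> nat) -> R) c j
    (e : 'I_n -> nat) k v : rot_inv T mu c j ->
  (\sum_i upd e c j k 0 i <= T)%N ->
  (\poly_(a < k.+1) ('C(k, a)%:R * mu (upd e c j (k - a)%N a))).[v] =
  Num.sqrt (1 + v ^+ 2) ^+ k * mu (upd e c j k 0%N).
Proof.
move=> ri eT.
have h0 : 0 < 1 + v ^+ 2 by rewrite ltr_pwDl // sqr_ge0.
set w := Num.sqrt (1 + v ^+ 2).
have w2 : w ^+ 2 = 1 + v ^+ 2 by rewrite sqr_sqrtr // ltW.
have w0 : w != 0 by rewrite gt_eqF // sqrtr_gt0.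
have uv : (w^-1) ^+ 2 + (v / w) ^+ 2 = 1.
  have -> : (w^-1) ^+ 2 + (v / w) ^+ 2 = (1 + v ^+ 2) / w ^+ 2 by field.
  by rewrite -w2 divff // expf_neq0.
rewrite -(ri e k eT _ _ uv) mulr_sumr horner_poly.
apply: eq_bigr => -[i iK] _ /=; rewrite exprMn !exprVn.
have -> : w ^+ k = w ^+ (k - i) * w ^+ i by rewrite -exprD subnK.
by field; rewrite !expf_neq0.
Qed.

Lemma coef_1X2 (R : realType) K a :
  ((1 + 'X^2) ^+ K : {poly R})`_a = if odd a then 0 else 'C(K, a./2)%:R.
Proof.
rewrite exprDn coef_sum.
under eq_bigr => i _ do rewrite expr1n mul1r -exprM coefMn coefXn.
case: ifP => oa.
  rewrite big1 // => i _; case: eqP => [E|_]; last by rewrite mul0rn.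
  by move: oa; rewrite E oddM.
have [aK|Ka] := leqP a./2 K.
  rewrite (bigD1 (Ordinal (aK : (a./2 < K.+1)%N))) //= big1.
    have -> : (a == 2 * a./2)%N by rewrite mul2n -{1}(odd_double_half a) oa.
    by rewrite addr0.
  move=> i /eqP ia; case: eqP => [E|_]; last by rewrite mul0rn.
  by case: ia; apply/val_inj; rewrite /= E mul2n doubleK.
rewrite bin_small // big1 // => i _; case: eqP => [E|_]; last by rewrite mul0rn.
by move: Ka; rewrite E mul2n doubleK ltnNge -ltnS ltn_ord.
Qed.

(** In even degree the power of the length is the polynomial [(1 + v^2) ^ K], so coefficients can be
    compared. *)
Lemma rot_inv_even (R : realType) n T (mu : ('I_n -> nat) -> R) c j
    (e : 'I_n -> nat) K a : rot_inv T mu c j ->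
  (\sum_i upd e c j K.*2 0 i <= T)%N -> (a <= K.*2)%N ->
  'C(K.*2, a)%:R * mu (upd e c j (K.*2 - a)%N a) =
  mu (upd e c j K.*2 0%N) * (if odd a then 0 else 'C(K, a./2)%:R).
Proof.
move=> ri eT aK.
have E : \poly_(a < K.*2.+1) ('C(K.*2, a)%:R * mu (upd e c j (K.*2 - a)%N a)) =
    mu (upd e c j K.*2 0%N) *: (1 + 'X^2) ^+ K.
  apply: poly_eq_horner => v; rewrite (rot_inv_horner _ ri eT).
  rewrite -mul2n exprM sqr_sqrtr ?addr_ge0 ?sqr_ge0 //.
  by rewrite !hornerE mulrC.
have := congr1 (fun p : {poly R} => p`_a) E.
by rewrite coef_poly ltnS aK coefZ coef_1X2.
Qed.

(** The half turn [u = -1], [v = 0] negates the pure moment of odd degree, so the whole polynomial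
    vanishes. *)
Lemma rot_inv_odd (R : realType) n T (mu : ('I_n -> nat) -> R) c j
    (e : 'I_n -> nat) k a : rot_inv T mu c j ->
  (\sum_i upd e c j k 0 i <= T)%N -> odd k -> (a <= k)%N ->
  mu (upd e c j (k - a)%N a) = 0.
Proof.
move=> ri eT ok ak.
have muk : mu (upd e c j k 0%N) = 0.
  have := ri e k eT (-1) 0; rewrite expr0n /= addr0 sqrrN expr1n => /(_ erefl).
  rewrite big_ord_recl big1.
    rewrite bin0 subn0 -signr_odd ok expr1 expr0 mul1r mulr1 mulN1r addr0 => /eqP.
    by rewrite -subr_eq0 -opprD oppr_eq0 -mulr2n mulrn_eq0 /= => /eqP.
  by move=> i _; rewrite expr0n /= mulr0 mul0r.
have E : \poly_(a < k.+1) ('C(k, a)%:R * mu (upd e c j (k - a)%N a)) = 0.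
  by apply: poly_eq_horner => v; rewrite (rot_inv_horner _ ri eT) muk mulr0 horner0.
have := congr1 (fun p : {poly R} => p`_a) E.
rewrite coef_poly ltnS ak coef0 => /eqP; rewrite mulf_eq0 pnatr_eq0.
by rewrite eqn0Ngt bin_gt0 ak /= => /eqP.
Qed.

Definition bump2 n (e : 'I_n -> nat) (j i : 'I_n) : nat := (e i + (i == j).*2)%N.

Lemma sum_bump2 n (e : 'I_n -> nat) j : (\sum_i bump2 e j i = (\sum_i e i).+2)%N.
Proof.
rewrite /bump2 big_split /= [X in (_ + X)%N](bigD1 j) //= eqxx [X in (_ + (_ + X))%N]big1 ?addn0 ?addn2 //.
by move=> i /negbTE ->.
Qed.

Lemma sphere_moment_bump2 (R : realType) n m (e : 'I_n -> nat) j :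
  sphere_moment R m (bump2 e j) =
  (e j).+1%:R / (m + \sum_i e i)%:R * sphere_moment R m e.
Proof.
have E : (\prod_i gauss_moment (bump2 e j i) =
    (e j).+1 * \prod_i gauss_moment (e i))%N.
  rewrite (bigD1 j) //= [in RHS](bigD1 j) //= mulnA; congr (_ * _)%N.
    by rewrite /bump2 eqxx addn2 gauss_momentSS.
  by apply: eq_bigr => i /negbTE ij; rewrite /bump2 ij addn0.
by rewrite /sphere_moment sum_bump2 rhoSS E !natrM invfM; ring.
Qed.

Lemma sphere_moment_odd (R : realType) n m (e : 'I_n -> nat) i :
  odd (e i) -> sphere_moment R m e = 0.
Proof.
by move=> oi; rewrite /sphere_moment (bigD1 i) //= gauss_moment_odd // mul0n mul0r.
Qed.

(** Both moments are coefficients of one identity of degree [K.*2], at the positions [b.*2] and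
    [b.+1.*2], where [a] and [b] are half the exponents at [c] and [j]; the rest is a ratio of
    binomial coefficients. *)
Lemma rot_inv_bump2 (R : realType) n T (mu : ('I_n -> nat) -> R) c j
    (e : 'I_n -> nat) : c != j -> rot_inv T mu c j ->
  ((\sum_i e i).+2 <= T)%N -> ~~ odd (e c) -> ~~ odd (e j) ->
  (e j).+1%:R * mu (bump2 e c) = (e c).+1%:R * mu (bump2 e j).
Proof.
move=> cj ri eT oc oj.
have [a ea] : exists a, e c = a.*2 by exists (e c)./2; rewrite even_halfK.
have [b eb] : exists b, e j = b.*2 by exists (e j)./2; rewrite even_halfK.
pose K := (a + b).+1.
have jc : (j == c) = false by rewrite eq_sym (negbTE cj).
have e1 : bump2 e c = upd e c j (K.*2 - b.*2) b.*2.
  apply/funext => i; rewrite /upd /bump2; case: (altP (i =P c)) => [->|ic].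
    by rewrite ea -doubleB /K -addSn addnK doubleS addn2.
  by case: eqP => [->|]; rewrite addn0 // eb.
have e2 : bump2 e j = upd e c j (K.*2 - b.+1.*2) b.+1.*2.
  apply/funext => i; rewrite /upd /bump2; case: (altP (i =P c)) => [->|ic].
    by rewrite (negbTE cj) ea addn0 -doubleB /K subSS addnK.
  by case: eqP => [->|]; rewrite ?addn0 // eb doubleS addn2.
have sT : (\sum_i upd e c j K.*2 0 i <= T)%N.
  apply: leq_trans eT; rewrite sum_upd // -(sum_bump2 e c) e1 // sum_upd //.
  rewrite addn0 subnK // leq_double /K ltnW // ltnS leq_addl //.
have bK : (b.*2 <= K.*2)%N by rewrite leq_double /K ltnW // ltnS leq_addl.
have bK' : (b.+1.*2 <= K.*2)%N by rewrite leq_double /K ltnS leq_addl.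
have := rot_inv_even ri sT bK; have := rot_inv_even ri sT bK'.
rewrite -e1 -e2 !odd_double !doubleK.
set M := mu (upd _ _ _ _ _); set m1 := mu (bump2 e c); set m2 := mu (bump2 e j).
move=> H2 H1.
have B1 : 'C(K, b.+1)%:R * b.+1%:R = a.+1%:R * 'C(K, b)%:R :> R.
  rewrite -!natrM mulnC mul_bin_left; congr (_ * _)%:R%N.
  by rewrite /K -addSn addnK.
have B2 : 'C(K.*2, b.+1.*2)%:R * (b.+1.*2%:R * b.*2.+1%:R) =
    a.+1.*2%:R * a.*2.+1%:R * 'C(K.*2, b.*2)%:R :> R.
  have E1 : (b.*2.+1 * 'C(K.*2, b.*2.+1) = (a.+1.*2) * 'C(K.*2, b.*2))%N.
    rewrite mul_bin_left -doubleB; congr (_.*2 * _)%N; by rewrite /K -addSn addnK.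
  have E2 : (b.+1.*2 * 'C(K.*2, b.+1.*2) = a.*2.+1 * 'C(K.*2, b.*2.+1))%N.
    rewrite doubleS mul_bin_left; congr (_ * _)%N.
    by rewrite /K doubleS subSS doubleD -addSn addnK.
  rewrite -!natrM; congr _%:R.
  by rewrite mulnC -mulnA mulnCA E2 mulnCA E1 mulnA [(a.*2.+1 * _)%N]mulnC.
have C0 : 'C(K.*2, b.*2)%:R != 0 :> R by rewrite pnatr_eq0 -lt0n bin_gt0.
have a0 : a.+1.*2%:R != 0 :> R by rewrite pnatr_eq0.
apply: (mulfI C0); apply: (mulfI a0).
rewrite ea eb.
transitivity (a.+1.*2%:R * b.*2.+1%:R * (M * 'C(K, b)%:R)).
  by rewrite -H1; ring.
have dS (p : nat) : p.+1.*2%:R = 2 * p.+1%:R :> R by rewrite -mul2n natrM.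
transitivity (2 * b.*2.+1%:R * (M * ('C(K, b.+1)%:R * b.+1%:R))).
  by rewrite B1 dS; ring.
transitivity ('C(K.*2, b.+1.*2)%:R * m2 * (b.+1.*2%:R * b.*2.+1%:R)).
  by rewrite H2 dS; ring.
rewrite mulrAC B2; ring.
Qed.

(* Rotations in the planes [(c, j)] determine the ratios of the moments of a
   given degree, and [|x|^2 = 1] links consecutive even degrees. *)
Lemma moments_unique (R : realType) n T (mu : ('I_n -> nat) -> R) (c c' : 'I_n) :
  c != c' -> (forall j, c != j -> rot_inv T mu c j) ->
  mu (fun=> 0%N) = 1 ->
  (forall e, ((\sum_i e i).+2 <= T)%N -> \sum_j mu (bump2 e j) = mu e) ->
  forall e, (\sum_i e i <= T)%N -> mu e = sphere_moment R n e.
Proof.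
move=> cc' ri mu0 musph.
have mu_odd e i : (\sum_i e i <= T)%N -> odd (e i) -> mu e = 0.
  move=> eT oi.
  (* A plane containing the axis [c] in which some exponent is odd; if the odd index is [c] itself,
     [c'] supplies the second axis. *)
  have [j cj oj] : exists2 j, c != j & odd (e c) || odd (e j).
    have [ic|ic] := eqVneq i c; first by exists c' => //; rewrite -ic oi.
    by exists i; rewrite 1?eq_sym // oi orbT.
  pose k := (e c + e j)%N.
  have sT : (\sum_i upd e c j k 0 i <= T)%N.
    by rewrite -(upd_id e c j) sum_upd // in eT; rewrite sum_upd // addn0.
  have jk : (e j <= k)%N by exact: leq_addl.
  have E : e = upd e c j (k - e j) (e j) by rewrite addnK upd_id.
  have [ok|ek] := boolP (odd k); first by rewrite E (rot_inv_odd (ri j cj) sT).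
  have oj' : odd (e j).
    by move: oj ek; rewrite /k oddD; case: (odd (e c)); case: (odd (e j)).
  have kK : k = k./2.*2 by rewrite even_halfK.
  rewrite kK in sT jk E.
  have := rot_inv_even (ri j cj) sT jk.
  rewrite -E oj' mulr0 => /eqP; rewrite mulf_eq0 pnatr_eq0.
  by rewrite eqn0Ngt bin_gt0 jk /= => /eqP.
have mu_bump e j : ((\sum_i e i).+2 <= T)%N -> (forall i, ~~ odd (e i)) ->
    mu (bump2 e j) = (e j).+1%:R / (n + \sum_i e i)%:R * mu e.
  move=> eT ev.
  (* All the moments two degrees up are proportional to [(e i).+1]; their sum is [mu e], which fixes
     the factor. *)
  have H i : mu (bump2 e i) = (e i).+1%:R * (mu (bump2 e c) / (e c).+1%:R).
    have [<-|ci] := eqVneq c i; first by field; rewrite addrC natr1 pnatr_eq0.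
    have := rot_inv_bump2 ci (ri i ci) eT (ev c) (ev i).
    rewrite mulrA => ->; rewrite mulrC mulKf // pnatr_eq0 //.
  have := musph e eT; rewrite (eq_bigr _ (fun i _ => H i)).
  rewrite -mulr_suml -natr_sum.
  under eq_bigr do rewrite -add1n.
  rewrite big_split /= sum1_card card_ord => <-.
  rewrite H; field.
  rewrite nat1r pnatr_eq0 -natrD pnatr_eq0 /= addn_eq0 negb_and -lt0n.
  by rewrite (leq_ltn_trans _ (ltn_ord c)).
move=> e; move: {2}(\sum_i e i)%N (leqnn (\sum_i e i)) => N.
elim: N e => [|N IH] e eN eT.
  have e0 : e = fun=> 0%N.
    apply/funext => i; apply/eqP; rewrite -leqn0 (leq_trans _ eN) //.
    by rewrite (bigD1 i) //= leq_addr.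
  rewrite e0 mu0 /sphere_moment big1 // big1 // div1r invr1 //.
have [/existsP[i oi]|/existsPn ev] := boolP [exists i, odd (e i)].
  by rewrite (mu_odd e i) // (sphere_moment_odd _ _ oi).
have [/existsP[i ei]|/existsPn z] := boolP [exists i, e i != 0%N]; last first.
  have e0 : e = fun=> 0%N by apply/funext => i; have := z i; rewrite negbK => /eqP.
  by apply: IH => //; rewrite e0 big1.
pose e' k := (e k - (k == i).*2)%N.
have ee' : e = bump2 e' i.
  apply/funext => k; rewrite /bump2 /e' subnK //; case: eqP => [->|//].
  by move: ei (ev i); case: (e i) => [|[|]].
have sN : (\sum_i e i = (\sum_i e' i).+2)%N by rewrite {1}ee' sum_bump2.
have ev' k : ~~ odd (e' k).
  by have := ev k; rewrite ee' /bump2 oddD odd_double addbF.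
rewrite {1}ee' mu_bump //; last by rewrite -sN.
rewrite IH; [by rewrite -sphere_moment_bump2 -ee'| |].
  by rewrite sN in eN; exact: ltnW.
by rewrite sN in eT; rewrite ltnW // ltnW.
Qed.

(** * Integration over the sphere and its rotations *)

Lemma open_borel (R : realType) n (A : set 'rV[R]_n) :
  open A -> measurable (A : set (borelRn R n)).
Proof. by move=> oA; apply: sub_sigma_algebra. Qed.

Lemma continuous_borel (R : realType) n (f : 'rV[R]_n -> R) :
  continuous f -> measurable_fun setT (f : borelRn R n -> R).
Proof.
move=> /continuousP cf; apply: (measurability _ (RGenOpens.measurableE R)).
move=> _ [_ [a [b ->] <-]]; rewrite setTI; apply: open_borel.
exact/cf/interval_open.
Qed.

Lemma sphere_sum (R : realType) d (x : 'rV[R]_d.+1) :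
  sphere d x <-> \sum_i x 0 i ^+ 2 = 1.
Proof.
split=> [h|h]; last by rewrite /sphere /= /euclid h sqrtr1.
have h0 : 0 <= \sum_i x 0 i ^+ 2 by apply: sumr_ge0 => i _; exact: sqr_ge0.
by rewrite -[LHS]sqr_sqrtr // -[Num.sqrt _]/(euclid x) h expr1n.
Qed.

Lemma measurable_sphere (R : realType) d :
  measurable (sphere d : set (borelRn R d.+1)).
Proof.
have -> : (sphere d : set (borelRn R d.+1)) =
    setT `&` (fun x : 'rV[R]_d.+1 => \sum_i x 0 i ^+ 2) @^-1` [set 1].
  by rewrite setTI; apply/seteqP; split => x /sphere_sum.
apply: (continuous_borel _ measurableT) => // x.
apply: continuous_bigsum => i; apply: continuous_exprn; exact: coord_continuous.
Qed.

Lemma sphere_coord_le1 (R : realType) d (x : 'rV[R]_d.+1) i :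
  sphere d x -> `|x 0 i| <= 1.
Proof.
move=> /sphere_sum h; rewrite -(ler_pXn2r (ltn0Sn 1)) ?nnegrE // expr1n -h.
rewrite (bigD1 i) //= real_normK ?num_real // lerDl; apply: sumr_ge0 => j _.
exact: sqr_ge0.
Qed.

Lemma sphere_mono_le1 (R : realType) d (x : 'rV[R]_d.+1) e :
  sphere d x -> `|mono e x| <= 1.
Proof.
move=> sx; rewrite /mono normr_prod; apply: prodr_ile1 => i _.
rewrite normr_ge0 normrX exprn_ile1 //; exact: sphere_coord_le1.
Qed.

Lemma sphere_integrable (R : realType) d (sigma : probability (borelRn R d.+1) R)
    (f : 'rV[R]_d.+1 -> R) (M : R) :
  continuous f -> (forall x, sphere d x -> `|f x| <= M) ->
  sigma.-integrable (sphere d) (EFin \o f).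
Proof.
move=> cf fM; apply: measurable_bounded_integrable.
- exact: measurable_sphere.
- apply: le_lt_trans (ltry 1); apply: probability_le1; exact: measurable_sphere.
- by apply: measurable_funTS; exact: continuous_borel.
- exists M; split; first exact: num_real.
  by move=> B MB x sx; apply: le_trans (ltW MB); exact: fM.
Qed.

Lemma sphere_orthogonal (R : realType) d (U : 'M[R]_d.+1) (x : 'rV[R]_d.+1) :
  U *m U^T = 1%:M -> sphere d (x *m U) <-> sphere d x.
Proof.
move=> UU.
have E (y : 'rV[R]_d.+1) : \sum_i y 0 i ^+ 2 = (y *m y^T) 0 0.
  by rewrite mxE; apply: eq_bigr => i _; rewrite mxE expr2.
rewrite !sphere_sum !E trmx_mul mulmxA -[_ *m U *m _]mulmxA UU mulmx1.
by [].
Qed.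

Lemma cvg_row (R : realType) (T : Type) (F : set_system T) (FF : Filter F) n
    (g : T -> 'rV[R]_n) (l : 'rV[R]_n) :
  (forall j, (g x 0 j) @[x --> F] --> l 0 j) -> g x @[x --> F] --> l.
Proof.
move=> gl; apply/cvgrPdist_le => /= e e0; near=> x.
rewrite /Num.Def.normr/= mx_normrE (bigmax_le _ (ltW e0))//= => -[i j] _.
rewrite (ord1 i) !mxE/=.
move: j {i}; near: x; apply: filter_forall => /= j.
exact: ((cvgrPdist_le _ _).1 (gl j)).
Unshelve. all: by end_near. Qed.

Lemma continuous_row (R : realType) (T : topologicalType) n (g : T -> 'rV[R]_n) :
  (forall j, continuous (fun s => g s 0 j)) -> continuous g.
Proof. by move=> cg x; apply: cvg_row => j; exact: cg. Qed.

Lemma within_continuous_row (R : realType) (T : topologicalType) (A : set T) n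
    (g : T -> 'rV[R]_n) :
  (forall j, {within A, continuous (fun s => g s 0 j)}) -> {within A, continuous g}.
Proof. by move=> cg x; apply: cvg_row => j; exact: cg. Qed.

Lemma continuous_mulmxr (R : realType) n (U : 'M[R]_n) :
  continuous (fun x : 'rV[R]_n => x *m U).
Proof.
apply: continuous_row => j x.
have -> : (fun s : 'rV[R]_n => (s *m U) 0 j) = fun s => \sum_i s 0 i * U i j.
  by apply/funext => s; rewrite mxE.
apply: continuous_bigsum => i; apply: continuousM; last exact: cst_continuous.
exact: coord_continuous.
Qed.

Lemma sphere_integral_orthogonal (R : realType) d
    (sigma : probability (borelRn R d.+1) R) (U : 'M[R]_d.+1)
    (f : 'rV[R]_d.+1 -> R) (M : R) :
  uniform_on_sphere sigma -> U *m U^T = 1%:M ->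
  continuous f -> (forall x, sphere d x -> `|f x| <= M) ->
  \int[sigma]_(x in sphere d) f (x *m U) = \int[sigma]_(x in sphere d) f x.
Proof.
move=> [_ inv] UU cf fM; rewrite /Rintegral; congr fine.
pose phi : borelRn R d.+1 -> borelRn R d.+1 := fun x => (x : 'rV[R]_d.+1) *m U.
have mphi : measurable_fun setT phi.
  apply: (@measurability _ _ (borelRn R d.+1) (borelRn R d.+1) setT phi (@open 'rV[R]_d.+1) (erefl _)).
  move=> _ [A oA <-]; rewrite setTI; apply: open_borel.
  by have /continuousP := @continuous_mulmxr R d.+1 U; apply.
have pre : phi @^-1` sphere d = sphere d.
  by apply/seteqP; split => x /=; [move/(sphere_orthogonal x UU)|move=> h; apply/(sphere_orthogonal x UU)].
have cfU : continuous (fun x : 'rV[R]_d.+1 => f (x *m U)).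
  by move=> x; apply: continuous_comp; [exact: continuous_mulmxr|exact: cf].
have int : sigma.-integrable (phi @^-1` sphere d) ((EFin \o f) \o phi).
  rewrite pre; apply: (@sphere_integrable _ _ _ (fun x => f (x *m U)) M cfU).
  by move=> x sx; apply: fM; apply/(sphere_orthogonal x UU).
have mf : measurable_fun setT (EFin \o f : borelRn R d.+1 -> \bar R).
  by apply/measurable_EFinP; exact: continuous_borel.
have := integral_pushforward mphi mf int (@measurable_sphere R d).
rewrite pre => <-.
by apply: eq_measure_integral => A mA _; exact: inv.
Qed.

Definition givens (R : realType) n (c j : 'I_n) (u v : R) : 'M[R]_n :=
  \matrix_(a, b) if b == c then (if a == c then u else if a == j then v else 0)
    else if b == j then (if a == c then - v else if a == j then u else 0)
    else (a == b)%:R.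

Lemma givens_c (R : realType) n (c j : 'I_n) (u v : R) (x : 'rV[R]_n) :
  c != j -> (x *m givens c j u v) 0 c = u * x 0 c + v * x 0 j.
Proof.
move=> cj; have jc : j != c by rewrite eq_sym.
rewrite mxE (bigD1 c) //= (bigD1 j) //= big1.
  by rewrite !mxE !eqxx (negbTE jc); ring.
by move=> i /andP[/negbTE ic /negbTE ij]; rewrite !mxE eqxx ic ij mulr0.
Qed.

Lemma givens_j (R : realType) n (c j : 'I_n) (u v : R) (x : 'rV[R]_n) :
  c != j -> (x *m givens c j u v) 0 j = - v * x 0 c + u * x 0 j.
Proof.
move=> cj; have jc : j != c by rewrite eq_sym.
rewrite mxE (bigD1 c) //= (bigD1 j) //= big1.
  by rewrite !mxE !eqxx (negbTE jc); ring.
by move=> i /andP[/negbTE ic /negbTE ij]; rewrite !mxE eqxx (negbTE jc) ic ij mulr0.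
Qed.

Lemma givens_other (R : realType) n (c j i : 'I_n) (u v : R) (x : 'rV[R]_n) :
  i != c -> i != j -> (x *m givens c j u v) 0 i = x 0 i.
Proof.
move=> ic ij; rewrite mxE (bigD1 i) //= big1.
  by rewrite !mxE (negbTE ic) (negbTE ij) eqxx mulr1 addr0.
by move=> k /negbTE ki; rewrite !mxE (negbTE ic) (negbTE ij) ki mulr0.
Qed.

Lemma givens_orthogonal (R : realType) n (c j : 'I_n) (u v : R) :
  c != j -> u ^+ 2 + v ^+ 2 = 1 -> givens c j u v *m (givens c j u v)^T = 1%:M.
Proof.
move=> cj uv; have jc : j != c by rewrite eq_sym.
apply/matrixP => a b.
have -> : (givens c j u v *m (givens c j u v)^T) a b =
    (row b (givens c j u v) *m (givens c j u v)^T) 0 a.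
  by rewrite !mxE; apply: eq_bigr => k _; rewrite !mxE mulrC.
rewrite !mxE (bigD1 c) //= (bigD1 j) //= !mxE !eqxx (negbTE jc).
rewrite (eq_bigr (fun k => (b == k)%:R * (a == k)%:R)); last first.
  by move=> k /andP[/negbTE kc /negbTE kj]; rewrite !mxE kc kj.
have S0 (y z : 'I_n) : (z == c) || (z == j) ->
    \sum_(k < n | (k != c) && (k != j)) (y == k)%:R * (z == k)%:R = 0 :> R.
  move=> zcj; apply: big1 => k /andP[/negbTE kc /negbTE kj].
  by case: (z =P k) zcj => [->|_]; rewrite ?kc ?kj ?mulr0.
have S0' (y z : 'I_n) : (z == c) || (z == j) ->
    \sum_(k < n | (k != c) && (k != j)) (z == k)%:R * (y == k)%:R = 0 :> R.
  by move=> h; rewrite -[RHS](S0 y z h); apply: eq_bigr => k _; rewrite mulrC.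
have [bc|bc] := eqVneq b c.
  rewrite bc S0' ?eqxx //.
  by case: (eqVneq a c) => [_|_] /=; [rewrite -uv; ring|case: (eqVneq a j) => [_|_]; ring].
have [bj|bj] := eqVneq b j.
  rewrite bj S0' ?eqxx ?orbT //.
  case: (eqVneq a c) => [->|_] /=; first by rewrite (negbTE cj) -[RHS]/(0 : R); ring.
  case: (eqVneq a j) => [_|_]; first by rewrite -[RHS]/(1 : R) -uv; ring.
  by rewrite -[RHS]/(0 : R); ring.
rewrite !mul0r !add0r.
have [ac|ac] := eqVneq a c; first by rewrite ac S0 ?eqxx // eq_sym (negbTE bc).
have [aj|aj] := eqVneq a j; first by rewrite aj S0 ?eqxx ?orbT // eq_sym (negbTE bj).
rewrite (bigD1 b) ?bc ?bj //= big1 ?addr0 ?eqxx ?mul1r //.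
by move=> k /andP[_ /negbTE kb]; rewrite eq_sym kb mul0r.
Qed.

Lemma mono_rot (R : realType) n (e : 'I_n -> nat) (c j : 'I_n) k (u v : R)
    (x y : 'rV[R]_n) : c != j ->
  y 0 c = u * x 0 c + v * x 0 j ->
  (forall i, i != c -> i != j -> y 0 i = x 0 i) ->
  mono (upd e c j k 0%N) y =
  \sum_(a < k.+1) 'C(k, a)%:R * u ^+ (k - a) * v ^+ a *
    mono (upd e c j (k - a)%N a) x.
Proof.
move=> cj yc yi; have jc : j != c by rewrite eq_sym.
have E a b (z : 'rV[R]_n) : mono (upd e c j a b) z =
    z 0 c ^+ a * z 0 j ^+ b * \prod_(i | (i != c) && (i != j)) z 0 i ^+ e i.
  rewrite /mono (bigD1 c) //= (bigD1 j) //= /upd !eqxx (negbTE jc) mulrA.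
  by congr (_ * _); apply: eq_bigr => i /andP[/negbTE -> /negbTE ->].
rewrite E yc expr0 mulr1.
rewrite (eq_bigr (fun i => x 0 i ^+ e i)); last first.
  by move=> i /andP[ic ij]; rewrite yi.
rewrite exprDn mulr_suml; apply: eq_bigr => -[a ak] _ /=.
rewrite E !exprMn -mulr_natl; ring.
Qed.

Lemma mono_bump2 (R : realType) n (e : 'I_n -> nat) j (x : 'rV[R]_n) :
  mono (bump2 e j) x = x 0 j ^+ 2 * mono e x.
Proof.
rewrite /mono (bigD1 j) //= [in RHS](bigD1 j) //= mulrA -exprD.
congr (_ ^+ _ * _); first by rewrite /bump2 eqxx addnC.
by apply: eq_bigr => i /negbTE ij; rewrite /bump2 ij addn0.
Qed.

Lemma Rintegral_sum (R : realType) d (T : measurableType d)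
    (mu : {measure set T -> \bar R}) (D : set T) (n : nat) (f : 'I_n -> T -> R)
    (w : 'I_n -> R) : measurable D ->
  (forall i, mu.-integrable D (EFin \o f i)) ->
  mu.-integrable D (EFin \o (fun x => \sum_i w i * f i x)) /\
  \int[mu]_(x in D) (\sum_i w i * f i x) = \sum_i w i * \int[mu]_(x in D) f i x.
Proof.
move=> mD intf.
elim: n f w intf => [|n IH] f w intf.
  have -> : (fun x => \sum_(i < 0) w i * f i x) = (fun=> 0).
    by apply/funext => x; rewrite big_ord0.
  rewrite big_ord0; split; first exact: integrable0.
  by rewrite Rintegral_cst // mul0r.
have [h1 h2] := IH (fun i => f (lift ord0 i)) (fun i => w (lift ord0 i))
  (fun i => intf (lift ord0 i)).
have -> : (fun x => \sum_(i < n.+1) w i * f i x) =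
    (fun x => w ord0 * f ord0 x + \sum_(i < n) w (lift ord0 i) * f (lift ord0 i) x).
  by apply/funext => x; rewrite big_ord_recl.
have h0 : mu.-integrable D (EFin \o (fun x => w ord0 * f ord0 x)).
  by have := integrableZl mD (w ord0) (intf ord0).
split; first by have := integrableD mD h0 h1.
by rewrite RintegralD // h2 RintegralZl // big_ord_recl.
Qed.

(** The image of the uniform measure under [H] is recognized by its symmetries: it is enough to lift
    the rotations in the planes through one axis of the target to orthogonal maps of the source.
    Used for the identity and for the Hopf map. *)
Lemma sphere_map_moments (R : realType) d n (sigma : probability (borelRn R d.+1) R)
    (H : 'rV[R]_d.+1 -> 'rV[R]_n.+1) (c c' : 'I_n.+1) :
  uniform_on_sphere sigma -> continuous H ->
  (forall x, sphere d x -> sphere n (H x)) -> c != c' ->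
  (forall j, c != j -> forall u v : R, u ^+ 2 + v ^+ 2 = 1 ->
    exists U : 'M[R]_d.+1, U *m U^T = 1%:M /\ forall x,
      H (x *m U) 0 c = u * H x 0 c + v * H x 0 j /\
      forall i, i != c -> i != j -> H (x *m U) 0 i = H x 0 i) ->
  forall e, \int[sigma]_(x in sphere d) mono e (H x) = sphere_moment R n.+1 e.
Proof.
move=> us cH sH cc' lift e.
have cm e' : continuous (fun x => mono e' (H x)).
  by move=> x; apply: continuous_comp; [exact: cH|exact: continuous_mono].
have bm e' x : sphere d x -> `|mono e' (H x)| <= 1.
  by move=> /sH; exact: sphere_mono_le1.
have im e' : sigma.-integrable (sphere d) (EFin \o (fun x => mono e' (H x))).
  exact: sphere_integrable (cm e') (bm e').
have mS := @measurable_sphere R d.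
pose mu e' := \int[sigma]_(x in sphere d) mono e' (H x).
apply: (@moments_unique R n.+1 (\sum_i e i)%N mu c c') => //.
- move=> j cj e' k _ u v uv; have [U [UU HU]] := lift j cj u v uv.
  have [_ <-] := Rintegral_sum (fun a : 'I_k.+1 => 'C(k, a)%:R * u ^+ (k - a) * v ^+ a)
    mS (fun a : 'I_k.+1 => im (upd e' c j (k - a)%N a)).
  rewrite -[RHS](sphere_integral_orthogonal us UU (cm _) (bm _)).
  apply: eq_Rintegral => x _; have [h1 h2] := HU x.
  by rewrite (mono_rot _ _ cj h1 h2).
- rewrite /mu; have -> : (fun x => mono (fun=> 0%N) (H x)) = cst 1.
    by apply/funext => x; rewrite /mono big1.
  transitivity (1 * fine (sigma (sphere d))); first exact: Rintegral_cst.
  by rewrite us.1 mulr1.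
- move=> e' _.
  have [_ H1] := Rintegral_sum (fun=> 1) mS (fun j => im (bump2 e' j)).
  have -> : \sum_j mu (bump2 e' j) = \sum_j 1 * mu (bump2 e' j).
    by apply: eq_bigr => j _; rewrite mul1r.
  rewrite -H1; apply: eq_Rintegral => x; rewrite inE => sx.
  under eq_bigr do rewrite mul1r mono_bump2.
  by rewrite -mulr_suml; move/sH/sphere_sum : sx => ->; rewrite mul1r.
Qed.

Lemma sphere_moments (R : realType) d (sigma : probability (borelRn R d.+2) R) :
  uniform_on_sphere sigma ->
  forall e, \int[sigma]_(x in sphere d.+1) mono e x = sphere_moment R d.+2 e.
Proof.
move=> us; apply: (@sphere_map_moments R d.+1 d.+1 sigma id ord0 ord_max) => //.
- by move=> x; exact: cvg_id.
- move=> j cj u v uv; exists (givens ord0 j u v); split.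
    exact: givens_orthogonal.
  by move=> x; split; [exact: givens_c|move=> i; exact: givens_other].
Qed.

Lemma sphere_integral_polyfun (R : realType) d (sigma : probability (borelRn R d.+2) R)
    (p : mpoly d.+2 R) : uniform_on_sphere sigma ->
  (\int[sigma]_(x in sphere d.+1) (polyfun p x)%:E =
  (\sum_(m <- msupp p) mcoeff m p * sphere_moment R d.+2 m)%:E)%E.
Proof.
move=> us; have mS := @measurable_sphere R d.+1.
have im e : sigma.-integrable (sphere d.+1) (EFin \o mono e).
  apply: (@sphere_integrable _ _ _ _ 1); first by move=> x; exact: continuous_mono.
  by move=> x; exact: sphere_mono_le1.
pose m i := tnth (in_tuple (msupp p)) i.
have [h1 h2] := Rintegral_sum (fun i => mcoeff (m i) p) mS (fun i => im (m i)).
have E x : polyfun p x = \sum_i mcoeff (m i) p * mono (m i) x.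
  by rewrite polyfunE big_tnth.
under eq_integral do rewrite E.
rewrite -[LHS]fineK; last exact: integrable_fin_num h1.
congr EFin; rewrite -[LHS]/(Rintegral _ _ _) h2 [RHS]big_tnth.
by apply: eq_bigr => i _; rewrite sphere_moments.
Qed.

(** * The Hopf map *)

Local Open Scope complex_scope.

Lemma expiD (R : realType) (x y : R) : expi (x + y) = expi x * expi y.
Proof.
rewrite /expi cosD sinD; apply/eqP; rewrite eq_complex /= eqxx /=.
by apply/eqP; ring.
Qed.

Lemma expi0 (R : realType) : expi 0 = 1 :> R[i].
Proof. by rewrite /expi cos0 sin0. Qed.

Lemma expi_conj (R : realType) (x : R) : expi x * (expi x)^* = 1.
Proof.
rewrite /expi; apply/eqP; rewrite eq_complex /=; apply/andP; split; apply/eqP.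
  by rewrite -(cos2Dsin2 x); ring.
by ring.
Qed.

Lemma expi2pi (R : realType) : expi (2 * pi) = 1 :> R[i].
Proof. by rewrite mulr_natl /expi cos2pi sin2pi. Qed.

Lemma expi_natM (R : realType) (x : R) n : expi (n%:R * x) = expi x ^+ n.
Proof.
elim: n => [|n IH]; first by rewrite mul0r expi0 expr0.
by rewrite -natr1 mulrDl mul1r expiD IH exprSr.
Qed.

Lemma expi2pi_int (R : realType) (k : int) : expi (2 * pi * k%:~R) = 1 :> R[i].
Proof.
case: k => n.
  by rewrite mulrC -pmulrn expi_natM expi2pi expr1n.
have H : expi (2 * pi * n.+1%:R) = 1 :> R[i] by rewrite mulrC expi_natM expi2pi expr1n.
have : expi (2 * pi * (Negz n)%:~R) * expi (2 * pi * n.+1%:R) = 1 :> R[i].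
  by rewrite -expiD -mulrDr NegzE mulrNz -pmulrn addNr mulr0 expi0.
by rewrite H mulr1.
Qed.

(** After reduction to [[0, 2 pi[] the equation [cos y = 1] forces [sin (y / 2) = 0], while the sine
    is positive on []0, pi[]. *)
Lemma expi_eq1 (R : realType) (x : R) : expi x = 1 -> exists k : int, x = 2 * pi * k%:~R.
Proof.
move=> h; have p0 : 0 < 2 * pi :> R by rewrite mulr_gt0 ?pi_gt0.
pose k := Num.floor (x / (2 * pi)); exists k.
pose y := x - 2 * pi * k%:~R.
have hy : expi y = 1.
  have : expi y * expi (2 * pi * k%:~R) = 1 by rewrite -expiD subrK.
  by rewrite expi2pi_int mulr1.
have y0 : 0 <= y.
  by rewrite subr_ge0 mulrC -ler_pdivlMr // floor_le.
have y1 : y < 2 * pi.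
  rewrite ltrBlDr -[X in X + _]mulr1 -mulrDr mulrC -ltr_pdivrMr // addrC.
  by rewrite -[1]/(1%:~R) -intrD floorD1_gt.
have cy : cos y = 1 by move/(congr1 (@complex.Re R)) : hy.
have s0 : sin (y / 2) = 0.
  have y2 : (y / 2) *+ 2 = y by rewrite -mulr_natr divfK // pnatr_eq0.
  have := cos_mulr2n (y / 2); rewrite y2 cy => E.
  have S := cos2Dsin2 (y / 2).
  by apply/eqP; rewrite -sqrf_eq0; apply/eqP; lra.
suff : y = 0 by move/eqP; rewrite subr_eq0 => /eqP.
apply/eqP; apply: contraT => yn0.
have : 0 < sin (y / 2).
  have yp : 0 < y by rewrite lt_neqAle eq_sym yn0.
  by apply: sin_gt0_pi; apply/andP; split; lra.
by rewrite s0 ltxx.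
Qed.

(** Complex linear forms whose real parts are the four real coordinates. A phase acts on each of
    them as a scalar, which fails for the coordinates themselves. *)
Definition lform (R : realType) (i : 'I_4) (z : R[i] * R[i]) : R[i] :=
  [:: z.1; - 'i * z.1; z.2; - 'i * z.2]`_i.

Definition phase_mul (R : realType) (w : R[i]) (z : R[i] * R[i]) : R[i] * R[i] :=
  (w * z.1, w * z.2).

Lemma real_of_C2E (R : realType) (z : R[i] * R[i]) i :
  real_of_C2 z 0 i = complex.Re (lform i z).
Proof.
rewrite mxE /lform; case: z => -[a b] [c d].
by case: i => -[|[|[|[|//]]]] //= _; ring.
Qed.

Lemma lform_scale (R : realType) i w (z : R[i] * R[i]) :
  lform i (phase_mul w z) = w * lform i z.
Proof. by rewrite /lform; case: i => -[|[|[|[|//]]]] //= _; ring. Qed.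

Definition bimono (R : realType) (p : seq 'I_4 * seq 'I_4) (z : R[i] * R[i]) : R[i] :=
  (\prod_(i <- p.1) lform i z) * \prod_(i <- p.2) (lform i z)^*.

(** The terms in the expansion of the product of the sums [lform i z + (lform i z)^*] over [s]: each
    factor is assigned to the holomorphic or to the antiholomorphic side. *)
Fixpoint bimono_terms (s : seq 'I_4) : seq (seq 'I_4 * seq 'I_4) :=
  if s is i :: s' then
    [seq (i :: p.1, p.2) | p <- bimono_terms s'] ++
    [seq (p.1, i :: p.2) | p <- bimono_terms s']
  else [:: ([::], [::])].

Lemma size_bimono_terms s p :
  p \in bimono_terms s -> (size p.1 + size p.2 = size s)%N.
Proof.
elim: s p => [|i s IH] p /=; first by rewrite inE => /eqP ->.
by rewrite mem_cat => /orP[] /mapP[q /IH qs ->] /=; rewrite ?addSn ?addnS qs.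
Qed.

Lemma prod_Re_lform (R : realType) (s : seq 'I_4) (z : R[i] * R[i]) :
  (\prod_(i <- s) complex.Re (lform i z))%:C =
  2 ^- size s * \sum_(p <- bimono_terms s) bimono p z.
Proof.
elim: s => [|i s IH].
  by rewrite big_nil /= big_seq1 /bimono !big_nil expr0 invr1 !mul1r.
rewrite big_cons rmorphM /= IH ReJ_add big_cat /= !big_map.
have E1 : \sum_(p <- bimono_terms s) bimono (i :: p.1, p.2) z =
    lform i z * \sum_(p <- bimono_terms s) bimono p z.
  by rewrite mulr_sumr; apply: eq_bigr => p _; rewrite /bimono big_cons /= mulrA.
have E2 : \sum_(p <- bimono_terms s) bimono (p.1, i :: p.2) z =
    (lform i z)^* * \sum_(p <- bimono_terms s) bimono p z.
  by rewrite mulr_sumr; apply: eq_bigr => p _; rewrite /bimono big_cons /= mulrCA.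
rewrite E1 E2 exprS invfM; ring.
Qed.

Lemma bimono_scale (R : realType) (w : R[i]) p z :
  bimono p (phase_mul w z) = w ^+ size p.1 * w^* ^+ size p.2 * bimono p z.
Proof.
rewrite /bimono.
have E1 (s : seq 'I_4) : \prod_(i <- s) lform i (phase_mul w z) =
    w ^+ size s * \prod_(i <- s) lform i z.
  elim: s => [|i s IH]; first by rewrite !big_nil expr0 mul1r.
  by rewrite !big_cons IH lform_scale /= exprS; ring.
have E2 (s : seq 'I_4) : \prod_(i <- s) (lform i (phase_mul w z))^* =
    w^* ^+ size s * \prod_(i <- s) (lform i z)^*.
  elim: s => [|i s IH]; first by rewrite !big_nil expr0 mul1r.
  by rewrite !big_cons IH lform_scale /= exprS rmorphM; ring.
by rewrite E1 E2; ring.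
Qed.

Lemma sum_expr_root (F : fieldType) (x : F) N :
  x ^+ N = 1 -> x != 1 -> \sum_(j < N) x ^+ j = 0.
Proof.
move=> xN x1; apply/eqP.
have := subrX1 x N; rewrite xN subrr => /esym/eqP.
by rewrite mulf_eq0 subr_eq0 (negbTE x1).
Qed.

(** A geometric sum whose ratio is the power [|a - b| < N] of [zeta] or of its conjugate; the ratio
    is 1 only for [a = b]. *)
Lemma phase_sum (R : realType) (zeta : R[i]) N a b :
  zeta * zeta^* = 1 -> zeta ^+ N = 1 ->
  (forall w, (0 < w < N)%N -> zeta ^+ w != 1) -> (a + b < N)%N ->
  \sum_(j < N) (zeta ^+ j) ^+ a * (zeta ^+ j)^* ^+ b = if a == b then N%:R else 0.
Proof.
move=> zz zN z1 abN.
have E (j : 'I_N) : (zeta ^+ j) ^+ a * (zeta ^+ j)^* ^+ b =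
    (zeta ^+ a * zeta^* ^+ b) ^+ j.
  by rewrite rmorphXn /= exprMn -!exprM mulnC [(j * b)%N]mulnC.
rewrite (eq_bigr _ (fun j _ => E j)).
have zcN : zeta^* ^+ N = 1 by rewrite -rmorphXn /= zN rmorph1.
case: ltngtP => [ab|ba|->].
- apply: sum_expr_root.
    by rewrite exprMn ![(_ ^+ _) ^+ N]exprAC zN zcN !expr1n mulr1.
  rewrite -(subnK (ltnW ab)) addnC exprD mulrA -exprMn zz expr1n mul1r.
  have := z1 (b - a)%N; rewrite subn_gt0 ab (leq_ltn_trans (leq_subr _ _)) ?(leq_ltn_trans _ abN) ?leq_addl // => /(_ isT).
  by rewrite -rmorphXn /= -[1 in X in _ -> X](rmorph1 (@conjc R)) (inj_eq (can_inj (@conjcK R))).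
- apply: sum_expr_root.
    by rewrite exprMn ![(_ ^+ _) ^+ N]exprAC zN zcN !expr1n mulr1.
  rewrite -(subnK (ltnW ba)) exprD -mulrA -exprMn zz expr1n mulr1.
  by apply: z1; rewrite subn_gt0 ba (leq_ltn_trans (leq_subr _ _)) // (leq_ltn_trans _ abN) ?leq_addr.
- rewrite -exprMn zz (eq_bigr (fun=> 1)); last by move=> j _; rewrite !expr1n.
  by rewrite sumr_const card_ord.
Qed.

Lemma phase_average (R : realType) (zeta : R[i]) N (s : seq 'I_4) z :
  zeta * zeta^* = 1 -> zeta ^+ N = 1 ->
  (forall w, (0 < w < N)%N -> zeta ^+ w != 1) -> (size s < N)%N ->
  (\sum_(j < N) \prod_(i <- s) complex.Re (lform i (phase_mul (zeta ^+ j) z)))%:C =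
  2 ^- size s * N%:R *
  \sum_(p <- bimono_terms s | size p.1 == size p.2) bimono p z.
Proof.
move=> zz zN z1 sN; rewrite rmorph_sum /=.
rewrite (eq_bigr _ (fun j _ => prod_Re_lform s _)) -mulr_sumr -mulrA; congr (_ * _).
rewrite exchange_big /= [in RHS]big_mkcond /= mulr_sumr big_seq [RHS]big_seq.
apply: eq_bigr => p /size_bimono_terms ps.
rewrite (eq_bigr _ (fun j _ => bimono_scale _ _ _)) -mulr_suml.
rewrite phase_sum ?ps //; case: ifP => _; ring.
Qed.

(** Only terms of equal degree in the forms and in their conjugates survive the average, and these
    are invariant under the whole circle, although the sum runs over finitely many phases. *)
Lemma phase_average_inv (R : realType) (zeta w : R[i]) N (s : seq 'I_4) z :
  zeta * zeta^* = 1 -> zeta ^+ N = 1 ->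
  (forall k, (0 < k < N)%N -> zeta ^+ k != 1) -> (size s < N)%N ->
  w * w^* = 1 ->
  \sum_(j < N) \prod_(i <- s) complex.Re (lform i (phase_mul (zeta ^+ j) (phase_mul w z))) =
  \sum_(j < N) \prod_(i <- s) complex.Re (lform i (phase_mul (zeta ^+ j) z)).
Proof.
move=> zz zN z1 sN ww; apply: (@complexI R).
rewrite !(phase_average _ zz zN z1 sN); congr (_ * _).
apply: eq_bigr => p /eqP ps; rewrite bimono_scale ps -exprMn ww expr1n mul1r //.
Qed.

(** A monomial as a list of indices with repetition, since the expansion into bidegrees recurses
    over the factors. *)
Definition mono_seq (e : 'I_4 -> nat) : seq 'I_4 :=
  flatten [seq nseq (e i) i | i <- enum 'I_4].

Lemma prod_mono_seq (A : comPzRingType) (e : 'I_4 -> nat) (f : 'I_4 -> A) :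
  \prod_(i <- mono_seq e) f i = \prod_i f i ^+ e i.
Proof.
rewrite /mono_seq big_flatten /= big_map big_enum /=.
by apply: eq_bigr => i _; rewrite big_nseq -Monoid.iteropE.
Qed.

Lemma size_mono_seq (e : 'I_4 -> nat) : size (mono_seq e) = (\sum_i e i)%N.
Proof.
rewrite /mono_seq size_flatten /shape -map_comp sumnE big_map big_enum /=.
by apply: eq_bigr => i _; rewrite size_nseq.
Qed.

Lemma mono_real_of_C2 (R : realType) (e : 'I_4 -> nat) (z : R[i] * R[i]) :
  mono e (real_of_C2 z) = \prod_(i <- mono_seq e) complex.Re (lform i z).
Proof.
by rewrite prod_mono_seq; apply: eq_bigr => i _; rewrite real_of_C2E.
Qed.

(** In complex terms the entries are [|z1|^2 - |z2|^2] and the real and the negated imaginary part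
    of [2 conj(z1) z2]. The signs are those for which [gamma] projects to [alpha]. *)
Definition hopf (R : realType) (x : 'rV[R]_4) : 'rV[R]_3 :=
  \row_j [:: x 0 (inord 0) ^+ 2 + x 0 (inord 1) ^+ 2 - x 0 (inord 2) ^+ 2 - x 0 (inord 3) ^+ 2;
    2 * (x 0 (inord 0) * x 0 (inord 2) + x 0 (inord 1) * x 0 (inord 3));
    - 2 * (x 0 (inord 0) * x 0 (inord 3) - x 0 (inord 1) * x 0 (inord 2))]`_j.

(** Equality is asked only on the sphere: [|z1|^2 + |z2|^2 = 1] enters when [|z1|^2] and [|z2|^2]
    are expressed by the first Hopf coordinate. *)
Definition hopf_poly (R : realType) (l : nat) (f : R[i] * R[i] -> R[i]) :=
  exists hr hi : mpoly 3 R, [/\ (msize hr <= l.+1)%N, (msize hi <= l.+1)%N &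
    forall z, sphere 3 (real_of_C2 z) ->
    f z = (polyfun hr (hopf (real_of_C2 z)))%:C + 'i * (polyfun hi (hopf (real_of_C2 z)))%:C].

Lemma polyfunD (R : realType) n (p q : mpoly n R) x :
  polyfun (p + q) x = polyfun p x + polyfun q x.
Proof. exact: mevalD. Qed.

Lemma polyfunM (R : realType) n (p q : mpoly n R) x :
  polyfun (p * q) x = polyfun p x * polyfun q x.
Proof. exact: mevalM. Qed.

Lemma polyfunN (R : realType) n (p : mpoly n R) x : polyfun (- p) x = - polyfun p x.
Proof. exact: mevalN. Qed.

Lemma msizeD_leq (R : realType) n (p q : mpoly n R) k :
  (msize p <= k)%N -> (msize q <= k)%N -> (msize (p + q) <= k)%N.
Proof.
by move=> pk qk; apply: leq_trans (mmeasureD_le _ _ _) _; rewrite geq_max pk.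
Qed.

Lemma msizeM_leq (R : realType) n (p q : mpoly n R) k l :
  (msize p <= k.+1)%N -> (msize q <= l.+1)%N -> (msize (p * q) <= (k + l).+1)%N.
Proof.
have [->|p0] := eqVneq p 0; first by rewrite mul0r mmeasure0.
have [->|q0] := eqVneq q 0; first by rewrite mulr0 mmeasure0.
move=> pk ql; rewrite msizeM //.
by rewrite -subn1 leq_subLR add1n -addnS -addSn leq_add.
Qed.

Lemma hopf_polyM (R : realType) k l (f g : R[i] * R[i] -> R[i]) :
  hopf_poly k f -> hopf_poly l g -> hopf_poly (k + l) (fun z => f z * g z).
Proof.
move=> [fr [fi [sfr sfi hf]]] [gr [gi [sgr sgi hg]]].
exists (fr * gr - fi * gi), (fr * gi + fi * gr); split.
- by apply: msizeD_leq; rewrite ?mmeasureN; apply: msizeM_leq.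
- by apply: msizeD_leq; apply: msizeM_leq.
- move=> z sz; rewrite hf // hg // !polyfunD polyfunN !polyfunM.
  rewrite !(rmorphD, rmorphN, rmorphM) /=.
  have := sqr_i R; rewrite expr2 => ii.
  set a := (polyfun fr _)%:C; set b := (polyfun fi _)%:C.
  set c := (polyfun gr _)%:C; set d := (polyfun gi _)%:C.
  have -> : (a + 'i * b) * (c + 'i * d) = a * c + ('i * 'i) * (b * d) + 'i * (a * d + b * c).
    by ring.
  rewrite ii; ring.
Qed.

Lemma hopf_poly_cst (R : realType) (c : R[i]) : hopf_poly 0 (fun=> c).
Proof.
exists (mpolyC 3 (complex.Re c)), (mpolyC 3 (complex.Im c)); split.
- by rewrite mmeasureC; case: (_ == _).
- by rewrite mmeasureC; case: (_ == _).
- by move=> z _; rewrite /polyfun !mevalC -complexE.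
Qed.

Lemma hopf_polyZ (R : realType) l (c : R[i]) f :
  hopf_poly l f -> hopf_poly l (fun z : R[i] * R[i] => c * f z).
Proof. by move=> hf; rewrite -[l]add0n; apply: hopf_polyM => //; exact: hopf_poly_cst. Qed.

Lemma affine_poly (R : realType) (r0 : R) (r : 'I_3 -> R) :
  exists h : mpoly 3 R, (msize h <= 2)%N /\
    forall x, polyfun h x = r0 + (r 0 * x 0 0 + (r 1 * x 0 1 + r 2 * x 0 2)).
Proof.
pose X (k : 'I_3) : mpoly 3 R := mpolyX R (mnm1 k).
have sX k : (msize (mpolyC 3 (r k) * X k) <= 2)%N.
  rewrite mul_mpolyC; apply: leq_trans (msizeZ_le _ _) _.
  by rewrite /X msizeX mdeg1.
exists (mpolyC 3 r0 + (mpolyC 3 (r 0) * X 0 + (mpolyC 3 (r 1) * X 1 + mpolyC 3 (r 2) * X 2))).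
split.
  apply: msizeD_leq; first by rewrite mmeasureC; case: (_ == _).
  by apply: msizeD_leq => //; apply: msizeD_leq.
move=> x; rewrite !polyfunD !polyfunM /polyfun !mevalC.
by rewrite /X !mevalXU.
Qed.

Lemma sphere3_real_of_C2 (R : realType) (z : R[i] * R[i]) :
  sphere 3 (real_of_C2 z) <->
  complex.Re z.1 ^+ 2 + complex.Im z.1 ^+ 2 + complex.Re z.2 ^+ 2 + complex.Im z.2 ^+ 2 = 1.
Proof.
rewrite sphere_sum; do 4!rewrite big_ord_recl; rewrite big_ord0 !mxE /= addr0 !addrA.
by [].
Qed.

Lemma hopf_real_of_C2 (R : realType) (z : R[i] * R[i]) :
  [/\ hopf (real_of_C2 z) 0 0 = complex.Re z.1 ^+ 2 + complex.Im z.1 ^+ 2 -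
        complex.Re z.2 ^+ 2 - complex.Im z.2 ^+ 2,
      hopf (real_of_C2 z) 0 1 = 2 * (complex.Re z.1 * complex.Re z.2 + complex.Im z.1 * complex.Im z.2)
    & hopf (real_of_C2 z) 0 2 = - 2 * (complex.Re z.1 * complex.Im z.2 - complex.Im z.1 * complex.Re z.2)].
Proof. by rewrite /hopf !mxE /= !inordK. Qed.

(** With Hopf coordinates [(a0, a1, a2)] the four products are [(1 + a0) / 2], [(1 - a0) / 2],
    [(a1 + 'i a2) / 2] and [(a1 - 'i a2) / 2]; [sg] is the sign that occurs in them. *)
Lemma hopf_poly_base (R : realType) (a b : bool) :
  hopf_poly 1 (fun z : R[i] * R[i] => (if a then z.1 else z.2) * (if b then z.1 else z.2)^*).
Proof.
pose s (k : 'I_3) (c : R) (j : 'I_3) : R := if j == k then c else 0.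
pose sg : R := if a then 1 else -1.
have [h0 [s0 e0]] := affine_poly 0 (s 0 0).
have [hX [sX eX]] := affine_poly (1 / 2) (s 0 (sg / 2)).
have [hY [sY eY]] := affine_poly 0 (s 1 (1 / 2)).
have [hZ [sZ eZ]] := affine_poly 0 (s 2 (sg / 2)).
have {}e0 x : polyfun h0 x = 0 by rewrite e0 /s /=; ring.
have {}eX x : polyfun hX x = 1 / 2 + sg / 2 * x 0 0 by rewrite eX /s /=; ring.
have {}eY x : polyfun hY x = 1 / 2 * x 0 1 by rewrite eY /s /=; ring.
have {}eZ x : polyfun hZ x = sg / 2 * x 0 2 by rewrite eZ /s /=; ring.
exists (if a == b then hX else hY), (if a == b then h0 else hZ); split.
- by case: ifP.
- by case: ifP.
- move=> z /sphere3_real_of_C2 sz; have [E0 E1 E2] := hopf_real_of_C2 z.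
  case: z sz E0 E1 E2 => -[x0 x1] [x2 x3] /= sz E0 E1 E2.
  rewrite [X in _ = X%:C + _](_ : _ = if a == b then 1 / 2 + sg / 2 * (x0 ^+ 2 + x1 ^+ 2 - x2 ^+ 2 - x3 ^+ 2)
      else 1 / 2 * (2 * (x0 * x2 + x1 * x3))); last first.
    by case: (a == b); rewrite ?eX ?eY ?E0 ?E1.
  rewrite [X in _ = _ + _ * X%:C](_ : _ = if a == b then 0
      else sg / 2 * (- 2 * (x0 * x3 - x1 * x2))); last first.
    by case: (a == b); rewrite ?e0 ?eZ ?E2.
  rewrite /sg; clear -sz.
  by case: a; case: b; apply/eqP; rewrite eq_complex /=; apply/andP; split; apply/eqP; lra.
Qed.

Lemma hopf_poly_lform (R : realType) (i j : 'I_4) :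
  hopf_poly 1 (fun z : R[i] * R[i] => lform i z * (lform j z)^*).
Proof.
pose a (i : 'I_4) := (i < 2)%N.
pose c (i : 'I_4) : R[i] := if odd i then - 'i else 1.
have L k (z : R[i] * R[i]) : lform k z = c k * (if a k then z.1 else z.2).
  by rewrite /lform /c /a; case: k => -[|[|[|[|//]]]] //= _; rewrite mul1r.
have := hopf_polyZ (c i * (c j)^*) (hopf_poly_base R (a i) (a j)).
by congr hopf_poly; apply/funext => z; rewrite !L rmorphM /=; ring.
Qed.

(** The two lists have equal length, so each form pairs off with a conjugate form, and each pair has
    degree one in the Hopf coordinates. This is what halves the degree. *)
Lemma hopf_poly_bimono (R : realType) (p : seq 'I_4 * seq 'I_4) :
  size p.1 = size p.2 -> hopf_poly (size p.1) (fun z : R[i] * R[i] => bimono p z).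
Proof.
case: p => la lb /=; elim: la lb => [|i la IH] [|j lb] //=.
  move=> _; have := hopf_poly_cst (1 : R[i]).
  by congr hopf_poly; apply/funext => z; rewrite /bimono !big_nil mulr1.
move=> [/IH h]; have := hopf_polyM (hopf_poly_lform R i j) h.
by congr hopf_poly; apply/funext => z; rewrite /bimono /= !big_cons; ring.
Qed.

Lemma hopf_poly_sum (R : realType) l (ps : seq (seq 'I_4 * seq 'I_4)) :
  (forall p, p \in ps -> size p.1 = size p.2 -> (size p.1 <= l)%N) ->
  hopf_poly l (fun z : R[i] * R[i] => \sum_(p <- ps | size p.1 == size p.2) bimono p z).
Proof.
elim: ps => [_|p ps IH psl].
  exists 0, 0; split; rewrite ?mmeasure0 // => z _.
  by rewrite big_nil /polyfun meval0 mulr0 addr0.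
have [|fr [fi [sfr sfi hf]]] := IH.
  by move=> q qs; apply: psl; rewrite inE qs orbT.
have [pp|pp] := eqVneq (size p.1) (size p.2); last first.
  by exists fr, fi; split => // z sz; rewrite big_cons (negbTE pp) hf.
have [gr [gi [sgr sgi hg]]] := hopf_poly_bimono R pp.
have pl : (size p.1 <= l)%N by apply: psl => //; rewrite inE eqxx.
exists (gr + fr), (gi + fi); split.
- by apply: msizeD_leq => //; exact: leq_trans sgr _.
- by apply: msizeD_leq => //; exact: leq_trans sgi _.
- move=> z sz; rewrite big_cons pp eqxx hf // hg // !polyfunD !rmorphD /=; ring.
Qed.

(* Averaging over the fibre phases turns a polynomial of degree less than [2 l + 2]
   into a polynomial of degree at most [l] in the Hopf coordinates. *)
Lemma phase_average_hopf (R : realType) (zeta : R[i]) N l (e : 'I_4 -> nat) :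
  zeta * zeta^* = 1 -> zeta ^+ N = 1 ->
  (forall k, (0 < k < N)%N -> zeta ^+ k != 1) -> (\sum_i e i < N)%N ->
  (\sum_i e i < l.+1.*2)%N ->
  exists h : mpoly 3 R, (msize h <= l.+1)%N /\ forall z : R[i] * R[i],
    sphere 3 (real_of_C2 z) ->
    \sum_(j < N) mono e (real_of_C2 (phase_mul (zeta ^+ j) z)) =
    polyfun h (hopf (real_of_C2 z)).
Proof.
move=> zz zN z1 eN el; set s := mono_seq e.
have ss : size s = (\sum_i e i)%N by exact: size_mono_seq.
have [|hr [hi [sr si hh]]] := @hopf_poly_sum R l (bimono_terms s).
  move=> p ps pp; have := size_bimono_terms ps.
  rewrite ss -pp addnn => E; rewrite -ltnS -ltn_double E //.
pose c : R := (2 ^- size s * N%:R).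
exists (c *: hr); split.
  exact: leq_trans (msizeZ_le _ _) sr.
move=> z sz.
have := phase_average z zz zN z1 (_ : (size s < N)%N); rewrite ss => /(_ eN).
rewrite hh // -ss => /(congr1 (@complex.Re R)) /=.
rewrite (eq_bigr (fun j : 'I_N => mono e (real_of_C2 (phase_mul (zeta ^+ j) z)))); last first.
  by move=> j _; rewrite mono_real_of_C2.
have -> : (2 ^- size s * N%:R : R[i]) = c%:C.
  by rewrite /c rmorphM fmorphV rmorphXn !rmorph_nat.
move=> ->; rewrite /polyfun mevalZ -/(polyfun hr _) /=; ring.
Qed.

Local Close Scope complex_scope.

(** * Suspension of moments *)

(** [J p b] models the mean of [h ^ p * v ^ b], where [h] is the distance from the axis and [v] the
    height of a uniform point of the unit sphere in dimension [n + 1]. The first hypothesis is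
    [h^2 + v^2 = 1], the second an integration by parts; eliminating [J p.+2 b] gives the
    recursion. *)
Lemma latitude_step (R : realType) n (J : nat -> nat -> R) :
  (forall p b, J p.+2 b + J p b.+2 = J p b) ->
  (forall p b, (p + n)%:R * J p b.+2 = b.+1%:R * J p.+2 b) ->
  forall p b, J p b.+2 = b.+1%:R / (p + b + n).+1%:R * J p b.
Proof.
move=> Jsum Jpart p b; have := Jsum p b; have := Jpart p b.
have : (p + b + n).+1%:R != 0 :> R by rewrite pnatr_eq0.
rewrite -![_.+1%:R]natr1 !natrD => h h1 h2.
have E : (p%:R + b%:R + n%:R + 1) * J p b.+2 = (b%:R + 1) * J p b by rewrite -h2 mulrDr -h1; ring.
by apply: (mulfI h); rewrite E; field.
Qed.

Lemma latitude_odd (R : realType) n (J : nat -> nat -> R) :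
  (forall p b, J p.+2 b + J p b.+2 = J p b) ->
  (forall p b, (p + n)%:R * J p b.+2 = b.+1%:R * J p.+2 b) ->
  (forall p, J p 1%N = 0) ->
  forall p b, odd b -> J p b = 0.
Proof.
move=> Jsum Jpart J1 p b ob; rewrite -(odd_double_half b) ob add1n.
by elim: (b./2) => [//|c IH]; rewrite doubleS (latitude_step Jsum Jpart) IH mulr0.
Qed.

Lemma latitude_moment (R : realType) n (J : nat -> nat -> R) : (0 < n)%N ->
  J 0%N 0%N = 1 -> (forall p b, J p.+2 b + J p b.+2 = J p b) ->
  (forall p b, (p + n)%:R * J p b.+2 = b.+1%:R * J p.+2 b) ->
  (forall p, J p 1%N = 0) ->
  forall i b, J i.*2 b =
    (gauss_moment b)%:R * (rho n i.*2)%:R / (rho n.+1 (i.*2 + b))%:R.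
Proof.
move=> n0 J0 Jsum Jpart J1.
have posr k : (k + n)%:R != 0 :> R by rewrite pnatr_eq0 addn_eq0 negb_and orbC -lt0n n0.
have posr' k : (k + n).+1%:R != 0 :> R by rewrite pnatr_eq0.
have stepb := latitude_step Jsum Jpart.
have stepp p : J p.+2 0%N = (p + n)%:R / (p + n).+1%:R * J p 0%N.
  have := Jsum p 0%N; have := Jpart p 0%N; have := posr' p.
  rewrite -![_.+1%:R]natr1 !natrD => h h1 h2.
  have E : (p%:R + n%:R + 1) * J p.+2 0%N = (p%:R + n%:R) * J p 0%N by rewrite -h2 mulrDr h1; ring.
  by apply: (mulfI h); rewrite E; field.
have Jeven i b : J i.*2 b.*2 =
    (gauss_moment b.*2)%:R * (rho n i.*2)%:R / (rho n.+1 (i.*2 + b.*2))%:R.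
  elim: b => [|b IH].
    elim: i => [|i IH]; first by rewrite J0 mulr1 divr1.
    rewrite addn0 in IH *; rewrite doubleS stepp IH.
    have h : (rho n.+1 i.*2)%:R != 0 :> R by rewrite pnatr_eq0 -lt0n rho_gt0.
    rewrite double0 addn0 !rhoSS addSn [(n + _)%N]addnC !natrM.
    move: (posr' i.*2); move: (_.+1%:R) => A A0.
    by field; rewrite h A0.
  rewrite doubleS stepb IH gauss_momentSS !addnS rhoSS !natrM.
  have h : (rho n.+1 (i.*2 + b.*2))%:R != 0 :> R by rewrite pnatr_eq0 -lt0n rho_gt0.
  rewrite addSn [(n + _)%N]addnC.
  move: (posr' (i.*2 + b.*2)%N); move: (_.+1%:R) => A A0.
  by field; rewrite h A0.
move=> i b; have [ob|eb] := boolP (odd b); last by rewrite -(even_halfK eb).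
by rewrite (latitude_odd Jsum Jpart) // gauss_moment_odd // !mul0r.
Qed.

(** The index type is kept and the last exponent set to 0, so that the equator is treated inside the
    ambient space. *)
Definition equatorial n (e : 'I_n.+1 -> nat) (i : 'I_n.+1) : nat :=
  if i == ord_max then 0%N else e i.

Lemma sum_equatorial n (e : 'I_n.+1 -> nat) :
  (\sum_i e i = \sum_i equatorial e i + e ord_max)%N.
Proof.
rewrite (bigD1 ord_max) //= addnC; congr addn.
rewrite [in RHS](bigD1 ord_max) //= {1}/equatorial eqxx add0n.
by apply: eq_bigr => i /negbTE h; rewrite /equatorial h.
Qed.

(** The factor [rho n] of the equatorial degree in the latitude moment cancels the denominator of
    the equatorial moment, and the Gaussian moments multiply. An odd equatorial exponent makes both
    sides vanish. *)
Lemma sphere_moment_suspension (R : realType) n (J : nat -> nat -> R)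
    (e : 'I_n.+1 -> nat) : (0 < n)%N ->
  J 0%N 0%N = 1 -> (forall p b, J p.+2 b + J p b.+2 = J p b) ->
  (forall p b, (p + n)%:R * J p b.+2 = b.+1%:R * J p.+2 b) ->
  (forall p, J p 1%N = 0) ->
  sphere_moment R n.+1 e =
  J (\sum_i equatorial e i)%N (e ord_max) * sphere_moment R n (equatorial e).
Proof.
move=> n0 J0 Jsum Jpart J1.
have [[i oi]|alleven] := pselect (exists i, odd (equatorial e i)).
  rewrite (sphere_moment_odd R n oi) mulr0 (@sphere_moment_odd _ _ _ _ i) //.
  by move: oi; rewrite /equatorial; case: eqP.
have ev i : ~~ odd (equatorial e i) by apply/negP => oi; apply: alleven; exists i.
have : ~~ odd (\sum_i equatorial e i)%N.
  by elim/big_ind: _ => // a b; rewrite oddD => /negbTE -> /negbTE ->.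
move=> es; rewrite -(even_halfK es) (latitude_moment n0 J0 Jsum Jpart J1).
rewrite even_halfK // /sphere_moment -sum_equatorial.
have -> : (\prod_i gauss_moment (e i) =
    gauss_moment (e ord_max) * \prod_i gauss_moment (equatorial e i))%N.
  rewrite (bigD1 ord_max) //=; congr (_ * _)%N.
  rewrite [in RHS](bigD1 ord_max) //= {1}/equatorial eqxx mul1n.
  by apply: eq_bigr => i /negbTE h; rewrite /equatorial h.
have h1 : (rho n (\sum_i equatorial e i))%:R != 0 :> R by rewrite pnatr_eq0 -lt0n rho_gt0.
have h2 : (rho n.+1 (\sum_i e i))%:R != 0 :> R by rewrite pnatr_eq0 -lt0n rho_gt0.
by rewrite natrM; field; rewrite h1 h2.
Qed.

Lemma mono_suspension (R : realType) n (e : 'I_n.+1 -> nat) (h v : R)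
    (y x : 'rV[R]_n.+1) : x 0 ord_max = v ->
  (forall i, i != ord_max -> x 0 i = h * y 0 i) ->
  mono e x = h ^+ (\sum_i equatorial e i) * v ^+ e ord_max * mono (equatorial e) y.
Proof.
move=> xm xi; rewrite /mono (bigD1 ord_max) //= xm mulrAC mulrC; congr (_ * _).
rewrite [X in _ = _ * X](bigD1 ord_max) //= {2}/equatorial eqxx expr0 mul1r.
rewrite [X in _ = _ ^+ X * _](bigD1 ord_max) //= {1}/equatorial eqxx add0n -prodrXr -big_split /=.
by apply: eq_bigr => i im; rewrite xi // exprMn /equatorial (negbTE im).
Qed.

(** * Curves glued from pieces *)

Lemma smooth_on_local (R : realType) (V : normedModType R) (U : set R) (f : R -> V) :
  (forall x, U x -> exists W : set R, [/\ open W, W x & smooth_on W f]) -> smooth_on U f.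
Proof.
move=> loc; apply: derivable_smooth_on => n x /loc[W [oW Wx sW]].
exact: (smooth_on_derivable oW sW).
Qed.

Lemma smooth_on_affine (R : realType) (U W : set R) (c d : R) (f : R -> R) :
  (forall x, U x -> W (c * x + d)) -> smooth_on W f ->
  smooth_on U (fun x => f (c * x + d)).
Proof.
move=> UW sf; apply: (smooth_on_comp UW sf).
apply: smooth_onD; last exact: smooth_on_cst.
by apply: smooth_onM; [exact: smooth_on_cst|exact: smooth_on_id].
Qed.

Lemma Rintegral_eq_off_seq (R : realType) (l : seq R) (f g : R -> R) :
  (forall x : R, off l x -> f x = g x) -> (forall x : R, off l x -> {for x, continuous g}) ->
  (@lebesgue_measure R).-integrable `[0, 1] (EFin \o g) ->
  (@lebesgue_measure R).-integrable `[0, 1] (EFin \o f) /\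
  \int[@lebesgue_measure R]_(x in `[0, 1]) f x =
  \int[@lebesgue_measure R]_(x in `[0, 1]) g x.
Proof.
move=> fg cg ig.
pose Z : set R := [set` [:: 0, 1 & l]].
have mZ : measurable Z by exact: measurable_set_seq.
have Z0 : (@lebesgue_measure R) Z = 0%E.
  by apply: countable_lebesgue_measure0; apply: finite_set_countable; exact: finite_seq.
have offZ x : (`[0, 1]%classic `\` Z) x -> off l x.
  move=> [] /=; rewrite in_itvcc /Z /= !inE => /andP[x0 x1] /negP; rewrite !negb_or => /and3P[n0 n1 nl].
  by split=> //; rewrite in_itvoo !lt_neqAle eq_sym n0 n1 x0.
have cf x : off l x -> {for x, continuous f}.
  move=> ox; have := cg x ox.
  have oo := @open_off R l.
  have nr : \forall y \near x, g y = f y.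
    by have := open_nbhs_nbhs (conj oo ox); apply: filterS => y /fg.
  rewrite /continuous_at /prop_for -(fg x ox) => h.
  by apply: cvg_trans h; apply: near_eq_cvg.
have mf : measurable_fun (`[0, 1]%classic : set R) (EFin \o f).
  apply/measurable_EFinP; apply: (@measurable_fun_off_seq _ _ _ l) => x x01 xl.
  exact: cf.
have iff : (@lebesgue_measure R).-integrable `[0, 1] (EFin \o f).
  apply/integrableP; split => //.
  move/integrableP : ig => [mg]; apply: le_lt_trans.
  rewrite le_eqVlt; apply/orP; left; apply/eqP.
  apply: ae_eq_integral => //.
  - by apply: measurableT_comp.
  - by apply: measurableT_comp.
  - exists Z; split => // x /= /not_implyP[xD xn]; apply: contrapT => nz; apply: xn.
    by rewrite fg //; exact: offZ.
split=> //; rewrite /Rintegral; congr fine.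
apply: ae_eq_integral => //.
  by move/integrableP : ig => [].
exists Z; split => // x /= /not_implyP[xD xn]; apply: contrapT => nz; apply: xn.
by rewrite fg //; exact: offZ.
Qed.

(** Piece [k] occupies [[k / N, (k + 1) / N]]. At [s = 1] the floor is [N], so the value there is
    that of piece [N] at 0, one index past the last piece. *)
Definition glue (R : realType) (T : Type) (N : nat) (P : int -> R -> T) (s : R) : T :=
  let k := Num.floor (N%:R * s) in P k (N%:R * s - k%:~R).

Definition glue_breaks (R : realType) (N : nat) (l : seq R) : seq R :=
  [seq N%:R^-1 * r + N%:R^-1 * k%:R | r <- [:: 0, 1 & l], k <- iota 0 N].

Lemma glue_piece_lt (R : realType) (T : Type) N (P : int -> R -> T) (k : nat) (r : R) :
  (0 < N)%N -> 0 <= r < 1 ->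
  glue N P (N%:R^-1 * r + N%:R^-1 * k%:R) = P k r.
Proof.
move=> N0 /andP[r0 r1]; have N1 : N%:R != 0 :> R by rewrite pnatr_eq0 -lt0n.
have -> : N%:R^-1 * r + N%:R^-1 * k%:R = (r + k%:R) / N%:R by field.
rewrite /glue mulrC divfK //.
have -> : Num.floor (r + k%:R) = k.
  by apply: floor_def; rewrite intrD -!pmulrn lerDr r0 addrC ltrD2l r1.
by rewrite -pmulrn addrK.
Qed.

Lemma glue_piece (R : realType) (T : Type) N (P : int -> R -> T) (k : nat) (r : R) :
  (0 < N)%N -> (forall k : nat, P k 1 = P k.+1 0) -> 0 <= r <= 1 ->
  glue N P (N%:R^-1 * r + N%:R^-1 * k%:R) = P k r.
Proof.
move=> N0 PP /andP[r0]; rewrite le_eqVlt => /orP[/eqP ->|r1]; last first.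
  by apply: glue_piece_lt; rewrite ?r0.
rewrite PP -(@glue_piece_lt _ _ N P k.+1 0 N0) ?lexx ?ltr01 //.
by congr glue; rewrite -[in RHS]natr1; ring.
Qed.

Lemma piece_cases (R : realType) N (s : R) : (0 < N)%N -> 0 <= s < 1 ->
  exists (k : nat) (r : R), [/\ (k < N)%N, 0 <= r < 1 & s = N%:R^-1 * r + N%:R^-1 * k%:R].
Proof.
move=> N0 /andP[s0 s1]; have NR : 0 < N%:R :> R by rewrite ltr0n.
have f0 : 0 <= Num.floor (N%:R * s) by rewrite floor_ge0 mulr_ge0.
have [k fk] : exists k : nat, Num.floor (N%:R * s) = k.
  by case: (Num.floor _) f0 => // k _; exists k.
have fl := floor_le (N%:R * s); have fg := floorD1_gt (N%:R * s).
rewrite fk intrD -!pmulrn in fl fg.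
exists k, (N%:R * s - k%:R); split.
- rewrite -(ltr_nat R); apply: le_lt_trans fl _.
  by rewrite -[ltRHS]mulr1 ltr_pM2l.
- by rewrite subr_ge0 fl ltrBlDr addrC.
- by field; rewrite gt_eqF.
Qed.

Lemma glue_continuous (R : realType) (V : topologicalType) N (P : int -> R -> V) :
  (0 < N)%N -> (forall k : nat, P k 1 = P k.+1 0) ->
  (forall k : nat, {within `[0, 1], continuous (P k)}) ->
  {within `[0, 1], continuous (glue N P)}.
Proof.
move=> N0 PP cP; have NR : 0 < N%:R :> R by rewrite ltr0n.
have piece (k : nat) : {within `[N%:R^-1 * k%:R, N%:R^-1 * k.+1%:R], continuous (glue N P)}.
  have ck : {within `[N%:R^-1 * k%:R, N%:R^-1 * k.+1%:R],
      continuous (P k \o (fun s => N%:R * s + - k%:R))}.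
    refine (within_continuous_compW (B := `[0 : R, 1]%classic) _ _ (cP k)).
      move=> x /=; rewrite !in_itvcc => /andP[h1 h2].
      move: h1 h2; rewrite ler_pdivrMl // ler_pdivlMl // => h1 h2.
      by rewrite subr_ge0 h1 lerBlDr addrC natr1.
    apply: continuous_subspaceT => x.
    by apply: cvgD; [apply: cvgM; [exact: cvg_cst|exact: cvg_id]|exact: cvg_cst].
  apply: subspace_eq_continuous ck => x; rewrite inE /= in_itvcc => /andP[h1 h2].
  have E : x = N%:R^-1 * (N%:R * x - k%:R) + N%:R^-1 * k%:R by field; rewrite gt_eqF.
  rewrite [RHS]/from_subspace [in RHS]E glue_piece //.
  move: h1 h2; rewrite ler_pdivrMl // ler_pdivlMl // => h1 h2.
  by rewrite subr_ge0 h1 lerBlDr addrC natr1.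
have H (k : nat) : {within `[0, N%:R^-1 * k.+1%:R], continuous (glue N P)}.
  elim: k => [|k IH]; first by have := piece 0%N; rewrite mulr0.
  have -> : `[0, N%:R^-1 * k.+2%:R]%classic =
      `[0, N%:R^-1 * k.+1%:R]%classic `|` `[N%:R^-1 * k.+1%:R, N%:R^-1 * k.+2%:R]%classic :> set R.
    apply/seteqP; split => x /=; rewrite !in_itvcc.
      move=> /andP[x0 x1]; have [h|h] := leP x (N%:R^-1 * k.+1%:R); [left|right].
        by rewrite x0.
      by rewrite (ltW h).
    have kk : N%:R^-1 * k.+1%:R <= N%:R^-1 * k.+2%:R :> R.
      by rewrite ler_pM2l ?invr_gt0 // ler_nat.
    have k0 : 0 <= N%:R^-1 * k.+1%:R :> R by rewrite mulr_ge0 // invr_ge0 ltW.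
    by move=> [|] /andP[h1 h2]; apply/andP; split=> //; lra.
  apply: withinU_continuous => //; exact: interval_closed || exact: itv_closed.
by have := H N.-1; rewrite prednK // mulVf // gt_eqF.
Qed.

Lemma off_glue_breaks (R : realType) N (l : seq R) (s : R) : (0 < N)%N ->
  off (glue_breaks N l) s ->
  exists (k : nat) (r : R), [/\ (k < N)%N, off l r & s = N%:R^-1 * r + N%:R^-1 * k%:R].
Proof.
move=> N0 [s01 sl].
have [|k [r [kN /andP[r0 r1] sE]]] := @piece_cases R N s N0.
  by move: s01; rewrite in_itvoo => /andP[/ltW -> ->].
exists k, r; split=> //; split; last first.
  apply: contra sl => rl; rewrite sE; apply/allpairsP; exists (r, k); split=> //=.
    by rewrite !inE rl !orbT.
  by rewrite mem_iota.
rewrite in_itvoo r1 andbT lt_neqAle r0 andbT; apply: contra sl => /eqP r0'.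
rewrite sE -r0'; apply/allpairsP; exists (0, k); split=> //=; first by rewrite inE eqxx.
by rewrite mem_iota.
Qed.

(** Away from the breakpoints the floor is locally constant, so the glued curve is locally one
    rescaled piece. *)
Lemma glue_near (R : realType) (T : Type) N (P : int -> R -> T) (l : seq R) (k : nat) (r : R) :
  (0 < N)%N -> off l r ->
  let W := [set s : R | off l (N%:R * s + - k%:R)] in
  [/\ open W, W (N%:R^-1 * r + N%:R^-1 * k%:R) &
    forall s, W s -> P k (N%:R * s + - k%:R) = glue N P s].
Proof.
move=> N0 rl W; have NR : N%:R != 0 :> R by rewrite pnatr_eq0 -lt0n.
split.
- apply: (@open_comp _ _ (fun s : R => N%:R * s + - k%:R)); last exact: open_off.
  move=> x _.
  by apply: cvgD; [apply: cvgM; [exact: cvg_cst|exact: cvg_id]|exact: cvg_cst].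
- rewrite /W /=; suff -> : N%:R * (N%:R^-1 * r + N%:R^-1 * k%:R) + - k%:R = r by [].
  by field.
- move=> s [s01 _].
  have {2}-> : s = N%:R^-1 * (N%:R * s + - k%:R) + N%:R^-1 * k%:R by field.
  rewrite glue_piece_lt //.
  by move: s01; rewrite in_itvoo => /andP[/ltW -> ->].
Qed.

Lemma glue_smooth (R : realType) N (P : int -> R -> R) (l : seq R) :
  (0 < N)%N -> (forall k : nat, (k < N)%N -> smooth_on (off l) (P k)) ->
  smooth_on (off (glue_breaks N l)) (glue N P).
Proof.
move=> N0 sP; apply: smooth_on_local => s /(off_glue_breaks N0)[k [r [kN rl ->]]].
have [oW Wr WP] := glue_near P k N0 rl.
exists [set s : R | off l (N%:R * s + - k%:R)]; split=> //.
apply: (smooth_on_eq oW WP).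
by apply: (@smooth_on_affine _ _ (off l)) => //; exact: sP.
Qed.

Lemma glue_row (R : realType) n N (P : int -> R -> 'rV[R]_n) (j : 'I_n) :
  (fun s => glue N P s 0 j) = glue N (fun k r => P k r 0 j).
Proof. by []. Qed.

Lemma glue_row_smooth (R : realType) n N (P : int -> R -> 'rV[R]_n.+1) (l : seq R) :
  (0 < N)%N -> (forall k : nat, (k < N)%N -> smooth_on (off l) (P k)) ->
  smooth_on (off (glue_breaks N l)) (glue N P).
Proof.
move=> N0 sP; apply/smooth_on_rowP; first exact: open_off.
move=> j; rewrite glue_row; apply: glue_smooth => // k kN.
by have /smooth_on_rowP := sP k kN; apply; exact: open_off.
Qed.

Lemma glue_derive1 (R : realType) n N (P : int -> R -> 'rV[R]_n.+1) (l : seq R) (k : nat) (r : R) :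
  (0 < N)%N -> smooth_on (off l) (P k) -> off l r ->
  derive1 (glue N P) (N%:R^-1 * r + N%:R^-1 * k%:R) = N%:R *: derive1 (P k) r.
Proof.
move=> N0 sP rl; have NR : N%:R != 0 :> R by rewrite pnatr_eq0 -lt0n.
have [oW Wr WP] := glue_near P k N0 rl.
apply: derive1_row => j; rewrite mxE [_%:R * _]mulrC.
apply: (@is_derive_eq_on _ _ _ (fun s => P k (N%:R * s + - k%:R) 0 j) _ _ _ oW Wr).
  by move=> y Wy; rewrite WP.
apply: (@is_derive_comp_affine _ _ _ _ _ (fun s => P k s 0 j)).
have -> : N%:R * (N%:R^-1 * r + N%:R^-1 * k%:R) + - k%:R = r by field.
have D := smooth_on_is_derive sP rl.
by have /is_derive_rowP := D; apply.
Qed.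

Lemma glue_speed (R : realType) n N (P : int -> R -> 'rV[R]_n.+1) (l : seq R) (k : nat) (r : R) :
  (0 < N)%N -> smooth_on (off l) (P k) -> off l r ->
  speed (glue N P) (N%:R^-1 * r + N%:R^-1 * k%:R) = N%:R * speed (P k) r.
Proof. by move=> N0 sP rl; rewrite /speed (glue_derive1 N0 sP rl) euclidZ ger0_norm. Qed.

Lemma glue_Rintegral (R : realType) (V : topologicalType) N (P : int -> R -> V)
    (f : V -> R) :
  (0 < N)%N -> (forall k : nat, P k 1 = P k.+1 0) ->
  (forall k : nat, {within `[0, 1], continuous (P k)}) -> continuous f ->
  \int[@lebesgue_measure R]_(s in `[0, 1]) f (glue N P s) =
  N%:R^-1 * \sum_(k < N) \int[@lebesgue_measure R]_(r in `[0, 1]) f (P k r).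
Proof.
move=> N0 PP cP cf.
have cg : {within `[0, 1], continuous (fun s => f (glue N P s))}.
  by apply: (within_continuous_compT (f := f) cf); exact: glue_continuous.
rewrite (Rintegral_split (l := [::]) N0).
- congr (_ * _); apply: eq_bigr => k _; apply: eq_Rintegral => r.
  by rewrite inE /= in_itvcc => r01; rewrite glue_piece.
- exact: integrable_within01.
- by move=> x x01 _; exact: within01_continuous.
Qed.

(** The factor [N] by which a derivative grows on a rescaled piece cancels the [1 / N] of the
    substitution, so lengths and weighted integrals simply add up. *)
Lemma piecewise_integral (R : realType) N (l : seq R) (f : R -> R) (h : nat -> R -> R) :
  (0 < N)%N -> (forall s, off (glue_breaks N l) s -> {for s, continuous f}) ->
  (forall k : nat, (k < N)%N -> forall r : R, off l r -> {for r, continuous (h k)}) ->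
  (forall k : nat, (k < N)%N -> forall r : R, off l r ->
    f (N%:R^-1 * r + N%:R^-1 * k%:R) = N%:R * h k r) ->
  (forall k : nat, (k < N)%N ->
    (@lebesgue_measure R).-integrable `[0, 1] (EFin \o h k)) ->
  (@lebesgue_measure R).-integrable `[0, 1] (EFin \o f) /\
  \int[@lebesgue_measure R]_(s in `[0, 1]) f s =
  \sum_(k < N) \int[@lebesgue_measure R]_(r in `[0, 1]) h k r.
Proof.
move=> N0 cf ch fh ih; have NR : 0 < N%:R :> R by rewrite ltr0n.
have piece (k : nat) : (k < N)%N ->
    (@lebesgue_measure R).-integrable `[0, 1] (EFin \o
      (fun r => f (N%:R^-1 * r + N%:R^-1 * k%:R))) /\
    \int[@lebesgue_measure R]_(r in `[0, 1]) f (N%:R^-1 * r + N%:R^-1 * k%:R) =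
    N%:R * \int[@lebesgue_measure R]_(r in `[0, 1]) h k r.
  move=> kN; rewrite -RintegralZl //; last exact: ih.
  apply: (@Rintegral_eq_off_seq _ l).
  - by move=> r rl; rewrite fh.
  - by move=> r rl; apply: cvgM; [exact: cvg_cst|exact: ch].
  - by have := integrableZl _ N%:R (ih k kN); apply; exact: measurable_itv.
have cfb x : x \in `]0, 1[%R -> x \notin glue_breaks N l -> {for x, continuous f}.
  by move=> x01 xl; apply: cf; split.
have fi : (@lebesgue_measure R).-integrable `[0, 1] (EFin \o f).
  apply: (@integrable_split _ (glue_breaks N l) N f N0 cfb).
  by move=> k kN; have [] := piece k kN.
split=> //; apply: (etrans (@Rintegral_split _ (glue_breaks N l) N f N0 fi cfb)).
rewrite mulr_sumr; apply: eq_bigr => k _.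
apply: (etrans (congr1 (fun z => N%:R^-1 * z) (piece k (ltn_ord k)).2)).
by rewrite mulKf // gt_eqF.
Qed.

Lemma glue_length (R : realType) n N (P : int -> R -> 'rV[R]_n.+1) (l : seq R) :
  (0 < N)%N -> (forall k : nat, (k < N)%N -> smooth_on (off l) (P k)) ->
  (forall k : nat, (k < N)%N -> forall r, off l r -> 0 < speed (P k) r) ->
  (forall k : nat, (k < N)%N ->
    (@lebesgue_measure R).-integrable `[0, 1] (EFin \o speed (P k))) ->
  [/\ forall s, off (glue_breaks N l) s -> {for s, continuous (speed (glue N P))},
    (@lebesgue_measure R).-integrable `[0, 1] (EFin \o speed (glue N P)) &
  \int[@lebesgue_measure R]_(s in `[0, 1]) speed (glue N P) s =
  \sum_(k < N) \int[@lebesgue_measure R]_(r in `[0, 1]) speed (P k) r].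
Proof.
move=> N0 sP pP iP; have NR : 0 < N%:R :> R by rewrite ltr0n.
have ssm (k : nat) : (k < N)%N -> smooth_on (off l) (speed (P k)).
  by move=> kN; apply: smooth_on_speed; [exact: open_off|exact: sP|exact: pP].
have cs s : off (glue_breaks N l) s -> {for s, continuous (speed (glue N P))}.
  have sg : smooth_on (off (glue_breaks N l)) (speed (glue N P)).
    apply: smooth_on_speed; [exact: open_off|exact: glue_row_smooth|].
    move=> x /(off_glue_breaks N0)[k [r [kN rl ->]]].
    by rewrite (glue_speed N0 (sP k kN) rl) mulr_gt0 // pP.
  exact: smooth_on_continuous sg.
have [isp e] := @piecewise_integral R N l (speed (glue N P)) (fun k => speed (P k)) N0 cs
  (fun k kN r rl => smooth_on_continuous (ssm k kN) rl)
  (fun k kN r rl => glue_speed N0 (sP k kN) rl) iP.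
by split.
Qed.

(** * Equally spaced points on the circle *)

Local Open Scope complex_scope.

(** A power [k] equal to 1 makes [N] divide [k c], hence [k], by coprimality. *)
Lemma expi_root_unity (R : realType) (c N : nat) (z : R[i]) : (0 < N)%N -> coprime N c ->
  z = expi (2 * pi * c%:R / N%:R) ->
  [/\ z * z^* = 1, z ^+ N = 1 & forall k, (0 < k < N)%N -> z ^+ k != 1].
Proof.
move=> N0 cN ->; have NR : N%:R != 0 :> R by rewrite pnatr_eq0 -lt0n.
split; first exact: expi_conj.
  by rewrite -expi_natM mulrC divfK // -[c%:R]/(c%:~R) expi2pi_int.
move=> k /andP[k0 kN]; apply/negP => /eqP; rewrite -expi_natM => /expi_eq1[m].
have p0 : 2 * pi != 0 :> R by rewrite mulf_neq0 ?gt_eqF ?pi_gt0.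
have -> : k%:R * (2 * pi * c%:R / N%:R) = 2 * pi * (k%:R * c%:R / N%:R) :> R by ring.
move/(mulfI p0)/(congr1 (fun x => x * N%:R)); rewrite divfK // -natrM.
rewrite -[X in X = _]/((k * c)%:R) pmulrn [N%:R]pmulrn -intrM => /eqP.
rewrite eqr_int => /eqP E.
have : (N %| k * c)%N by rewrite -[(_ %| _)%N]/((N%:Z %| (k * c)%:Z)%Z) E dvdz_mull.
by rewrite Gauss_dvdl // gtnNdvd.
Qed.

Definition row2 (R : realType) (a b : R) : 'rV[R]_2 := \row_j [:: a; b]`_j.

Lemma mono_row2 (R : realType) (e : 'I_2 -> nat) (a b : R) :
  mono e (row2 a b) = a ^+ e 0 * b ^+ e 1.
Proof. rewrite /mono !big_ord_recl big_ord0 !mxE /= mulr1.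
by congr (_ * b ^+ e _); apply: val_inj. Qed.

(** The circle is viewed as the set of pairs [(z, 0)], so that the phase averages made for the Hopf
    map apply to it. *)
Definition pad2 (e : 'I_2 -> nat) (i : 'I_4) : nat := if (i < 2)%N then e (inord i) else 0%N.

Lemma sum_pad2 (e : 'I_2 -> nat) : (\sum_i pad2 e i = \sum_i e i)%N.
Proof.
rewrite !big_ord_recl !big_ord0 /pad2 /= !addn0.
by congr (e _ + e _)%N; apply: val_inj; rewrite /= inordK.
Qed.

Lemma mono_pad2 (R : realType) (e : 'I_2 -> nat) (z : R[i]) :
  mono (pad2 e) (real_of_C2 (z, 0)) = mono e (row2 (complex.Re z) (complex.Im z)).
Proof.
rewrite mono_row2 /mono !big_ord_recl !big_ord0 /pad2 !mxE /= !mulr1.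
by congr (_ ^+ e _ * _ ^+ e _); apply: val_inj; rewrite /= inordK.
Qed.

(** By [phase_average_inv] the average over the [N] points is invariant under all rotations on
    monomials of degree less than [N], so [moments_unique] identifies it; [a] only turns the
    configuration. *)
Lemma circle_design (R : realType) (N : nat) (a : R) (e : 'I_2 -> nat) :
  (\sum_i e i < N)%N ->
  N%:R^-1 * \sum_(k < N) mono e (row2 (cos (a + 2 * pi * k%:R / N%:R)) (sin (a + 2 * pi * k%:R / N%:R))) =
  sphere_moment R 2 e.
Proof.
move=> eN; have N0 : (0 < N)%N by exact: leq_trans eN.
have NR : N%:R != 0 :> R by rewrite pnatr_eq0 -lt0n.
pose zeta : R[i] := expi (2 * pi * 1%:R / N%:R).
have [zz zN z1] := expi_root_unity N0 (coprimen1 N) (erefl zeta).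
have zk k : expi (a + 2 * pi * k%:R / N%:R) = zeta ^+ k * expi a.
  rewrite expiD mulrC -expi_natM; congr (expi _ * _); rewrite mulr1; ring.
pose x k := row2 (cos (a + 2 * pi * k%:R / N%:R)) (sin (a + 2 * pi * k%:R / N%:R)).
have xk k e' : mono e' (x k) = mono (pad2 e') (real_of_C2 (@phase_mul R (zeta ^+ k) (expi a, 0))).
  by rewrite /phase_mul /= mulr0 mono_pad2 -zk.
pose mu e' := N%:R^-1 * \sum_(k < N) mono e' (x k).
apply: (@moments_unique R 2 N.-1 mu 0 1) => //; last by rewrite -ltnS prednK.
- move=> j j0; have {j0}-> : j = 1 by case: j j0 => -[|[|//]] //= i h; apply: val_inj.
  move=> e' k; rewrite -ltnS prednK // => eT u v uv; rewrite /mu.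
  pose y k := row2 (u * x k 0 0 + v * x k 0 1) (- v * x k 0 0 + u * x k 0 1).
  transitivity (N%:R^-1 * \sum_(l < N) mono (upd e' 0 1 k 0%N) (y l)).
    rewrite [in RHS](eq_bigr _ (fun (l : 'I_N) _ => @mono_rot R 2 e' 0 1 k u v (x l) (y l) isT _ _)); first last.
    - by move=> l _; case=> -[|[|//]].
    - by move=> l _; rewrite /y [LHS]mxE.
    rewrite exchange_big /= mulr_sumr; apply: eq_bigr => i _.
    by rewrite mulrCA -mulr_sumr.
  congr (_ * _).
  (* Multiplication by [u - 'i v] is the rotation that sends [(x, y)] to
     [(u x + v y, - v x + u y)]. *)
  pose w : R[i] := u +i* - v.
  have ww : w * w^* = 1.
    by apply/eqP; rewrite eq_complex /= opprK; apply/andP; split; apply/eqP; rewrite -?uv; ring.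
  have := @phase_average_inv R zeta w N (mono_seq (pad2 (upd e' 0 1 k 0%N))) (expi a, 0) zz zN z1.
  rewrite size_mono_seq sum_pad2 => /(_ eT ww).
  under eq_bigr do rewrite -mono_real_of_C2.
  under [in X in _ = X -> _]eq_bigr do rewrite -mono_real_of_C2 -xk.
  move=> <-; apply: eq_bigr => l _.
  rewrite /phase_mul /= !mulr0 mono_pad2 mulrCA -zk.
  by congr mono; congr row2; rewrite !mxE /=; ring.
- rewrite /mu (eq_bigr (fun=> 1)); last by move=> k _; rewrite mono_row2 !expr0 mulr1.
  by rewrite sumr_const card_ord mulVf.
- move=> e' _; rewrite /mu -mulr_sumr exchange_big /=; congr (_ * _).
  apply: eq_bigr => k _; rewrite !big_ord_recl big_ord0 addr0 !mono_bump2 -mulrDl !mxE /=.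
  by rewrite cos2Dsin2 mul1r.
Qed.

Local Close Scope complex_scope.

(** * Height integrals on the two-sphere *)

Lemma Rintegral_lincomb (R : realType) (a b : R) (f g : R -> R) :
  (@lebesgue_measure R).-integrable `[0, 1] (EFin \o f) ->
  (@lebesgue_measure R).-integrable `[0, 1] (EFin \o g) ->
  (@lebesgue_measure R).-integrable `[0, 1] (EFin \o (fun x => a * f x + b * g x)) /\
  \int[@lebesgue_measure R]_(x in `[0, 1]) (a * f x + b * g x) =
  a * \int[@lebesgue_measure R]_(x in `[0, 1]) f x + b * \int[@lebesgue_measure R]_(x in `[0, 1]) g x.
Proof.
move=> fi gi.
have [|i e] := @Rintegral_sum R _ _ (@lebesgue_measure R) `[0, 1]%classic 2
  (fun i => if i == 0 then f else g) (fun i => if i == 0 then a else b) (measurable_itv _).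
  by move=> i; case: ifP.
have E : (fun x : R => \sum_(i < 2) (if i == 0 then a else b) * (if i == 0 then f else g) x) =
    (fun x => a * f x + b * g x).
  by apply/funext => x; rewrite !big_ord_recl big_ord0 addr0.
move: i e; rewrite E => i ->; split=> //.
by rewrite !big_ord_recl big_ord0 addr0.
Qed.

Lemma is_derive_exprn (R : realType) (f : R -> R) n (x df : R) :
  is_derive x 1 f df -> is_derive x 1 (fun y => f y ^+ n) (n%:R * f x ^+ n.-1 * df).
Proof.
move=> D; have -> : (fun y => f y ^+ n) = f ^+ n by rewrite exprfctE.
exact: (is_deriveX n D).
Qed.

(** The radius of the parallel of [S^2] at height [2 * r - 1]. *)
Definition chord (R : realType) (r : R) : R := Num.sqrt (1 - (2 * r - 1) ^+ 2).

Lemma chord_sqr_ge0 (R : realType) (r : R) : 0 <= r <= 1 -> 0 <= 1 - (2 * r - 1) ^+ 2.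
Proof.
move=> /andP[r0 r1]; have -> : 1 - (2 * r - 1) ^+ 2 = 4 * (r * (1 - r)) by ring.
by rewrite mulr_ge0 // mulr_ge0 // subr_ge0.
Qed.

Lemma chord_sqr (R : realType) (r : R) : 0 <= r <= 1 -> chord r ^+ 2 = 1 - (2 * r - 1) ^+ 2.
Proof. by move=> r01; rewrite sqr_sqrtr // chord_sqr_ge0. Qed.

Lemma chord_sqr_gt0 (R : realType) (r : R) : 0 < r < 1 -> 0 < 1 - (2 * r - 1) ^+ 2.
Proof.
move=> /andP[r0 r1]; have -> : 1 - (2 * r - 1) ^+ 2 = 4 * (r * (1 - r)) by ring.
by rewrite mulr_gt0 // mulr_gt0 // subr_gt0.
Qed.

Lemma chord_gt0 (R : realType) (r : R) : 0 < r < 1 -> 0 < chord r.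
Proof. by move=> r01; rewrite sqrtr_gt0 chord_sqr_gt0. Qed.

Lemma chord0 (R : realType) : chord (0 : R) = 0.
Proof. by rewrite /chord mulr0 sub0r sqrrN expr1n subrr sqrtr0. Qed.

Lemma chord1 (R : realType) : chord (1 : R) = 0.
Proof. by rewrite /chord (_ : 2 * 1 - 1 = 1 :> R) ?expr1n ?subrr ?sqrtr0 //; ring. Qed.

Lemma chord_le1 (R : realType) (r : R) : chord r <= 1.
Proof.
by rewrite /chord -[leRHS](sqrtr1 R) ler_wsqrtr // lerBlDr lerDl sqr_ge0.
Qed.

Lemma chord_continuous (R : realType) : continuous (@chord R).
Proof.
move=> r; apply: (continuous_comp (f := fun r : R => 1 - (2 * r - 1) ^+ 2)); last exact: sqrt_continuous.
apply: cvgB; first exact: cvg_cst.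
apply: (continuous_exprn (f := fun r : R => 2 * r - 1)).
by apply: cvgB; [apply: cvgM; [exact: cvg_cst|exact: cvg_id]|exact: cvg_cst].
Qed.

Lemma chord_is_derive (R : realType) (r : R) : 0 < r < 1 ->
  is_derive r 1 (@chord R) (- 2 * (2 * r - 1) / chord r).
Proof.
move=> r01; have c0 := chord_gt0 r01.
have D1 := @is_derive_affine R 2 (- 1) r.
have D2 := is_deriveX 2 D1.
have D3 := is_deriveB (is_derive_cst (1 : R) r 1) D2.
have D4 := @is_derive1_sqrt R _ (chord_sqr_gt0 r01).
have D5 := @is_derive1_comp R _ _ r _ _ D4 D3.
apply: is_derive_eq D5 _; rewrite -/(chord r) /= expr1 /GRing.scale /=.
by field; rewrite gt_eqF.
Qed.

Lemma chord_smooth (R : realType) : smooth_on [set r : R | 0 < r < 1] (@chord R).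
Proof.
apply: smooth_on_sqrt; first by move=> r /= /chord_sqr_gt0.
apply: smooth_onD; first exact: smooth_on_cst.
apply: smooth_onN; apply: smooth_onX; apply: smooth_onD; last exact: smooth_on_cst.
by apply: smooth_onM; [exact: smooth_on_cst|exact: smooth_on_id].
Qed.

Definition chord_integral (R : realType) (p b : nat) : R :=
  \int[@lebesgue_measure R]_(r in `[0, 1]) (chord r ^+ p * (2 * r - 1) ^+ b).

Lemma chord_mono_continuous (R : realType) p b :
  continuous (fun r : R => chord r ^+ p * (2 * r - 1) ^+ b).
Proof.
move=> r; apply: cvgM; first exact/continuous_exprn/chord_continuous.
apply: (continuous_exprn (f := fun r : R => 2 * r - 1)).
by apply: cvgB; [apply: cvgM; [exact: cvg_cst|exact: cvg_id]|exact: cvg_cst].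
Qed.

Lemma chord_mono_integrable (R : realType) p b :
  (@lebesgue_measure R).-integrable `[0, 1]
    (EFin \o (fun r : R => chord r ^+ p * (2 * r - 1) ^+ b)).
Proof.
apply: integrable_within01; apply: continuous_subspaceT.
exact: chord_mono_continuous.
Qed.

(** The function [F], which has one more square of the chord, vanishes at both poles, so the
    integral of its derivative is 0. For [b = 0] the equation says that the moments with a single
    height factor vanish. *)
Lemma chord_integral_parts (R : realType) p b :
  (p + 2)%:R * chord_integral R p b.+1 = b%:R * chord_integral R p.+2 b.-1.
Proof.
pose f (r : R) : R := (2 * b%:R) * (chord r ^+ p.+2 * (2 * r - 1) ^+ b.-1) +
  (- (2 * (p + 2)%:R)) * (chord r ^+ p * (2 * r - 1) ^+ b.+1).
pose F (r : R) : R := chord r ^+ p.+2 * (2 * r - 1) ^+ b.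
have [i1 fE] := Rintegral_lincomb (2 * b%:R) (- (2 * (p + 2)%:R))
  (@chord_mono_integrable R p.+2 b.-1) (@chord_mono_integrable R p b.+1).
have cf : continuous f.
  move=> r; apply: cvgD; apply: cvgM; try exact: cvg_cst; exact: chord_mono_continuous.
have : \int[@lebesgue_measure R]_(r in `[0, 1]) f r = F 1 - F 0.
  apply: (@RFTC2_off_seq R [::] 0 1 f F) => //.
  - by apply: continuous_subspaceT; exact: chord_mono_continuous.
  - by move=> r _ _; exact: cf.
  - move=> r; rewrite in_itvoo => r01 _; have c0 := chord_gt0 r01.
    have D1 := is_derive_exprn p.+2 (chord_is_derive r01).
    have D2 := is_derive_exprn b (@is_derive_affine R 2 (- 1) r).
    apply: is_derive_eq (is_deriveM D1 D2) _.
    rewrite /f /= !exprS natrD /GRing.scale /=.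
    by field; rewrite gt_eqF.
rewrite fE -/(chord_integral R p.+2 b.-1) -/(chord_integral R p b.+1).
rewrite /F chord0 chord1 !expr0n /= !mul0r subrr => E.
by move: (chord_integral R _ _) (chord_integral R _ _) E => A B E; lra.
Qed.

Lemma chord_integral_sum (R : realType) p b :
  chord_integral R p.+2 b + chord_integral R p b.+2 = chord_integral R p b.
Proof.
have [_] := Rintegral_lincomb 1 1 (@chord_mono_integrable R p.+2 b) (@chord_mono_integrable R p b.+2).
rewrite !mul1r => <-.
apply: eq_Rintegral => r; rewrite inE /= in_itvcc => r01.
rewrite -addn2 -[b.+2]addn2 !exprD chord_sqr // !mul1r; ring.
Qed.

Lemma chord_integral00 (R : realType) : chord_integral R 0 0 = 1.
Proof.
pose f (r : R) : R := chord r ^+ 0 * (2 * r - 1) ^+ 0.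
have c : {within `[0, 1], continuous (id : R -> R)}.
  by apply: continuous_subspaceT => x; exact: cvg_id.
have cf (x : R) : x \in `]0, 1[%R -> x \notin [::] -> {for x, continuous f}.
  by move=> _ _; exact: chord_mono_continuous.
have df (x : R) : x \in `]0, 1[%R -> x \notin [::] -> is_derive x 1 (id : R -> R) (f x).
  by move=> _ _; rewrite /f !expr0 mulr1; exact: is_derive_id.
apply: (etrans (RFTC2_off_seq ler01 (@chord_mono_integrable R 0 0) c cf df)).
by rewrite subr0.
Qed.

(** * The curve [alpha] *)

(* The tangent of half the latitude [asin (2 * r - 1)]. *)
Definition half_lat (R : realType) (r : R) : R := (2 * r - 1) / (1 + chord r).

Lemma chordD1_gt0 (R : realType) (r : R) : 0 < 1 + chord r.
Proof. by rewrite ltr_wpDr // sqrtr_ge0. Qed.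

Lemma half_lat_continuous (R : realType) : continuous (@half_lat R).
Proof.
move=> r; apply: cvgM.
  by apply: cvgB; [apply: cvgM; [exact: cvg_cst|exact: cvg_id]|exact: cvg_cst].
apply: cvgV; first by rewrite gt_eqF // chordD1_gt0.
by apply: cvgD; [exact: cvg_cst|exact: chord_continuous].
Qed.

Lemma half_lat_is_derive (R : realType) (r : R) : 0 < r < 1 ->
  is_derive r 1 (@half_lat R) (2 / (chord r * (1 + chord r))).
Proof.
move=> r01; have c0 := chord_gt0 r01; have c1 := chordD1_gt0 r.
have D0 := chord_is_derive r01.
have D1 := is_deriveD (is_derive_cst (1 : R) r 1) D0.
have D2 := is_deriveV (lt0r_neq0 c1 : (cst 1 + @chord R) r != 0) D1.
have D3 := is_deriveM (@is_derive_affine R 2 (- 1) r) D2.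
apply: is_derive_eq D3 _; rewrite /GRing.scale /=.
have -> : (cst 1 + @chord R) r = 1 + chord r by [].
have u2 : (2 * r - 1) ^+ 2 = 1 - chord r ^+ 2.
  by rewrite chord_sqr ?subKr // !ltW ?(andP r01).1 ?(andP r01).2.
transitivity (2 * (2 * r - 1) ^+ 2 / (chord r * (1 + chord r) ^+ 2) + 2 / (1 + chord r)).
  by field; rewrite !gt_eqF.
by rewrite u2; field; rewrite !gt_eqF.
Qed.

(** One primitive serves twice: [T = 1] gives half the latitude, hence the length of a meridian, and
    other values of [T] give the drift of the Hopf lift. *)
Lemma atan_half_lat_is_derive (R : realType) (T r : R) : 0 < r < 1 ->
  is_derive r 1 (fun r => atan (T * half_lat r))
    (T * (2 / (chord r * (1 + chord r))) / (1 + (T * half_lat r) ^+ 2)).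
Proof.
move=> r01.
have D1 := is_deriveM (is_derive_cst T r 1) (half_lat_is_derive r01).
have D2 := @is_derive1_comp R (@atan R) _ r _ _ (is_derive1_atan _) D1.
by apply: is_derive_eq D2 _; rewrite /GRing.scale /= mulr0 addr0 mulrC.
Qed.

Lemma half_lat_sqr (R : realType) (r : R) : 0 <= r <= 1 ->
  half_lat r ^+ 2 = (1 - chord r) / (1 + chord r).
Proof.
move=> r01; rewrite /half_lat expr_div_n -[(2 * r - 1) ^+ 2](subKr 1) -chord_sqr //.
by field; rewrite gt_eqF // chordD1_gt0.
Qed.

Lemma half_lat0 (R : realType) : half_lat (0 : R) = - 1.
Proof. by rewrite /half_lat chord0 addr0 divr1 mulr0 sub0r. Qed.

Lemma half_lat1 (R : realType) : half_lat (1 : R) = 1.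
Proof. by rewrite /half_lat chord1 addr0 divr1; ring. Qed.

Lemma atan1 (R : realType) : atan 1 = pi / 4 :> R.
Proof.
have pi0 := @pi_gt0 R; rewrite -[X in atan X](@tan_piquarter R) tanK //.
by rewrite in_itvoo; apply/andP; split; lra.
Qed.

(** [2 / chord r] is the speed of a meridian parameterized by height, unbounded at both poles; its
    primitive is the latitude, which runs from [- pi / 2] to [pi / 2]. *)
Lemma chordV_integral (R : realType) :
  (@lebesgue_measure R).-integrable `[0, 1] (EFin \o (fun r : R => 2 / chord r)) /\
  \int[@lebesgue_measure R]_(r in `[0, 1]) (2 / chord r) = pi.
Proof.
pose F (r : R) := 2 * atan (1 * half_lat r).
have cF : {within `[0, 1], continuous F}.
  apply: continuous_subspaceT => x; apply: cvgM; first exact: cvg_cst.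
  apply: (continuous_comp (f := fun r => 1 * half_lat r)); last exact: continuous_atan.
  by apply: cvgM; [exact: cvg_cst|exact: half_lat_continuous].
have dF (r : R) : r \in `]0, 1[%R -> r \notin [::] -> is_derive r 1 F (2 / chord r).
  rewrite in_itvoo => r01 _.
  have D := is_deriveM (is_derive_cst (2 : R) r 1) (atan_half_lat_is_derive 1 r01).
  apply: is_derive_eq D _; rewrite /GRing.scale /= !mul1r half_lat_sqr; last first.
    by rewrite !ltW ?(andP r01).1 ?(andP r01).2.
  have c1 := chordD1_gt0 r; have c0 := chord_gt0 r01.
  field; rewrite !gt_eqF //=.
  by rewrite addrACA subrr addr0.
have cf (r : R) : r \in `]0, 1[%R -> r \notin [::] -> {for r, continuous (fun r : R => 2 / chord r)}.
  rewrite in_itvoo => r01 _; apply: cvgM; first exact: cvg_cst.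
  by apply: cvgV; [rewrite gt_eqF // chord_gt0|exact: chord_continuous].
have fi := ge0_FTC2_off_seq ler01 cF _ cf dF.
have fi' : (@lebesgue_measure R).-integrable `[0, 1] (EFin \o (fun r : R => 2 / chord r)).
  by apply: fi => r; rewrite in_itvoo => r01 _; rewrite divr_ge0 // ltW // chord_gt0.
split=> //; apply: (etrans (RFTC2_off_seq ler01 fi' cF cf dF)).
by rewrite /F half_lat0 half_lat1 !mul1r atanN atan1; field.
Qed.

Lemma sqr_signz (R : realType) (k : int) : ((-1 : R) ^ k) ^+ 2 = 1.
Proof. by case: k => n; rewrite ?exprVn -?exprnP ?sqrr_sign ?invr1 // /exprz exprVn sqrr_sign invr1. Qed.

Definition lon (R : realType) (t : nat) (k : int) : R :=
  pi * k%:~R / t%:R + pi / (2 * t%:R).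

Definition alpha_piece (R : realType) t (k : int) (r : R) : 'rV[R]_3 :=
  \row_j [:: chord r * cos (lon R t k); chord r * sin (lon R t k);
             (-1) ^ k * (2 * r - 1)]`_j.

Lemma alpha_glue (R : realType) t : @alpha R t = glue (2 * t) (alpha_piece t).
Proof.
apply/funext => s; rewrite /alpha /glue natrM; set k := Num.floor _.
have E3 : alpha3 t s = (-1) ^ k * (2 * (2 * t%:R * s - k%:~R) - 1).
  by rewrite /alpha3 -/k; congr (_ * _); ring.
have E : Num.sqrt (1 - alpha3 t s ^+ 2) = chord (2 * t%:R * s - k%:~R).
  by rewrite E3 exprMn sqr_signz mul1r.
apply/rowP => j; rewrite !mxE /alpha1 /alpha2 E E3 /alpha_longitude -/k.
by case: j => -[|[|[|//]]].
Qed.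

(** Both values are poles, where the chord vanishes and the longitude is forgotten; the heights
    agree because the sign alternates. *)
Lemma alpha_piece_match (R : realType) t (k : nat) :
  alpha_piece t k (1 : R) = alpha_piece t k.+1 0.
Proof.
apply/rowP => j; rewrite !mxE chord0 chord1 !mul0r.
case: j => -[|[|[|//]]] //= _; rewrite -!exprnP exprS; ring.
Qed.

Lemma alpha_piece_sphere (R : realType) t k (r : R) : 0 <= r <= 1 ->
  sphere 2 (alpha_piece t k r).
Proof.
move=> r01; apply/sphere_sum; rewrite !big_ord_recl big_ord0 !mxE /= addr0.
rewrite !exprMn sqr_signz mul1r addrA -mulrDr cos2Dsin2 mulr1 chord_sqr //; ring.
Qed.

Lemma alpha_piece_continuous (R : realType) t k : continuous (@alpha_piece R t k).
Proof.
apply: continuous_row => j; rewrite (_ : (fun s => _) =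
  fun r : R => [:: chord r * cos (lon R t k); chord r * sin (lon R t k);
             (-1) ^ k * (2 * r - 1)]`_j); last by apply/funext => r; rewrite mxE.
case: j => -[|[|[|//]]] //= _ r; apply: cvgM; try exact: cvg_cst; try exact: chord_continuous.
by apply: cvgB; [apply: cvgM; [exact: cvg_cst|exact: cvg_id]|exact: cvg_cst].
Qed.

Lemma off_nil (R : realType) (r : R) : off [::] r <-> 0 < r < 1.
Proof. by rewrite /off /= in_itvoo; split=> [[]|]. Qed.

Lemma alpha_piece_smooth (R : realType) t k : smooth_on (off [::]) (@alpha_piece R t k).
Proof.
have sc : smooth_on (off [::]) (@chord R).
  by apply: smooth_onS (@chord_smooth R) => r /off_nil.
apply/smooth_on_rowP; first exact: open_off.
move=> j; rewrite (_ : (fun s => _) =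
  fun r : R => [:: chord r * cos (lon R t k); chord r * sin (lon R t k);
             (-1) ^ k * (2 * r + - 1)]`_j); last by apply/funext => r; rewrite mxE.
case: j => -[|[|[|//]]] //= _; apply: smooth_onM => //; try exact: smooth_on_cst.
apply: smooth_onD; last exact: smooth_on_cst.
by apply: smooth_onM; [exact: smooth_on_cst|exact: smooth_on_id].
Qed.

Lemma alpha_piece_derive1 (R : realType) t k (r : R) : 0 < r < 1 ->
  derive1 (alpha_piece t k) r = \row_j [:: - 2 * (2 * r - 1) / chord r * cos (lon R t k);
    - 2 * (2 * r - 1) / chord r * sin (lon R t k); 2 * (-1) ^ k]`_j.
Proof.
move=> r01; apply: derive1_row => j; rewrite (_ : (fun s => _) =
  fun r : R => [:: chord r * cos (lon R t k); chord r * sin (lon R t k);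
             (-1) ^ k * (2 * r - 1)]`_j); last by apply/funext => s; rewrite mxE.
have Dc := chord_is_derive r01.
have D (a : R) := is_deriveM Dc (is_derive_cst a r 1).
have D' := is_deriveM (is_derive_cst ((-1) ^ k : R) r 1) (@is_derive_affine R 2 (- 1) r).
rewrite mxE; case: j => -[|[|[|//]]] /= _.
- by apply: is_derive_eq (D (cos (lon R t k))) _; rewrite /GRing.scale /=; ring.
- by apply: is_derive_eq (D (sin (lon R t k))) _; rewrite /GRing.scale /=; ring.
- by apply: is_derive_eq D' _; rewrite /GRing.scale /=; ring.
Qed.

Lemma alpha_piece_speed (R : realType) t k (r : R) : 0 < r < 1 ->
  speed (alpha_piece t k) r = 2 / chord r.
Proof.
move=> r01; rewrite /speed alpha_piece_derive1 // /euclid !big_ord_recl big_ord0 !mxE /= addr0.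
have c0 := chord_gt0 r01.
rewrite -[RHS]gtr0_norm ?divr_gt0 // -sqrtr_sqr; congr Num.sqrt.
rewrite !exprMn sqr_signz mulr1 addrA -mulrDr cos2Dsin2 mulr1 exprVn chord_sqr; last first.
  by rewrite !ltW ?(andP r01).1 ?(andP r01).2.
by field; rewrite gt_eqF // chord_sqr_gt0.
Qed.

Lemma glue_range (R : realType) (T : Type) (Q : T -> Prop) N (P : int -> R -> T) (s : R) :
  (0 < N)%N -> (forall (k : int) (r : R), 0 <= r <= 1 -> Q (P k r)) ->
  0 <= s <= 1 -> Q (glue N P s).
Proof.
move=> N0 QP _; apply: QP; rewrite subr_ge0 floor_le /=.
by rewrite lerBlDr addrC -[1]/(1%:~R) -intrD ltW // floorD1_gt.
Qed.

Lemma alpha_sphere (R : realType) t (s : R) : 0 <= s <= 1 -> sphere 2 (alpha t s).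
Proof.
move=> s01; rewrite alpha_glue.
have [t0|t0] := posnP t.
  by rewrite t0 /glue mul0r floor0 subr0; apply: alpha_piece_sphere; rewrite lexx ler01.
apply: glue_range => //; first by rewrite muln_gt0.
by move=> k r r01; exact: alpha_piece_sphere.
Qed.

Lemma alpha_continuous (R : realType) t : (0 < t)%N -> {within `[0, 1], continuous (@alpha R t)}.
Proof.
move=> t0; rewrite alpha_glue; apply: glue_continuous; first by rewrite muln_gt0.
- exact: alpha_piece_match.
- by move=> k; apply: continuous_subspaceT; exact: alpha_piece_continuous.
Qed.

Lemma alpha_smooth (R : realType) t : (0 < t)%N ->
  smooth_on (off (@glue_breaks R (2 * t) [::])) (alpha t).
Proof.
move=> t0; rewrite alpha_glue; apply: glue_row_smooth; first by rewrite muln_gt0.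
by move=> k _; exact: alpha_piece_smooth.
Qed.

Lemma alpha_piece_speed_integral (R : realType) t k :
  (@lebesgue_measure R).-integrable `[0, 1] (EFin \o speed (alpha_piece t k)) /\
  \int[@lebesgue_measure R]_(r in `[0, 1]) speed (alpha_piece t k) r = pi.
Proof.
have [vi ve] := chordV_integral R; rewrite -ve.
apply: (@Rintegral_eq_off_seq _ [::]) => //.
  by move=> r /off_nil r01; rewrite alpha_piece_speed.
move=> r /off_nil r01; apply: cvgM; first exact: cvg_cst.
by apply: cvgV; [rewrite gt_eqF // chord_gt0|exact: chord_continuous].
Qed.

Lemma alpha_length (R : realType) t : (0 < t)%N ->
  (@lebesgue_measure R).-integrable `[0, 1] (EFin \o speed (alpha t)) /\
  curve_length (@alpha R t) = (2 * pi * t%:R)%:E.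
Proof.
move=> t0; rewrite alpha_glue.
have N0 : (0 < 2 * t)%N by rewrite muln_gt0.
have sp (k : nat) : (k < 2 * t)%N -> forall r : R, off [::] r -> 0 < speed (alpha_piece t k) r.
  by move=> _ r /off_nil h; rewrite alpha_piece_speed // divr_gt0 // chord_gt0.
have [_ i e] := @glue_length R 2 (2 * t) (alpha_piece t) [::] N0
  (fun k _ => @alpha_piece_smooth R t k) sp (fun k _ => (@alpha_piece_speed_integral R t k).1).
split=> //; rewrite /curve_length integral_EFin_Rintegral //; congr EFin.
apply: (etrans e); rewrite (eq_bigr (fun=> pi)) ?sumr_const ?card_ord.
  by rewrite -[LHS]mulr_natr natrM; ring.
by move=> k _; rewrite (alpha_piece_speed_integral R t k).2.
Qed.

Lemma alpha_speed_piece (R : realType) t (k : nat) (r : R) : (0 < t)%N -> 0 < r < 1 ->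
  speed (alpha t) ((2 * t)%:R^-1 * r + (2 * t)%:R^-1 * k%:R) = (2 * t)%:R * (2 / chord r).
Proof.
move=> t0 r01; rewrite alpha_glue.
have := @glue_speed R 2 (2 * t) (alpha_piece t) [::] k r.
rewrite muln_gt0 t0 => /(_ isT (@alpha_piece_smooth R t k) (proj2 (off_nil r) r01)) ->.
by rewrite alpha_piece_speed.
Qed.

Lemma alpha_speed_ge (R : realType) t (s : R) : (0 < t)%N ->
  off (glue_breaks (2 * t) [::]) s -> 4 <= speed (alpha t) s.
Proof.
move=> t0; have N0 : (0 < 2 * t)%N by rewrite muln_gt0.
move=> /(off_glue_breaks N0)[k [r [_ /off_nil r01 ->]]].
rewrite alpha_speed_piece //; have c0 := chord_gt0 r01.
have h : 2 <= 2 / chord r :> R by rewrite ler_pdivlMr // ler_piMr // chord_le1.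
have h2 : 2 <= (2 * t)%:R :> R by rewrite ler_nat leq_pmulr.
apply: (@le_trans _ _ (2 * 2)); first by lra.
by apply: ler_pM.
Qed.

Lemma chord_small (R : realType) (M d : R) : 0 < d ->
  exists2 r : R, 0 < r < 1 & r < d /\ M < 2 / chord r.
Proof.
(* The summand [d^-1] gives [r < d], and [M ^+ 2] gives [M^2 r < 1], so that
   [(M chord r)^2 = 4 M^2 r (1 - r) < 4]. *)
move=> d0; pose p := 2 + M ^+ 2 + d^-1; pose r := p^-1.
have M2 : 0 <= M ^+ 2 by exact: sqr_ge0.
have dV : 0 < d^-1 by rewrite invr_gt0.
have p0 : 0 < p by rewrite /p; lra.
have p1 : 1 < p by rewrite /p; lra.
have r01 : 0 < r < 1 by rewrite invr_gt0 p0 invf_lt1.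
have rd : r < d by rewrite -[d]invrK ltf_pV2 ?posrE // /p; lra.
exists r => //; split=> //; have c0 := chord_gt0 r01.
have [M0|M0] := leP M 0; first by rewrite (le_lt_trans M0) // divr_gt0.
rewrite ltr_pdivlMr // -(@ltr_pXn2r _ 2) ?nnegrE ?mulr_ge0 ?(ltW M0) ?(ltW c0) //.
rewrite exprMn chord_sqr; last by rewrite !ltW ?(andP r01).1 ?(andP r01).2.
have -> : 1 - (2 * r - 1) ^+ 2 = 4 * r * (1 - r) by ring.
have h : M ^+ 2 * r < 1 by rewrite ltr_pdivrMr // mul1r /p; lra.
have h2 : 0 < M ^+ 2 * r by rewrite mulr_gt0 // ?exprn_gt0 // (andP r01).1.
have r1 := (andP r01).2; have r0 := (andP r01).1.
have -> : M ^+ 2 * (4 * r * (1 - r)) = 4 * (M ^+ 2 * r) * (1 - r) by ring.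
set x := M ^+ 2 * r in h h2 *; nra.
Qed.

Lemma glue_derivable (R : realType) n N (P : int -> R -> 'rV[R]_n.+1) (l : seq R)
    (k : nat) (r : R) : (0 < N)%N -> smooth_on (off l) (P k) -> off l r ->
  derivable (glue N P) (N%:R^-1 * r + N%:R^-1 * k%:R) 1.
Proof.
move=> N0 sP rl; have [oW Wr WP] := glue_near P k N0 rl.
have sl : smooth_on [set s : R | off l (N%:R * s + - k%:R)] (glue N P).
  apply/(smooth_on_rowP _ oW) => j.
  apply: (smooth_on_eq oW (f := fun s => P k (N%:R * s + - k%:R) 0 j)).
    by move=> y Wy; rewrite -WP.
  apply: (@smooth_on_affine _ _ (off l) _ _ (fun s => P k s 0 j)) => //.
  by have /smooth_on_rowP := sP; apply; exact: open_off.
by have [] := smooth_on_is_derive sl Wr.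
Qed.

Lemma alpha_unbounded_speed (R : realType) t : (0 < t)%N -> ~ bounded_speed (@alpha R t).
Proof.
move=> t0 [M HM]; have [r r01 [_ Mr]] := chord_small M ltr01.
have N0 : (0 < 2 * t)%N by rewrite muln_gt0.
have D := @glue_derivable R 2 (2 * t) (alpha_piece t) [::] 0 r N0
  (@alpha_piece_smooth R t 0) (proj2 (off_nil r) r01).
rewrite -alpha_glue in D; have := HM _ _ D.
rewrite alpha_speed_piece // mulr0 addr0.
have -> : 0 < (2 * t)%:R^-1 * r < 1.
  rewrite mulr_gt0 ?invr_gt0 ?(andP r01).1 ?ltr0n //= mulrC ltr_pdivrMr ?ltr0n // mul1r.
  by rewrite (lt_le_trans (andP r01).2) // ler1n.
move=> /(_ isT); apply/negP; rewrite -ltNge (lt_le_trans Mr) //.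
by rewrite ler_peMl ?ler1n // divr_ge0 // ltW // chord_gt0.
Qed.

(** The longitudes are spaced by [2 pi / (2 t)], so a coincidence would make the power [k - l] of a
    primitive root of order [2 t] equal to 1. *)
Lemma lon_expi (R : realType) t (k l : nat) : (k < 2 * t)%N -> (l < 2 * t)%N ->
  cos (lon R t k) = cos (lon R t l) -> sin (lon R t k) = sin (lon R t l) -> k = l.
Proof.
wlog kl : k l / (l <= k)%N => [h kt lt c s|].
  by have [lk|/ltnW kl] := leqP l k; [exact: h|apply/esym; exact: h].
move=> kt lt c s; have t0 : (0 < 2 * t)%N by exact: leq_ltn_trans kt.
have [_ _ z1] := expi_root_unity t0 (coprimen1 (2 * t)) (erefl (expi (2 * pi * 1%:R / (2 * t)%:R) : R[i])).
have := z1 (k - l)%N; rewrite -expi_natM.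
have tR : t%:R != 0 :> R by move: t0; rewrite muln_gt0 pnatr_eq0 -lt0n.
have -> : (k - l)%:R * (2 * pi * 1 / (2 * t)%:R) = lon R t k - lon R t l :> R.
  by rewrite natrB // natrM /lon -!pmulrn; field.
have -> : expi (lon R t k - lon R t l) = 1.
  rewrite expiD -(expi_conj (lon R t l)); congr (_ * _); rewrite /expi ?c ?s //.
  by rewrite cosN sinN.
rewrite eqxx (leq_ltn_trans (leq_subr _ _) kt) andbT subn_gt0.
by case: ltngtP kl => // _ _ /(_ isT).
Qed.

Lemma glue_end (R : realType) (T : Type) N (P : int -> R -> T) : glue N P 1 = P N 0.
Proof. by rewrite /glue mulr1 -[N%:R]/(N%:~R) intrKfloor subrr. Qed.

(** The curve meets itself only at the poles: heights equal up to sign give equal chords; off the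
    poles the horizontal coordinates then determine the longitude, hence the piece, and the height
    determines [r]. *)
Lemma alpha_eq_breaks (R : realType) t (s1 s2 : R) : (0 < t)%N ->
  0 <= s1 -> s1 < s2 -> s2 <= 1 -> alpha t s1 = alpha t s2 ->
  (exists2 k, (k <= 2 * t)%N & s1 = (2 * t)%:R^-1 * k%:R) /\
  (exists2 k, (k <= 2 * t)%N & s2 = (2 * t)%:R^-1 * k%:R).
Proof.
move=> t0 s10 s12 s21; have N0 : (0 < 2 * t)%N by rewrite muln_gt0.
have NR : (2 * t)%:R != 0 :> R by rewrite pnatr_eq0 -lt0n.
have [|k1 [r1 [k1t r1i s1E]]] := @piece_cases R (2 * t) s1 N0.
  by rewrite s10 (lt_le_trans s12).
(* The end [s2 = 1] is written as piece [2 t] at [r = 0]; the last clause makes the index smaller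
   than [2 t] in the interior of a piece. *)
have [k2 [r2 [k2t r2i s2E pole2]]] : exists (k : nat) (r : R), [/\ (k <= 2 * t)%N,
    0 <= r < 1, s2 = (2 * t)%:R^-1 * r + (2 * t)%:R^-1 * k%:R & 0 < r -> (k < 2 * t)%N].
  move: s21; rewrite le_eqVlt => /orP[/eqP s21|s21].
    exists (2 * t)%N, 0; rewrite leqnn lexx ltr01 s21; split=> //; last by rewrite ltxx.
    by rewrite mulr0 add0r mulVf.
  have [|k [r [kt ri e]]] := @piece_cases R (2 * t) s2 N0.
    by rewrite s21 (le_trans s10) ?ltW.
  by exists k, r; split=> //; exact: ltnW.
rewrite s1E s2E alpha_glue !glue_piece_lt // => E.
have {}E j : alpha_piece t k1 r1 0 j = alpha_piece t k2 r2 0 j by rewrite E.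
have E0 := E 0; have E1 := E 1; have E2 := E 2; rewrite !mxE /= in E0 E1 E2.
have sq : (2 * r1 - 1) ^+ 2 = (2 * r2 - 1) ^+ 2.
  by have := congr1 (fun x => x ^+ 2) E2; rewrite !exprMn !sqr_signz !mul1r.
have cc : chord r1 = chord r2 by rewrite /chord sq.
have brk (r : R) (k : nat) : 0 <= r < 1 -> (0 < r -> False) -> (k <= 2 * t)%N ->
    exists2 l, (l <= 2 * t)%N & (2 * t)%:R^-1 * r + (2 * t)%:R^-1 * k%:R = (2 * t)%:R^-1 * l%:R.
  move=> /andP[r0 _] rn kt; exists k => //; move: r0; rewrite le_eqVlt => /orP[/eqP <-|/rn //].
  by rewrite mulr0 add0r.
have pos12 : 0 < r1 -> 0 < r2.
  move=> r10; have := chord_gt0 (_ : 0 < r1 < 1); rewrite r10 (andP r1i).2 cc => /(_ isT) c2.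
  rewrite lt_neqAle (andP r2i).1 andbT; apply/eqP => r20.
  by move: c2; rewrite -r20 chord0 ltxx.
have pos21 : 0 < r2 -> 0 < r1.
  move=> r20; have := chord_gt0 (_ : 0 < r2 < 1); rewrite r20 (andP r2i).2 -cc => /(_ isT) c1.
  rewrite lt_neqAle (andP r1i).1 andbT; apply/eqP => r10.
  by move: c1; rewrite -r10 chord0 ltxx.
have no : 0 < r1 -> False.
  move=> r10; have r20 := pos12 r10.
  have c1 := chord_gt0 (_ : 0 < r1 < 1); rewrite r10 (andP r1i).2 in c1.
  have c1' : chord r1 != 0 by rewrite gt_eqF // c1.
  rewrite -cc in E0 E1.
  have kk := lon_expi k1t (pole2 r20) (mulfI c1' E0) (mulfI c1' E1).
  move: E2; rewrite kk => /mulfI; rewrite -sqrf_eq0 sqr_signz oner_eq0 => /(_ isT) rr.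
  have {}rr : r1 = r2 by lra.
  by move: s12; rewrite s1E s2E kk rr ltxx.
split; [by apply: brk => //; exact: ltnW|by apply: brk => // /pos21].
Qed.

Lemma alpha_closed (R : realType) t : (0 < t)%N -> @alpha R t 0 = alpha t 1.
Proof.
move=> t0; rewrite alpha_glue glue_end /glue mulr0 floor0 subr0.
apply/rowP => j; rewrite !mxE chord0 !mul0r.
case: j => -[|[|[|//]]] //= _; rewrite -!exprnP.
by rewrite exprM sqrrN !expr1n expr0.
Qed.

Lemma alpha_self_intersections (R : realType) t : (0 < t)%N ->
  finite_set (self_intersections (@alpha R t)).
Proof.
move=> t0; pose Z : set R := [set` [seq (2 * t)%:R^-1 * k%:R : R | k <- iota 0 (2 * t).+1]].
apply: (@sub_finite_set _ _ (Z `*` Z)); last by apply: finite_setX; exact: finite_seq.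
move=> [s1 s2] [/= s10 s12 s21 _ E].
have [[k1 k1t ->] [k2 k2t ->]] := alpha_eq_breaks t0 s10 s12 s21 E.
have inZ k : (k <= 2 * t)%N -> Z ((2 * t)%:R^-1 * k%:R).
  by move=> kt; apply/mapP; exists k; rewrite // mem_iota.
by split; exact: inZ.
Qed.

Lemma equatorial_moment_2 (R : realType) (e : 'I_3 -> nat) :
  sphere_moment R 2 (equatorial e) =
  sphere_moment R 2 (fun i : 'I_2 => e (widen_ord (leqnSn 2) i)).
Proof.
have E (i : 'I_2) : equatorial e (widen_ord (leqnSn 2) i) = e (widen_ord (leqnSn 2) i).
  rewrite /equatorial; case: eqP => // /(congr1 val) /= h.
  by have := ltn_ord i; rewrite h ltnn.
have M : equatorial e ord_max = 0%N by rewrite /equatorial eqxx.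
rewrite /sphere_moment big_ord_recr [in X in _ / X]big_ord_recr /= M muln1 addn0.
by congr (_%:R / (rho 2 _)%:R); apply: eq_bigr => i _; rewrite E.
Qed.

Lemma sum_equatorial_2 (e : 'I_3 -> nat) :
  (\sum_(i < 2) e (widen_ord (leqnSn 2) i) = \sum_i equatorial e i)%N.
Proof.
rewrite [RHS]big_ord_recr /= [X in (_ + X)%N]/equatorial eqxx addn0; apply: eq_bigr => i _.
rewrite /equatorial; case: eqP => // /(congr1 val) /= h.
by have := ltn_ord i; rewrite h ltnn.
Qed.

Lemma alpha_moments (R : realType) t (e : 'I_3 -> nat) : (0 < t)%N ->
  (\sum_i e i < 2 * t)%N ->
  \int[@lebesgue_measure R]_(s in `[0, 1]) mono e (alpha t s) = sphere_moment R 3 e.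
Proof.
move=> t0 et; have N0 : (0 < 2 * t)%N by rewrite muln_gt0.
have tR : t%:R != 0 :> R by rewrite pnatr_eq0 -lt0n.
have parts p b : (p + 2)%:R * chord_integral R p b.+2 = b.+1%:R * chord_integral R p.+2 b.
  exact: chord_integral_parts.
have J1 p : chord_integral R p 1 = 0.
  have := @chord_integral_parts R p 0; rewrite mul0r => /eqP.
  by rewrite mulf_eq0 pnatr_eq0 addn2 /= => /eqP.
have eqt : (\sum_i equatorial e i < 2 * t)%N.
  by apply: leq_ltn_trans et; rewrite [leqRHS]sum_equatorial leq_addr.
rewrite (@sphere_moment_suspension R 2 (chord_integral R) e) //; first last.
- exact: chord_integral_sum.
- exact: chord_integral00.
set p := (\sum_i equatorial e i)%N; set b := e ord_max.
rewrite alpha_glue glue_Rintegral //; first last.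
- exact: continuous_mono.
- by move=> k; apply: continuous_subspaceT; exact: alpha_piece_continuous.
- exact: alpha_piece_match.
pose node (k : nat) := row2 (cos (lon R t k)) (sin (lon R t k)).
pose e2 (i : 'I_2) := e (widen_ord (leqnSn 2) i).
have piece (k : nat) : \int[@lebesgue_measure R]_(r in `[0, 1]) mono e (alpha_piece t k r) =
    chord_integral R p b * mono e2 (node k).
  transitivity (\int[@lebesgue_measure R]_(r in `[0, 1])
      ((((-1) ^ k%:Z) ^+ b * mono e2 (node k)) * (chord r ^+ p * (2 * r - 1) ^+ b))).
    apply: eq_Rintegral => r _.
    pose y : 'rV[R]_3 := \row_j [:: cos (lon R t k); sin (lon R t k); 0]`_j.
    rewrite (@mono_suspension R 2 e (chord r) ((-1) ^ k%:Z * (2 * r - 1)) y); first last.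
    - by move=> i im; rewrite !mxE; case: i im => -[|[|[|//]]].
    - by rewrite mxE.
    rewrite -/p -/b exprMn mono_row2.
    have -> : mono (equatorial e) y = cos (lon R t k) ^+ e2 0 * sin (lon R t k) ^+ e2 1.
      rewrite /mono !big_ord_recr big_ord0 /= !mxE /= mul1r.
      rewrite {3}/equatorial eqxx expr0 mulr1.
      have E (i : 'I_2) : equatorial e (widen_ord (leqnSn 2) i) = e2 i.
        rewrite /equatorial; case: eqP => // /(congr1 val) /= h.
        by have := ltn_ord i; rewrite h ltnn.
      by congr (_ ^+ _ * _ ^+ _); rewrite -E; congr equatorial; apply: val_inj.
    ring.
  rewrite RintegralZl //; last exact: chord_mono_integrable.
  rewrite -/(chord_integral R p b).
  (* The direction alternates from piece to piece, but the sign is invisible: for odd [b] the height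
     integral vanishes, and for even [b] the sign is 1. *)
  have [ob|eb] := boolP (odd b).
    by rewrite (latitude_odd (@chord_integral_sum R) parts J1) // mulr0 mul0r.
  by rewrite -(even_halfK eb) -mul2n exprM sqr_signz expr1n mul1r mulrC.
rewrite (eq_bigr _ (fun (k : 'I_(2 * t)) _ => piece k)) -mulr_sumr mulrCA; congr (_ * _).
rewrite equatorial_moment_2 -(@circle_design R (2 * t) (pi / (2 * t%:R))); last first.
  by rewrite sum_equatorial_2.
congr (_ * _); apply: eq_bigr => k _; rewrite /node.
have -> : lon R t k = pi / (2 * t%:R) + 2 * pi * k%:R / (2 * t)%:R by rewrite /lon natrM -pmulrn; field.
by [].
Qed.

Lemma Rintegral_polyfun_moments (R : realType) d (g : R -> 'rV[R]_d.+2) (t : nat)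
    (sigma : probability (borelRn R d.+2) R) (p : mpoly d.+2 R) :
  uniform_on_sphere sigma -> {within `[0, 1], continuous g} ->
  (forall e, (\sum_i e i <= t)%N ->
    \int[@lebesgue_measure R]_(s in `[0, 1]) mono e (g s) = sphere_moment R d.+2 e) ->
  (msize p <= t.+1)%N ->
  (\int[@lebesgue_measure R]_(s in `[0, 1]) polyfun p (g s))%:E =
  (\int[sigma]_(x in sphere d.+1) (polyfun p x)%:E)%E.
Proof.
move=> us cg gm pt; rewrite sphere_integral_polyfun //; congr EFin.
pose m i := tnth (in_tuple (msupp p)) i.
have cm i : {within `[0, 1], continuous (fun s => mono (m i) (g s))}.
  by apply: (within_continuous_compT (f := mono (m i))) => //; exact: continuous_mono.
have [_ E] := @Rintegral_sum R _ _ (@lebesgue_measure R) `[0, 1]%classic _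
  (fun i s => mono (m i) (g s)) (fun i => mcoeff (m i) p) (measurable_itv _)
  (fun i => integrable_within01 (cm i)).
rewrite [RHS]big_tnth.
transitivity (\int[@lebesgue_measure R]_(s in `[0, 1])
    (\sum_i mcoeff (m i) p * mono (m i) (g s))).
  by apply: eq_Rintegral => s _; rewrite polyfunE big_tnth.
apply: (etrans E); apply: eq_bigr => i _; congr (_ * _); apply: gm.
have := msize_mdeg_lt (mem_tnth i (in_tuple (msupp p))).
by rewrite -mdegE => h; rewrite -ltnS (leq_trans h pt).
Qed.

Lemma alpha_design (R : realType) t (sigma : probability (borelRn R 3) R) :
  (0 < t)%N -> uniform_on_sphere sigma ->
  weighted_design_curve sigma (2 * t - 1) (alpha t) (fun s => (speed (alpha t) s)^-1).
Proof.
move=> t0 us.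
apply: (@weighted_design_curve_arclength R 2 sigma _ (glue_breaks (2 * t) [::]) 4).
- exact: alpha_sphere.
- exact: alpha_continuous.
- exact: alpha_smooth.
- by [].
- by move=> s; exact: alpha_speed_ge.
- by have [] := @alpha_length R t t0.
- exact: alpha_closed.
- exact: alpha_self_intersections.
- exact: alpha_unbounded_speed.
- move=> p pt; have m e : (\sum_i e i <= 2 * t - 1)%N ->
    \int[@lebesgue_measure R]_(s in `[0, 1]) mono e (alpha t s) = sphere_moment R 3 e.
    move=> et; apply: alpha_moments => //.
    by apply: leq_ltn_trans et _; rewrite subn1 prednK // muln_gt0.
  exact: (@Rintegral_polyfun_moments R 1 (alpha t) _ sigma p us (alpha_continuous t0) m pt).
Qed.

(** * Lifts of curves along the Hopf map *)

Local Open Scope complex_scope.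

(** The section of the Hopf map whose first complex coordinate is positive. It exists away from the
    point [(-1, 0, 0)], where [q = 0]. *)
Definition hopf_section (R : realType) (a : 'rV[R]_3) : R[i] * R[i] :=
  let q := Num.sqrt (1 + a 0 0) in
  ((q / Num.sqrt 2)%:C, (a 0 1 / q / Num.sqrt 2) -i* (a 0 2 / q / Num.sqrt 2)).

Definition hopf_lift (R : realType) (a : 'rV[R]_3) (phi : R) : 'rV[R]_4 :=
  real_of_C2 (phase_mul (expi phi) (hopf_section a)).

Lemma hopf_liftE (R : realType) (a : 'rV[R]_3) (phi : R) :
  let q := Num.sqrt (1 + a 0 0) in let m := a 0 1 / q in let n := a 0 2 / q in
  hopf_lift a phi = (Num.sqrt 2)^-1 *: \row_j [:: cos phi * q; sin phi * q;
    cos phi * m + sin phi * n; sin phi * m - cos phi * n]`_j.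
Proof.
move=> q m n; apply/rowP => j; rewrite !mxE /= -/q -/m -/n.
by case: j => -[|[|[|[|//]]]] //= _; ring.
Qed.

Lemma sphere2E (R : realType) (a : 'rV[R]_3) :
  sphere 2 a <-> a 0 0 ^+ 2 + a 0 1 ^+ 2 + a 0 2 ^+ 2 = 1.
Proof.
rewrite sphere_sum !big_ord_recl big_ord0 addr0 addrA.
have -> : lift ord0 ord0 = 1 :> 'I_3 by apply: val_inj.
by have -> : lift ord0 (lift ord0 ord0) = 2 :> 'I_3 by apply: val_inj.
Qed.

Lemma hopf_section_sqr (R : realType) (a : 'rV[R]_3) : sphere 2 a -> 0 < 1 + a 0 0 ->
  let q := Num.sqrt (1 + a 0 0) in
  q ^+ 2 = 1 + a 0 0 /\ (a 0 1 / q) ^+ 2 + (a 0 2 / q) ^+ 2 = 1 - a 0 0.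
Proof.
move=> /sphere2E sa a0 q; have q2 : q ^+ 2 = 1 + a 0 0 by rewrite sqr_sqrtr // ltW.
split=> //; rewrite !expr_div_n q2 -mulrDl.
have -> : a 0 1 ^+ 2 + a 0 2 ^+ 2 = (1 - a 0 0) * (1 + a 0 0) by lra.
by rewrite mulfK // gt_eqF.
Qed.

Lemma hopf_lift_sphere (R : realType) (a : 'rV[R]_3) (phi : R) :
  sphere 2 a -> 0 < 1 + a 0 0 -> sphere 3 (hopf_lift a phi).
Proof.
move=> sa a0; have [q2 mn] := hopf_section_sqr sa a0.
rewrite hopf_liftE; set q := Num.sqrt _ in q2 mn *.
set m := a 0 1 / q in mn *; set n := a 0 2 / q in mn *.
apply/sphere_sum; rewrite !big_ord_recl big_ord0 !mxE /= addr0 !exprMn exprVn sqr_sqrtr //.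
transitivity (2^-1 * ((cos phi ^+ 2 + sin phi ^+ 2) * (q ^+ 2 + (m ^+ 2 + n ^+ 2)))); first ring.
by rewrite cos2Dsin2 q2 mn mul1r; field.
Qed.

Lemma hopf_hopf_lift (R : realType) (a : 'rV[R]_3) (phi : R) :
  sphere 2 a -> 0 < 1 + a 0 0 -> hopf (hopf_lift a phi) = a.
Proof.
move=> sa a0; have [q2 mn] := hopf_section_sqr sa a0.
have q0 : Num.sqrt (1 + a 0 0) != 0 by rewrite gt_eqF // sqrtr_gt0.
have s2 : (Num.sqrt 2)^-1 * (Num.sqrt 2)^-1 = 2^-1 :> R by rewrite -expr2 exprVn sqr_sqrtr.
rewrite hopf_liftE; set q := Num.sqrt _ in q2 mn q0 *.
set m := a 0 1 / q in mn *; set n := a 0 2 / q in mn *.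
have mq : q * m = a 0 1 by rewrite /m; field.
have nq : q * n = a 0 2 by rewrite /n; field.
have cs := cos2Dsin2 phi.
apply/rowP => j; rewrite !mxE !inordK //=; set k := (Num.sqrt 2)^-1 in s2 *.
set c := cos phi in cs *; set s := sin phi in cs *.
case: j => -[|[|[|//]]] //= h.
- have -> : Ordinal h = 0 by apply: val_inj.
  transitivity (k * k * ((c ^+ 2 + s ^+ 2) * (q ^+ 2 - (m ^+ 2 + n ^+ 2)))); first ring.
  by rewrite s2 cs q2 mn; field.
- have -> : Ordinal h = 1 by apply: val_inj.
  transitivity (2 * (k * k) * ((c ^+ 2 + s ^+ 2) * (q * m))); first ring.
  by rewrite s2 cs mq; field.
- have -> : Ordinal h = 2 by apply: val_inj.
  transitivity (2 * (k * k) * ((c ^+ 2 + s ^+ 2) * (q * n))); first ring.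
  by rewrite s2 cs nq; field.
Qed.

Lemma hopf_lift_phase (R : realType) (a : 'rV[R]_3) (phi psi : R) :
  hopf_lift a (psi + phi) =
  real_of_C2 (phase_mul (expi psi) (phase_mul (expi phi) (hopf_section a))).
Proof. by rewrite /hopf_lift expiD /phase_mul /= !mulrA. Qed.

Lemma hopf_lift_inj (R : realType) (a : 'rV[R]_3) (phi psi : R) : 0 < 1 + a 0 0 ->
  hopf_lift a phi = hopf_lift a psi -> expi (phi - psi) = 1.
Proof.
move=> a0 E; have q0 : Num.sqrt (1 + a 0 0) != 0 by rewrite gt_eqF // sqrtr_gt0.
have s0 : (Num.sqrt 2)^-1 != 0 :> R by rewrite invr_eq0 gt_eqF // sqrtr_gt0.
have {}E j : hopf_lift a phi 0 j = hopf_lift a psi 0 j by rewrite E.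
have := E 0; have := E 1; rewrite !hopf_liftE !mxE /= => /(mulfI s0)/(mulIf q0) S.
move=> /(mulfI s0)/(mulIf q0) C.
by rewrite expiD -(expi_conj psi); congr (_ * _); rewrite /expi ?C ?S // cosN sinN.
Qed.

(* With [q' = a1' / (2 q)], [q m = a2] and [q n = a3]. *)
Lemma lift_speed_identity (R : realType) (q q' a2 a3 d2 d3 p : R) : q != 0 ->
  a2 ^+ 2 + a3 ^+ 2 = q ^+ 2 * (2 - q ^+ 2) ->
  a2 * d2 + a3 * d3 = - (2 * q * q' * (q ^+ 2 - 1)) ->
  let m' := d2 / q - a2 * q' / q ^+ 2 in let n' := d3 / q - a3 * q' / q ^+ 2 in
  2^-1 * (q' ^+ 2 + q ^+ 2 * p ^+ 2 + (m' + p * (a3 / q)) ^+ 2 + (n' - p * (a2 / q)) ^+ 2) =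
  4^-1 * ((2 * q * q') ^+ 2 + d2 ^+ 2 + d3 ^+ 2) +
    (p + (a3 * d2 - a2 * d3) / (2 * q ^+ 2)) ^+ 2.
Proof.
move=> q0 H1 H2 m' n'.
pose E1 := a2 ^+ 2 + a3 ^+ 2 - q ^+ 2 * (2 - q ^+ 2).
pose E2 := a2 * d2 + a3 * d3 + 2 * q * q' * (q ^+ 2 - 1).
have E10 : E1 = 0 by rewrite /E1 H1 subrr.
have E20 : E2 = 0 by rewrite /E2 H2 addNr.
(* [E1] and [E2] are the two hypotheses written as differences, and [c1], [c2] are cofactors for
   which the left side minus the right side is identically [E1 * c1 + E2 * c2]; this is an identity
   that [field] can check. *)
pose c1 := p ^+ 2 / (2 * q ^+ 2) + q' ^+ 2 / (2 * q ^+ 4) - (d2 ^+ 2 + d3 ^+ 2) / (4 * q ^+ 4).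
pose c2 := - q' / q ^+ 3 + (- (4 * q * q' * (q ^+ 2 - 1)) + E2) / (4 * q ^+ 4).
rewrite -[RHS]addr0 -[X in _ = _ + X](_ : E1 * c1 + E2 * c2 = 0); last first.
  by rewrite E10 E20 !mul0r addr0.
by rewrite /m' /n' /c1 /c2 /E1 /E2; field.
Qed.

(** Pythagoras for the Hopf fibration: the horizontal speed is half the speed of the base curve, as
    the base is a sphere of radius 1/2 in the quotient metric, and the vertical speed is [dphi] plus
    the connection form of the section on the velocity. *)
Lemma hopf_lift_speed (R : realType) (a : R -> 'rV[R]_3) (phi : R -> R) (r dphi : R)
    (da : 'rV[R]_3) :
  sphere 2 (a r) -> 0 < 1 + a r 0 0 ->
  a r 0 0 * da 0 0 + a r 0 1 * da 0 1 + a r 0 2 * da 0 2 = 0 ->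
  (forall j, is_derive r 1 (fun s => a s 0 j) (da 0 j)) -> is_derive r 1 phi dphi ->
  speed (fun s => hopf_lift (a s) (phi s)) r =
  Num.sqrt (4^-1 * euclid da ^+ 2 +
    (dphi + (a r 0 2 * da 0 1 - a r 0 1 * da 0 2) / (2 * (1 + a r 0 0))) ^+ 2).
Proof.
move=> sa a0 orth Da Dphi.
have q0 : Num.sqrt (1 + a r 0 0) != 0 by rewrite gt_eqF // sqrtr_gt0.
pose q s := Num.sqrt (1 + a s 0 0).
have [q2 mn] := hopf_section_sqr sa a0; rewrite -/(q r) in q0 q2 mn.
pose q' := da 0 0 / (2 * q r).
pose m s := a s 0 1 / q s; pose n s := a s 0 2 / q s.
pose m' := da 0 1 / q r - a r 0 1 * q' / q r ^+ 2.
pose n' := da 0 2 / q r - a r 0 2 * q' / q r ^+ 2.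
have Dq : is_derive r 1 q q'.
  have D1 := is_deriveD (is_derive_cst (1 : R) r 1) (Da 0).
  have D2 := @is_derive1_comp R (@Num.sqrt R) _ r _ _ (@is_derive1_sqrt R _ a0) D1.
  by apply: is_derive_eq D2 _; rewrite add0r mulrC.
have DqV := is_deriveV q0 Dq.
have Dm : is_derive r 1 m m'.
  apply: is_derive_eq (is_deriveM (Da 1) DqV) _; rewrite /m' /GRing.scale /=.
  by field.
have Dn : is_derive r 1 n n'.
  apply: is_derive_eq (is_deriveM (Da 2) DqV) _; rewrite /n' /GRing.scale /=.
  by field.
have Dc := @is_derive1_comp R (@cos R) phi r _ _ (is_derive_cos (phi r)) Dphi.
have Ds := @is_derive1_comp R (@sin R) phi r _ _ (is_derive_sin (phi r)) Dphi.
set c := cos (phi r) in Dc Ds *; set s := sin (phi r) in Dc Ds *.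
have cE : cos (phi r) = c by []; have sE : sin (phi r) = s by [].
have D0 := is_deriveM Dc Dq.
have D1 := is_deriveM Ds Dq.
have D2 := is_deriveD (is_deriveM Dc Dm) (is_deriveM Ds Dn).
have D3 := is_deriveB (is_deriveM Ds Dm) (is_deriveM Dc Dn).
pose k : R := (Num.sqrt 2)^-1.
pose dg : 'rV[R]_4 := \row_j [:: k * (c * q' - s * dphi * q r); k * (s * q' + c * dphi * q r);
   k * (c * (m' + dphi * n r) + s * (n' - dphi * m r));
   k * (s * (m' + dphi * n r) - c * (n' - dphi * m r))]`_j.
have Dg : derive1 (fun s => hopf_lift (a s) (phi s)) r = dg.
  apply: derive1_row => j; rewrite mxE.
  have -> : (fun s => hopf_lift (a s) (phi s) 0 j) = (fun s =>
      k * [:: cos (phi s) * q s; sin (phi s) * q s;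
      cos (phi s) * m s + sin (phi s) * n s; sin (phi s) * m s - cos (phi s) * n s]`_j).
    by apply/funext => z; rewrite hopf_liftE !mxE.
  have Dk f df : is_derive r 1 f df -> is_derive r 1 (fun s => k * f s) (k * df).
    move=> Df; apply: is_derive_eq (is_deriveM (is_derive_cst k r 1) Df) _.
    by rewrite /GRing.scale /= mulr0 addr0.
  case: j => -[|[|[|[|//]]]] /= _.
  - by apply: is_derive_eq (Dk _ _ D0) _; rewrite /GRing.scale /= ?cE ?sE; ring.
  - by apply: is_derive_eq (Dk _ _ D1) _; rewrite /GRing.scale /= ?cE ?sE; ring.
  - by apply: is_derive_eq (Dk _ _ D2) _; rewrite /GRing.scale /= ?cE ?sE; ring.
  - by apply: is_derive_eq (Dk _ _ D3) _; rewrite /GRing.scale /= ?cE ?sE; ring.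
rewrite /speed Dg /euclid sqr_sqrtr; last by apply: sumr_ge0 => i _; exact: sqr_ge0.
congr Num.sqrt.
have kk : k * k = 2^-1 by rewrite -expr2 exprVn sqr_sqrtr.
have da0 : da 0 0 = 2 * q r * q' by rewrite /q'; field.
move/sphere2E : sa => sa.
have H1 : a r 0 1 ^+ 2 + a r 0 2 ^+ 2 = q r ^+ 2 * (2 - q r ^+ 2).
  by rewrite q2; lra.
have H2 : a r 0 1 * da 0 1 + a r 0 2 * da 0 2 = - (2 * q r * q' * (q r ^+ 2 - 1)).
  by rewrite q2 -da0; lra.
have H := @lift_speed_identity R (q r) q' _ _ _ _ dphi q0 H1 H2.
transitivity (2^-1 * (q' ^+ 2 + q r ^+ 2 * dphi ^+ 2 + (m' + dphi * n r) ^+ 2 + (n' - dphi * m r) ^+ 2)).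
  rewrite !big_ord_recl big_ord0 !mxE /= addr0 !exprMn -kk.
  transitivity (k * k * ((c ^+ 2 + s ^+ 2) * (q' ^+ 2 + q r ^+ 2 * dphi ^+ 2 +
    (m' + dphi * n r) ^+ 2 + (n' - dphi * m r) ^+ 2))); first ring.
  by rewrite cos2Dsin2 mul1r /q' !exprMn.
rewrite H q2 -da0; congr (_ * _ + _).
rewrite !big_ord_recl big_ord0 addr0 addrA.
have -> : lift ord0 ord0 = 1 :> 'I_3 by apply: val_inj.
by have -> : lift ord0 (lift ord0 ord0) = 2 :> 'I_3 by apply: val_inj.
Qed.

(** The value -1 would give [2 k + 1 = 2 t m] for an integer [m], against parity. The offset
    [pi / (2 t)] of the longitudes thus keeps [alpha] off the point over which there is no
    section. *)
Lemma expi_lon_sqr (R : realType) t (k : int) : (0 < t)%N -> cos (lon R t k) = -1 -> False.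
Proof.
move=> t0 c1; have s0 : sin (lon R t k) = 0.
  by apply/eqP; rewrite -sqrf_eq0; have := cos2Dsin2 (lon R t k); rewrite c1 sqrrN expr1n => /eqP; rewrite -subr_eq0 addrAC subrr add0r.
have : expi (2 * lon R t k) = 1.
  rewrite mulr_natl -mulr_natl expi_natM expr2 /expi c1 s0.
  by apply/eqP; rewrite eq_complex /=; apply/andP; split; apply/eqP; ring.
move=> /expi_eq1[m E]; have p0 := @pi_gt0 R.
have tR : t%:R != 0 :> R by rewrite pnatr_eq0 -lt0n.
have : (2 * k + 1)%:~R = (2 * (t%:Z * m))%:~R :> R.
  have {}E : pi * (2 * k%:~R + 1) / t%:R = 2 * pi * m%:~R :> R by rewrite -E /lon; field.
  rewrite !(intrD, intrM) -[t%:Z%:~R]/(t%:R : R).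
  apply: (mulfI (lt0r_neq0 p0)); rewrite -[LHS](divfK tR) E; ring.
move=> /eqP; rewrite eqr_int => /eqP h.
have : (2 %| 1)%Z by rewrite (_ : 1%Z = 2 * (t%:Z * m - k)) ?dvdz_mulr // mulrBr -h; ring.
by [].
Qed.

Lemma cos_lon_gt (R : realType) t (k : int) : (0 < t)%N -> -1 < cos (lon R t k).
Proof.
move=> t0; rewrite lt_neqAle cos_geN1 andbT; apply/eqP => /esym.
exact: expi_lon_sqr.
Qed.

Lemma chord_ge0 (R : realType) (r : R) : 0 <= chord r.
Proof. exact: sqrtr_ge0. Qed.

Lemma alpha_gtN1 (R : realType) t (s : R) : (0 < t)%N -> 0 < 1 + alpha t s 0 0.
Proof.
move=> t0; rewrite alpha_glue /glue !mxE /=; set r := _ - _.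
have := @cos_lon_gt R t (Num.floor ((2 * t)%:R * s)) t0; set c := cos _ => c1.
have := chord_le1 r; have := chord_ge0 r; set h := chord r => h0 h1.
have [c0|c0] := leP 0 c; first by rewrite ltr_wpDr // mulr_ge0.
nra.
Qed.

(** The connection form of [hopf_section] along [alpha], that is, the vertical speed of the lift
    with constant phase. *)
Definition drift (R : realType) t (s : R) : R :=
  (alpha t s 0 2 * derive1 (alpha t) s 0 1 - alpha t s 0 1 * derive1 (alpha t) s 0 2) /
  (2 * (1 + alpha t s 0 0)).

Definition drift_piece (R : realType) t (k : int) (r : R) : R :=
  - (-1) ^ k * sin (lon R t k) / (chord r * (1 + chord r * cos (lon R t k))).

Lemma alpha_derive1_piece (R : realType) t (k : nat) (r : R) : (0 < t)%N -> 0 < r < 1 ->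
  derive1 (alpha t) ((2 * t)%:R^-1 * r + (2 * t)%:R^-1 * k%:R) =
  (2 * t)%:R *: derive1 (alpha_piece t k) r.
Proof.
move=> t0 r01; rewrite alpha_glue.
have := @glue_derive1 R 2 (2 * t) (alpha_piece t) [::] k r.
by rewrite muln_gt0 t0 => /(_ isT (@alpha_piece_smooth R t k) (proj2 (off_nil r) r01)).
Qed.

Lemma alpha_piece_gtN1 (R : realType) t (k : int) (r : R) : (0 < t)%N ->
  0 < 1 + chord r * cos (lon R t k).
Proof.
move=> t0; have := @cos_lon_gt R t k t0; set c := cos _ => c1.
have := chord_le1 r; have := chord_ge0 r; set h := chord r => h0 h1.
have [c0|c0] := leP 0 c; first by rewrite ltr_wpDr // mulr_ge0.
nra.
Qed.

Lemma drift_pieceE (R : realType) t (k : nat) (r : R) : (0 < t)%N -> 0 < r < 1 ->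
  drift t ((2 * t)%:R^-1 * r + (2 * t)%:R^-1 * k%:R) = (2 * t)%:R * drift_piece t k r.
Proof.
move=> t0 r01; rewrite /drift alpha_derive1_piece // alpha_glue glue_piece_lt ?muln_gt0 //; last first.
  by rewrite ltW ?(andP r01).1 ?(andP r01).2.
rewrite alpha_piece_derive1 // !mxE /= /drift_piece.
have c0 := chord_gt0 r01; have c1 := @alpha_piece_gtN1 R t k r t0.
have u2 : (2 * r - 1) ^+ 2 = 1 - chord r ^+ 2.
  by rewrite chord_sqr ?subKr // !ltW ?(andP r01).1 ?(andP r01).2.
have sg := @sqr_signz R k; set e := (-1) ^ k in sg *.
set s := sin _; set c := cos _ in c1 *; set h := chord r in c0 c1 u2 *.
transitivity ((2 * t)%:R * e * s * (- 2 * (2 * r - 1) ^+ 2 / h - 2 * h) / (2 * (1 + h * c))).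
  by field; rewrite !gt_eqF.
by rewrite u2; field; rewrite !gt_eqF.
Qed.

Lemma alpha_orth (R : realType) t (s : R) : (0 < t)%N -> off (glue_breaks (2 * t) [::]) s ->
  alpha t s 0 0 * derive1 (alpha t) s 0 0 + alpha t s 0 1 * derive1 (alpha t) s 0 1 +
  alpha t s 0 2 * derive1 (alpha t) s 0 2 = 0.
Proof.
move=> t0; have N0 : (0 < 2 * t)%N by rewrite muln_gt0.
move=> /(off_glue_breaks N0)[k [r [_ /off_nil r01 ->]]].
rewrite alpha_derive1_piece // alpha_glue glue_piece_lt //; last first.
  by rewrite ltW ?(andP r01).1 ?(andP r01).2.
rewrite alpha_piece_derive1 // !mxE /=.
have c0 := chord_gt0 r01; have sg := @sqr_signz R k; set e := (-1) ^ k in sg *.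
have cs := cos2Dsin2 (lon R t k); set n := sin _ in cs *; set c := cos _ in cs *; set h := chord r in c0 *.
transitivity ((2 * t)%:R * 2 * (2 * r - 1) * (e ^+ 2 - (c ^+ 2 + n ^+ 2))).
  by field; rewrite gt_eqF.
by rewrite sg cs subrr mulr0.
Qed.

(** On a meridian the drift is the derivative of [atan (T * half_lat r)], where [T] is up to sign
    the tangent of half the longitude. It keeps the sign of [T] throughout, and this gives
    integrability. *)
Lemma drift_piece_primitive (R : realType) t (k : int) : (0 < t)%N ->
  let T := - (-1) ^ k * (sin (lon R t k) / (1 + cos (lon R t k))) in
  (@lebesgue_measure R).-integrable `[0, 1] (EFin \o drift_piece t k) /\
  \int[@lebesgue_measure R]_(r in `[0, 1]) drift_piece t k r = 2 * atan T.
Proof.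
move=> t0 T; have k1 := @cos_lon_gt R t k t0.
have cs := cos2Dsin2 (lon R t k).
pose F (r : R) := atan (T * half_lat r).
have cF : {within `[0, 1], continuous F}.
  apply: continuous_subspaceT => x.
  apply: (continuous_comp (f := fun r => T * half_lat r)); last exact: continuous_atan.
  by apply: cvgM; [exact: cvg_cst|exact: half_lat_continuous].
have fE (r : R) : 0 < r < 1 -> drift_piece t k r =
    T * (2 / (chord r * (1 + chord r)) / (1 + (T * half_lat r) ^+ 2)).
  move=> r01; have c1 := chordD1_gt0 r; have c0 := chord_gt0 r01.
  have q0 := @alpha_piece_gtN1 R t k r t0.
  rewrite exprMn half_lat_sqr; last by rewrite !ltW ?(andP r01).1 ?(andP r01).2.
  rewrite /T exprMn sqrrN sqr_signz mul1r expr_div_n.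
  have -> : sin (lon R t k) ^+ 2 = (1 - cos (lon R t k)) * (1 + cos (lon R t k)) by lra.
  rewrite /drift_piece; set c := cos _ in k1 q0 *; set h := chord r in c1 c0 q0 *.
  have c2 : 0 < 1 + c by lra.
  have -> : 1 + (1 - c) * (1 + c) / (1 + c) ^+ 2 * ((1 - h) / (1 + h)) =
      2 * (1 + h * c) / ((1 + c) * (1 + h)) by field; rewrite !gt_eqF.
  by field; rewrite !gt_eqF.
have dF (r : R) : r \in `]0, 1[%R -> r \notin [::] -> is_derive r 1 F (drift_piece t k r).
  rewrite in_itvoo => r01 _.
  have D := atan_half_lat_is_derive T r01.
  by apply: is_derive_eq D _; rewrite (fE r r01) [RHS]mulrA.
have cf (r : R) : r \in `]0, 1[%R -> r \notin [::] -> {for r, continuous (@drift_piece R t k)}.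
  rewrite in_itvoo => r01 _; apply: cvgM; first exact: cvg_cst.
  apply: cvgV; first by rewrite mulf_neq0 // gt_eqF ?chord_gt0 ?alpha_piece_gtN1.
  apply: cvgM; first exact: chord_continuous.
  apply: cvgD; first exact: cvg_cst.
  by apply: cvgM; [exact: chord_continuous|exact: cvg_cst].
have fi : (@lebesgue_measure R).-integrable `[0, 1] (EFin \o drift_piece t k).
  have pos (r : R) : 0 < r < 1 -> 0 <= 2 / (chord r * (1 + chord r)) / (1 + (T * half_lat r) ^+ 2).
    move=> r01; rewrite !divr_ge0 // ?mulr_ge0 ?chord_ge0 ?ltW ?chordD1_gt0 //.
    by rewrite ltr_pwDl // sqr_ge0.
  have [T0|T0] := leP 0 T.
    apply: (ge0_FTC2_off_seq ler01 cF _ cf dF) => r; rewrite in_itvoo => r01 _.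
    by rewrite fE // mulr_ge0 // pos.
  have -> : EFin \o drift_piece t k = (fun r : R => (- 1)%:E * (- drift_piece t k r)%:E)%E.
    by apply/funext => r; rewrite /= -EFinM mulN1r opprK.
  apply: integrableZl; first exact: measurable_itv.
  apply: (@ge0_FTC2_off_seq R [::] 0 1 (fun r => - drift_piece t k r) (fun r => - F r) ler01).
  - by move=> x; apply: cvgN; exact: cF.
  - by move=> r; rewrite in_itvoo => r01 _; rewrite fE // -mulNr mulr_ge0 ?pos // oppr_ge0 ltW.
  - by move=> r r01 rl; apply: cvgN; exact: cf.
  - by move=> r r01 rl; exact: (is_deriveN (dF r r01 rl)).
split=> //; apply: (etrans (RFTC2_off_seq ler01 fi cF cf dF)).
by rewrite /F half_lat0 half_lat1 mulr1 mulrN1 atanN; ring.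
Qed.

(** [s / (1 + c)] is the tangent of half the angle with cosine [c] and sine [s]. *)
Lemma expi_2atan (R : realType) (c s : R) : -1 < c -> c ^+ 2 + s ^+ 2 = 1 ->
  expi (2 * atan (s / (1 + c))) = c +i* s.
Proof.
move=> c1 cs; have c0 : 1 + c != 0 by rewrite gt_eqF //; lra.
set T := s / (1 + c); set x := atan T.
have cx : cos x != 0.
  rewrite gt_eqF // cos_gt0_pihalf // atan_gtNpi2 atan_ltpi2 //.
have sx : sin x = T * cos x by rewrite -[T]atanK -/x /tan divfK.
have c2 : cos x ^+ 2 = (1 + c) / 2.
  have := cos2Dsin2 x; rewrite sx exprMn -[X in X + _]mul1r -mulrDl.
  have -> : 1 + T ^+ 2 = 2 / (1 + c).
    rewrite /T expr_div_n; have -> : s ^+ 2 = (1 - c) * (1 + c) by lra.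
    by field.
  by move=> h; apply: (mulfI (_ : 2 / (1 + c) != 0)); [rewrite mulf_neq0 ?invr_eq0|rewrite h; field].
rewrite mulr_natl -mulr_natl expi_natM expr2 /expi sx.
apply/eqP; rewrite eq_complex /=; apply/andP; split; apply/eqP.
  transitivity (cos x ^+ 2 * (1 - T ^+ 2)); first ring.
  rewrite c2 /T expr_div_n; have -> : s ^+ 2 = (1 - c) * (1 + c) by lra.
  by field.
transitivity (2 * T * cos x ^+ 2); first ring.
by rewrite c2 /T; field.
Qed.

Lemma expiN (R : realType) (x : R) : expi (- x) = (expi x)^*.
Proof. by rewrite /expi cosN sinN. Qed.

Lemma expi_sum (R : realType) n (x : 'I_n -> R) : expi (\sum_i x i) = \prod_i expi (x i).
Proof. by rewrite (big_morph _ (@expiD R) (@expi0 R)). Qed.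

Lemma sum_lon (R : realType) t n :
  \sum_(k < 2 * n) (-1) ^ (k : nat)%:Z * lon R t k = - (pi * n%:R / t%:R).
Proof.
elim: n => [|n IH]; first by rewrite muln0 big_ord0 mulr0 mul0r oppr0.
rewrite mulnS addnC addn2 !big_ord_recr /= IH /lon -!exprnP !exprS -!pmulrn.
rewrite exprM sqrrN !expr1n -[in n.+1%:R]natr1 -[in (2 * n).+1%:R]natr1 natrM; ring.
Qed.

(** Only the class modulo [2 pi] is computed: [2 * atan (S k)] has the same phase as the longitude
    of piece [k], and the alternating sum of the longitudes is [- pi]. *)
Lemma drift_integral (R : realType) t : (0 < t)%N ->
  (@lebesgue_measure R).-integrable `[0, 1] (EFin \o drift t) /\
  exists m : int, \int[@lebesgue_measure R]_(s in `[0, 1]) drift t s = pi + 2 * pi * m%:~R.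
Proof.
move=> t0; have N0 : (0 < 2 * t)%N by rewrite muln_gt0.
have tR : t%:R != 0 :> R by rewrite pnatr_eq0 -lt0n.
have ca : smooth_on (off (@glue_breaks R (2 * t) [::])) (alpha t) := alpha_smooth R t0.
have cc j s : off (glue_breaks (2 * t) [::]) s -> {for s, continuous (fun s : R => alpha t s 0 j)}.
  have /(smooth_on_rowP _ (@open_off R _)) := ca => /(_ j) sj; exact: smooth_on_continuous sj.
have cd j s : off (glue_breaks (2 * t) [::]) s -> {for s, continuous (fun s : R => derive1 (alpha t) s 0 j)}.
  have /(smooth_on_rowP _ (@open_off R _)) := smooth_on_derive1 (@open_off R _) ca.
  by move=> /(_ j) sj; exact: smooth_on_continuous sj.
have [] := @piecewise_integral R (2 * t) [::] (drift t) (fun k => drift_piece t k) N0.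
- move=> s os; apply: cvgM.
    by apply: cvgB; apply: cvgM; [exact: cc|exact: cd|exact: cc|exact: cd].
  apply: cvgV; first by rewrite mulf_neq0 // gt_eqF // alpha_gtN1.
  by apply: cvgM; [exact: cvg_cst|apply: cvgD; [exact: cvg_cst|exact: cc]].
- move=> k _ r /off_nil r01; apply: cvgM; first exact: cvg_cst.
  apply: cvgV; first by rewrite mulf_neq0 // gt_eqF ?chord_gt0 ?alpha_piece_gtN1.
  apply: cvgM; first exact: chord_continuous.
  apply: cvgD; first exact: cvg_cst.
  by apply: cvgM; [exact: chord_continuous|exact: cvg_cst].
- by move=> k _ r /off_nil r01; exact: drift_pieceE.
- by move=> k _; have [] := @drift_piece_primitive R t k t0.
move=> di de; split=> //.
rewrite de; pose S k := sin (lon R t k) / (1 + cos (lon R t k)).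
rewrite (eq_bigr (fun k : 'I_(2 * t) => - ((-1) ^ (k : nat)%:Z * (2 * atan (S k))))); last first.
  move=> k _; have [_ ->] := @drift_piece_primitive R t k t0; rewrite -/(S k).
  rewrite -exprnP -signr_odd; case: (odd k); rewrite ?expr1 ?expr0 ?opprK ?mul1r //.
  by rewrite mulN1r opprK.
  by rewrite mulN1r atanN; ring.
set X := \sum_k _.
have : expi (X - pi) = 1.
  have EX : expi X = expi pi.
    have -> : pi = \sum_(k < 2 * t) - ((-1) ^ (k : nat)%:Z * lon R t k) :> R.
      by rewrite sumrN sum_lon opprK mulfK.
    rewrite /X !expi_sum; apply: eq_bigr => k _; rewrite !expiN; congr (_ ^*).
    have E : expi (2 * atan (S k)) = expi (lon R t k).
      by apply: expi_2atan; [exact: cos_lon_gt|exact: cos2Dsin2].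
    rewrite -exprnP -signr_odd; case: (odd k); rewrite ?expr1 ?expr0 ?mul1r //.
    by rewrite !mulN1r !expiN E.
  by rewrite expiD EX -expiD subrr expi0.
by move=> /expi_eq1[m E]; exists m; rewrite -E; ring.
Qed.

Local Close Scope complex_scope.

(** * The curve [gamma] *)

Local Open Scope complex_scope.

Definition gamma_piece (R : realType) t (theta : R -> R) (k : int) (r : R) : 'rV[R]_4 :=
  hopf_lift (alpha t r) (2 * pi * (2 * t%:R + 1) / (4 * t%:R) * (r + k%:~R) + theta r).

Lemma gamma_glue (R : realType) t (theta : R -> R) : (0 < t)%N ->
  gamma t theta = glue (4 * t) (gamma_piece t theta).
Proof.
move=> t0; have tR : t%:R != 0 :> R by rewrite pnatr_eq0 -lt0n.
apply/funext => s; rewrite /gamma /glue natrM /gamma_piece /hopf_lift /gammaC2 /=.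
set k := (Num.floor _)%:~R; set r := _ - k.
have -> : 2 * pi * s * (2 * t%:R + 1) + theta r =
    2 * pi * (2 * t%:R + 1) / (4 * t%:R) * (r + k) + theta r.
  by congr (_ + _); rewrite subrK; field.
have [-> -> ->] : [/\ alpha1 t r = alpha t r 0 0, alpha2 t r = alpha t r 0 1 & alpha3 t r = alpha t r 0 2].
  by rewrite !mxE.
rewrite /phase_mul /hopf_section /=; congr real_of_C2; set u := expi _; set q := Num.sqrt (1 + _).
congr pair; rewrite mulrC; congr (_ * _).
  by rewrite -rmorphM mulrC.
rewrite -fmorphV /=; apply/eqP; rewrite eq_complex /=.
by apply/andP; split; apply/eqP; ring.
Qed.

(** The phase advances by [2 pi (2 t + 1) / (4 t)] from one piece to the next; coprimality makes the
    phases over a point of the base all the roots of unity of order [4 t], up to a common factor. *)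
Lemma coprime_gamma t : (0 < t)%N -> coprime (4 * t) (2 * t + 1).
Proof.
move=> t0; have -> : (4 * t = 2 * (2 * t))%N by rewrite mulnA.
rewrite coprimeMl; apply/andP; split; first by rewrite coprime2n oddD oddM.
by rewrite addn1 coprimenS.
Qed.

Lemma gamma_piece_phase (R : realType) t theta (k : int) (r x : R) :
  2 * pi * (2 * t%:R + 1) / (4 * t%:R) * (r + k%:~R) + theta r =
  2 * pi * (2 * t%:R + 1) / (4 * t%:R) * k%:~R +
  (2 * pi * (2 * t%:R + 1) / (4 * t%:R) * r + theta r).
Proof. ring. Qed.

Lemma hopf_lift_period (R : realType) (a : 'rV[R]_3) (phi : R) (m : int) :
  hopf_lift a (phi + 2 * pi * m%:~R) = hopf_lift a phi.
Proof. by rewrite /hopf_lift expiD expi2pi_int mulr1. Qed.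

(** [alpha] is closed and [theta] advances by a multiple of [2 pi], so the lift over one turn of the
    base ends where the next one starts. *)
Lemma gamma_piece_match (R : realType) t theta (k : nat) : (0 < t)%N ->
  (exists k : int, theta 1 - theta 0 = 2 * pi * k%:~R) ->
  gamma_piece t theta k (1 : R) = gamma_piece t theta k.+1 0.
Proof.
move=> t0 [m E]; rewrite /gamma_piece -alpha_closed //.
have -> : theta 1 = theta 0 + 2 * pi * m%:~R by rewrite -E; ring.
rewrite addrA hopf_lift_period; congr hopf_lift; congr (_ * _ + _).
by rewrite add0r -!pmulrn -natr1 addrC.
Qed.

Lemma hopf_lift_continuous (R : realType) (A : set R) (a : R -> 'rV[R]_3) (phi : R -> R) :
  (forall r, 0 < 1 + a r 0 0) ->
  (forall j, {within A, continuous (fun r => a r 0 j)}) -> {within A, continuous phi} ->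
  {within A, continuous (fun r => hopf_lift (a r) (phi r))}.
Proof.
move=> a0 ca cphi; apply: within_continuous_row => j.
pose q r := Num.sqrt (1 + a r 0 0).
have cq : {within A, continuous q}.
  have cy : continuous (fun y : R => Num.sqrt (1 + y)).
    move=> y; apply: (continuous_comp (f := fun y : R => 1 + y)); last exact: sqrt_continuous.
    by apply: cvgD; [exact: cvg_cst|exact: cvg_id].
  exact: (within_continuous_compT (f := fun y : R => Num.sqrt (1 + y)) cy (ca 0)).
have cqV j' : {within A, continuous (fun r => a r 0 j' / q r)}.
  move=> x; apply: cvgM; first exact: ca.
  by apply: cvgV; [rewrite gt_eqF // sqrtr_gt0|exact: cq].
have cc : {within A, continuous (fun r => cos (phi r))}.
  by apply: (within_continuous_compT (f := @cos R)) => //; exact: continuous_cos.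
have cs : {within A, continuous (fun r => sin (phi r))}.
  by apply: (within_continuous_compT (f := @sin R)) => //; exact: continuous_sin.
have -> : (fun s => hopf_lift (a s) (phi s) 0 j) = (fun s =>
    (Num.sqrt 2)^-1 * [:: cos (phi s) * q s; sin (phi s) * q s;
    cos (phi s) * (a s 0 1 / q s) + sin (phi s) * (a s 0 2 / q s);
    sin (phi s) * (a s 0 1 / q s) - cos (phi s) * (a s 0 2 / q s)]`_j).
  by apply/funext => z; rewrite hopf_liftE !mxE.
apply: within_continuousZl; case: j => -[|[|[|[|//]]]] /= _ x.
- by apply: cvgM; [exact: cc|exact: cq].
- by apply: cvgM; [exact: cs|exact: cq].
- by apply: cvgD; apply: cvgM; [exact: cc|exact: cqV|exact: cs|exact: cqV].
- by apply: cvgB; apply: cvgM; [exact: cs|exact: cqV|exact: cc|exact: cqV].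
Qed.

Lemma hopf_lift_smooth (R : realType) (U : set R) (a : R -> 'rV[R]_3) (phi : R -> R) :
  open U -> (forall r, 0 < 1 + a r 0 0) -> smooth_on U a -> smooth_on U phi ->
  smooth_on U (fun r => hopf_lift (a r) (phi r)).
Proof.
move=> oU a0 /(smooth_on_rowP _ oU) sa sphi; apply/(smooth_on_rowP _ oU) => j.
pose q r := Num.sqrt (1 + a r 0 0).
have sq : smooth_on U q.
  apply: smooth_on_sqrt; first by move=> x _; exact: a0.
  by apply: smooth_onD; [exact: smooth_on_cst|exact: sa].
have sqV j' : smooth_on U (fun r => a r 0 j' / q r).
  apply: smooth_onM; first exact: sa.
  by apply: smooth_on_inv => // x _; rewrite gt_eqF // sqrtr_gt0.
have sc := smooth_on_cos sphi; have ss := smooth_on_sin sphi.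
have -> : (fun s => hopf_lift (a s) (phi s) 0 j) = (fun s =>
    (Num.sqrt 2)^-1 * [:: cos (phi s) * q s; sin (phi s) * q s;
    cos (phi s) * (a s 0 1 / q s) + sin (phi s) * (a s 0 2 / q s);
    sin (phi s) * (a s 0 1 / q s) + - (cos (phi s) * (a s 0 2 / q s))]`_j).
  by apply/funext => z; rewrite hopf_liftE !mxE.
apply: smooth_onM; first exact: smooth_on_cst.
case: j => -[|[|[|[|//]]]] /= _; try exact: smooth_onM.
- by apply: smooth_onD; apply: smooth_onM.
- by apply: smooth_onD; [|apply: smooth_onN]; apply: smooth_onM.
Qed.

Lemma within_continuous_coord (R : realType) (A : set R) n (g : R -> 'rV[R]_n.+1) :
  {within A, continuous g} -> forall j, {within A, continuous (fun s => g s 0 j)}.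
Proof.
move=> cg j; apply: (within_continuous_compT (f := fun x : 'rV[R]_n.+1 => x 0 j)) => //.
exact: coord_continuous.
Qed.

Lemma gamma_piece_continuous (R : realType) t (theta : R -> R) k : (0 < t)%N ->
  {within `[0, 1], continuous theta} -> {within `[0, 1], continuous (gamma_piece t theta k)}.
Proof.
move=> t0 ct; apply: hopf_lift_continuous.
- by move=> r; exact: alpha_gtN1.
- exact: within_continuous_coord (alpha_continuous t0).
- have ca : {within `[0, 1], continuous (fun r : R => 2 * pi * (2 * t%:R + 1) / (4 * t%:R) * (r + k%:~R))}.
    apply: continuous_subspaceT => y; apply: cvgM; first exact: cvg_cst.
    by apply: cvgD; [exact: cvg_id|exact: cvg_cst].
  by move=> x; apply: cvgD; [exact: ca|exact: ct].
Qed.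

Definition gamma_breaks (R : realType) t (l : seq R) : seq R := glue_breaks (2 * t) [::] ++ l.

Lemma off_gamma_breaks (R : realType) t (l : seq R) s :
  off (gamma_breaks t l) s -> off (glue_breaks (2 * t) [::]) s /\ off l s.
Proof. by move=> os; split; apply: offS os => x xl; rewrite mem_cat xl ?orbT. Qed.

Lemma gamma_piece_smooth (R : realType) t (theta : R -> R) k l : (0 < t)%N ->
  smooth_on (off l) theta -> smooth_on (off (gamma_breaks t l)) (gamma_piece t theta k).
Proof.
move=> t0 st; apply: hopf_lift_smooth; first exact: open_off.
- by move=> r; exact: alpha_gtN1.
- by apply: smooth_onS (@alpha_smooth R t t0) => x /off_gamma_breaks[].
- apply: smooth_onD; last by apply: smooth_onS st => x /off_gamma_breaks[].
  apply: smooth_onM; first exact: smooth_on_cst.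
  by apply: smooth_onD; [exact: smooth_on_id|exact: smooth_on_cst].
Qed.

(** The vertical velocity, from the uniform winding, the angle function and the drift; it is the
    same on all the pieces. *)
Definition fibre_speed (R : realType) t (theta : R -> R) (s : R) : R :=
  pi * (2 * t%:R + 1) / (2 * t%:R) + derive1 theta s + drift t s.

Lemma gamma_piece_speed (R : realType) t (theta : R -> R) k l s : (0 < t)%N ->
  smooth_on (off l) theta -> off (gamma_breaks t l) s ->
  speed (gamma_piece t theta k) s =
  Num.sqrt ((speed (alpha t) s / 2) ^+ 2 + fibre_speed t theta s ^+ 2).
Proof.
move=> t0 st /off_gamma_breaks[sa sl]; have tR : t%:R != 0 :> R by rewrite pnatr_eq0 -lt0n.
have s01 : 0 <= s <= 1.
  by case: sa => + _; rewrite in_itvoo => /andP[/ltW -> /ltW ->].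
have Da := smooth_on_is_derive (@alpha_smooth R t t0) sa.
have {}Da j : is_derive s 1 (fun s => alpha t s 0 j) (derive1 (alpha t) s 0 j).
  by have /is_derive_rowP := Da; apply.
have Dt := smooth_on_is_derive st sl.
pose phi r := 2 * pi * (2 * t%:R + 1) / (4 * t%:R) * (r + k%:~R) + theta r.
have Dphi : is_derive s 1 phi (pi * (2 * t%:R + 1) / (2 * t%:R) + derive1 theta s).
  have D1 := is_deriveD (is_derive_id s 1) (is_derive_cst (k%:~R : R) s 1).
  have D2 := is_deriveD (is_deriveM (is_derive_cst (2 * pi * (2 * t%:R + 1) / (4 * t%:R) : R) s 1) D1) Dt.
  by apply: is_derive_eq D2 _; rewrite /GRing.scale /=; field.
have := @hopf_lift_speed R (alpha t) phi s _ _ (alpha_sphere t s01) (alpha_gtN1 s t0)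
  (alpha_orth t0 sa) Da Dphi.
rewrite /gamma_piece /phi => ->; congr Num.sqrt; congr (_ + _).
by rewrite /speed; field.
Qed.

Lemma fibre_speed_continuous (R : realType) t (theta : R -> R) l s : (0 < t)%N ->
  smooth_on (off l) theta -> off (gamma_breaks t l) s -> {for s, continuous (fibre_speed t theta)}.
Proof.
move=> t0 st /off_gamma_breaks[sa sl].
have ca : smooth_on (off (@glue_breaks R (2 * t) [::])) (alpha t) := alpha_smooth R t0.
have cc j : {for s, continuous (fun s : R => alpha t s 0 j)}.
  have /(smooth_on_rowP _ (@open_off R _)) := ca => /(_ j) sj; exact: smooth_on_continuous sj sa.
have cd j : {for s, continuous (fun s : R => derive1 (alpha t) s 0 j)}.
  have /(smooth_on_rowP _ (@open_off R _)) := smooth_on_derive1 (@open_off R _) ca.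
  by move=> /(_ j) sj; exact: smooth_on_continuous sj sa.
apply: cvgD; last first.
  apply: cvgM; first by apply: cvgB; apply: cvgM; [exact: cc|exact: cd|exact: cc|exact: cd].
  apply: cvgV; first by rewrite mulf_neq0 // gt_eqF // alpha_gtN1.
  by apply: cvgM; [exact: cvg_cst|apply: cvgD; [exact: cvg_cst|exact: cc]].
apply: cvgD; first exact: cvg_cst.
exact: smooth_on_continuous (smooth_on_derive1 (@open_off R _) st) sl.
Qed.

Lemma alpha_speed_continuous (R : realType) t (s : R) : (0 < t)%N ->
  off (glue_breaks (2 * t) [::]) s -> {for s, continuous (speed (alpha t))}.
Proof.
move=> t0; apply: smooth_on_continuous; apply: smooth_on_speed; first exact: open_off.
- exact: alpha_smooth.
- by move=> x /(alpha_speed_ge t0); apply: lt_le_trans.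
Qed.

(** The winding contributes [pi + pi / (2 t)] and the drift [pi] modulo [2 pi], so the rotation over
    one turn of the base lies in the class of [pi / (2 t)], whatever [theta] is. *)
Lemma fibre_speed_integral (R : realType) t (theta : R -> R) : (0 < t)%N ->
  admissible_angle theta ->
  (@lebesgue_measure R).-integrable `[0, 1] (EFin \o fibre_speed t theta) /\
  exists m : int, \int[@lebesgue_measure R]_(s in `[0, 1]) fibre_speed t theta s =
    pi / (2 * t%:R) + 2 * pi * m%:~R.
Proof.
move=> t0 [ct /smooth_off_finiteP[l sl] it [k tk]].
have tR : t%:R != 0 :> R by rewrite pnatr_eq0 -lt0n.
have [di [m dm]] := @drift_integral R t t0.
have ic : (@lebesgue_measure R).-integrable `[0, 1] (EFin \o (fun=> 1 : R)).
  by apply: integrable_within01; apply: continuous_subspaceT => x; exact: cvg_cst.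
have [i1 e1] := Rintegral_lincomb 1 1 it di.
have [i2 e2] := Rintegral_lincomb (pi * (2 * t%:R + 1) / (2 * t%:R)) 1 ic i1.
have E : fibre_speed t theta = (fun x => pi * (2 * t%:R + 1) / (2 * t%:R) * 1 +
    1 * (1 * derive1 theta x + 1 * drift t x)).
  by apply/funext => x; rewrite /fibre_speed; ring.
rewrite E; split=> //; rewrite e2 e1 dm.
have -> : \int[@lebesgue_measure R]_(x in `[0, 1]) (1 : R) = 1.
  have c1 : {within `[0, 1], continuous (id : R -> R)}.
    by apply: continuous_subspaceT => x; exact: cvg_id.
  have cf (x : R) : x \in `]0, 1[%R -> x \notin [::] -> {for x, continuous (fun=> 1 : R)}.
    by move=> _ _; exact: cvg_cst.
  have df (x : R) : x \in `]0, 1[%R -> x \notin [::] -> is_derive x 1 (id : R -> R) 1.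
    by move=> _ _; exact: is_derive_id.
  by apply: (etrans (RFTC2_off_seq ler01 ic c1 cf df)); rewrite subr0.
have -> : \int[@lebesgue_measure R]_(x in `[0, 1]) derive1 theta x = theta 1 - theta 0.
  apply: (RFTC2_off_seq (l := l) ler01 it ct) => x x01 xl.
    exact: smooth_on_continuous (smooth_on_derive1 (@open_off R _) sl) (conj x01 xl).
  exact: smooth_on_is_derive sl (conj x01 xl).
by exists (k + m + 1); rewrite tk !intrD; field.
Qed.

Lemma gamma_piece_speed_integrable (R : realType) t (theta : R -> R) k l : (0 < t)%N ->
  admissible_angle theta -> smooth_on (off l) theta ->
  (@lebesgue_measure R).-integrable `[0, 1] (EFin \o speed (gamma_piece t theta k)) /\
  \int[@lebesgue_measure R]_(s in `[0, 1]) speed (gamma_piece t theta k) s =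
  \int[@lebesgue_measure R]_(s in `[0, 1])
    Num.sqrt ((speed (alpha t) s / 2) ^+ 2 + fibre_speed t theta s ^+ 2).
Proof.
move=> t0 ad sl; pose f (s : R) := speed (alpha t) s / 2; pose g := fibre_speed t theta.
have cf s : off (gamma_breaks t l) s -> {for s, continuous f}.
  move=> /off_gamma_breaks[sa _]; apply: cvgM; last exact: cvg_cst.
  exact: alpha_speed_continuous.
have cg s : off (gamma_breaks t l) s -> {for s, continuous g}.
  by move=> os; exact: fibre_speed_continuous sl os.
pose h s := Num.sqrt (f s ^+ 2 + g s ^+ 2).
have ch s : off (gamma_breaks t l) s -> {for s, continuous h}.
  move=> os; apply: (continuous_comp (f := fun s => f s ^+ 2 + g s ^+ 2)); last exact: sqrt_continuous.
  by apply: cvgD; apply: continuous_exprn; [exact: cf|exact: cg].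
apply: (@Rintegral_eq_off_seq R (gamma_breaks t l)) => //.
  by move=> s os; exact: gamma_piece_speed sl os.
have [ig _] := fibre_speed_integral t0 ad.
have [ia _] := @alpha_length R t t0.
have mh : measurable_fun (`[0, 1]%classic : set R) h.
  by apply: (@measurable_fun_off_seq _ _ _ (gamma_breaks t l)) => x x01 xl; apply: ch; split.
(* Domination: the norm is at most the horizontal speed plus the absolute value of the vertical
   one. *)
have [isum _] := Rintegral_lincomb (2^-1) 1 ia (integrable_norm ig).
apply: (le_integrable _ _ _ isum) => //; first by exact/measurable_EFinP.
move=> s _ /=; rewrite lee_fin ger0_norm ?sqrtr_ge0 //.
have f0 : 0 <= f s by rewrite divr_ge0 // speed_ge0.
rewrite mul1r [2^-1 * _]mulrC -/(f s) -/(g s) ger0_norm ?addr_ge0 //.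
rewrite -(@ler_pXn2r _ 2) ?nnegrE ?sqrtr_ge0 ?addr_ge0 // sqr_sqrtr ?addr_ge0 ?sqr_ge0 //.
rewrite -[g s ^+ 2]real_normK ?num_real // sqrrD -addrA lerD2l lerDr.
by rewrite mulrn_wge0 // mulr_ge0.
Qed.

Lemma le_sqrt_sum_sqr (R : realType) (F G f g : R) :
  F * f + G * g <= Num.sqrt (F ^+ 2 + G ^+ 2) * Num.sqrt (f ^+ 2 + g ^+ 2).
Proof.
rewrite -sqrtrM ?addr_ge0 ?sqr_ge0 //; apply: le_trans (ler_norm _) _.
rewrite -sqrtr_sqr ler_wsqrtr // -subr_ge0.
have -> : (F ^+ 2 + G ^+ 2) * (f ^+ 2 + g ^+ 2) - (F * f + G * g) ^+ 2 = (F * g - G * f) ^+ 2.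
  by ring.
exact: sqr_ge0.
Qed.

(** The norm of the integral of a plane vector is at most the integral of its norm: pair [(f, g)]
    with its total [(F, G)], apply Cauchy-Schwarz and divide by the norm [L] of the total. *)
Lemma sqrt_Rintegral_le (R : realType) (f g : R -> R) :
  (@lebesgue_measure R).-integrable `[0, 1] (EFin \o f) ->
  (@lebesgue_measure R).-integrable `[0, 1] (EFin \o g) ->
  (@lebesgue_measure R).-integrable `[0, 1] (EFin \o (fun s => Num.sqrt (f s ^+ 2 + g s ^+ 2))) ->
  Num.sqrt ((\int[@lebesgue_measure R]_(s in `[0, 1]) f s) ^+ 2 +
    (\int[@lebesgue_measure R]_(s in `[0, 1]) g s) ^+ 2) <=
  \int[@lebesgue_measure R]_(s in `[0, 1]) Num.sqrt (f s ^+ 2 + g s ^+ 2).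
Proof.
move=> fi gi hi; set F := \int[@lebesgue_measure R]_(s in `[0, 1]) f s.
set G := \int[@lebesgue_measure R]_(s in `[0, 1]) g s.
set H := \int[@lebesgue_measure R]_(s in `[0, 1]) Num.sqrt _; set L := Num.sqrt _.
have L0 : 0 <= L by exact: sqrtr_ge0.
have L2 : L ^+ 2 = F ^+ 2 + G ^+ 2 by rewrite sqr_sqrtr // addr_ge0 ?sqr_ge0.
have [ii e] := Rintegral_lincomb F G fi gi.
have LH : F * F + G * G <= L * H.
  rewrite -e -RintegralZl //.
  apply: le_Rintegral => //.
    by have := integrableZl _ L hi; apply; exact: measurable_itv.
  by move=> s _; exact: le_sqrt_sum_sqr.
have [->|Ln0] := eqVneq L 0; first by apply: Rintegral_ge0 => s _; exact: sqrtr_ge0.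
by rewrite -(@ler_pM2l _ L) ?lt_neqAle 1?eq_sym ?Ln0 // -expr2 L2 !expr2.
Qed.

(** A number in []0, pi]] has the least absolute value in its class modulo [2 pi]. *)
Lemma angle_gap (R : realType) (t : nat) (m : int) : (0 < t)%N ->
  (pi / (2 * t%:R)) ^+ 2 <= (pi / (2 * t%:R) + 2 * pi * m%:~R) ^+ 2 :> R.
Proof.
move=> t0; have p0 := @pi_gt0 R.
have t1 : 1 <= t%:R :> R by rewrite ler1n.
have x0 : 0 < pi / (2 * t%:R) :> R by rewrite divr_gt0 // mulr_gt0 // ltr0n.
have x1 : pi / (2 * t%:R) <= pi :> R by rewrite ler_pdivrMr ?mulr_gt0 ?ltr0n // ler_peMr ?ltW //; lra.
set x := pi / _ in x0 x1 *.
have [m0|m0] := leP 0 m.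
  have m1 : 0 <= m%:~R :> R by rewrite ler0z.
  have h : 0 <= 2 * pi * m%:~R :> R by rewrite !mulr_ge0 // ltW.
  by rewrite ler_pXn2r ?nnegrE ?addr_ge0 ?(ltW x0) // lerDl.
have m1 : m%:~R <= - 1 :> R by rewrite -[- 1]/((- 1)%:~R) ler_int -ltzD1 addNr.
have h : 2 * pi * m%:~R <= - (2 * pi) :> R.
  rewrite -subr_ge0 (_ : _ - _ = 2 * (pi * (- 1 - m%:~R))); last by ring.
  by rewrite !mulr_ge0 ?(ltW p0) // subr_ge0.
rewrite -subr_ge0; set y := 2 * pi * _ in h *.
have -> : (x + y) ^+ 2 - x ^+ 2 = (- y) * (- (2 * x + y)) by ring.
by rewrite mulr_ge0 //; lra.
Qed.

Lemma gamma_length (R : realType) t (theta : R -> R) : (0 < t)%N -> admissible_angle theta ->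
  (@lebesgue_measure R).-integrable `[0, 1] (EFin \o speed (gamma t theta)) /\
  curve_length (gamma t theta) = ((4 * t)%:R * \int[@lebesgue_measure R]_(s in `[0, 1])
    Num.sqrt ((speed (alpha t) s / 2) ^+ 2 + fibre_speed t theta s ^+ 2))%:E.
Proof.
move=> t0 ad; have [_ /smooth_off_finiteP[l sl] _ _] := ad.
have N0 : (0 < 4 * t)%N by rewrite muln_gt0.
have sp (k : nat) : (k < 4 * t)%N -> smooth_on (off (gamma_breaks t l)) (gamma_piece t theta k).
  by move=> _; exact: gamma_piece_smooth.
have pp (k : nat) : (k < 4 * t)%N -> forall r : R, off (gamma_breaks t l) r ->
    0 < speed (gamma_piece t theta k) r.
  move=> _ r os; rewrite (gamma_piece_speed _ t0 sl os) sqrtr_gt0.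
  have [/(alpha_speed_ge t0) a4 _] := off_gamma_breaks os.
  by rewrite ltr_wpDr ?sqr_ge0 // exprn_gt0 // divr_gt0 // (lt_le_trans _ a4).
have ip (k : nat) (kt : (k < 4 * t)%N) := (gamma_piece_speed_integrable k t0 ad sl).1.
have [_ i e] := @glue_length R 3 (4 * t) (gamma_piece t theta) _ N0 sp pp ip.
rewrite gamma_glue //; split=> //.
rewrite /curve_length integral_EFin_Rintegral //; congr EFin.
apply: (etrans e); rewrite (eq_bigr (fun=> \int[@lebesgue_measure R]_(s in `[0, 1])
    Num.sqrt ((speed (alpha t) s / 2) ^+ 2 + fibre_speed t theta s ^+ 2))).
  by rewrite sumr_const card_ord -[LHS]mulr_natl.
by move=> k _; have [_ ->] := gamma_piece_speed_integrable k t0 ad sl.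
Qed.

Lemma sqrt_length (R : realType) t : (0 < t)%N ->
  (4 * t)%:R * Num.sqrt ((pi * t%:R) ^+ 2 + (pi / (2 * t%:R)) ^+ 2) =
  2 * pi * Num.sqrt (4 * t%:R ^+ 4 + 1) :> R.
Proof.
move=> t0; have p0 := @pi_gt0 R.
have tR : t%:R != 0 :> R by rewrite pnatr_eq0 -lt0n.
rewrite -[X in X * _ = _]ger0_norm // -[X in _ = X * _]ger0_norm ?mulr_ge0 ?(ltW p0) //.
rewrite -!sqrtr_sqr -!sqrtrM ?sqr_ge0 //; congr Num.sqrt.
by rewrite natrM; field.
Qed.

Lemma alpha_half_integral (R : realType) t : (0 < t)%N ->
  (@lebesgue_measure R).-integrable `[0, 1] (EFin \o (fun s => speed (alpha t) s / 2)) /\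
  \int[@lebesgue_measure R]_(s in `[0, 1]) (speed (alpha t) s / 2) = pi * t%:R.
Proof.
move=> t0; have [ia ea] := @alpha_length R t t0.
have [i e] := Rintegral_lincomb (2^-1) 0 ia ia.
have E : (fun s : R => speed (alpha t) s / 2) = (fun s => 2^-1 * speed (alpha t) s + 0 * speed (alpha t) s).
  by apply/funext => s; ring.
rewrite E; split=> //; rewrite e mul0r addr0.
move: ea; rewrite /curve_length integral_EFin_Rintegral // => -[->].
by field.
Qed.

Lemma sqrt_integrable (R : realType) t (theta : R -> R) : (0 < t)%N -> admissible_angle theta ->
  (@lebesgue_measure R).-integrable `[0, 1] (EFin \o (fun s =>
    Num.sqrt ((speed (alpha t) s / 2) ^+ 2 + fibre_speed t theta s ^+ 2))).
Proof.
move=> t0 ad; have [_ /smooth_off_finiteP[l sl] _ _] := ad.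
have [i _] := gamma_piece_speed_integrable 0 t0 ad sl.
have cs s : off (gamma_breaks t l) s -> {for s, continuous (speed (gamma_piece t theta 0))}.
  apply: smooth_on_continuous; apply: smooth_on_speed; first exact: open_off.
    exact: gamma_piece_smooth.
  move=> r os; rewrite (gamma_piece_speed _ t0 sl os) sqrtr_gt0.
  have [/(alpha_speed_ge t0) a4 _] := off_gamma_breaks os.
  by rewrite ltr_wpDr ?sqr_ge0 // exprn_gt0 // divr_gt0 // (lt_le_trans _ a4).
pose f s := Num.sqrt ((speed (@alpha R t) s / 2) ^+ 2 + fibre_speed t theta s ^+ 2).
have fE s : off (gamma_breaks t l) s -> f s = speed (gamma_piece t theta 0) s.
  by move=> os; rewrite (gamma_piece_speed _ t0 sl os).
by have [] := Rintegral_eq_off_seq fE cs i.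
Qed.

Lemma gamma_length_ge (R : realType) t (theta : R -> R) : (0 < t)%N -> admissible_angle theta ->
  ((2 * pi * Num.sqrt (4 * t%:R ^+ 4 + 1))%:E <= curve_length (gamma t theta))%E.
Proof.
move=> t0 ad; have [_ ->] := gamma_length t0 ad.
rewrite -sqrt_length // lee_fin ler_wpM2l //.
have [ig [m eg]] := fibre_speed_integral t0 ad.
have [ia ea] := @alpha_half_integral R t t0.
apply: le_trans (sqrt_Rintegral_le ia ig (sqrt_integrable t0 ad)).
by rewrite ea eg ler_wsqrtr // lerD2l angle_gap.
Qed.

Lemma smooth_on_primitive (R : realType) (U : set R) (f F : R -> R) :
  (forall x, U x -> is_derive x 1 F (f x)) -> smooth_on U f -> smooth_on U F.
Proof. by move=> FD sf [|n] //=; exists f; split=> //; exact: sf. Qed.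

(** The triangle inequality is an equality when the vertical speed is a constant multiple [k] of the
    horizontal one, and this condition prescribes the derivative [f] of [theta]. *)
Lemma gamma_length_eq (R : realType) t : (0 < t)%N ->
  exists2 theta : R -> R, admissible_angle theta &
  curve_length (gamma t theta) = (2 * pi * Num.sqrt (4 * t%:R ^+ 4 + 1))%:E.
Proof.
move=> t0; have tR : t%:R != 0 :> R by rewrite pnatr_eq0 -lt0n.
pose l : seq R := glue_breaks (2 * t) [::].
have N0 : (0 < 2 * t)%N by rewrite muln_gt0.
have sa : smooth_on (off l) (@alpha R t) by exact: alpha_smooth.
have sds : smooth_on (off l) (speed (@alpha R t)).
  apply: smooth_on_speed => //; first exact: open_off.
  by move=> x /(alpha_speed_ge t0); apply: lt_le_trans.
have /(smooth_on_rowP _ (@open_off R _)) sac := sa.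
have /(smooth_on_rowP _ (@open_off R _)) sdc := smooth_on_derive1 (@open_off R _) sa.
have sdr : smooth_on (off l) (@drift R t).
  apply: smooth_onM.
    by apply: smooth_onD; [|apply: smooth_onN]; apply: smooth_onM.
  apply: smooth_on_inv; first by move=> x _; rewrite mulf_neq0 // gt_eqF // alpha_gtN1.
  by apply: smooth_onM; [exact: smooth_on_cst|apply: smooth_onD => //; exact: smooth_on_cst].
pose c0 : R := pi * (2 * t%:R + 1) / (2 * t%:R).
(* The ratio of the minimal rotation [pi / (2 t)] to the horizontal length [pi t] of one turn. *)
pose k : R := (2 * t%:R ^+ 2)^-1.
pose f s := k * (speed (@alpha R t) s / 2) + 1 * (- 1 * drift t s + - c0 * 1).
have sf : smooth_on (off l) f.
  apply: smooth_onD; (apply: smooth_onM; first exact: smooth_on_cst).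
    by apply: smooth_onM => //; exact: smooth_on_cst.
  apply: smooth_onD; last exact: smooth_on_cst.
  by apply: smooth_onM => //; exact: smooth_on_cst.
have [di [m dm]] := @drift_integral R t t0.
have [ai ae] := @alpha_half_integral R t t0.
have ic : (@lebesgue_measure R).-integrable `[0, 1] (EFin \o (fun=> 1 : R)).
  by apply: integrable_within01; apply: continuous_subspaceT => x; exact: cvg_cst.
have ce : \int[@lebesgue_measure R]_(x in `[0, 1]) (1 : R) = 1.
  have c1 : {within `[0, 1], continuous (id : R -> R)}.
    by apply: continuous_subspaceT => x; exact: cvg_id.
  have cf (x : R) : x \in `]0, 1[%R -> x \notin [::] -> {for x, continuous (fun=> 1 : R)}.
    by move=> _ _; exact: cvg_cst.
  have df (x : R) : x \in `]0, 1[%R -> x \notin [::] -> is_derive x 1 (id : R -> R) 1.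
    by move=> _ _; exact: is_derive_id.
  by apply: (etrans (RFTC2_off_seq ler01 ic c1 cf df)); rewrite subr0.
have [i1 e1] := Rintegral_lincomb (- 1) (- c0) di ic.
have [fi fe] := Rintegral_lincomb k 1 ai i1.
rewrite -/f e1 ae dm ce in fe.
have cf (x : R) : x \in `]0, 1[%R -> x \notin l -> {for x, continuous f}.
  by move=> x01 xl; exact: smooth_on_continuous sf (conj x01 xl).
have [theta [ct th0 th1 _ dt]] := parameterized_integral_off_seq ler01 fi cf.
have Dt x : off l x -> is_derive x 1 theta (f x) by move=> [x01 xl]; exact: dt.
have st : smooth_on (off l) theta by exact: smooth_on_primitive Dt sf.
have dE x : off l x -> derive1 theta x = f x.
  by move=> ox; have D := Dt x ox; rewrite derive1E derive_val.
have ad : admissible_angle theta.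
  split=> //.
  - by apply/smooth_off_finiteP; exists l.
  - have cfo x : off l x -> {for x, continuous f} by move=> [x01 xl]; exact: cf.
    by have [] := Rintegral_eq_off_seq dE cfo fi.
  (* The increment of [theta] is [pi / (2 t) - (pi + 2 pi m) - (pi + pi / (2 t))]. *)
  - exists (- m - 1); rewrite th0 subr0 (etrans th1 fe).
    by rewrite /k /c0 !intrD mulrNz; field.
exists theta => //; have [_ ->] := gamma_length t0 ad; congr EFin.
rewrite -sqrt_length //; congr (_ * _).
have [ci ce'] := Rintegral_lincomb (Num.sqrt (1 + k ^+ 2)) 0 ai ai.
pose h s := Num.sqrt ((speed (@alpha R t) s / 2) ^+ 2 + fibre_speed t theta s ^+ 2).
have hE x : off l x -> h x = Num.sqrt (1 + k ^+ 2) * (speed (@alpha R t) x / 2) + 0 * (speed (@alpha R t) x / 2).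
  move=> ox; rewrite /h /fibre_speed (dE x ox) /f mul0r addr0.
  set a := speed _ _ / 2; have a0 : 0 <= a by rewrite divr_ge0 // speed_ge0.
  rewrite -[X in _ = _ * X](ger0_norm a0) -[X in _ = _ * X]sqrtr_sqr.
  rewrite -sqrtrM ?addr_ge0 ?sqr_ge0 //; congr Num.sqrt; rewrite -/c0; ring.
have hc x : off l x -> {for x, continuous (fun x => Num.sqrt (1 + k ^+ 2) * (speed (@alpha R t) x / 2) + 0 * (speed (@alpha R t) x / 2))}.
  move=> ox; have ca : {for x, continuous (fun x => speed (@alpha R t) x / 2)}.
    by apply: cvgM; [exact: smooth_on_continuous sds ox|exact: cvg_cst].
  by apply: cvgD; apply: cvgM => //; exact: cvg_cst.
have [_ he] := Rintegral_eq_off_seq hE hc ci.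
apply: (etrans he); rewrite ce' ae mul0r addr0.
have p0 := @pi_gt0 R.
set a := pi * t%:R; have a0 : 0 <= a by rewrite mulr_ge0 // ltW.
rewrite -[X in _ * X = _](ger0_norm a0) -[X in _ * X = _]sqrtr_sqr.
by rewrite -sqrtrM ?addr_ge0 ?sqr_ge0 //; congr Num.sqrt; rewrite /k /a; field.
Qed.

Lemma phase_mul_orthogonal (R : realType) (x : R) : exists U : 'M[R]_4, U *m U^T = 1%:M /\
  forall z, real_of_C2 z *m U = real_of_C2 (phase_mul (expi x) z).
Proof.
pose c : 'I_4 -> 'I_4 -> 'M[R]_4 := fun i j => givens i j (cos x) (- sin x).
have cs : cos x ^+ 2 + (- sin x) ^+ 2 = 1 by rewrite sqrrN cos2Dsin2.
pose i0 : 'I_4 := inord 0; pose i1 : 'I_4 := inord 1; pose i2 : 'I_4 := inord 2; pose i3 : 'I_4 := inord 3.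
have ne (a b : nat) : (a < 4)%N -> (b < 4)%N -> a != b -> inord a != inord b :> 'I_4.
  by move=> a4 b4 ab; rewrite -val_eqE /= !inordK.
exists (c i0 i1 *m c i2 i3); split.
  rewrite trmx_mul mulmxA -[c i0 i1 *m _ *m _]mulmxA givens_orthogonal ?ne // mulmx1.
  by rewrite givens_orthogonal ?ne.
move=> [[z1 z2] [z3 z4]]; rewrite mulmxA /c; set x0 := real_of_C2 _; set y := x0 *m _ *m _.
have y0 : y 0 i0 = cos x * x0 0 i0 + - sin x * x0 0 i1.
  by rewrite (givens_other _ _ _ (ne 0%N 2%N _ _ _)) ?ne // givens_c ?ne.
have y1 : y 0 i1 = - - sin x * x0 0 i0 + cos x * x0 0 i1.
  by rewrite (givens_other _ _ _ (ne 1%N 2%N _ _ _)) ?ne // givens_j ?ne.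
have y2 : y 0 i2 = cos x * x0 0 i2 + - sin x * x0 0 i3.
  by rewrite givens_c ?ne // !(givens_other _ _ _ (ne _ 0%N _ _ _)) ?ne.
have y3 : y 0 i3 = - - sin x * x0 0 i2 + cos x * x0 0 i3.
  by rewrite givens_j ?ne // !(givens_other _ _ _ (ne _ 0%N _ _ _)) ?ne.
clearbody y; apply/rowP => j; have jE : j = inord j by rewrite inord_val.
rewrite !mxE in y0 y1 y2 y3; rewrite !inordK //= in y0 y1 y2 y3.
by rewrite jE mxE inordK //; case: j jE => -[|[|[|[|//]]]] /= _ _;
  rewrite ?y0 ?y1 ?y2 ?y3; ring.
Qed.

Lemma real_of_C2_surj (R : realType) (x : 'rV[R]_4) : exists z, x = real_of_C2 z.
Proof.
exists (x 0 (inord 0) +i* x 0 (inord 1), x 0 (inord 2) +i* x 0 (inord 3)).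
apply/rowP => j; rewrite mxE; case: j => -[|[|[|[|//]]]] /= h;
  by congr (x 0 _); apply: val_inj; rewrite /= inordK.
Qed.

Lemma hopf_sphere (R : realType) (x : 'rV[R]_4) : sphere 3 x -> sphere 2 (hopf x).
Proof.
have [z ->] := real_of_C2_surj x => /sphere3_real_of_C2 sz; apply/sphere2E.
have [-> -> ->] := hopf_real_of_C2 z.
set a := complex.Re z.1 in sz *; set b := complex.Im z.1 in sz *.
set c := complex.Re z.2 in sz *; set d := complex.Im z.2 in sz *.
transitivity ((a ^+ 2 + b ^+ 2 + c ^+ 2 + d ^+ 2) ^+ 2); first ring.
by rewrite sz expr1n.
Qed.

Lemma hopf_continuous (R : realType) : continuous (@hopf R).
Proof.
have cc (i : 'I_4) : continuous (fun x : 'rV[R]_4 => x 0 i) by exact: coord_continuous.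
apply: continuous_row => j; rewrite (_ : (fun s => _) = fun x : 'rV[R]_4 =>
  [:: x 0 (inord 0) ^+ 2 + x 0 (inord 1) ^+ 2 - x 0 (inord 2) ^+ 2 - x 0 (inord 3) ^+ 2;
    2 * (x 0 (inord 0) * x 0 (inord 2) + x 0 (inord 1) * x 0 (inord 3));
    - 2 * (x 0 (inord 0) * x 0 (inord 3) - x 0 (inord 1) * x 0 (inord 2))]`_j); last first.
  by apply/funext => x; rewrite mxE.
have cs (i : 'I_4) : continuous (fun x : 'rV[R]_4 => x 0 i ^+ 2).
  by move=> x; apply: (continuous_exprn (f := fun x : 'rV[R]_4 => x 0 i)); exact: cc.
case: j => -[|[|[|//]]] /= _ x.
- exact: (cvgB (cvgB (cvgD (cs _ x) (cs _ x)) (cs _ x)) (cs _ x)).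
- exact: (cvgM (cvg_cst _) (cvgD (cvgM (cc _ x) (cc _ x)) (cvgM (cc _ x) (cc _ x)))).
- exact: (cvgM (cvg_cst _) (cvgB (cvgM (cc _ x) (cc _ x)) (cvgM (cc _ x) (cc _ x)))).
Qed.

(* Rotations of the base are lifted by real rotations of the pair [(z1, z2)] by half the
   angle and by phase changes of [z2]. *)
Lemma hopf_moments (R : realType) (sigma : probability (borelRn R 4) R) (e : 'I_3 -> nat) :
  uniform_on_sphere sigma ->
  \int[sigma]_(x in sphere 3) mono e (hopf x) = sphere_moment R 3 e.
Proof.
move=> us.
have ne (a b : nat) : (a < 4)%N -> (b < 4)%N -> a != b -> inord a != inord b :> 'I_4.
  by move=> a4 b4 ab; rewrite -val_eqE /= !inordK.
apply: (@sphere_map_moments R 3 2 sigma (@hopf R) 1 0) => //.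
- exact: hopf_continuous.
- exact: hopf_sphere.
move=> j j1 u v uv; have [j0|j2] : j = 0 \/ j = 2.
  case: j j1 => -[|[|[|//]]] // h _; [left|right]; exact: val_inj.
- rewrite j0; pose c := Num.sqrt ((1 + u) / 2).
  (* [c] and [s] are the cosine and sine of half the angle; the sign of [s] is chosen so that
     [- 2 * c * s = v]. *)
  pose s := if v <= 0 then Num.sqrt ((1 - u) / 2) else - Num.sqrt ((1 - u) / 2).
  have u1 : -1 <= u <= 1 by rewrite -ler_norml -(@ler_pXn2r _ 2) ?nnegrE // real_normK ?num_real // expr1n -uv lerDl sqr_ge0.
  have cp : 0 <= (1 + u) / 2 by lra.
  have sp : 0 <= (1 - u) / 2 by lra.
  have c2 : c ^+ 2 = (1 + u) / 2 by rewrite sqr_sqrtr.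
  have s2 : s ^+ 2 = (1 - u) / 2 by rewrite /s; case: ifP => _; rewrite ?sqrrN sqr_sqrtr.
  have csv : - 2 * c * s = v.
    have E : Num.sqrt ((1 + u) / 2) * Num.sqrt ((1 - u) / 2) = `|v| / 2.
      rewrite -sqrtrM // -[RHS]ger0_norm ?divr_ge0 // -sqrtr_sqr; congr Num.sqrt.
      rewrite expr_div_n real_normK ?num_real //.
      have -> : v ^+ 2 = 1 - u ^+ 2 by rewrite -uv; ring.
      by field.
    rewrite /s; case: ifP => v0; rewrite -mulrA ?mulrN E.
      by rewrite ler0_norm //; field.
    by rewrite gtr0_norm ?ltNge ?v0 //; field.
  have cs : c ^+ 2 + s ^+ 2 = 1 by rewrite c2 s2; field.
  exists (givens (inord 0) (inord 2) c s *m givens (inord 1) (inord 3) c s); split.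
    rewrite trmx_mul mulmxA -[_ *m _ *m (givens (inord 1) _ _ _)^T]mulmxA givens_orthogonal ?ne // mulmx1.
    by rewrite givens_orthogonal ?ne.
  move=> x; rewrite mulmxA; set y := x *m _ *m _.
  have y0 : y 0 (inord 0) = c * x 0 (inord 0) + s * x 0 (inord 2).
    by rewrite (givens_other _ _ _ (ne 0%N 1%N _ _ _)) ?ne // givens_c ?ne.
  have y2 : y 0 (inord 2) = - s * x 0 (inord 0) + c * x 0 (inord 2).
    by rewrite (givens_other _ _ _ (ne 2%N 1%N _ _ _)) ?ne // givens_j ?ne.
  have y1 : y 0 (inord 1) = c * x 0 (inord 1) + s * x 0 (inord 3).
    by rewrite givens_c ?ne // !(givens_other _ _ _ (ne _ 0%N _ _ _)) ?ne.
  have y3 : y 0 (inord 3) = - s * x 0 (inord 1) + c * x 0 (inord 3).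
    by rewrite givens_j ?ne // !(givens_other _ _ _ (ne _ 0%N _ _ _)) ?ne.
  clearbody y; have uE : u = c ^+ 2 - s ^+ 2 by rewrite c2 s2; field.
  split; first by rewrite !mxE /= y0 y1 y2 y3 uE -csv; ring.
  case=> -[|[|[|//]]] // h _ _; rewrite !mxE /= y0 y1 y2 y3.
  rewrite -[RHS]mul1r -cs; ring.
- rewrite j2; exists (givens (inord 2) (inord 3) u (- v)); split.
    by rewrite givens_orthogonal ?ne // sqrrN.
  move=> x; set y := x *m _.
  have y0 : y 0 (inord 0) = x 0 (inord 0) by rewrite (givens_other _ _ _ (ne 0%N 2%N _ _ _)) ?ne.
  have y1 : y 0 (inord 1) = x 0 (inord 1) by rewrite (givens_other _ _ _ (ne 1%N 2%N _ _ _)) ?ne.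
  have y2 : y 0 (inord 2) = u * x 0 (inord 2) + - v * x 0 (inord 3) by rewrite givens_c ?ne.
  have y3 : y 0 (inord 3) = - - v * x 0 (inord 2) + u * x 0 (inord 3) by rewrite givens_j ?ne.
  clearbody y; split; first by rewrite !mxE /= y0 y1 y2 y3; ring.
  case=> -[|[|[|//]]] // h _ _; rewrite !mxE /= y0 y1 y2 y3.
  transitivity (x 0 (inord 0) ^+ 2 + x 0 (inord 1) ^+ 2 - (u ^+ 2 + v ^+ 2) * (x 0 (inord 2) ^+ 2 + x 0 (inord 3) ^+ 2)); first ring.
  by rewrite uv; ring.
Qed.

(** The phase average of the monomial is a polynomial [h] of degree at most [2 t - 1] in the Hopf
    coordinates. Along the curve the [4 t] pieces supply the phases and [h] is integrated over
    [alpha]; on the sphere each phase is an orthogonal map and [h] is integrated through the Hopf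
    map. Both integrals of [h] are the same sum [S] of moments of [S^2]. *)
Lemma gamma_moments (R : realType) t (theta : R -> R) (sigma : probability (borelRn R 4) R)
    (e : 'I_4 -> nat) : (0 < t)%N -> uniform_on_sphere sigma -> admissible_angle theta ->
  (\sum_i e i < 4 * t)%N ->
  \int[@lebesgue_measure R]_(s in `[0, 1]) mono e (gamma t theta s) = sphere_moment R 4 e.
Proof.
move=> t0 us [ct _ _ tk] et; have N0 : (0 < 4 * t)%N by rewrite muln_gt0.
have tR : t%:R != 0 :> R by rewrite pnatr_eq0 -lt0n.
pose zeta : R[i] := expi (2 * pi * (2 * t + 1)%:R / (4 * t)%:R).
have [zz zN z1] := expi_root_unity N0 (coprime_gamma t0) (erefl zeta).
have et2 : (\sum_i e i < (2 * t - 1).+1.*2)%N.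
  by rewrite subn1 prednK ?muln_gt0 // -mul2n mulnA.
have [h [sh hE]] := phase_average_hopf zz zN z1 et et2.
have hE' x : sphere 3 x -> \sum_(j < 4 * t) mono e (real_of_C2 (phase_mul (zeta ^+ j) (projT1 (cid (real_of_C2_surj x))))) = polyfun h (hopf x).
  by case: (cid _) => z /= -> sz; rewrite hE.
have zk (k : nat) : zeta ^+ k = expi (k%:R * (2 * pi * (2 * t + 1)%:R / (4 * t)%:R)) by rewrite expi_natM.
pose m i := tnth (in_tuple (msupp h)) i.
have mle i : (\sum_j (m i) j < 2 * t)%N.
  have := msize_mdeg_lt (mem_tnth i (in_tuple (msupp h))).
  rewrite -mdegE => hlt; apply: (leq_trans hlt); apply: (leq_trans sh).
  by rewrite subn1 prednK // muln_gt0.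
pose S := \sum_i mcoeff (m i) h * sphere_moment R 3 (m i).
have hpoly y : polyfun h y = \sum_i mcoeff (m i) h * mono (m i) y.
  by rewrite polyfunE big_tnth.
have Scurve : \int[@lebesgue_measure R]_(s in `[0, 1]) polyfun h (alpha t s) = S.
  have cm i : {within `[0, 1], continuous (fun s => mono (m i) (@alpha R t s))}.
    by apply: (within_continuous_compT (f := mono (m i))); [exact: continuous_mono|exact: alpha_continuous].
  have [_ E] := @Rintegral_sum R _ _ (@lebesgue_measure R) `[0, 1]%classic _
    (fun i s => mono (m i) (@alpha R t s)) (fun i => mcoeff (m i) h) (measurable_itv _)
    (fun i => integrable_within01 (cm i)).
  transitivity (\int[@lebesgue_measure R]_(s in `[0, 1])
      (\sum_i mcoeff (m i) h * mono (m i) (alpha t s))).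
    by apply: eq_Rintegral => s _; exact: hpoly.
  apply: (etrans E); apply: eq_bigr => i _; congr (_ * _).
  by apply: alpha_moments.
have Ssphere : \int[sigma]_(x in sphere 3) polyfun h (hopf x) = S.
  have cm i : continuous (fun x : 'rV[R]_4 => mono (m i) (hopf x)).
    by move=> x; apply: continuous_comp; [exact: hopf_continuous|exact: continuous_mono].
  have im i : sigma.-integrable (sphere 3) (EFin \o (fun x => mono (m i) (hopf x))).
    apply: (@sphere_integrable R 3 sigma _ 1); first exact: cm.
    by move=> x /hopf_sphere; exact: sphere_mono_le1.
  have [_ E] := @Rintegral_sum R _ _ sigma (sphere 3) _ (fun i x => mono (m i) (hopf x))
    (fun i => mcoeff (m i) h) (@measurable_sphere R 3) im.
  transitivity (\int[sigma]_(x in sphere 3) (\sum_i mcoeff (m i) h * mono (m i) (hopf x))).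
    by apply: eq_Rintegral => x _; exact: hpoly.
  by apply: (etrans E); apply: eq_bigr => i _; rewrite hopf_moments.
have NR : (4 * t)%:R != 0 :> R by rewrite pnatr_eq0 -lt0n.
transitivity ((4 * t)%:R^-1 * S).
  rewrite gamma_glue // glue_Rintegral //; first last.
  - exact: continuous_mono.
  - by move=> k; exact: gamma_piece_continuous.
  - by move=> k; exact: gamma_piece_match.
  congr (_ * _).
  have cp (k : 'I_(4 * t)) : {within `[0, 1], continuous (fun r => mono e (gamma_piece t theta (k : nat) r))}.
    apply: (within_continuous_compT (f := mono e)); first exact: continuous_mono.
    exact: gamma_piece_continuous.
  have [_ E] := @Rintegral_sum R _ _ (@lebesgue_measure R) `[0, 1]%classic _
    (fun (k : 'I_(4 * t)) r => mono e (gamma_piece t theta (k : nat) r)) (fun=> 1) (measurable_itv _)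
    (fun k => integrable_within01 (cp k)).
  rewrite -Scurve; rewrite (eq_bigr _ (fun k _ => esym (mul1r _))); apply: (etrans (esym E)).
  apply: eq_Rintegral => r; rewrite inE /= in_itvcc => r01.
  have sa := alpha_sphere t r01; have ga := @alpha_gtN1 R t r t0.
  pose phi : R := 2 * pi * (2 * t%:R + 1) / (4 * t%:R) * r + theta r.
  rewrite -[in RHS](hopf_hopf_lift phi sa ga) /hopf_lift -hE; last exact: hopf_lift_sphere.
  apply: eq_bigr => k _; rewrite mul1r /gamma_piece gamma_piece_phase // hopf_lift_phase.
  congr (mono e (real_of_C2 (phase_mul _ _))); rewrite zk; congr expi.
  by rewrite -pmulrn natrD !natrM; ring.
rewrite -Ssphere -(sphere_moments us).
have us1 (k : 'I_(4 * t)) : \int[sigma]_(x in sphere 3)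
    mono e (real_of_C2 (phase_mul (zeta ^+ k) (projT1 (cid (real_of_C2_surj x))))) =
    \int[sigma]_(x in sphere 3) mono e x.
  have [U [UU UE]] := @phase_mul_orthogonal R (k%:R * (2 * pi * (2 * t + 1)%:R / (4 * t)%:R)).
  rewrite -(@sphere_integral_orthogonal R 3 sigma U (mono e) 1 us UU); first last.
  - by move=> x; exact: sphere_mono_le1.
  - exact: continuous_mono.
  apply: eq_Rintegral => x _; congr mono; rewrite zk.
  by case: (cid _) => z /= xz; rewrite xz UE.
have iU (k : 'I_(4 * t)) : sigma.-integrable (sphere 3) (EFin \o (fun x =>
    mono e (real_of_C2 (phase_mul (zeta ^+ k) (projT1 (cid (real_of_C2_surj x))))))).
  have [U [UU UE]] := @phase_mul_orthogonal R (k%:R * (2 * pi * (2 * t + 1)%:R / (4 * t)%:R)).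
  rewrite (_ : (fun x => _) = (fun x => mono e (x *m U))); last first.
    apply/funext => x; congr mono; rewrite zk.
    by case: (cid _) => z /= xz; rewrite xz UE.
  apply: (@sphere_integrable R 3 sigma _ 1).
    by move=> x; apply: continuous_comp; [exact: continuous_mulmxr|exact: continuous_mono].
  by move=> x /(sphere_orthogonal x UU); exact: sphere_mono_le1.
have [_ E] := @Rintegral_sum R _ _ sigma (sphere 3) _ _ (fun=> 1) (@measurable_sphere R 3) iU.
rewrite (_ : \int[sigma]_(x in sphere 3) polyfun h (hopf x) =
    \sum_(k < 4 * t) 1 * \int[sigma]_(x in sphere 3) mono e x).
  by rewrite sumr_const card_ord mul1r -[X in _ * X]mulr_natl mulKf.
rewrite -(eq_bigr _ (fun k _ => congr1 (fun z => 1 * z) (us1 k))) -E.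
apply: eq_Rintegral => x; rewrite inE => sx; rewrite -hE' //.
by apply: eq_bigr => k _; rewrite mul1r.
Qed.

Lemma gamma_sphere (R : realType) t (theta : R -> R) (s : R) : (0 < t)%N ->
  0 <= s <= 1 -> sphere 3 (gamma t theta s).
Proof.
move=> t0 s01; rewrite gamma_glue //; apply: glue_range => //; first by rewrite muln_gt0.
by move=> k r r01; apply: hopf_lift_sphere; [exact: alpha_sphere|exact: alpha_gtN1].
Qed.

Lemma piece_cases_le (R : realType) N (s : R) : (0 < N)%N -> 0 <= s <= 1 ->
  exists (k : nat) (r : R), [/\ (k <= N)%N, 0 <= r < 1, s = N%:R^-1 * r + N%:R^-1 * k%:R &
    0 < r -> (k < N)%N].
Proof.
move=> N0 /andP[s0]; rewrite le_eqVlt => /orP[/eqP ->|s1].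
  exists N, 0; rewrite leqnn lexx ltr01; split=> //; last by rewrite ltxx.
  by rewrite mulr0 add0r mulVf // pnatr_eq0 -lt0n.
have [|k [r [kt ri e]]] := @piece_cases R N s N0; first by rewrite s0.
by exists k, r; split=> //; exact: ltnW.
Qed.

(** A self-intersection projects to a coincidence of [alpha], so both parameters lie over
    breakpoints unless the base parameters agree. In that case the phases differ by the power
    [k2 - k1] of a primitive root of order [4 t], which is 1 only for the pair that closes the
    curve. *)
Lemma gamma_self_intersections (R : realType) t (theta : R -> R) : (0 < t)%N ->
  finite_set (self_intersections (gamma t theta)).
Proof.
move=> t0; have N0 : (0 < 4 * t)%N by rewrite muln_gt0.
have NR : (4 * t)%:R != 0 :> R by rewrite pnatr_eq0 -lt0n.
pose B : seq R := [seq (2 * t)%:R^-1 * k%:R : R | k <- iota 0 (2 * t).+1].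
pose Z : set R := [set` [seq (4 * t)%:R^-1 * r + (4 * t)%:R^-1 * k%:R : R | r <- B, k <- iota 0 (4 * t).+1]].
apply: (@sub_finite_set _ _ (Z `*` Z)); last by apply: finite_setX; exact: finite_seq.
move=> [s1 s2] [/= s10 s12 s21 s01 E].
have [|k1 [r1 [k1t r1i s1E pole1]]] := @piece_cases_le R (4 * t) s1 N0.
  by rewrite s10 (le_trans (ltW s12)).
have [|k2 [r2 [k2t r2i s2E pole2]]] := @piece_cases_le R (4 * t) s2 N0.
  by rewrite s21 (le_trans s10) ?ltW.
move: E; rewrite s1E s2E gamma_glue // !glue_piece_lt // /gamma_piece => E.
have r1i' : 0 <= r1 <= 1 by rewrite (andP r1i).1 ltW // (andP r1i).2.
have r2i' : 0 <= r2 <= 1 by rewrite (andP r2i).1 ltW // (andP r2i).2.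
have aE : alpha t r1 = alpha t r2.
  have := congr1 (@hopf R) E.
  by rewrite !hopf_hopf_lift // ?alpha_gtN1 //; exact: alpha_sphere.
have inZ (k l : nat) : (k <= 2 * t)%N -> (l <= 4 * t)%N ->
    Z ((4 * t)%:R^-1 * ((2 * t)%:R^-1 * k%:R) + (4 * t)%:R^-1 * l%:R).
  move=> kt lt; apply/allpairsP; exists ((2 * t)%:R^-1 * k%:R, l); split=> //=.
    by apply/mapP; exists k; rewrite // mem_iota.
  by rewrite -[_ :: _]/(iota 0 (4 * t).+1) mem_iota.
have [r12|r21|rr] := ltgtP r1 r2.
- have [[j1 j1t ->] [j2 j2t ->]] := alpha_eq_breaks t0 (andP r1i).1 r12 (andP r2i').2 aE.
  by split; exact: inZ.
- have [[j2 j2t ->] [j1 j1t ->]] := alpha_eq_breaks t0 (andP r2i).1 r21 (andP r1i').2 (esym aE).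
  by split; exact: inZ.
exfalso; have k12 : (k1 < k2)%N.
  by move: s12; rewrite s1E s2E rr ltrD2l ltr_pM2l ?invr_gt0 ?ltr0n // ltr_nat.
rewrite rr in E.
have := hopf_lift_inj (@alpha_gtN1 R t r2 t0) (esym E).
pose zeta : R[i] := expi (2 * pi * (2 * t + 1)%:R / (4 * t)%:R).
have [zz zN z1] := expi_root_unity N0 (coprime_gamma t0) (erefl zeta).
have -> : 2 * pi * (2 * t%:R + 1) / (4 * t%:R) * (r2 + k2%:~R) + theta r2 -
    (2 * pi * (2 * t%:R + 1) / (4 * t%:R) * (r2 + k1%:~R) + theta r2) =
    (k2 - k1)%:R * (2 * pi * (2 * t + 1)%:R / (4 * t)%:R).
  by rewrite natrB ?(ltnW k12) // -!pmulrn natrD !natrM; ring.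
rewrite expi_natM => /eqP; apply/negP; apply: z1.
rewrite subn_gt0 k12 /= ltn_neqAle (leq_trans (leq_subr _ _) k2t) andbT.
apply/eqP => kk; have k20 : k2 = (4 * t)%N by apply/eqP; rewrite eqn_leq k2t -kk leq_subr.
have k10 : k1 = 0%N.
  have := subnK (ltnW k12); rewrite kk k20 => /eqP.
  by rewrite -[X in _ == X]addn0 eqn_add2l => /eqP.
have r20 : r2 = 0.
  apply/eqP; rewrite eq_le (andP r2i).1 andbT leNgt; apply/negP => /pole2.
  by rewrite k20 ltnn.
by apply: s01; rewrite s1E s2E rr r20 k10 k20 !mulr0 addr0 add0r mulVf.
Qed.

Lemma exists_below_seq (R : realType) (l : seq R) :
  exists2 d : R, 0 < d & forall x, x \in l -> 0 < x -> d <= x.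
Proof.
elim: l => [|y l [d d0 dl]]; first by exists 1.
have [y0|y0] := ltP 0 y; last first.
  by exists d => // x; rewrite inE => /predU1P[->|/dl//]; rewrite ltNge y0.
exists (Num.min d y); first by rewrite lt_min d0.
move=> x; rewrite inE => /predU1P[->|xl x0]; first by rewrite ge_min lexx orbT.
by rewrite ge_min dl.
Qed.

(** The horizontal speed alone blows up at the start, where [alpha] leaves a pole; the point [r'] is
    taken before the first positive breakpoint. *)
Lemma gamma_unbounded_speed (R : realType) t (theta : R -> R) : (0 < t)%N ->
  smooth_off_finite theta -> ~ bounded_speed (gamma t theta).
Proof.
move=> t0 /smooth_off_finiteP[l sl] [M HM].
have N0 : (0 < 4 * t)%N by rewrite muln_gt0.
have [d d0 dl] := exists_below_seq (gamma_breaks t l).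
have [r r01 [rd Mr]] := chord_small M d0; have [r0 r1] := andP r01.
have c0 := chord_gt0 r01.
pose r' := (2 * t)%:R^-1 * r.
have r'0 : 0 < r' by rewrite mulr_gt0 // invr_gt0 ltr0n muln_gt0.
have r'r : r' <= r by rewrite ler_piMl ?(ltW r0) // invf_le1 ?ltr0n ?ler1n muln_gt0.
have os : off (gamma_breaks t l) r'.
  split; first by rewrite in_itvoo r'0 (le_lt_trans r'r).
  apply/negP => /dl /(_ r'0); rewrite leNgt => /negP; apply.
  exact: le_lt_trans rd.
have sp := gamma_piece_smooth 0 t0 sl.
have D := glue_derivable (P := gamma_piece t theta) (k := 0) N0 sp os.
rewrite -gamma_glue // in D; have := HM _ _ D.
have -> : 0 < (4 * t)%:R^-1 * r' + (4 * t)%:R^-1 * 0%:R < 1.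
  rewrite mulr0 addr0 mulr_gt0 ?invr_gt0 ?ltr0n //= mulrC ltr_pdivrMr ?ltr0n // mul1r.
  by rewrite (lt_le_trans (le_lt_trans r'r r1)) // ler1n.
move=> /(_ isT); apply/negP; rewrite -ltNge.
rewrite gamma_glue // (glue_speed (P := gamma_piece t theta) (k := 0) N0 sp os).
apply: (lt_le_trans Mr).
have aE : speed (alpha t) r' = (2 * t)%:R * (2 / chord r).
  by have := alpha_speed_piece 0 t0 r01; rewrite mulr0 addr0.
apply: (@le_trans _ _ (speed (gamma_piece t theta 0) r')); last first.
  by rewrite ler_peMl ?speed_ge0 // ler1n.
rewrite (gamma_piece_speed _ t0 sl os) aE natrM.
have h0 : 0 <= 2 / chord r by rewrite divr_ge0 // ltW.
rewrite -[leLHS](ger0_norm h0) -sqrtr_sqr ler_wsqrtr //.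
rewrite -[leLHS]addr0 lerD ?sqr_ge0 //.
have t1 : 1 <= t%:R :> R by rewrite ler1n.
have -> : 2 * t%:R * (2 / chord r) / 2 = t%:R * (2 / chord r) by field; rewrite gt_eqF.
set y := 2 / chord r in h0 *.
by have yt : y <= t%:R * y; [rewrite ler_peMl|rewrite !expr2 ler_pM].
Qed.

(** At [s = 1] the base parameter has wrapped to 0, so both ends use [theta 0], and the phases
    differ by [2 pi (2 t + 1)]. *)
Lemma gamma_closed (R : realType) t (theta : R -> R) : (0 < t)%N ->
  gamma t theta 0 = gamma t theta 1.
Proof.
move=> t0; have tR : t%:R != 0 :> R by rewrite pnatr_eq0 -lt0n.
rewrite gamma_glue // glue_end /glue mulr0 floor0 subr0 /gamma_piece.
have -> : 2 * pi * (2 * t%:R + 1) / (4 * t%:R) * (0 + (Posz (4 * t))%:~R) + theta 0 =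
    2 * pi * (2 * t%:R + 1) / (4 * t%:R) * (0 + 0%:~R) + theta 0 + 2 * pi * (Posz (2 * t + 1))%:~R :> R.
  have E (n : nat) : (Posz n)%:~R = n%:R :> R by [].
  by rewrite !E natrD !natrM; field.
by rewrite hopf_lift_period.
Qed.

Lemma gamma_design (R : realType) t (theta : R -> R) (sigma : probability (borelRn R 4) R) :
  (0 < t)%N -> uniform_on_sphere sigma -> admissible_angle theta ->
  weighted_design_curve sigma (4 * t - 1) (gamma t theta)
    (fun s => (speed (gamma t theta) s)^-1).
Proof.
move=> t0 us ad; have [ct so _ tk] := ad; have /smooth_off_finiteP[l sl] := so.
have N0 : (0 < 4 * t)%N by rewrite muln_gt0.
have cg : {within `[0, 1], continuous (gamma t theta)}.
  rewrite gamma_glue //; apply: glue_continuous => // k; first exact: gamma_piece_match.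
  exact: gamma_piece_continuous.
(* The lower bound 2 for the speed is half of the bound 4 for [alpha] and comes from the horizontal
   part alone. *)
apply: (@weighted_design_curve_arclength R 3 sigma _ (glue_breaks (4 * t) (gamma_breaks t l)) 2).
- by move=> s; exact: gamma_sphere.
- exact: cg.
- by rewrite gamma_glue //; apply: glue_row_smooth => // k _; exact: gamma_piece_smooth.
- by [].
- move=> s /(off_glue_breaks N0)[k [r [_ os ->]]].
  have sp := gamma_piece_smooth k t0 sl.
  rewrite gamma_glue // (glue_speed (P := gamma_piece t theta) N0 sp os).
  apply: (@le_trans _ _ (speed (gamma_piece t theta k) r)); last first.
    by rewrite ler_peMl ?speed_ge0 // ler1n.
  rewrite (gamma_piece_speed _ t0 sl os).
  have [/(alpha_speed_ge t0) a4 _] := off_gamma_breaks os.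
  have h : 2 <= speed (alpha t) r / 2 by rewrite ler_pdivlMr //; lra.
  rewrite -[leLHS](@ger0_norm _ 2) // -sqrtr_sqr ler_wsqrtr //.
  rewrite -[leLHS]addr0 lerD ?sqr_ge0 // ler_pXn2r ?nnegrE //.
  exact: le_trans h.
- by have [] := gamma_length t0 ad.
- exact: gamma_closed.
- exact: gamma_self_intersections.
- exact: gamma_unbounded_speed.
- move=> p pt; have m e : (\sum_i e i <= 4 * t - 1)%N ->
    \int[@lebesgue_measure R]_(s in `[0, 1]) mono e (gamma t theta s) = sphere_moment R 4 e.
    move=> et; apply: (gamma_moments t0 us ad).
    by apply: leq_ltn_trans et _; rewrite subn1 prednK.
  exact: (@Rintegral_polyfun_moments R 2 (gamma t theta) _ sigma p us cg m pt).
Qed.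

Local Close Scope complex_scope.

(** * Tchakaloff's theorem *)

Definition independent_on (R : realType) n (I : finType) (v : I -> 'rV[R]_n) (c : I -> R) :=
  forall l : I -> R, (forall i, c i = 0 -> l i = 0) -> \sum_i l i *: v i = 0 ->
  forall i, l i = 0.

(** Subtract a multiple of a dependency that has a positive coefficient: the least ratio [c j / l j]
    keeps all coefficients nonnegative and kills that of [j], so the support shrinks. *)
Lemma conic_reduction (R : realType) n (I : finType) (v : I -> 'rV[R]_n) (c : I -> R) :
  (forall i, 0 <= c i) ->
  exists c' : I -> R, [/\ forall i, 0 <= c' i, \sum_i c' i *: v i = \sum_i c i *: v i &
    independent_on v c'].
Proof.
move=> c0; have [k] := ubnP #|[set i | c i != 0%R]%SET|.
elim: k c c0 => // k IH c c0; rewrite ltnS => ck.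
have [ind|nind] := pselect (independent_on v c); first by exists c.
have [l [lc lv [i0 li0]]] : exists l : I -> R, [/\ forall i, c i = 0 -> l i = 0,
    \sum_i l i *: v i = 0 & exists i, 0 < l i].
  move/existsNP: nind => [l /not_implyP[lc /not_implyP[lv /existsNP[i /eqP li]]]].
  have [l0|l0] := ltP 0 (l i); first by exists l; split=> //; exists i.
  exists (fun i => - l i); split.
  - by move=> j /lc ->; rewrite oppr0.
  - by under eq_bigr do rewrite scaleNr; rewrite sumrN lv oppr0.
  - by exists i; rewrite oppr_gt0 lt_neqAle li.
case: (@arg_minP _ _ _ i0 (fun i => 0 < l i) (fun i => c i / l i) li0) => j lj jmin.
pose s := c j / l j; pose c2 i := c i - s * l i.
have cj : 0 < c j by rewrite lt_neqAle c0 andbT eq_sym; apply/eqP => /lc h; rewrite h ltxx in lj.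
have s0 : 0 < s by rewrite divr_gt0.
have c20 i : 0 <= c2 i.
  rewrite subr_ge0; have [li|li] := ltP 0 (l i); first by rewrite -ler_pdivlMr // jmin.
  by apply: le_trans (c0 i); rewrite mulr_ge0_le0 // ltW.
have [|c' [c'0 c'v c'ind]] := IH c2 c20.
  apply: leq_trans ck; apply: proper_card; apply/properP; split.
    apply/fintype.subsetP => i; rewrite !inE; apply: contraNN => /eqP ci.
    by rewrite /c2 ci lc // mulr0 subrr.
  exists j; rewrite inE; first by rewrite gt_eqF.
  by rewrite negbK /c2 /s divfK ?subrr // gt_eqF.
exists c'; split=> //; rewrite c'v.
rewrite (eq_bigr (fun i => c i *: v i - s *: (l i *: v i))); last first.
  by move=> i _; rewrite scalerA -scalerBl.
by rewrite sumrB -scaler_sumr lv scaler0 subr0.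
Qed.

Lemma independent_on_card (R : realType) n (I : finType) (v : I -> 'rV[R]_n) (c : I -> R) :
  independent_on v c -> (#|[set i | c i != 0%R]%SET| <= n)%N.
Proof.
move=> ind; set S := [set i | c i != 0]%SET.
pose A : 'M[R]_(#|S|, n) := \matrix_(k < #|S|) v (enum_val k).
suff rA : row_free A by rewrite -(eqP rA) rank_leq_col.
apply: inj_row_free => u uA.
have [S0|/set0Pn[x0 x0S]] := eqVneq S finset.set0.
  apply/rowP => k; have : (k < #|S|)%N := ltn_ord k.
  by rewrite [X in (_ < X)%N](_ : _ = 0%N) // S0 cards0.
pose l i := if i \in S then u 0 (enum_rank_in x0S i) else 0.
have l0 : forall i, l i = 0.
  apply: ind => [i ci|]; first by rewrite /l inE ci eqxx.
  rewrite (bigID (mem S)) /= [X in _ + X]big1 ?addr0; last by move=> i /negbTE iS; rewrite /l iS scale0r.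
  rewrite big_enum_val; apply: (etrans _ uA); rewrite mulmx_sum_row; apply: eq_bigr => k _.
  by rewrite /l enum_valP enum_valK_in rowK.
apply/rowP => k; rewrite mxE -(l0 (enum_val k)) /l enum_valP.
by rewrite enum_valK_in.
Qed.

Lemma conic_caratheodory (R : realType) n (I : finType) (v : I -> 'rV[R]_n) (c : I -> R) :
  (forall i, 0 <= c i) ->
  exists (k : nat) (s : 'I_k -> I) (c' : 'I_k -> R), [/\ (k <= n)%N, forall i, 0 < c' i,
    \sum_i c' i *: v (s i) = \sum_i c i *: v i & injective (fun i => v (s i))].
Proof.
move=> c0; have [c' [c'0 c'v ind]] := conic_reduction v c0.
set S := [set i | c' i != 0]%SET.
exists #|S|, (fun k => enum_val k), (fun k => c' (enum_val k)); split.
- exact: (independent_on_card ind).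
- by move=> k; have := enum_valP k; rewrite inE lt_neqAle c'0 andbT eq_sym.
- rewrite -c'v [RHS](bigID (mem S)) /= [X in _ = _ + X]big1 ?addr0; last first.
    by move=> i; rewrite inE negbK => /eqP ->; rewrite scale0r.
  by rewrite [RHS]big_enum_val.
- move=> k1 k2 vk; apply: enum_val_inj; apply/eqP; apply: contraT => k12.
  set a := enum_val k1 in vk k12 *; set b := enum_val k2 in vk k12 *.
  have ab : (b == a) = false by rewrite eq_sym (negbTE k12).
  have aS : a \in S := enum_valP k1; have bS : b \in S := enum_valP k2.
  have := ind (fun i => if i == a then 1 else if i == b then - 1 else 0).
  move=> /(_ _ _ a); rewrite eqxx => H.
  have : (1 : R) = 0.
    apply: H => [i ci|].
      have iS : i \notin S by rewrite inE ci eqxx.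
      by case: eqP => [ia|_]; [rewrite ia aS in iS|case: eqP => // ib; rewrite ib bS in iS].
    rewrite (bigD1 a) //= eqxx (bigD1 b) /= ?ab // eqxx big1 => [|i /andP[/negbTE -> /negbTE ->]].
      by rewrite scale1r scaleN1r vk addr0 subrr.
    by rewrite scale0r.
  by move=> /eqP; rewrite oner_eq0.
Qed.

(** First-order optimality: if a move by [s] in a direction never decreases the squared distance,
    the linear term, here [x], cannot be positive. *)
Lemma sqr_dist_direction (R : realType) (x B : R) : 0 <= B ->
  (forall s, 0 < s <= 1 -> 2 * s * x <= s ^+ 2 * B) -> x <= 0.
Proof.
move=> B0 H; rewrite leNgt; apply/negP => x0.
(* With this [s] one has [s * B <= x], against [2 * x <= s * B]. *)
pose s := x / (x + B + 1).
have d0 : 0 < x + B + 1 by lra.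
have s0 : 0 < s by rewrite divr_gt0.
have s1 : s <= 1 by rewrite ler_pdivrMr // mul1r; lra.
have := H s; rewrite s0 s1 => /(_ isT).
have sd : s * (x + B + 1) = x by rewrite /s divfK // gt_eqF.
move=> h; have {}h : 2 * x <= s * B.
  rewrite -(ler_pM2l s0) (_ : s * (2 * x) = 2 * s * x); last by ring.
  by rewrite (_ : s * (s * B) = s ^+ 2 * B); last by ring.
have sB : s * B <= x by rewrite -[leRHS]sd ler_pM2l //; lra.
lra.
Qed.

(** Combinations of exactly [n] points: by Caratheodory's theorem they exhaust the cone, and their
    parameters form a space of fixed dimension in which compactness can be used. *)
Definition cone_comb (R : realType) m n (Phi : 'rV[R]_m -> 'rV[R]_n) k
    (u : 'rV[R]_k * 'rV['rV[R]_m]_k) : 'rV[R]_n :=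
  \sum_i u.1 0 i *: Phi (u.2 0 i).

Lemma continuous_row_coord (T : topologicalType) k (i : 'I_k) :
  continuous (fun u : 'rV[T]_k => u 0 i).
Proof.
move=> u P uP; exists (fun _ j => if j == i then P else setT).
  by move=> a b; rewrite (ord1 a); case: eqP => [->//|_]; exact: filterT.
by move=> v /(_ 0 i); rewrite eqxx.
Qed.

Lemma cone_comb_exists (R : realType) m n (Phi : 'rV[R]_m -> 'rV[R]_n)
    (E : set 'rV[R]_m) (I : finType) (y : I -> 'rV[R]_m) (c : I -> R) :
  E !=set0 -> (forall i, E (y i)) -> (forall i, 0 <= c i) ->
  exists u : 'rV[R]_n * 'rV['rV[R]_m]_n,
    (forall i, 0 <= u.1 0 i /\ E (u.2 0 i)) /\ cone_comb Phi u = \sum_i c i *: Phi (y i).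
Proof.
move=> [y0 Ey0] Ey c0.
have [k [s [c' [kn c'0 c'v _]]]] := conic_caratheodory (fun i => Phi (y i)) c0.
(* Fewer than [n] points are padded with the weight 0 at [y0]. *)
pose G (i : nat) : R * 'rV[R]_m := if insub i is Some j then (c' j, y (s j)) else (0, y0).
exists (\row_i (G i).1, \row_i (G i).2); split.
  move=> i; rewrite !mxE /G; case: insubP => [j _ _|_] /=; last by split.
  by split; [exact: ltW|exact: Ey].
rewrite -c'v /cone_comb.
have -> : \sum_(i < k) c' i *: Phi (y (s i)) = \sum_(i < k) (G i).1 *: Phi (G i).2.
  by apply: eq_bigr => i _; rewrite /G valK.
rewrite (big_ord_widen n (fun i => (G i).1 *: Phi (G i).2) kn) [RHS]big_mkcond /=.
apply: eq_bigr => i _; rewrite !mxE; case: ifP => // ik.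
by rewrite /G insubF // scale0r.
Qed.

(* The nearest point of the cone to [M] exists by compactness, since by Caratheodory's
   theorem [n] points suffice; the residual is then a functional separating [M] from the
   cone. *)
Lemma tchakaloff (R : realType) m n (E : set 'rV[R]_m) (Phi : 'rV[R]_m -> 'rV[R]_n)
    (M : 'rV[R]_n) (j0 : 'I_n) :
  compact E -> E !=set0 -> continuous Phi -> (forall y, E y -> Phi y 0 j0 = 1) ->
  (forall a : 'rV[R]_n, (forall y, E y -> \sum_j a 0 j * Phi y 0 j <= 0) ->
    \sum_j a 0 j * M 0 j <= 0) ->
  exists (k : nat) (y : 'I_k -> 'rV[R]_m) (c : 'I_k -> R),
    [/\ (k <= n)%N, forall i, E (y i), forall i, 0 < c i,
      \sum_i c i *: Phi (y i) = M & injective (fun i => Phi (y i))].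
Proof.
move=> cE E0 cPhi Phi1 sep.
pose U := ('rV[R]_n * 'rV['rV[R]_m]_n)%type.
pose cone (u : U) := forall i, 0 <= u.1 0 i /\ E (u.2 0 i).
pose F (u : U) := \sum_j (cone_comb Phi u 0 j - M 0 j) ^+ 2.
pose Q := \sum_j M 0 j ^+ 2.
have Q0 : 0 <= Q by apply: sumr_ge0 => j _; exact: sqr_ge0.
(* Coordinate [j0] of a combination is the sum of its weights. A weight above [S] puts the
   combination farther from [M] than the origin, whose squared distance is [Q], so a minimum over
   weights in [[0, S]] is a minimum over the cone. *)
pose S := `|M 0 j0| + Q + 1.
have S0 : 0 <= S by rewrite !addr_ge0.
pose A1 : set 'rV[R]_n := [set c | forall i, `[0, S]%classic (c ord0 i)].
pose A2 : set 'rV['rV[R]_m]_n := [set y | forall i, E (y ord0 i)].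
pose A : set U := A1 `*` A2.
have cA : compact A.
  apply: compact_setX; first exact: (@rV_compact R n (fun=> `[0, S]%classic) (fun=> @segment_compact R 0 S)).
  by apply: (@rV_compact 'rV[R]_m n (fun=> E)).
have [y0 Ey0] := E0.
pose u0 : U := (0, \row_i y0).
have Au0 : A u0.
  by split=> i; rewrite mxE //= in_itvcc lexx.
have Fu0 : F u0 = Q.
  apply: eq_bigr => j _; rewrite /cone_comb big1; last by move=> i _; rewrite mxE scale0r.
  by rewrite mxE sub0r sqrrN.
have cF : continuous F.
  move=> u; apply: (@continuous_bigsum R U _ _ (fun j u => (cone_comb Phi u 0 j - M 0 j) ^+ 2)) => j.
  apply: continuous_exprn; apply: (@continuousB _ _ _ (fun u : U => cone_comb Phi u 0 j)); last exact: cvg_cst.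
  rewrite (_ : (fun u => _) = (fun u : U => \sum_i u.1 0 i * Phi (u.2 0 i) 0 j)); last first.
    apply/funext => w; rewrite /cone_comb summxE; apply: eq_bigr => i _; by rewrite mxE.
  apply: continuous_bigsum => i.
  apply: (@continuousM _ _ (fun u : U => u.1 0 i) (fun u : U => Phi (u.2 0 i) 0 j)).
    by apply: (continuous_comp (f := fst) (g := fun c : 'rV[R]_n => c 0 i)); [exact: cvg_fst|exact: continuous_row_coord].
  apply: (continuous_comp (f := fun u : U => u.2 0 i) (g := fun y => Phi y 0 j)).
    by apply: (continuous_comp (f := snd) (g := fun y : 'rV['rV[R]_m]_n => y 0 i)); [exact: cvg_snd|exact: continuous_row_coord].
  apply: (continuous_comp (f := Phi) (g := fun z => z 0 j)); first exact: cPhi.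
  exact: continuous_row_coord.
have [|u uA umin] := @compact_EVT_min U R F A _ cA (continuous_subspaceT cF); first by exists u0.
have {}uA : cone u.
  move: uA; rewrite inE => -[uA1 uA2] i; split; last exact: uA2.
  by have := uA1 i; rewrite /= in_itvcc => /andP[].
have {}umin w : cone w -> F u <= F w.
  move=> cw; have [Aw|nAw] := pselect (A w).
    by apply: umin; rewrite inE.
  have [i ci] : exists i, S < w.1 0 i.
    apply: contra_notP nAw => /forallNP h; split=> i; last exact: (cw i).2.
    by rewrite /= in_itvcc (cw i).1 leNgt; apply/negP; exact: h.
  apply: (@le_trans _ _ Q); first by rewrite -Fu0; apply: umin; rewrite inE.
  rewrite /F (bigD1 j0) //= -[leLHS]addr0 lerD //; last first.
    by apply: sumr_ge0 => j _; exact: sqr_ge0.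
  have -> : cone_comb Phi w 0 j0 = \sum_i w.1 0 i.
    rewrite /cone_comb summxE; apply: eq_bigr => l _.
    by rewrite mxE Phi1 ?mulr1 //; exact: (cw l).2.
  have h : Q + 1 <= \sum_i w.1 0 i - M 0 j0.
    rewrite (bigD1 i) //=; have : 0 <= \sum_(i0 | i0 != i) w.1 0 i0.
      by apply: sumr_ge0 => l _; exact: (cw l).1.
    have := ler_norm (M 0 j0); rewrite /S in ci; lra.
  apply: (@le_trans _ _ ((Q + 1) ^+ 2)); first by rewrite expr2; nra.
  by rewrite !expr2 ler_pM //; lra.
pose p := cone_comb Phi u; pose a := M - p.
(* The residual [a] has nonpositive product with every direction that stays in the cone. Such
   directions are [Phi y], by adding weight at [y], and [- p], by shrinking all weights; together
   they force [a = 0]. *)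
have dir (w : 'rV[R]_n) : (forall s, 0 < s <= 1 ->
    exists v : U, cone v /\ cone_comb Phi v = p + s *: w) -> \sum_j a 0 j * w 0 j <= 0.
  move=> H; apply: (@sqr_dist_direction _ _ (\sum_j w 0 j ^+ 2)).
    by apply: sumr_ge0 => j _; exact: sqr_ge0.
  move=> s /H[v [cv vE]]; have := umin v cv.
  have -> : F v = F u + (s ^+ 2 * (\sum_j w 0 j ^+ 2) - 2 * s * \sum_j a 0 j * w 0 j).
    rewrite /F vE !mulr_sumr -sumrB -big_split /=; apply: eq_bigr => j _.
    by rewrite -/p !mxE; ring.
  by rewrite lerDl subr_ge0.
have aPhi y : E y -> \sum_j a 0 j * Phi y 0 j <= 0.
  move=> Ey; apply: dir => s /andP[s0 _].
  have [||v [cv vE]] := @cone_comb_exists R m n Phi E (option 'I_n)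
    (fun o => if o is Some i then u.2 0 i else y) (fun o => if o is Some i then u.1 0 i else s) E0.
  - by case=> [i|] //; exact: (uA i).2.
  - by case=> [i|]; [exact: (uA i).1|exact: ltW].
  exists v; split=> //; rewrite vE.
  rewrite (bigD1 None) //= addrC; congr (_ + _).
  by rewrite (reindex_omap (@Some 'I_n) id) => [|[]//]; apply: eq_bigl => i; rewrite eqxx.
have ap : \sum_j a 0 j * (- p) 0 j <= 0.
  apply: dir => s /andP[s0 s1].
  have [||v [cv vE]] := @cone_comb_exists R m n Phi E 'I_n
    (fun i => u.2 0 i) (fun i => (1 - s) * u.1 0 i) E0.
  - by move=> i; exact: (uA i).2.
  - by move=> i; rewrite mulr_ge0 ?subr_ge0 //; exact: (uA i).1.
  exists v; split=> //; rewrite vE.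
  under eq_bigr do rewrite -scalerA; rewrite -scaler_sumr -/p scalerBl scale1r scalerN //.
have aM := sep a aPhi.
have aa : \sum_j a 0 j ^+ 2 <= 0.
  have -> : \sum_j a 0 j ^+ 2 = \sum_j a 0 j * M 0 j + \sum_j a 0 j * (- p) 0 j.
    by rewrite -big_split /=; apply: eq_bigr => j _; rewrite !mxE; ring.
  by rewrite -[leRHS]addr0 lerD.
have a0 : a = 0.
  apply/rowP => j; rewrite [RHS]mxE; apply/eqP; rewrite -sqrf_eq0.
  have : \sum_j a 0 j ^+ 2 == 0.
    by rewrite eq_le aa sumr_ge0 // => i _; exact: sqr_ge0.
  by rewrite psumr_eq0 => [/allP/(_ j (mem_index_enum _))|i _]; last exact: sqr_ge0.
have pM : p = M by apply/eqP; rewrite eq_sym -subr_eq0 -/a a0.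
have [k [s [c' [kn c'0 c'v inj]]]] := @conic_caratheodory R n _ (fun i => Phi (u.2 0 i))
  (fun i => u.1 0 i) (fun i => (uA i).1).
exists k, (fun i => u.2 0 (s i)), c'; split=> //.
- by move=> i; exact: (uA _).2.
- by rewrite c'v -pM.
Qed.

(** * Nodes on the equator *)

Definition equator (R : realType) n : set 'rV[R]_n.+1 :=
  [set y | sphere n y /\ y 0 ord_max = 0].

Lemma sphere_continuous_sum (R : realType) n :
  continuous (fun x : 'rV[R]_n.+1 => \sum_i x 0 i ^+ 2).
Proof.
move=> x; apply: continuous_bigsum => i; apply: (continuous_exprn (f := fun x : 'rV[R]_n.+1 => x 0 i)).
exact: continuous_row_coord.
Qed.

Lemma equator_compact (R : realType) n : compact (@equator R n).
Proof.
pose A : set 'rV[R]_n.+1 := [set x | forall i, `[-1, 1]%classic (x ord0 i)].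
have cA : compact A by exact: (@rV_compact R n.+1 (fun=> `[-1, 1]%classic) (fun=> @segment_compact R (-1) 1)).
apply: subclosed_compact cA _.
  have -> : @equator R n = (fun x : 'rV[R]_n.+1 => \sum_i x 0 i ^+ 2) @^-1` [set 1] `&`
      (fun x : 'rV[R]_n.+1 => x 0 ord_max) @^-1` [set 0].
    by apply/seteqP; split=> x /= [/sphere_sum h1 h2].
  apply: closedI.
    by apply: closed_comp (@closed_eq R 1) => x _; exact: sphere_continuous_sum.
  by apply: closed_comp (@closed_eq R 0) => x _; exact: continuous_row_coord.
move=> y [sy _] i; rewrite /= in_itvcc -ler_norml.
exact: sphere_coord_le1.
Qed.

Lemma equator_nonempty (R : realType) n : (0 < n)%N -> (@equator R n) !=set0.
Proof.
move=> n0; exists (delta_mx 0 ord0); split; last first.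
  by rewrite mxE eqxx /=; case: eqP => [/(congr1 val) /= h|//]; rewrite h in n0.
apply/sphere_sum; rewrite (bigD1 ord0) //= mxE !eqxx expr1n big1 ?addr0 //.
by move=> i /negbTE i0; rewrite mxE i0 andbF expr0n.
Qed.

(** [f] gives the first [q] exponents and the next one fills the degree up to [N]. The subtraction
    is truncated, so the degree is [N] only if the sum of [f] is at most [N]. *)
Definition expo q N (f : {ffun 'I_q -> 'I_N.+1}) (i : 'I_q.+2) : nat :=
  if insub (val i) is Some j then f j
  else if val i == q then (N - \sum_j f j)%N else 0%N.

Lemma expo_max q N (f : {ffun 'I_q -> 'I_N.+1}) : expo f ord_max = 0%N.
Proof. by rewrite /expo insubF /= ?(gtn_eqF (ltnSn q)) // ltnNge leqnSn. Qed.

Lemma sum_expo q N (f : {ffun 'I_q -> 'I_N.+1}) : (\sum_j f j <= N)%N -> (\sum_i expo f i = N)%N.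
Proof.
move=> fN; rewrite big_ord_recr /= expo_max addn0 big_ord_recr /=.
rewrite [X in (_ + X)%N]/expo insubF /= ?ltnn // eqxx.
rewrite (eq_bigr (fun j : 'I_q => f j : nat)) ?subnKC //.
by move=> j _; rewrite /expo /= (valK j).
Qed.

Lemma expo_surj q N (e : 'I_q.+2 -> nat) : e ord_max = 0%N -> (\sum_i e i = N)%N ->
  exists2 f : {ffun 'I_q -> 'I_N.+1}, (\sum_j f j <= N)%N & expo f = e.
Proof.
move=> em eN; pose w (j : 'I_q) : 'I_q.+2 := widen_ord (leqnSn _) (widen_ord (leqnSn _) j).
have eN' : (\sum_j e (w j) + e (widen_ord (leqnSn _) ord_max) = N)%N.
  by rewrite -eN big_ord_recr /= em addn0 big_ord_recr.
have ej j : (e (w j) < N.+1)%N.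
  by rewrite ltnS -eN' (bigD1 j) //= -addnA leq_addr.
pose f : {ffun 'I_q -> 'I_N.+1} := [ffun j => Ordinal (ej j)].
have fs : (\sum_j f j = \sum_j e (w j))%N by apply: eq_bigr => j _; rewrite ffunE.
exists f; first by rewrite fs -eN' leq_addr.
apply/funext => i; rewrite /expo; case: insubP => [j jq jE|].
  by rewrite ffunE /=; congr e; apply: val_inj.
rewrite -leqNgt leq_eqVlt => /orP[/eqP iq|iq].
  rewrite -iq eqxx fs -eN' addKn; congr e; apply: val_inj; exact: iq.
rewrite gtn_eqF // -em; congr e; apply: val_inj => /=; apply/eqP.
by rewrite eqn_leq iq -ltnS ltn_ord.
Qed.

(** [None] stands for a function that is 1 on the equator. Admitting all maps from ['I_q] to
    ['I_N.+1], including those of too large a sum, makes the cardinality, and with it the bound on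
    the number of nodes, explicit. *)
Definition node_index q N := option {ffun 'I_q -> 'I_N.+1}.

Lemma card_node_index q N : #|{: node_index q N}| = (N.+1 ^ q).+1.
Proof. by rewrite card_option card_ffun !card_ord. Qed.

(* Homogeneous of degree [m.*2] on the first [q.+1] coordinates. *)
Definition moment_fun (R : realType) q m (o : node_index q m.*2) (x : 'rV[R]_q.+2) : R :=
  if o is Some f then (if (\sum_j f j <= m.*2)%N then mono (expo f) x else 0)
  else (1 - x 0 ord_max ^+ 2) ^+ m.

Lemma moment_fun_continuous (R : realType) q m (o : node_index q m.*2) :
  continuous (@moment_fun R q m o).
Proof.
move=> x; case: o => [f|] /=; last first.
  apply: (continuous_exprn (f := fun x : 'rV[R]_q.+2 => 1 - x 0 ord_max ^+ 2)).
  have c2 : {for x, continuous (fun x : 'rV[R]_q.+2 => x 0 ord_max ^+ 2)}.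
    by apply: (continuous_exprn (f := fun x : 'rV[R]_q.+2 => x 0 ord_max)); exact: continuous_row_coord.
  exact: (cvgB (cvg_cst _) c2).
have [fm|fm] := boolP (\sum_j f j <= m.*2)%N.
  have -> : moment_fun (Some f) = @mono R _ (expo f) by apply/funext => z; rewrite /= fm.
  exact: continuous_mono.
have -> : moment_fun (Some f) = (fun=> 0 : R) by apply/funext => z; rewrite /= (negbTE fm).
exact: cst_continuous.
Qed.

Lemma moment_fun_le1 (R : realType) q m (o : node_index q m.*2) (x : 'rV[R]_q.+2) :
  sphere q.+1 x -> `|moment_fun o x| <= 1.
Proof.
move=> sx; case: o => [f|] /=.
  by case: ifP => _; [exact: sphere_mono_le1|rewrite normr0].
have := sphere_coord_le1 ord_max sx; rewrite -(@ler_pXn2r _ 2) ?nnegrE // expr1n real_normK ?num_real // => h.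
have h0 : 0 <= x 0 ord_max ^+ 2 by exact: sqr_ge0.
rewrite normrX exprn_ile1 // ger0_norm; lra.
Qed.

Lemma equatorial_id n (e : 'I_n.+1 -> nat) : e ord_max = 0%N -> equatorial e = e.
Proof. by move=> e0; apply/funext => i; rewrite /equatorial; case: eqP => [->|]. Qed.

(** Apart from its last coordinate, a point of the sphere is a point of the equator shrunk by [r],
    and all the moment functions scale by [r ^ m.*2]. At a pole [r = 0] and any [y] serves. *)
Lemma moment_fun_homog (R : realType) q m (x : 'rV[R]_q.+2) :
  sphere q.+1 x -> exists (k : R) (y : 'rV[R]_q.+2), [/\ 0 <= k, equator y &
    forall o, moment_fun o x = k * @moment_fun R q m o y].
Proof.
move=> sx; pose r := Num.sqrt (1 - x 0 ord_max ^+ 2).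
have xs : 1 - x 0 ord_max ^+ 2 = \sum_(i | i != ord_max) x 0 i ^+ 2.
  by have /sphere_sum := sx; rewrite (bigD1 ord_max) //= => <-; ring.
have xs0 : 0 <= 1 - x 0 ord_max ^+ 2 by rewrite xs sumr_ge0 // => i _; exact: sqr_ge0.
have r2 : r ^+ 2 = 1 - x 0 ord_max ^+ 2 by rewrite sqr_sqrtr.
have [y [[sy y0] xy]] : exists y : 'rV[R]_q.+2, equator y /\
    forall i, i != ord_max -> x 0 i = r * y 0 i.
  have [r0|rn0] := eqVneq r 0.
    have [y Ey] := @equator_nonempty R q.+1 isT; exists y; split=> // i im.
    move: r2; rewrite r0 expr0n /= xs => /esym/eqP; rewrite psumr_eq0; last by move=> j _; exact: sqr_ge0.
    by move=> /allP/(_ i (mem_index_enum _)); rewrite im /= sqrf_eq0 mul0r => /eqP.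
  exists (\row_i (if i == ord_max then 0 else x 0 i / r)); split; last first.
    by move=> i im; rewrite mxE (negbTE im) mulrC divfK.
  split; last by rewrite mxE eqxx.
  apply/sphere_sum; rewrite (bigD1 ord_max) //= mxE eqxx expr0n /= add0r.
  rewrite (eq_bigr (fun i => r ^- 2 * x 0 i ^+ 2)); last first.
    by move=> i /negbTE im; rewrite mxE im expr_div_n mulrC.
  by rewrite -mulr_sumr -xs -r2 mulVf // expf_neq0.
exists (r ^+ m.*2), y; split=> //; first by rewrite exprn_ge0 // sqrtr_ge0.
case=> [f|] /=; last by rewrite y0 expr0n /= subr0 expr1n mulr1 -r2 -exprM mul2n.
case: ifP => [fm|_]; last by rewrite mulr0.
rewrite (@mono_suspension R q.+1 _ r (x 0 ord_max) y x) // equatorial_id ?expo_max //.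
by rewrite sum_expo // expr0 mulr1.
Qed.

Lemma moment_fun_integrable (R : realType) q m (o : node_index q m.*2)
    (sigma : probability (borelRn R q.+2) R) :
  sigma.-integrable (sphere q.+1) (EFin \o moment_fun o).
Proof.
apply: (@sphere_integrable R q.+1 sigma _ 1); first exact: moment_fun_continuous.
by move=> x; exact: moment_fun_le1.
Qed.

(** The integrand dominates the power [m.*2] of the first coordinate, whose moment is positive by
    the closed formula. *)
Lemma moment_mass_gt0 (R : realType) q m (sigma : probability (borelRn R q.+2) R) :
  uniform_on_sphere sigma -> 0 < \int[sigma]_(x in sphere q.+1) @moment_fun R q m None x.
Proof.
move=> us; pose e (i : 'I_q.+2) := if i == ord0 then m.*2 else 0%N.
have em : e ord_max = 0%N by rewrite /e.
have sm : 0 < sphere_moment R q.+2 e.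
  rewrite /sphere_moment divr_gt0 // ltr0n ?rho_gt0 //.
  apply: prodn_gt0 => i; rewrite /e; case: eqP => _ //; exact: gauss_moment_gt0.
apply: lt_le_trans sm _; rewrite -(sphere_moments us).
apply: le_Rintegral.
- exact: (@measurable_sphere R q.+1).
- apply: (@sphere_integrable R q.+1 sigma _ 1); first exact: continuous_mono.
  by move=> x; exact: sphere_mono_le1.
- exact: moment_fun_integrable.
move=> x sx; have [k [y [k0 [sy y0] xy]]] := moment_fun_homog m sx.
have -> : mono e x = x 0 ord0 ^+ m.*2.
  rewrite /mono (bigD1 ord0) //= big1 ?mulr1; first by rewrite /e eqxx.
  by move=> i /negbTE i0; rewrite /e i0 expr0.
have -> : x 0 ord0 ^+ m.*2 = (x 0 ord0 ^+ 2) ^+ m by rewrite -exprM mul2n.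
apply: lerXn2r; rewrite ?nnegrE ?sqr_ge0 //; last first.
  have /sphere_sum := sx; rewrite (bigD1 ord_max) //= (bigD1 ord0) //= => h.
  rewrite -h lerBrDl lerD2l lerDl sumr_ge0 // => i _; exact: sqr_ge0.
have /sphere_sum := sx; rewrite (bigD1 ord_max) //= => h.
by rewrite -h addrAC subrr add0r sumr_ge0 // => i _; exact: sqr_ge0.
Qed.

(** No measure on the equator is at hand: Tchakaloff's theorem is applied to integration over the
    whole sphere, normalized by the function [None]. A combination that is nonpositive on the
    equator is nonpositive on the sphere by homogeneity. *)
Lemma equatorial_nodes (R : realType) q m (sigma : probability (borelRn R q.+2) R) :
  uniform_on_sphere sigma ->
  exists (k : nat) (y : 'I_k -> 'rV[R]_q.+2) (c : 'I_k -> R),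
    [/\ (k <= (m.*2.+1 ^ q).+1)%N, forall i, equator (y i), forall i, 0 < c i,
      forall o, \sum_i c i * moment_fun o (y i) =
        (\int[sigma]_(x in sphere q.+1) @moment_fun R q m o x) /
        \int[sigma]_(x in sphere q.+1) @moment_fun R q m None x &
      forall i j, (forall o, @moment_fun R q m o (y i) = moment_fun o (y j)) -> i = j].
Proof.
move=> us; have B0 := @moment_mass_gt0 R q m sigma us.
set B := \int[sigma]_(x in sphere q.+1) @moment_fun R q m None x in B0 *.
pose n := #|{: node_index q m.*2}|.
pose Phi (y : 'rV[R]_q.+2) : 'rV[R]_n := \row_j moment_fun (enum_val j) y.
pose M : 'rV[R]_n := \row_j ((\int[sigma]_(x in sphere q.+1) moment_fun (enum_val j) x) / B).
pose j0 : 'I_n := enum_rank None.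
have cPhi : continuous Phi.
  apply: continuous_row => j; rewrite (_ : (fun s => _) = moment_fun (enum_val j)); last first.
    by apply/funext => y; rewrite mxE.
  exact: moment_fun_continuous.
have Phi1 y : equator y -> Phi y 0 j0 = 1.
  by move=> [_ y0]; rewrite mxE enum_rankK /= y0 expr0n /= subr0 expr1n.
have sep (a : 'rV[R]_n) : (forall y, equator y -> \sum_j a 0 j * Phi y 0 j <= 0) ->
    \sum_j a 0 j * M 0 j <= 0.
  move=> H; have [ii ie] := @Rintegral_sum R _ _ sigma (sphere q.+1) n
    (fun j x => moment_fun (enum_val j) x) (fun j => a 0 j) (@measurable_sphere R q.+1)
    (fun j => moment_fun_integrable (enum_val j) sigma).
  have -> : \sum_j a 0 j * M 0 j = (\sum_j a 0 j * \int[sigma]_(x in sphere q.+1) moment_fun (enum_val j) x) / B.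
    by rewrite mulr_suml; apply: eq_bigr => j _; rewrite mxE mulrA.
  rewrite -ie pmulr_lle0 ?invr_gt0 //.
  have E := RintegralZl (-1) (@measurable_sphere R q.+1) ii.
  rewrite -oppr_ge0 -mulN1r -E; apply: Rintegral_ge0 => x sx.
  have [k [y [k0 Ey xy]]] := moment_fun_homog m sx.
  rewrite mulN1r oppr_ge0 (eq_bigr (fun j => k * (a 0 j * Phi y 0 j))); last first.
    by move=> j _; rewrite mxE xy; ring.
  by rewrite -mulr_sumr mulr_ge0_le0 // H.
have [k [y [c [kn Ey c0 cM inj]]]] := tchakaloff (@equator_compact R q.+1)
  (@equator_nonempty R q.+1 isT) cPhi Phi1 sep.
exists k, y, c; split=> //.
- by rewrite -card_node_index.
- move=> o; have := congr1 (fun z : 'rV[R]_n => z 0 (enum_rank o)) cM.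
  by rewrite summxE mxE enum_rankK => <-; apply: eq_bigr => i _; rewrite !mxE enum_rankK.
- move=> i j ij; apply: inj; apply/rowP => l; by rewrite !mxE ij.
Qed.

Lemma mono_opp (R : realType) n (e : 'I_n -> nat) (y : 'rV[R]_n) :
  mono e (- y) = (-1) ^+ (\sum_i e i) * mono e y.
Proof.
rewrite /mono -prodrXr -big_split /=; apply: eq_bigr => i _.
by rewrite mxE -[- y 0 i]mulN1r exprMn.
Qed.

(** Exactness in the top degree [m.*2] descends to the lower even degrees because the squares of the
    coordinates add up to 1 on the equator; the antipodal average kills the odd degrees. The moment
    functions separate the nodes and are even, so no two nodes agree up to sign. *)
Lemma equatorial_design (R : realType) q m (sigma : probability (borelRn R q.+2) R) :
  uniform_on_sphere sigma ->
  exists (k : nat) (y : 'I_k -> 'rV[R]_q.+2) (c : 'I_k -> R),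
    [/\ (0 < k <= (m.*2.+1 ^ q).+1)%N, forall i, equator (y i), forall i, 0 < c i,
      forall e, e ord_max = 0%N -> (\sum_i e i <= m.*2)%N ->
        \sum_i c i / 2 * (mono e (y i) + mono e (- y i)) = sphere_moment R q.+1 e &
      forall i j, y i = y j \/ y i = - y j -> i = j].
Proof.
move=> us; have [k [y [c [kn Ey c0 cM inj]]]] := @equatorial_nodes R q m sigma us.
have B0 := @moment_mass_gt0 R q m sigma us.
set B := \int[sigma]_(x in sphere q.+1) @moment_fun R q m None x in B0 cM.
pose mu e := \sum_i c i * mono e (y i).
have Bn0 : B != 0 by rewrite gt_eqF.
have csum : \sum_i c i = 1.
  have := cM None; rewrite -/B divff // => <-; apply: eq_bigr => i _.
  by have [_ y0] := Ey i; rewrite /= y0 expr0n /= subr0 expr1n mulr1.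
(* A priori the node sums are the moments of the equator up to this common factor; degree 0 shows
   that it is 1. *)
pose C := (rho q.+1 m.*2)%:R / (rho q.+2 m.*2)%:R / B.
have rn0 n p : (rho n.+1 p)%:R != 0 :> R by rewrite pnatr_eq0 -lt0n rho_gt0.
have key p : forall e, e ord_max = 0%N -> (\sum_i e i + p.*2 = m.*2)%N ->
    mu e = C * sphere_moment R q.+1 e.
  elim: p => [|p IH] e em.
    rewrite addn0 => eN; have [f fN fe] := expo_surj em eN.
    have := cM (Some f); rewrite /= fN fe => E.
    rewrite /mu E (sphere_moments us) /sphere_moment eN /C.
    by field; rewrite !rn0 Bn0.
  rewrite doubleS !addnS => eN.
  have -> : mu e = \sum_(j | j != ord_max) mu (bump2 e j).
    rewrite /mu exchange_big /=; apply: eq_bigr => i _.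
    have [/sphere_sum sy y0] := Ey i.
    rewrite (eq_bigr (fun j => y i 0 j ^+ 2 * (c i * mono e (y i)))); last first.
      by move=> j _; rewrite mono_bump2; ring.
    rewrite -mulr_suml; have : \sum_(j | j != ord_max) y i 0 j ^+ 2 = 1.
      by rewrite -sy [in RHS](bigD1 ord_max) //= y0 expr0n /= add0r.
    by move=> ->; rewrite mul1r.
  rewrite (eq_bigr (fun j => C * sphere_moment R q.+1 (bump2 e j))); last first.
    move=> j jm; apply: IH; first by rewrite /bump2 em eq_sym (negbTE jm).
    by rewrite sum_bump2 !addSn.
  rewrite -mulr_sumr; congr (_ * _).
  rewrite (eq_bigr (fun j => (e j).+1%:R * (sphere_moment R q.+1 e / (q.+1 + \sum_i e i)%:R))); last first.
    by move=> j _; rewrite sphere_moment_bump2; ring.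
  rewrite -mulr_suml -natr_sum.
  have -> : (\sum_(j | j != ord_max) (e j).+1 = q.+1 + \sum_i e i)%N.
    rewrite [in RHS](bigD1 ord_max) //= em add0n.
    rewrite (eq_bigr (fun j => 1 + e j)%N); last by move=> j _; rewrite add1n.
    by rewrite big_split /= sum1_card cardC1 card_ord.
  by rewrite mulrCA divff ?mulr1 // pnatr_eq0.
have C1 : C = 1.
  have := key m (fun=> 0%N) erefl; rewrite sum_nat_const muln0 add0n => /(_ erefl).
  rewrite /mu /sphere_moment sum_nat_const muln0 /= big1_eq divr1 mulr1 => <-.
  rewrite -csum; apply: eq_bigr => i _; rewrite /mono big1 ?mulr1 //.
exists k, y, c; split=> //.
- rewrite kn andbT lt0n; apply/eqP => k0; move: csum; move: y c {kn Ey c0 cM inj mu key}.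
  by rewrite k0 => y c; rewrite big_ord0 => /eqP; rewrite eq_sym oner_eq0.
- move=> e em eN; have [oe|ee] := boolP (odd (\sum_i e i)).
    rewrite big1; last by move=> i _; rewrite mono_opp -signr_odd oe expr1; ring.
    have [i oi] : exists i, odd (e i).

      apply: contrapT => /forallNP H; move: oe; apply/negP.
      elim/big_ind: _ => // [a b|i _]; first by rewrite oddD => /negbTE -> /negbTE ->.
      by apply/negP; exact: H.
    by rewrite (sphere_moment_odd R q.+1 oi).
  rewrite -[RHS]mul1r -[X in X * sphere_moment _ _ _]C1 -(key (m - (\sum_i e i)./2)%N) //; last first.
    by rewrite doubleB even_halfK // subnKC.
  by apply: eq_bigr => i _; rewrite mono_opp -signr_odd (negbTE ee) expr0; field.
- move=> i j ij; apply: inj => -[f|] /=.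
    case: ifP => // fN; case: ij => -> //.
    by rewrite mono_opp sum_expo // -signr_odd odd_double expr0 mul1r.
  by have [_ ->] := Ey i; have [_ ->] := Ey j.
Qed.

(** * Twisted meridians *)

Definition lat_fun (R : realType) (p b : nat) (r : R) : R :=
  sin (pi * r) ^+ p * (- cos (pi * r)) ^+ b.

Definition lat_integral (R : realType) (p b : nat) : R :=
  \int[@lebesgue_measure R]_(r in `[0, 1]) lat_fun p b r.

Lemma sinpi_is_derive (R : realType) (r : R) :
  is_derive r 1 (fun r => sin (pi * r)) (pi * cos (pi * r)).
Proof.
have D1 := is_deriveM (is_derive_cst (pi : R) r 1) (is_derive_id r 1).
have D2 := @is_derive1_comp R (@sin R) _ r _ _ (is_derive_sin _) D1.
by apply: is_derive_eq D2 _; rewrite /GRing.scale /=; ring.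
Qed.

Lemma cospi_is_derive (R : realType) (r : R) :
  is_derive r 1 (fun r => - cos (pi * r)) (pi * sin (pi * r)).
Proof.
have D1 := is_deriveM (is_derive_cst (pi : R) r 1) (is_derive_id r 1).
have D2 := is_deriveN (@is_derive1_comp R (@cos R) _ r _ _ (is_derive_cos _) D1).
by apply: is_derive_eq D2 _; rewrite /GRing.scale /=; ring.
Qed.

Lemma is_derive_continuous_at (R : realType) (f : R -> R) (x d : R) :
  is_derive x 1 f d -> {for x, continuous f}.
Proof. by move=> [df _]; apply: differentiable_continuous; apply/derivable1_diffP. Qed.

Lemma lat_fun_continuous (R : realType) p b : continuous (@lat_fun R p b).
Proof.
move=> r; apply: cvgM.
  apply: (continuous_exprn (f := fun r => sin (pi * r))).
  exact: is_derive_continuous_at (sinpi_is_derive r).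
apply: (continuous_exprn (f := fun r => - cos (pi * r))).
exact: is_derive_continuous_at (cospi_is_derive r).
Qed.

Lemma lat_fun_integrable (R : realType) p b :
  (@lebesgue_measure R).-integrable `[0, 1] (EFin \o lat_fun p b).
Proof. by apply: integrable_within01; apply: continuous_subspaceT; exact: lat_fun_continuous. Qed.

Lemma lat_integral_parts (R : realType) p b :
  p.+1%:R * lat_integral R p b.+1 = b%:R * lat_integral R p.+2 b.-1.
Proof.
pose f (r : R) := (pi * b%:R) * lat_fun p.+2 b.-1 r + (- (pi * p.+1%:R)) * lat_fun p b.+1 r.
pose F (r : R) : R := lat_fun p.+1 b r.
have [fi fE] := Rintegral_lincomb (pi * b%:R) (- (pi * p.+1%:R))
  (@lat_fun_integrable R p.+2 b.-1) (@lat_fun_integrable R p b.+1).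
have cF : {within `[0, 1], continuous F} by apply: continuous_subspaceT; exact: lat_fun_continuous.
have cf (r : R) : r \in `]0, 1[%R -> r \notin [::] -> {for r, continuous f}.
  by move=> _ _; apply: cvgD; apply: cvgM; try exact: cvg_cst; exact: lat_fun_continuous.
have df (r : R) : r \in `]0, 1[%R -> r \notin [::] -> is_derive r 1 F (f r).
  move=> _ _; have D1 := is_derive_exprn p.+1 (sinpi_is_derive r).
  have D2 := is_derive_exprn b (cospi_is_derive r).
  apply: is_derive_eq (is_deriveM D1 D2) _.
  by rewrite /f /lat_fun /= !exprS /GRing.scale /=; ring.
have := RFTC2_off_seq ler01 fi cF cf df.
have F0 : F 0 = 0 by rewrite /F /lat_fun mulr0 sin0 expr0n /= mul0r.
have F1 : F 1 = 0 by rewrite /F /lat_fun mulr1 sinpi expr0n /= mul0r.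
rewrite F0 F1 subrr => E; have := etrans (esym fE) E.
rewrite -/(lat_integral R p.+2 b.-1) -/(lat_integral R p b.+1) => H.
by apply: (mulfI (lt0r_neq0 (@pi_gt0 R))); move: (lat_integral R _ _) (lat_integral R _ _) H => A B H; lra.
Qed.

Lemma lat_integral_sum (R : realType) p b :
  lat_integral R p.+2 b + lat_integral R p b.+2 = lat_integral R p b.
Proof.
have [_] := Rintegral_lincomb 1 1 (@lat_fun_integrable R p.+2 b) (@lat_fun_integrable R p b.+2).
rewrite !mul1r => <-; apply: eq_Rintegral => r _; rewrite !mul1r /lat_fun !exprS.
transitivity ((cos (pi * r) ^+ 2 + sin (pi * r) ^+ 2) * (sin (pi * r) ^+ p * (- cos (pi * r)) ^+ b)).
  by ring.
by rewrite cos2Dsin2 mul1r.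
Qed.

Lemma lat_integral_gt0 (R : realType) p : 0 < lat_integral R p 0.
Proof.
suff [] : 0 < lat_integral R p 0 /\ 0 < lat_integral R p.+1 0 by [].
elim: p => [|p [p0 p1]]; last first.
  split=> //; have := @lat_integral_parts R p 1; have := @lat_integral_sum R p 0; rewrite mul1r /=.
  move: (lat_integral R p 0) (lat_integral R p.+2 0) (lat_integral R p 2) p0 => A B C A0 h1 h2.
  have : (p.+2%:R) * B = p.+1%:R * A by rewrite -h1 mulrDr h2 -[p.+2%:R]natr1; ring.
  by move=> h; rewrite -(@pmulr_rgt0 _ p.+2%:R) // h mulr_gt0.
split.
  have c1 : {within `[0, 1], continuous (id : R -> R)}.
    by apply: continuous_subspaceT => x; exact: cvg_id.
  have cf (x : R) : x \in `]0, 1[%R -> x \notin [::] -> {for x, continuous (@lat_fun R 0 0)}.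
    by move=> _ _; exact: lat_fun_continuous.
  have df (x : R) : x \in `]0, 1[%R -> x \notin [::] -> is_derive x 1 (id : R -> R) (lat_fun 0 0 x).
    by move=> _ _; rewrite /lat_fun !expr0 mulr1; exact: is_derive_id.
  rewrite (_ : lat_integral R 0 0 = 1) //.
  by apply: (etrans (RFTC2_off_seq ler01 (@lat_fun_integrable R 0 0) c1 cf df)); rewrite subr0.
pose F (r : R) := pi^-1 * - cos (pi * r).
have cF : {within `[0, 1], continuous F}.
  apply: continuous_subspaceT => x; apply: cvgM; first exact: cvg_cst.
  exact: is_derive_continuous_at (cospi_is_derive x).
have cf (x : R) : x \in `]0, 1[%R -> x \notin [::] -> {for x, continuous (@lat_fun R 1 0)}.
  by move=> _ _; exact: lat_fun_continuous.
have pi0 : pi != 0 :> R by rewrite gt_eqF // pi_gt0.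
have df (x : R) : x \in `]0, 1[%R -> x \notin [::] -> is_derive x 1 F (lat_fun 1 0 x).
  move=> _ _; apply: is_derive_eq (is_deriveM (is_derive_cst (pi^-1 : R) x 1) (cospi_is_derive x)) _.
  by rewrite /GRing.scale /lat_fun /= expr1 expr0 mulr1 mulr0 addr0 mulKf.
rewrite (_ : lat_integral R 1 0 = 2 / pi) ?divr_gt0 ?pi_gt0 //.
apply: (etrans (RFTC2_off_seq ler01 (@lat_fun_integrable R 1 0) cF cf df)).
by rewrite /F mulr1 mulr0 cos0 cospi opprK; ring.
Qed.

(** The affine substitution is made for increasing maps, so the reflection is done on the primitive
    [- F (1 - r)]. *)
Lemma Rintegral_reflect (R : realType) (f : R -> R) : continuous f ->
  \int[@lebesgue_measure R]_(r in `[0, 1]) f (1 - r) =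
  \int[@lebesgue_measure R]_(r in `[0, 1]) f r.
Proof.
move=> cf; have fi : (@lebesgue_measure R).-integrable `[0, 1] (EFin \o f).
  by apply: integrable_within01; exact: continuous_subspaceT.
have cr : continuous (fun r : R => f (1 - r)).
  move=> r; apply: (continuous_comp (f := fun r : R => 1 - r)); last exact: cf.
  by apply: cvgB; [exact: cvg_cst|exact: cvg_id].
have fri : (@lebesgue_measure R).-integrable `[0, 1] (EFin \o (fun r => f (1 - r))).
  by apply: integrable_within01; exact: continuous_subspaceT.
have cfs (x : R) : x \in `]0, 1[%R -> x \notin [::] -> {for x, continuous f} by move=> _ _; exact: cf.
have [F [cF F0 F1 _ dF]] := parameterized_integral_off_seq ler01 fi cfs.
pose G r := - F (1 - r).
have cG : {within `[0, 1], continuous G}.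
  move=> x; apply: cvgN; move: x.
  refine (within_continuous_compW (B := `[0 : R, 1]%classic) _ _ cF).
    by move=> x /=; rewrite !in_itvcc => /andP[h1 h2]; apply/andP; split; lra.
  by apply: continuous_subspaceT => x; apply: cvgB; [exact: cvg_cst|exact: cvg_id].
have cfr (x : R) : x \in `]0, 1[%R -> x \notin [::] -> {for x, continuous (fun r : R => f (1 - r))}.
  by move=> _ _; exact: cr.
have dG (x : R) : x \in `]0, 1[%R -> x \notin [::] -> is_derive x 1 G (f (1 - x)).
  rewrite in_itvoo => /andP[x0 x1] _.
  have D : is_derive (- 1 * x + 1) 1 F (f (1 - x)).
    rewrite (_ : - 1 * x + 1 = 1 - x); last by ring.
    by apply: dF => //; rewrite in_itvoo; apply/andP; split; lra.
  have D2 := is_deriveN (is_derive_comp_affine D).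
  have -> : G = - (fun y => F (- 1 * y + 1)).
    by apply/funext => y; rewrite /G; congr (- F _); ring.
  by apply: is_derive_eq D2 _; ring.
apply: (etrans (RFTC2_off_seq ler01 fri cG cfr dG)).
by rewrite /G subrr subr0 F0 F1; ring.
Qed.

Definition rot01 (R : realType) p (th : R) (z : 'rV[R]_p.+3) : 'rV[R]_p.+3 :=
  z *m givens ord0 (inord 1) (cos th) (- sin th).

Lemma ord0_inord1 p : (ord0 : 'I_p.+3) != inord 1.
Proof. by rewrite -val_eqE /= inordK. Qed.

Lemma inord1_max p : (inord 1 : 'I_p.+3) != ord_max.
Proof. by rewrite -val_eqE /= inordK. Qed.

Lemma rot01_orthogonal (R : realType) p (th : R) :
  let U : 'M[R]_p.+3 := givens ord0 (inord 1) (cos th) (- sin th) in U *m U^T = 1%:M.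
Proof. by apply: givens_orthogonal; [exact: ord0_inord1|rewrite sqrrN cos2Dsin2]. Qed.

Lemma rot01_max (R : realType) p (th : R) (z : 'rV[R]_p.+3) : rot01 th z 0 ord_max = z 0 ord_max.
Proof. by rewrite /rot01 givens_other // eq_sym inord1_max. Qed.

(** Homogeneous polynomials of degree [N] without the last coordinate. A rotation of the first two
    coordinates turns a monomial into such a combination, no longer into a monomial. *)
Definition equatorial_form (R : realType) n N (f : 'rV[R]_n.+1 -> R) : Prop :=
  exists (T : finType) (a : T -> R) (e : T -> 'I_n.+1 -> nat),
    (forall i, e i ord_max = 0%N /\ (\sum_j e i j = N)%N) /\
    forall x, f x = \sum_i a i * mono (e i) x.

Lemma equatorial_form1 (R : realType) n : equatorial_form 0 (fun _ : 'rV[R]_n.+1 => 1).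
Proof.
exists unit, (fun _ => 1), (fun _ _ => 0%N); split=> [i|x]; first by rewrite big1.
by rewrite (big_pred1 tt) => [|[]//]; rewrite mul1r /mono big1 // => i _; rewrite expr0.
Qed.

Lemma equatorial_formM (R : realType) n N M (f g : 'rV[R]_n.+1 -> R) :
  equatorial_form N f -> equatorial_form M g ->
  equatorial_form (N + M) (fun x => f x * g x).
Proof.
move=> [T [a [e [eP fE]]]] [S [b [h [hP gE]]]].
exists (T * S)%type, (fun u => a u.1 * b u.2), (fun u j => e u.1 j + h u.2 j)%N.
split=> [[i j] /=|x].
  have [e0 <-] := eP i; have [h0 <-] := hP j; rewrite e0 h0 addn0; split=> //.
  exact: big_split.
rewrite fE gE big_distrlr pair_big /=; apply: eq_bigr => -[i j] _ /=.
rewrite [RHS](_ : _ = a i * b j * (mono (e i) x * mono (h j) x)); first by ring.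
by congr (_ * _); rewrite /mono -big_split /=; apply: eq_bigr => k _; rewrite exprD.
Qed.

Lemma equatorial_formX (R : realType) n N k (f : 'rV[R]_n.+1 -> R) :
  equatorial_form N f -> equatorial_form (k * N) (fun x => f x ^+ k).
Proof.
move=> fP; elim: k => [|k IH]; first exact: equatorial_form1.
have := equatorial_formM fP IH; rewrite mulSn.
by rewrite (_ : (fun x => f x * f x ^+ k) = (fun x => f x ^+ k.+1)) //; apply/funext => x; rewrite exprS.
Qed.

Lemma equatorial_form_linear (R : realType) n (i j : 'I_n.+1) (u v : R) :
  i != ord_max -> j != ord_max ->
  equatorial_form 1 (fun x : 'rV[R]_n.+1 => u * x 0 i + v * x 0 j).
Proof.
move=> im jm.
exists bool, (fun b => if b then u else v), (fun b k => (k == (if b then i else j)) : nat).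
have mE (k : 'I_n.+1) (x : 'rV[R]_n.+1) : mono (fun l => (l == k) : nat) x = x 0 k.
  by rewrite /mono (bigD1 k) //= eqxx expr1 big1 ?mulr1 // => l /negPf ->; rewrite expr0.
split=> [b|x]; last by rewrite big_bool /= !mE.
split; first by case: b; rewrite eq_sym ?(negPf im) ?(negPf jm).
by rewrite (bigD1 (if b then i else j)) //= eqxx big1 // => l /negPf ->.
Qed.

Lemma equatorial_form_prod (R : realType) n (I : Type) (s : seq I) (N : I -> nat)
    (f : I -> 'rV[R]_n.+1 -> R) : (forall i, equatorial_form (N i) (f i)) ->
  equatorial_form (\sum_(i <- s) N i) (fun x => \prod_(i <- s) f i x).
Proof.
move=> fP; elim: s => [|i s IH].
  by rewrite big_nil; under eq_fun do rewrite big_nil; exact: equatorial_form1.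
rewrite big_cons (_ : (fun x => _) = fun x => f i x * \prod_(i <- s) f i x).
  exact: equatorial_formM.
by apply/funext => x; rewrite big_cons.
Qed.

Lemma mono_rot01_form (R : realType) p (th : R) (e : 'I_p.+3 -> nat) : e ord_max = 0%N ->
  equatorial_form (\sum_i e i) (fun x => mono e (rot01 th x)).
Proof.
move=> em; rewrite /mono.
rewrite (_ : (\sum_i e i = \sum_i e i * 1)%N); last by apply: eq_bigr => i _; rewrite muln1.
apply: (@equatorial_form_prod _ _ _ _ _ (fun i x => rot01 th x 0 i ^+ e i)) => i.
have [-> | im] := eqVneq i ord_max.
  by rewrite em; under eq_fun do rewrite expr0; exact: equatorial_form1.
apply: equatorial_formX.
have [i0 | i0] := eqVneq i ord0.
  rewrite i0 (_ : (fun _ => _) = fun x : 'rV[R]_p.+3 => cos th * x 0 ord0 + - sin th * x 0 (inord 1)).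
    by apply: equatorial_form_linear => //; exact: inord1_max.
  by apply/funext => x; rewrite /rot01 givens_c // ord0_inord1.
have [i1 | i1] := eqVneq i (inord 1).
  rewrite i1 (_ : (fun _ => _) = fun x : 'rV[R]_p.+3 => sin th * x 0 ord0 + cos th * x 0 (inord 1)).
    by apply: equatorial_form_linear => //; exact: inord1_max.
  by apply/funext => x; rewrite /rot01 givens_j ?ord0_inord1 // opprK.
rewrite (_ : (fun _ => _) = fun x : 'rV[R]_p.+3 => 1 * x 0 i + 0 * x 0 i).
  exact: equatorial_form_linear.
by apply/funext => x; rewrite /rot01 givens_other // mul1r mul0r addr0.
Qed.

(** The polar angle of a uniform point of the unit sphere in dimension [q + 2] has density
    proportional to the power [q] of the sine. *)
Definition lat_moment (R : realType) q p b : R := lat_integral R (p + q) b / lat_integral R q 0.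

Lemma lat_moment_sum (R : realType) q p b :
  lat_moment R q p.+2 b + lat_moment R q p b.+2 = lat_moment R q p b.
Proof. by rewrite /lat_moment -mulrDl !addSn lat_integral_sum. Qed.

Lemma sphere_moment_lat (R : realType) q (e : 'I_q.+2 -> nat) :
  sphere_moment R q.+2 e =
  lat_moment R q (\sum_i equatorial e i) (e ord_max) * sphere_moment R q.+1 (equatorial e).
Proof.
apply: (sphere_moment_suspension (J := lat_moment R q)) => //.
- by rewrite /lat_moment add0n divff // gt_eqF // lat_integral_gt0.
- exact: lat_moment_sum.
- move=> p b; rewrite /lat_moment addnS !mulrA lat_integral_parts /= !addSn //.
- move=> p; rewrite /lat_moment; have := lat_integral_parts R (p + q) 0.
  by rewrite mul0r => /eqP; rewrite mulf_eq0 pnatr_eq0 /= => /eqP ->; rewrite mul0r.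
Qed.

(** All monomials of the form have the same degree, so the latitude factor of the suspension formula
    is common to them. *)
Lemma equatorial_form_mean (R : realType) p N k (y : 'I_k -> 'rV[R]_p.+3) (c : 'I_k -> R)
    (sigma : probability (borelRn R p.+3) R) (f : 'rV[R]_p.+3 -> R) :
  uniform_on_sphere sigma ->
  (forall e, e ord_max = 0%N -> (\sum_i e i = N)%N ->
    \sum_i c i / 2 * (mono e (y i) + mono e (- y i)) = sphere_moment R p.+2 e) ->
  equatorial_form N f ->
  \int[sigma]_(x in sphere p.+2) f x =
  lat_moment R p.+1 N 0 * \sum_i c i / 2 * (f (y i) + f (- y i)).
Proof.
move=> us nodes [T [a [e [eP fE]]]].
pose v (i : 'I_#|T|) : T := enum_val i.
have -> : f = fun x => \sum_i a (v i) * mono (e (v i)) x.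
  by apply/funext => x; rewrite fE (reindex _ (onW_bij _ (enum_val_bij T))).
have [_ E] := Rintegral_sum (fun i => a (v i)) (@measurable_sphere R p.+2)
  (fun i => sphere_integrable sigma (@continuous_mono R _ (e (v i)))
     (fun x sx => sphere_mono_le1 (e (v i)) sx)).
apply: (etrans E).
transitivity (\sum_(i < #|T|) a (v i) * (lat_moment R p.+1 N 0 *
    \sum_j c j / 2 * (mono (e (v i)) (y j) + mono (e (v i)) (- y j)))).
  apply: eq_bigr => i _; have [e0 eN] := eP (v i).
  by rewrite sphere_moments // nodes // sphere_moment_lat equatorial_id // eN e0.
rewrite mulr_sumr.
under eq_bigr do rewrite mulrCA mulr_sumr mulr_sumr.
rewrite exchange_big /=; apply: eq_bigr => j _.
rewrite mulrDr mulrDr !mulr_sumr -!big_split /=; apply: eq_bigr => i _; ring.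
Qed.

Lemma lat_moment_gt0 (R : realType) q p : 0 < lat_moment R q p 0.
Proof. by rewrite divr_gt0 // lat_integral_gt0. Qed.

(* In a given degree the node sums are a fixed multiple of the integrals over the whole
   sphere, which are invariant under rotations. *)
Lemma rot01_nodes (R : realType) p N k (y : 'I_k -> 'rV[R]_p.+3) (c : 'I_k -> R)
    (sigma : probability (borelRn R p.+3) R) (th : R) :
  uniform_on_sphere sigma ->
  (forall e, e ord_max = 0%N -> (\sum_i e i <= N)%N ->
    \sum_i c i / 2 * (mono e (y i) + mono e (- y i)) = sphere_moment R p.+2 e) ->
  forall e, e ord_max = 0%N -> (\sum_i e i <= N)%N ->
    \sum_i c i / 2 * (mono e (rot01 th (y i)) + mono e (rot01 th (- y i))) =
    sphere_moment R p.+2 e.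
Proof.
move=> us nodes e em eN.
have nodes' e' : e' ord_max = 0%N -> (\sum_i e' i = \sum_i e i)%N ->
    \sum_i c i / 2 * (mono e' (y i) + mono e' (- y i)) = sphere_moment R p.+2 e'.
  by move=> h1 h2; apply: nodes; rewrite ?h2.
have h := equatorial_form_mean us nodes' (mono_rot01_form th em).
apply: (mulfI (lt0r_neq0 (lat_moment_gt0 R p.+1 (\sum_i e i)))).
rewrite -[LHS]h.
rewrite (sphere_integral_orthogonal (M := 1) us (@rot01_orthogonal R p th) (@continuous_mono R _ e)).
  by rewrite sphere_moments // sphere_moment_lat equatorial_id // em.
by move=> x; exact: sphere_mono_le1.
Qed.

(** The derivative of [rot01] in the angle. *)
Definition rot01' (R : realType) p (th : R) (z : 'rV[R]_p.+3) : 'rV[R]_p.+3 :=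
  \row_j if j == ord0 then - rot01 th z 0 (inord 1)
         else if j == inord 1 then rot01 th z 0 ord0 else 0.

Lemma rot01_0 (R : realType) p (th : R) (z : 'rV[R]_p.+3) :
  rot01 th z 0 ord0 = cos th * z 0 ord0 + - sin th * z 0 (inord 1).
Proof. by rewrite /rot01 givens_c // ord0_inord1. Qed.

Lemma rot01_1 (R : realType) p (th : R) (z : 'rV[R]_p.+3) :
  rot01 th z 0 (inord 1) = sin th * z 0 ord0 + cos th * z 0 (inord 1).
Proof. by rewrite /rot01 givens_j ?ord0_inord1 // opprK. Qed.

Lemma rot01_sqr (R : realType) p (th : R) (z : 'rV[R]_p.+3) :
  \sum_j rot01 th z 0 j ^+ 2 = \sum_j z 0 j ^+ 2.
Proof.
have n1 := ord0_inord1 p.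
rewrite (bigD1 ord0) //= (bigD1 (inord 1)) ?(eq_sym _ ord0) //=.
rewrite [in RHS](bigD1 ord0) //= [in RHS](bigD1 (inord 1)) ?(eq_sym _ ord0) //=.
rewrite !addrA; congr (_ + _); last first.
  by apply: eq_bigr => j /andP[j0 j1]; rewrite /rot01 givens_other.
rewrite rot01_0 rot01_1.
transitivity ((cos th ^+ 2 + sin th ^+ 2) * (z 0 ord0 ^+ 2 + z 0 (inord 1) ^+ 2)).
  by ring.
by rewrite cos2Dsin2 mul1r.
Qed.

Lemma rot01_inj (R : realType) p (th : R) : injective (@rot01 R p th).
Proof.
move=> x y E; have h (z : 'rV[R]_p.+3) : rot01 th z *m (givens ord0 (inord 1) (cos th) (- sin th))^T = z.
  by rewrite /rot01 -mulmxA rot01_orthogonal mulmx1.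
by rewrite -(h x) E h.
Qed.

Lemma rot01_is_derive (R : realType) p (a x : R) (z : 'rV[R]_p.+3) j :
  is_derive x 1 (fun x => rot01 (a * x) z 0 j) (a * rot01' (a * x) z 0 j).
Proof.
have D1 := is_deriveM (is_derive_cst (a : R) x 1) (is_derive_id x 1).
have Dc := @is_derive1_comp R (@cos R) _ x _ _ (is_derive_cos _) D1.
have Ds := @is_derive1_comp R (@sin R) _ x _ _ (is_derive_sin _) D1.
pose u := z 0 ord0; pose v := z 0 (inord 1).
have D0 := is_deriveB (is_deriveM Dc (is_derive_cst (u : R) x 1)) (is_deriveM Ds (is_derive_cst (v : R) x 1)).
have D2 := is_deriveD (is_deriveM Ds (is_derive_cst (u : R) x 1)) (is_deriveM Dc (is_derive_cst (v : R) x 1)).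
rewrite mxE rot01_0 rot01_1 -/u -/v; have [->|j0] := eqVneq j ord0.
  rewrite (_ : (fun _ => _) = fun x => cos (a * x) * u - sin (a * x) * v).
    by apply: is_derive_eq D0 _; rewrite /GRing.scale /=; ring.
  by apply/funext => y; rewrite rot01_0 mulNr.
have [->|j1] := eqVneq j (inord 1).
  rewrite (_ : (fun _ => _) = fun x => sin (a * x) * u + cos (a * x) * v).
    by apply: is_derive_eq D2 _; rewrite /GRing.scale /=; ring.
  by apply/funext => y; rewrite rot01_1.
rewrite mulr0 (_ : (fun _ => _) = cst (z 0 j)); first exact: is_derive_cst.
by apply/funext => y; rewrite /rot01 givens_other.
Qed.

Definition equatorial_radius2 (R : realType) p (z : 'rV[R]_p.+3) : R :=
  z 0 ord0 ^+ 2 + z 0 (inord 1) ^+ 2.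

(** [rot01'] is orthogonal to [rot01] and its squared length is the squared radius in the plane of
    rotation, so there is no cross term. *)
Lemma sum_rot01' (R : realType) p (th u v : R) (z : 'rV[R]_p.+3) :
  \sum_j (u * rot01 th z 0 j + v * rot01' th z 0 j) ^+ 2 =
  u ^+ 2 * \sum_j z 0 j ^+ 2 + v ^+ 2 * equatorial_radius2 z.
Proof.
rewrite -(rot01_sqr th); have n1 := ord0_inord1 p.
rewrite (bigD1 ord0) //= (bigD1 (inord 1)) ?(eq_sym _ ord0) //=.
rewrite [in RHS](bigD1 ord0) //= [in RHS](bigD1 (inord 1)) ?(eq_sym _ ord0) //=.
have rest : \sum_(i < p.+3 | (i != ord0) && (i != inord 1))
    (u * rot01 th z 0 i + v * rot01' th z 0 i) ^+ 2 =
    u ^+ 2 * \sum_(i < p.+3 | (i != ord0) && (i != inord 1)) rot01 th z 0 i ^+ 2.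
  rewrite mulr_sumr; apply: eq_bigr => j /andP[j0 j1].
  by rewrite [rot01' _ _ _ _]mxE (negPf j0) (negPf j1) mulr0 addr0 exprMn.
have -> : equatorial_radius2 z = rot01 th z 0 ord0 ^+ 2 + rot01 th z 0 (inord 1) ^+ 2.
  rewrite /equatorial_radius2 rot01_0 rot01_1.
  transitivity ((cos th ^+ 2 + sin th ^+ 2) * (z 0 ord0 ^+ 2 + z 0 (inord 1) ^+ 2)).
    by rewrite cos2Dsin2 mul1r.
  by ring.
rewrite rest ![rot01' _ _ _ _]mxE eqxx [inord 1 == ord0]eq_sym (negPf n1) eqxx; ring.
Qed.

(* The meridian through the equatorial point [z], twisted by a rotation of the first two
   coordinates through an angle proportional to the polar angle [x]. *)
Definition meridian (R : realType) p (a : R) (z : 'rV[R]_p.+3) (x : R) : 'rV[R]_p.+3 :=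
  \row_j if j == ord_max then - cos x else sin x * rot01 (a * x) z 0 j.

Lemma meridian_sqr (R : realType) p (a x : R) (z : 'rV[R]_p.+3) : equator z ->
  \sum_j meridian a z x 0 j ^+ 2 = 1.
Proof.
move=> [/sphere_sum z1 zm]; have z1' := z1; rewrite -(rot01_sqr (a * x)) in z1'.
rewrite -(cos2Dsin2 x) -[in RHS](mulr1 (sin x ^+ 2)) -{}z1'.
rewrite (bigD1 ord_max) // [in RHS](bigD1 ord_max) //= rot01_max zm expr0n /= add0r.
rewrite mxE eqxx sqrrN mulr_sumr; congr (_ + _); apply: eq_bigr => j /negPf jm.
by rewrite mxE jm exprMn.
Qed.

Definition meridian' (R : realType) p (a : R) (z : 'rV[R]_p.+3) (x : R) : 'rV[R]_p.+3 :=
  \row_j if j == ord_max then sin x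
         else cos x * rot01 (a * x) z 0 j + sin x * a * rot01' (a * x) z 0 j.

Lemma meridian_is_derive (R : realType) p (a x : R) (z : 'rV[R]_p.+3) j :
  is_derive x 1 (fun x => meridian a z x 0 j) (meridian' a z x 0 j).
Proof.
rewrite mxE; have [->|jm] := eqVneq j ord_max.
  rewrite (_ : (fun _ => _) = fun x => - cos x); last by apply/funext => y; rewrite mxE eqxx.
  have D : is_derive x 1 (fun x : R => - cos x) (- - sin x) by exact: is_deriveN.
  by apply: is_derive_eq D _; rewrite opprK.
rewrite (_ : (fun _ => _) = fun x => sin x * rot01 (a * x) z 0 j); last first.
  by apply/funext => y; rewrite mxE (negPf jm).
have D := is_deriveM (is_derive_sin x) (rot01_is_derive a x z j).
by apply: is_derive_eq D _; rewrite /GRing.scale /=; ring.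
Qed.

Lemma meridian'_sqr (R : realType) p (a x : R) (z : 'rV[R]_p.+3) : equator z ->
  \sum_j meridian' a z x 0 j ^+ 2 = 1 + (a * sin x) ^+ 2 * equatorial_radius2 z.
Proof.
move=> [/sphere_sum z1 zm].
have := sum_rot01' (a * x) (cos x) (sin x * a) z; rewrite z1 mulr1.
have m' : rot01' (a * x) z 0 ord_max = 0.
  by rewrite mxE -[ord_max == ord0]val_eqE /= eq_sym (negPf (inord1_max p)).
rewrite (bigD1 ord_max) //= rot01_max zm m' !mulr0 addr0 expr0n /= add0r => E.
rewrite (bigD1 ord_max) //= mxE eqxx -(cos2Dsin2 x) [a * sin x]mulrC.
rewrite addrAC -E addrC; congr (_ + _); apply: eq_bigr => j /negPf jm.
by rewrite mxE jm.
Qed.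

(** The polar angle is measured from the pole with last coordinate -1; the pieces with [b] true run
    back towards it. *)
Definition arc_param (R : realType) (b : bool) (r : R) : R := pi * (if b then 1 - r else r).

(** Pieces [2 i] and [2 i + 1] go up through [y i] and down through [- y i]. *)
Definition merid_piece (R : realType) p K (a : R) (y : 'I_K.+1 -> 'rV[R]_p.+3) (k : int) (r : R) :
    'rV[R]_p.+3 :=
  meridian a ((-1) ^+ odd `|k| *: y (inord `|k|./2)) (arc_param (odd `|k|) r).

Lemma sin_arc_param (R : realType) b (r : R) : sin (arc_param b r) = sin (pi * r).
Proof.
case: b => //; rewrite /arc_param mulrBr mulr1 sinB sinpi cospi; ring.
Qed.

Lemma arc_param_is_derive (R : realType) b (r : R) :
  is_derive r 1 (arc_param b) ((-1) ^+ b * pi).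
Proof.
have D1 := is_deriveM (is_derive_cst (pi : R) r 1) (is_derive_id r 1).
case: b; last by apply: is_derive_eq D1 _; rewrite /GRing.scale /=; ring.
have D2 := is_deriveB (is_derive_cst (1 : R) r 1) (is_derive_id r 1).
have D3 := is_deriveM (is_derive_cst (pi : R) r 1) D2.
by apply: is_derive_eq D3 _; rewrite /GRing.scale /=; ring.
Qed.

Lemma equator_opp (R : realType) n (z : 'rV[R]_n.+1) (b : bool) :
  equator z -> equator ((-1) ^+ b *: z).
Proof.
move=> [/sphere_sum z1 zm]; split; last by rewrite mxE zm mulr0.
apply/sphere_sum; rewrite -[RHS]z1; apply: eq_bigr => i _; rewrite mxE exprMn.
by case: b; rewrite ?sqrrN ?expr1n mul1r.
Qed.

Lemma equatorial_radius2_opp (R : realType) p (z : 'rV[R]_p.+3) (b : bool) :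
  equatorial_radius2 ((-1) ^+ b *: z) = equatorial_radius2 z.
Proof. by rewrite /equatorial_radius2 !mxE !exprMn; case: b; rewrite ?sqrrN ?expr1n !mul1r. Qed.

Lemma merid_piece_is_derive (R : realType) p K (a : R) (y : 'I_K.+1 -> 'rV[R]_p.+3) k (r : R) j :
  is_derive r 1 (fun r => merid_piece a y k r 0 j)
    (((-1) ^+ odd `|k| * pi) * meridian' a ((-1) ^+ odd `|k| *: y (inord `|k|./2))
      (arc_param (odd `|k|) r) 0 j).
Proof.
have D := @is_derive1_comp R _ _ r _ _ (meridian_is_derive a _
  ((-1) ^+ odd `|k| *: y (inord `|k|./2)) j) (arc_param_is_derive (odd `|k|) r).
by apply: is_derive_eq D _; rewrite mulrC.
Qed.

Definition arc_speed (R : realType) (a c r : R) : R :=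
  pi * Num.sqrt (1 + (a * sin (pi * r)) ^+ 2 * c).

Lemma merid_piece_speed (R : realType) p K (a : R) (y : 'I_K.+1 -> 'rV[R]_p.+3) k (r : R) :
  (forall i, equator (y i)) ->
  speed (merid_piece a y k) r = arc_speed a (equatorial_radius2 (y (inord `|k|./2))) r.
Proof.
move=> ey; have E : derive1 (merid_piece a y k) r =
    ((-1) ^+ odd `|k| * pi) *: meridian' a ((-1) ^+ odd `|k| *: y (inord `|k|./2))
      (arc_param (odd `|k|) r).
  by apply: derive1_row => j; rewrite mxE; exact: merid_piece_is_derive.
rewrite /speed E euclidZ normrM (ger0_norm (pi_ge0 R)) normrX normrN1 expr1n mul1r.
rewrite /euclid meridian'_sqr; last exact: equator_opp.
by rewrite sin_arc_param equatorial_radius2_opp.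
Qed.

Lemma merid_piece_smooth (R : realType) p K (a : R) (y : 'I_K.+1 -> 'rV[R]_p.+3) k :
  smooth_on (off [::]) (merid_piece a y k).
Proof.
apply/smooth_on_rowP => [|j]; first exact: open_off.
have sa c : smooth_on (off [::]) (fun r : R => c * arc_param (odd `|k|) r).
  have -> : (fun r : R => c * arc_param (odd `|k|) r) =
      (fun r => (c * pi * (-1) ^+ odd `|k|) * r + c * pi * (odd `|k|)%:R).
    by apply/funext => r; rewrite /arc_param; case: (odd _); rewrite ?expr1 ?expr0 /=; ring.
  apply: smooth_onD; last exact: smooth_on_cst.
  by apply: smooth_onM; [exact: smooth_on_cst|exact: smooth_on_id].
have s1 : smooth_on (off [::]) (arc_param (R := R) (odd `|k|)).
  by have := sa 1; rewrite (_ : (fun r => _) = arc_param (odd `|k|)) //; apply/funext => r; rewrite mul1r.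
pose z := (-1) ^+ odd `|k| *: y (inord `|k|./2).
have [->|jm] := eqVneq j ord_max.
  rewrite (_ : (fun _ => _) = fun r => - cos (arc_param (odd `|k|) r)).
    by apply: smooth_onN; exact: smooth_on_cos.
  by apply/funext => r; rewrite mxE eqxx.
rewrite (_ : (fun _ => _) = fun r => sin (arc_param (odd `|k|) r) *
    rot01 (a * arc_param (odd `|k|) r) z 0 j); last first.
  by apply/funext => r; rewrite mxE (negPf jm).
apply: smooth_onM; first exact: smooth_on_sin.
have cc u : smooth_on (off [::]) (fun r => cos (a * arc_param (odd `|k|) r) * u).
  by apply: smooth_onM; [exact: smooth_on_cos|exact: smooth_on_cst].
have ss u : smooth_on (off [::]) (fun r => sin (a * arc_param (odd `|k|) r) * u).
  by apply: smooth_onM; [exact: smooth_on_sin|exact: smooth_on_cst].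
have [->|j0] := eqVneq j ord0.
  have := smooth_onD (cc (z 0 ord0)) (ss (- z 0 (inord 1))).
  by apply: (smooth_on_eq (@open_off R [::])) => r _; rewrite rot01_0 mulrN mulNr.
have [->|j1] := eqVneq j (inord 1).
  have := smooth_onD (ss (z 0 ord0)) (cc (z 0 (inord 1))).
  by apply: (smooth_on_eq (@open_off R [::])) => r _; rewrite rot01_1.
rewrite (_ : (fun _ => _) = fun _ => z 0 j); first exact: smooth_on_cst.
by apply/funext => r; rewrite /rot01 givens_other.
Qed.

Lemma merid_piece_continuous (R : realType) p K (a : R) (y : 'I_K.+1 -> 'rV[R]_p.+3) k :
  continuous (merid_piece a y k).
Proof.
by apply: continuous_row => j r; exact: is_derive_continuous_at (merid_piece_is_derive a y k r j).
Qed.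

Lemma merid_piece_match (R : realType) p K (a : R) (y : 'I_K.+1 -> 'rV[R]_p.+3) (k : nat) :
  merid_piece a y k 1 = merid_piece a y k.+1 0.
Proof.
apply/rowP => j; rewrite !mxE !sin_arc_param mulr1 mulr0 sinpi sin0 !mul0r.
by case: eqP => // _; rewrite /arc_param /=; case: (odd k); rewrite /= ?subrr ?subr0.
Qed.

Lemma merid_piece_sphere (R : realType) p K (a : R) (y : 'I_K.+1 -> 'rV[R]_p.+3) k (r : R) :
  (forall i, equator (y i)) -> sphere p.+2 (merid_piece a y k r).
Proof. by move=> ey; apply/sphere_sum; apply: meridian_sqr; exact: equator_opp. Qed.

Lemma arc_speed_gt0 (R : realType) (a c r : R) : 0 <= c -> 0 < arc_speed a c r.
Proof.
by move=> c0; rewrite mulr_gt0 ?pi_gt0 // sqrtr_gt0 ltr_pwDl // mulr_ge0 ?sqr_ge0.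
Qed.

Lemma arc_speed_continuous (R : realType) (a c : R) : continuous (arc_speed a c).
Proof.
move=> r; apply: cvgM; first exact: cvg_cst.
apply: (continuous_comp (f := fun r => 1 + (a * sin (pi * r)) ^+ 2 * c) (g := @Num.sqrt R)); last first.
  exact: sqrt_continuous.
apply: cvgD; first exact: cvg_cst.
apply: cvgM; last exact: cvg_cst.
apply: (continuous_exprn (f := fun r => a * sin (pi * r))).
apply: cvgM; first exact: cvg_cst.
exact: is_derive_continuous_at (sinpi_is_derive r).
Qed.

Lemma equatorial_radius2_itv (R : realType) p (z : 'rV[R]_p.+3) :
  equator z -> 0 <= equatorial_radius2 z <= 1.
Proof.
move=> [/sphere_sum z1 _]; rewrite /equatorial_radius2 addr_ge0 ?sqr_ge0 //=.
rewrite -z1 (bigD1 ord0) //= (bigD1 (inord 1)) ?(eq_sym _ ord0) ?ord0_inord1 //= addrA.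
by rewrite lerDl sumr_ge0 // => i _; exact: sqr_ge0.
Qed.

(** * Arc length as a function of the twist *)

Lemma sqrt1D_lip (R : realType) (a b x : R) : 0 <= x <= 1 ->
  Num.sqrt (1 + a ^+ 2 * x) <= Num.sqrt (1 + b ^+ 2 * x) + `|a - b|.
Proof.
move=> /andP[x0 x1].
have pb : 0 <= 1 + b ^+ 2 * x by rewrite addr_ge0 // mulr_ge0 // sqr_ge0.
have S0 := sqrtr_ge0 (1 + b ^+ 2 * x); have := sqr_sqrtr pb.
set S := Num.sqrt (1 + b ^+ 2 * x) in S0 *; move=> S2.
have d0 := normr_ge0 (a - b).
rewrite -[leRHS]ger0_norm ?addr_ge0 // -sqrtr_sqr ler_wsqrtr //.
have d2 : `|a - b| ^+ 2 = (a - b) ^+ 2 by rewrite real_normK // num_real.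
have bS : b ^+ 2 * x <= S ^+ 2 by rewrite S2; lra.
have cross : b * (a - b) * x <= S * `|a - b|.
  apply: le_trans (ler_norm _) _; rewrite !normrM mulrAC ler_wpM2r //.
  rewrite -(@ler_pXn2r _ 2) ?nnegrE ?mulr_ge0 // exprMn !real_normK ?num_real //.
  by apply: le_trans bS; rewrite ler_wpM2l ?sqr_ge0 // expr2 ler_piMl.
have dx : (a - b) ^+ 2 * x <= (a - b) ^+ 2 by rewrite ler_piMr // sqr_ge0.
rewrite sqrrD d2 S2.
have -> : a ^+ 2 * x = b ^+ 2 * x + (b * (a - b) * x) *+ 2 + (a - b) ^+ 2 * x.
  by rewrite mulr2n; ring.
by rewrite mulr2n; lra.
Qed.

Definition arc_length (R : realType) (a c : R) : R :=
  \int[@lebesgue_measure R]_(r in `[0, 1]) arc_speed a c r.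

Lemma arc_speed_integrable (R : realType) (a c : R) :
  (@lebesgue_measure R).-integrable `[0, 1] (EFin \o arc_speed a c).
Proof.
by apply: integrable_within01; apply: continuous_subspaceT; exact: arc_speed_continuous.
Qed.

Lemma cst_integrable01 (R : realType) (k : R) :
  (@lebesgue_measure R).-integrable `[0, 1] (EFin \o (fun _ : R => k)).
Proof. by apply: integrable_within01; apply: continuous_subspaceT; exact: cst_continuous. Qed.

Lemma Rintegral_cst01 (R : realType) (k : R) :
  \int[@lebesgue_measure R]_(r in `[0, 1]) k = k.
Proof.
by rewrite Rintegral_cst //= lebesgue_measure_itv /= lte_fin ltr01 sube0 /= mulr1.
Qed.

Lemma arc_length_lip (R : realType) (a b c : R) : 0 <= c <= 1 ->
  arc_length a c <= arc_length b c + pi * `|a - b|.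
Proof.
move=> c01.
have [i1 e1] := Rintegral_lincomb 1 (pi * `|a - b|) (arc_speed_integrable b c) (@cst_integrable01 R 1).
rewrite [1 * Rintegral _ _ _]mul1r Rintegral_cst01 [X in _ = _ + X]mulr1 in e1; rewrite -[leRHS]e1.
apply: le_Rintegral => //; first exact: arc_speed_integrable.
move=> r _; rewrite mul1r mulr1 /arc_speed -mulrDr ler_wpM2l ?pi_ge0 //.
have := @sqrt1D_lip R a b (sin (pi * r) ^+ 2 * c).
rewrite !exprMn !mulrA; apply; apply/andP; split.
  by rewrite mulr_ge0 ?sqr_ge0 // (andP c01).1.
rewrite mulr_ile1 ?sqr_ge0 ?(andP c01).1 ?(andP c01).2 //.
Qed.

Lemma arc_length0 (R : realType) (c : R) : arc_length 0 c = pi.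
Proof.
rewrite /arc_length -[RHS]Rintegral_cst01; apply: eq_Rintegral => r _.
by rewrite /arc_speed mul0r expr0n /= mul0r addr0 sqrtr1 mulr1.
Qed.

Lemma arc_length_ge (R : realType) (a c : R) : 0 <= a -> 0 <= c ->
  a * (pi * Num.sqrt c * lat_integral R 1 0) <= arc_length a c.
Proof.
move=> a0 c0.
have [i1 e1] := Rintegral_lincomb (a * (pi * Num.sqrt c)) 0 (@lat_fun_integrable R 1 0)
  (@cst_integrable01 R 1).
rewrite [0 * Rintegral _ _ _]mul0r addr0 in e1; rewrite mulrA -[leLHS]e1.
apply: le_Rintegral => //; first exact: arc_speed_integrable.
move=> r /=; rewrite in_itvcc => /andP[r0 r1]; rewrite mul0r addr0 /lat_fun expr1 expr0 mulr1.
rewrite /arc_speed [a * _]mulrC -!mulrA ler_wpM2l ?pi_ge0 //.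
have s0 : 0 <= sin (pi * r).
  by apply: sin_ge0_pi; rewrite mulr_ge0 ?pi_ge0 //= ler_piMr ?pi_ge0.
rewrite -[leLHS]ger0_norm ?mulr_ge0 ?sqrtr_ge0 // -sqrtr_sqr ler_wsqrtr //.
rewrite exprMn sqr_sqrtr //.
have -> : 1 + a * (sin (pi * r) * (a * (sin (pi * r) * c))) = 1 + c * (a * sin (pi * r)) ^+ 2.
  by ring.
by rewrite lerDr.
Qed.

(** Intermediate value theorem in the twist [a]: the total is [pi n] at 0, is Lipschitz in [a]
    because each root is the length of a vector [(1, a sqrt x)], and grows at least linearly because
    one radius is positive. *)
Lemma arc_length_total (R : realType) n (c : 'I_n -> R) (W : R) :
  (forall i, 0 <= c i <= 1) -> (exists i, 0 < c i) -> pi * n%:R <= W ->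
  exists a, \sum_i arc_length a (c i) = W.
Proof.
move=> c01 [i0 ci0] nW; pose L (a : R) := \sum_i arc_length a (c i).
have lip a b : L a <= L b + pi * n%:R * `|a - b|.
  apply: le_trans (_ : \sum_i (arc_length b (c i) + pi * `|a - b|) <= _).
    by apply: ler_sum => i _; exact: arc_length_lip.
  by rewrite big_split /= lerD2l sumr_const card_ord -mulrA [_%:R * _]mulr_natl mulrnAr.
have cL : continuous L.
  have n1 : 0 < pi * n%:R + 1 :> R by rewrite ltr_wpDl // mulr_ge0 // pi_ge0.
  move=> a; apply/cvgrPdist_le => e e0; near=> b.
  have h1 := lip a b; have h2 := lip b a; rewrite distrC in h2.
  have : pi * n%:R * `|a - b| <= e.
    apply: le_trans (_ : (pi * n%:R + 1) * `|a - b| <= _).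
      by rewrite ler_wpM2r // lerDl.
    rewrite mulrC -ler_pdivlMr //; near: b.
    apply/nbhs_ballP; exists (e / (pi * n%:R + 1)); first by rewrite /= divr_gt0.
    by move=> x; rewrite /ball /= => /ltW.
  by rewrite ler_norml; lra.
have L0 : L 0 = pi * n%:R.
  by rewrite /L (eq_bigr _ (fun i _ => arc_length0 (c i))) sumr_const card_ord mulr_natr.
pose k := pi * Num.sqrt (c i0) * lat_integral R 1 0.
have k0 : 0 < k by rewrite !mulr_gt0 ?pi_gt0 ?sqrtr_gt0 //; exact: (@lat_integral_gt0 R 1).
have W0 : 0 <= W by apply: le_trans nW; rewrite mulr_ge0 // pi_ge0.
have A0 : 0 <= W / k by rewrite divr_ge0 // ltW.
have LA : W <= L (W / k).
  rewrite /L (bigD1 i0) //=.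
  apply: le_trans (_ : arc_length (W / k) (c i0) <= _).
    by have := arc_length_ge A0 (andP (c01 i0)).1; rewrite -/k divfK // gt_eqF.
  rewrite lerDl sumr_ge0 // => i _; rewrite Rintegral_ge0 // => r _.
  exact: ltW (arc_speed_gt0 _ _ (andP (c01 i)).1).
have [|a _ aE] := @IVT R L 0 (W / k) W A0 (continuous_subspaceT cL).
  by rewrite ge_min le_max L0 nW LA orbT.
by exists a.
Unshelve. all: by end_near. Qed.

Lemma sum_even_odd (V : nmodType) n (F : nat -> V) :
  \sum_(k < n.*2) F k = \sum_(i < n) (F i.*2 + F i.*2.+1).
Proof.
by elim: n => [|n IH]; rewrite ?big_ord0 // doubleS !big_ord_recr /= IH addrA.
Qed.

(** * The curve through all the meridians and its weight *)

Definition merid_curve (R : realType) p K (a : R) (y : 'I_K.+1 -> 'rV[R]_p.+3) : R -> 'rV[R]_p.+3 :=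
  glue K.+1.*2 (merid_piece a y).

(** Half the weight of the node, which is shared by two meridians, times the normalized density of
    the polar angle; the division by the speed cancels the factor [|g'|] of the line integral. *)
Definition merid_weight_piece (R : realType) p K (a : R) (y : 'I_K.+1 -> 'rV[R]_p.+3)
    (c : 'I_K.+1 -> R) (k : int) (r : R) : R :=
  c (inord `|k|./2) / 2 / lat_integral R p.+1 0 * sin (pi * r) ^+ p.+1 /
  arc_speed a (equatorial_radius2 (y (inord `|k|./2))) r.

Definition merid_weight (R : realType) p K (a : R) (y : 'I_K.+1 -> 'rV[R]_p.+3)
    (c : 'I_K.+1 -> R) : R -> R :=
  glue K.+1.*2 (merid_weight_piece a y c).

Lemma sinpi_gt0 (R : realType) (r : R) : 0 < r < 1 -> 0 < sin (pi * r).
Proof.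
by move=> /andP[r0 r1]; apply: sin_gt0_pi; rewrite mulr_gt0 ?pi_gt0 //= gtr_pMr ?pi_gt0.
Qed.

Lemma arc_param_itv (R : realType) b (r : R) : 0 <= r <= 1 -> 0 <= arc_param b r <= pi.
Proof.
move=> /andP[r0 r1]; have p0 := @pi_ge0 R; rewrite /arc_param; case: b.
  by rewrite mulr_ge0 ?subr_ge0 //= ler_piMr // gerBl.
by rewrite mulr_ge0 //= ler_piMr.
Qed.

Lemma signed_node_inj (R : realType) p K (y : 'I_K.+1 -> 'rV[R]_p.+3) (k l : nat) :
  (forall i, equator (y i)) -> (forall i j, y i = y j \/ y i = - y j -> i = j) ->
  (k < K.+1.*2)%N -> (l < K.+1.*2)%N ->
  (-1) ^+ odd k *: y (inord k./2) = (-1) ^+ odd l *: y (inord l./2) -> k = l.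
Proof.
move=> ey yinj kK lK E.
have lt m : (m < K.+1.*2)%N -> (m./2 < K.+1)%N by rewrite ltn_half_double.
have e0 i : y i <> 0.
  move=> y0; have [/sphere_sum h _] := ey i; move: h; rewrite y0.
  by rewrite big1 => [/eqP|j _]; rewrite ?mxE ?expr0n // eq_sym oner_eq0.
have n0 i : - y i <> y i.
  move=> E'; apply: (e0 i); apply/rowP => j.
  by have := congr1 (fun z : 'rV[R]_p.+3 => z 0 j) E'; rewrite !mxE; lra.
have half : k./2 = l./2.
  suff E2 : inord k./2 = inord l./2 :> 'I_K.+1.
    by rewrite -(@inordK K k./2) ?lt // E2 inordK // lt.
  apply: yinj.
  move: E; case: (odd k); case: (odd l); rewrite ?expr1 ?expr0 ?scaleN1r ?scale1r => E.
  - by left; apply: oppr_inj.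
  - by right; rewrite -E opprK.
  - by right.
  - by left.
rewrite -(odd_double_half k) -(odd_double_half l) half; congr addn.
move: E; rewrite half; case: (odd k); case: (odd l) => //; rewrite ?expr1 ?expr0 ?scaleN1r ?scale1r => E.
- by case: (n0 _ E).
- by case: (n0 _ (esym E)).
Qed.

Lemma merid_curve_closed (R : realType) p K (a : R) (y : 'I_K.+1 -> 'rV[R]_p.+3) :
  merid_curve a y 0 = merid_curve a y 1.
Proof.
rewrite /merid_curve glue_end /glue mulr0 floor0 subr0.
apply/rowP => j; rewrite !mxE !sin_arc_param mulr0 sin0 !mul0r.
by case: eqP => // _; rewrite /= odd_double.
Qed.

(** The last coordinate determines the polar angle. Off the poles, two points with the same polar
    angle have been rotated by the same angle, so their signed nodes agree, and with them the
    piece. *)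
Lemma merid_curve_eq (R : realType) p K (a : R) (y : 'I_K.+1 -> 'rV[R]_p.+3) (s1 s2 : R) :
  (forall i, equator (y i)) -> (forall i j, y i = y j \/ y i = - y j -> i = j) ->
  0 <= s1 -> s1 < s2 -> s2 <= 1 -> merid_curve a y s1 = merid_curve a y s2 ->
  (exists2 k, (k <= K.+1.*2)%N & s1 = K.+1.*2%:R^-1 * k%:R) /\
  (exists2 k, (k <= K.+1.*2)%N & s2 = K.+1.*2%:R^-1 * k%:R).
Proof.
move=> ey yinj s10 s12 s21.
have N0 : (0 < K.+1.*2)%N by [].
have [|k1 [r1 [k1N r1i s1E l1]]] := @piece_cases_le R _ s1 N0.
  by rewrite s10 (le_trans (ltW s12)).
have [|k2 [r2 [k2N r2i s2E l2]]] := @piece_cases_le R _ s2 N0.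
  by rewrite s21 (le_trans s10) ?ltW.
rewrite s1E s2E /merid_curve !glue_piece_lt // => E.
have {}E j : merid_piece a y k1 r1 0 j = merid_piece a y k2 r2 0 j by rewrite E.
have i1 : 0 <= r1 <= 1 by rewrite (andP r1i).1 ltW // (andP r1i).2.
have i2 : 0 <= r2 <= 1 by rewrite (andP r2i).1 ltW // (andP r2i).2.
have psiE : arc_param (odd k1) r1 = arc_param (odd k2) r2.
  have := E ord_max; rewrite !mxE eqxx => /oppr_inj; apply: cos_inj; rewrite ?in_itvcc; exact: arc_param_itv.
have sinE : sin (pi * r1) = sin (pi * r2).
  by rewrite -(sin_arc_param (odd k1)) psiE sin_arc_param.
have brk (r : R) (k : nat) : 0 <= r < 1 -> (0 < r -> False) -> (k <= K.+1.*2)%N ->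
    exists2 l, (l <= K.+1.*2)%N & K.+1.*2%:R^-1 * r + K.+1.*2%:R^-1 * k%:R = K.+1.*2%:R^-1 * l%:R.
  move=> /andP[r0 _] rn kt; exists k => //; move: r0; rewrite le_eqVlt => /orP[/eqP <-|/rn //].
  by rewrite mulr0 add0r.
have pos (r r' : R) : 0 <= r < 1 -> 0 <= r' < 1 -> sin (pi * r) = sin (pi * r') -> 0 < r -> 0 < r'.
  move=> /andP[_ rl] /andP[r'0 _] e r0; rewrite lt_neqAle r'0 andbT; apply/eqP => r'E.
  by have := @sinpi_gt0 R r; rewrite r0 rl e -r'E mulr0 sin0 ltxx => /(_ isT).
have no : 0 < r1 -> False.
  move=> r10; have r20 := pos _ _ r1i r2i sinE r10.
  have sp : 0 < sin (pi * r1) by apply: sinpi_gt0; rewrite r10 (andP r1i).2.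
  have nodes : (-1) ^+ odd k1 *: y (inord k1./2) = (-1) ^+ odd k2 *: y (inord k2./2).
    apply: (@rot01_inj R p (a * arc_param (odd k1) r1)).
    apply/rowP => j; have [->|/negPf jm] := eqVneq j ord_max.
      by rewrite !rot01_max !mxE (ey _).2 (ey _).2 !mulr0.
    have := E j; rewrite ![merid_piece _ _ _ _ _ _]mxE jm /= !sin_arc_param sinE psiE.
    by apply: mulfI; rewrite -sinE gt_eqF.
  have kk := signed_node_inj ey yinj (l1 r10) (l2 r20) nodes.
  have rr : r1 = r2.
    move: psiE; rewrite kk /arc_param => /(mulfI (lt0r_neq0 (@pi_gt0 R))).
    by case: (odd k2) => // h; lra.
  by move: s12; rewrite s1E s2E kk rr ltxx.
split; [exact: brk|apply: brk => // r20].
by apply: no; exact: pos r2i r1i (esym sinE) r20.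
Qed.

Lemma merid_curve_self_intersections (R : realType) p K (a : R) (y : 'I_K.+1 -> 'rV[R]_p.+3) :
  (forall i, equator (y i)) -> (forall i j, y i = y j \/ y i = - y j -> i = j) ->
  finite_set (self_intersections (merid_curve a y)).
Proof.
move=> ey yinj; pose Z : set R := [set` [seq K.+1.*2%:R^-1 * k%:R : R | k <- iota 0 K.+1.*2.+1]].
apply: (@sub_finite_set _ _ (Z `*` Z)); last by apply: finite_setX; exact: finite_seq.
move=> [s1 s2] [/= s10 s12 s21 _ E].
have [[k1 k1t ->] [k2 k2t ->]] := merid_curve_eq ey yinj s10 s12 s21 E.
have inZ k : (k <= K.+1.*2)%N -> Z (K.+1.*2%:R^-1 * k%:R).
  by move=> kt; apply/mapP; exists k; rewrite // mem_iota.
by split; exact: inZ.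
Qed.

(** The sine in the density is positive in the interior of every piece, so the weight can fail to be
    positive only where the pieces meet. *)
Lemma merid_weight_positive (R : realType) p K (a : R) (y : 'I_K.+1 -> 'rV[R]_p.+3)
    (c : 'I_K.+1 -> R) : (forall i, 0 < c i) -> (forall i, equator (y i)) ->
  finite_set [set s : R | 0 <= s <= 1 /\ ~ (0 < merid_weight a y c s)].
Proof.
move=> c0 ey; pose Z : set R := [set` [seq K.+1.*2%:R^-1 * k%:R : R | k <- iota 0 K.+1.*2.+1]].
apply: (@sub_finite_set _ _ Z); last exact: finite_seq.
move=> s [s01 sn].
have [k [r [kN ri sE _]]] := @piece_cases_le R _ s (isT : (0 < K.+1.*2)%N) s01.
have [r0|r0] := ltP 0 r; last first.
  have rE : r = 0 by apply/eqP; rewrite eq_le r0 (andP ri).1.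
  by apply/mapP; exists k; rewrite ?mem_iota // sE rE mulr0 add0r.
exfalso; apply: sn; rewrite sE /merid_weight glue_piece_lt //.
have e0 := (andP (equatorial_radius2_itv (ey (inord k./2)))).1.
rewrite /merid_weight_piece divr_gt0 ?arc_speed_gt0 // mulr_gt0 //.
  by rewrite !divr_gt0 // lat_integral_gt0.
by rewrite exprn_gt0 // sinpi_gt0 // r0 (andP ri).2.
Qed.

Lemma merid_curve_length (R : realType) p K (a : R) (y : 'I_K.+1 -> 'rV[R]_p.+3) :
  (forall i, equator (y i)) ->
  [/\ forall s, off (glue_breaks K.+1.*2 [::]) s -> {for s, continuous (speed (merid_curve a y))},
    (@lebesgue_measure R).-integrable `[0, 1] (EFin \o speed (merid_curve a y)) &
    \int[@lebesgue_measure R]_(s in `[0, 1]) speed (merid_curve a y) s =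
    \sum_(k < K.+1.*2) arc_length a (equatorial_radius2 (y (inord k./2)))].
Proof.
move=> ey; have e0 i := (andP (equatorial_radius2_itv (ey i))).1.
have sE (k : nat) : speed (merid_piece a y k) = arc_speed a (equatorial_radius2 (y (inord k./2))).
  by apply/funext => r; rewrite merid_piece_speed.
have [//|k _|k _ r _|k _|h1 h2 h3] := @glue_length R p.+2 K.+1.*2 (merid_piece a y) [::].
- exact: merid_piece_smooth.
- by rewrite sE arc_speed_gt0.
- by rewrite sE; exact: arc_speed_integrable.
by split=> //; apply: (etrans h3); apply: eq_bigr => k _; rewrite sE.
Qed.

Lemma merid_curve_piecewise_smooth (R : realType) p K (a : R) (y : 'I_K.+1 -> 'rV[R]_p.+3) :
  (forall i, equator (y i)) -> piecewise_smooth (merid_curve a y).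
Proof.
move=> ey; have N0 : (0 < K.+1.*2)%N by [].
have sP (k : nat) : (k < K.+1.*2)%N -> smooth_on (off [::]) (merid_piece a y k).
  by move=> _; exact: merid_piece_smooth.
split.
- apply: glue_continuous => // k; first exact: merid_piece_match.
  by apply: continuous_subspaceT; exact: merid_piece_continuous.
- apply/smooth_off_finiteP; exists (glue_breaks K.+1.*2 [::]).
  exact: glue_row_smooth.
pose B := glue_breaks K.+1.*2 ([::] : seq R); pose g := merid_curve a y.
have S0 : 0 <= \sum_(b <- B) speed g b by rewrite sumr_ge0 // => b _; exact: speed_ge0.
exists (K.+1.*2%:R * (pi * Num.sqrt (1 + a ^+ 2)) + \sum_(b <- B) speed g b) => s s01 _.
have M0 : 0 <= K.+1.*2%:R * (pi * Num.sqrt (1 + a ^+ 2)) :> R.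
  by rewrite !mulr_ge0 ?pi_ge0 ?sqrtr_ge0.
have [sB|sB] := boolP (s \in B).
  rewrite (big_rem s) //= addrCA lerDl addr_ge0 // sumr_ge0 // => b _; exact: speed_ge0.
have [|k [r [kN rl ->]]] := @off_glue_breaks R _ [::] s N0; first by split; rewrite ?in_itvoo.
apply: le_trans (_ : K.+1.*2%:R * (pi * Num.sqrt (1 + a ^+ 2)) <= _); last by rewrite lerDl.
rewrite (glue_speed N0 (sP k kN) rl) merid_piece_speed // !ler_wpM2l ?pi_ge0 //.
rewrite ler_wsqrtr // lerD2l exprMn -mulrA ler_piMr ?sqr_ge0 //.
have /andP[e0 e1] := equatorial_radius2_itv (ey (inord k./2)).
rewrite mulr_ile1 ?sqr_ge0 //.
Qed.

Lemma Rintegral_reflect_if (R : realType) (b : bool) (f : R -> R) : continuous f ->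
  \int[@lebesgue_measure R]_(r in `[0, 1]) f (if b then 1 - r else r) =
  \int[@lebesgue_measure R]_(r in `[0, 1]) f r.
Proof. by case: b => // cf; exact: Rintegral_reflect. Qed.

Lemma rot01_path_continuous (R : realType) p (b : R) (z : 'rV[R]_p.+3) e :
  continuous (fun r => mono e (rot01 (b * r) z)).
Proof.
move=> r; apply: (continuous_comp (f := fun r => rot01 (b * r) z) (g := mono e)).
  move: r; apply: continuous_row => j r.
  exact: is_derive_continuous_at (rot01_is_derive b r z j).
exact: continuous_mono.
Qed.

(** In terms of the polar fraction [x] the direction of travel disappears: only the sign of the node
    still depends on the parity of [k]. *)
Lemma merid_piece_mono (R : realType) p K (a : R) (y : 'I_K.+1 -> 'rV[R]_p.+3) e (k : nat) (r : R) :
  let x := if odd k then 1 - r else r in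
  sin (pi * r) ^+ p.+1 * mono e (merid_piece a y k r) =
  lat_fun (\sum_i equatorial e i + p.+1) (e ord_max) x *
    mono (equatorial e) (rot01 (a * pi * x) ((-1) ^+ odd k *: y (inord k./2))).
Proof.
move=> x; have E := @mono_suspension R p.+2 e (sin (pi * r)) (- cos (pi * x))
  (rot01 (a * pi * x) ((-1) ^+ odd k *: y (inord k./2))) (merid_piece a y k r).
rewrite E => [||i /negPf im].
- have -> : sin (pi * r) = sin (pi * x) by rewrite -(sin_arc_param (odd k)).
  by rewrite /lat_fun exprD; ring.
- by rewrite mxE eqxx.
- by rewrite [merid_piece _ _ _ _ _ _]mxE im sin_arc_param /arc_param mulrA.
Qed.

(** The sum over the pieces is taken under the integral: at each polar angle the nodes, all rotated
    by the same angle, are still exact by [rot01_nodes], and what remains is the latitude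
    integral. *)
Lemma merid_curve_moments (R : realType) p K (a : R) (y : 'I_K.+1 -> 'rV[R]_p.+3)
    (c : 'I_K.+1 -> R) t (sigma : probability (borelRn R p.+3) R) (e : 'I_p.+3 -> nat) :
  uniform_on_sphere sigma -> (forall i, equator (y i)) ->
  (forall e, e ord_max = 0%N -> (\sum_i e i <= t)%N ->
    \sum_i c i / 2 * (mono e (y i) + mono e (- y i)) = sphere_moment R p.+2 e) ->
  (\sum_i e i <= t)%N ->
  let f s := mono e (merid_curve a y s) * merid_weight a y c s * speed (merid_curve a y) s in
  (@lebesgue_measure R).-integrable `[0, 1] (EFin \o f) /\
  \int[@lebesgue_measure R]_(s in `[0, 1]) f s = sphere_moment R p.+3 e.
Proof.
move=> us ey nodes et f; have N0 : (0 < K.+1.*2)%N by [].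
have e0 i := (andP (equatorial_radius2_itv (ey i))).1.
pose I0 := lat_integral R p.+1 0.
have I00 : I0 != 0 by rewrite gt_eqF // lat_integral_gt0.
pose H (b : bool) (i : 'I_K.+1) (r : R) := lat_fun (\sum_i equatorial e i + p.+1) (e ord_max) r *
    mono (equatorial e) (rot01 (a * pi * r) ((-1) ^+ b *: y i)).
have cH b i : continuous (H b i).
  by move=> r; apply: cvgM; [exact: lat_fun_continuous|exact: rot01_path_continuous].
have iH b i : (@lebesgue_measure R).-integrable `[0, 1] (EFin \o H b i).
  by apply: integrable_within01; apply: continuous_subspaceT; exact: cH.
(* [H] is the integrand in the polar fraction and [G] the same integrand in the direction of travel;
   a reflection equates their integrals. *)
pose G (k : nat) (r : R) := H (odd k) (inord k./2) (if odd k then 1 - r else r).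
have cG k : continuous (G k).
  rewrite /G; case: (odd k); last exact: cH.
  move=> r; apply: (continuous_comp (f := fun r : R => 1 - r)); last exact: cH.
  by apply: cvgB; [exact: cvg_cst|exact: cvg_id].
pose h (k : nat) (r : R) := c (inord k./2) / 2 / I0 * G k r.
have ch k : continuous (h k) by move=> r; apply: cvgM; [exact: cvg_cst|exact: cG].
have sP (k : nat) : (k < K.+1.*2)%N -> smooth_on (off [::]) (merid_piece a y k).
  by move=> _; exact: merid_piece_smooth.
have [cs _ _] := merid_curve_length a ey.
have cf s : off (glue_breaks K.+1.*2 [::]) s -> {for s, continuous f}.
  move=> so; apply: cvgM; last exact: cs.
  apply: cvgM.
    apply: (continuous_comp (f := merid_curve a y) (g := mono e)).
      have sm : smooth_on (off (glue_breaks K.+1.*2 [::])) (merid_curve a y) by exact: glue_row_smooth.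
      exact: (smooth_on_continuous sm so).
    exact: continuous_mono.
  suff sw : smooth_on (off (glue_breaks K.+1.*2 [::])) (merid_weight a y c).
    exact: (smooth_on_continuous sw so).
  apply: glue_smooth => // k _.
  apply: smooth_onM.
    apply: smooth_onM; first exact: smooth_on_cst.
    apply: smooth_onX; apply: smooth_on_sin; apply: smooth_onM; first exact: smooth_on_cst.
    exact: smooth_on_id.
  have sE : speed (merid_piece a y k) = arc_speed a (equatorial_radius2 (y (inord k./2))).
    by apply/funext => r; rewrite merid_piece_speed.
  rewrite -sE; apply: smooth_on_inv => [r _|]; first by rewrite sE gt_eqF // arc_speed_gt0.
  apply: smooth_on_speed; [exact: open_off|exact: merid_piece_smooth|].
  by move=> r _; rewrite sE arc_speed_gt0.
have [] := @piecewise_integral R K.+1.*2 [::] f h N0 cf.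
- by move=> k _ r _; exact: ch.
- move=> k kN r ro; have /off_nil/andP[r0 r1] := ro.
  have r01 : 0 <= r < 1 by rewrite ltW.
  rewrite /f /merid_curve /merid_weight (glue_speed N0 (sP k kN) ro) !glue_piece_lt //.
  rewrite merid_piece_speed // /merid_weight_piece /h /G /H -/I0.
  have <- := merid_piece_mono a y e k r.
  have s0 : arc_speed a (equatorial_radius2 (y (inord k./2))) r != 0.
    by rewrite gt_eqF // arc_speed_gt0.
  by field; rewrite I00.
- move=> k _; apply: integrable_within01; apply: continuous_subspaceT; exact: ch.
move=> fi fE; split=> //; apply: (etrans fE).
have hE (k : nat) :
    \int[@lebesgue_measure R]_(r in `[0, 1]) h k r =
    c (inord k./2) / 2 / I0 * \int[@lebesgue_measure R]_(r in `[0, 1]) H (odd k) (inord k./2) r.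
  have Gi : (@lebesgue_measure R).-integrable `[0, 1] (EFin \o G k).
    by apply: integrable_within01; apply: continuous_subspaceT; exact: cG.
  have -> : \int[@lebesgue_measure R]_(r in `[0, 1]) H (odd k) (inord k./2) r =
      \int[@lebesgue_measure R]_(r in `[0, 1]) G k r.
    exact: (esym (Rintegral_reflect_if (odd k) (cH (odd k) (inord k./2)))).
  by rewrite -RintegralZl.
rewrite (eq_bigr _ (fun (k : 'I_K.+1.*2) _ => hE k)).
rewrite (sum_even_odd K.+1 (fun k : nat => c (inord k./2) / 2 / I0 *
  \int[@lebesgue_measure R]_(r in `[0, 1]) H (odd k) (inord k./2) r)).
have [jH iJ] : (forall i, (@lebesgue_measure R).-integrable `[0, 1]
      (EFin \o (fun r => 1 * H false i r + 1 * H true i r))) /\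
    (forall i, \int[@lebesgue_measure R]_(r in `[0, 1]) (1 * H false i r + 1 * H true i r) =
      1 * \int[@lebesgue_measure R]_(r in `[0, 1]) H false i r +
      1 * \int[@lebesgue_measure R]_(r in `[0, 1]) H true i r).
  by split=> i; have [] := Rintegral_lincomb 1 1 (iH false i) (iH true i).
have [_ sE] := @Rintegral_sum R _ _ (@lebesgue_measure R) `[0, 1]%classic _
  (fun i r => 1 * H false i r + 1 * H true i r) (fun i => c i / 2 / I0) (measurable_itv _) jH.
transitivity (\sum_i c i / 2 / I0 *
    \int[@lebesgue_measure R]_(r in `[0, 1]) (1 * H false i r + 1 * H true i r)).
  apply: eq_bigr => i _; rewrite iJ !mul1r /= odd_double doubleK uphalf_double /= inord_val.
  by rewrite mulrDr.
apply: (etrans (esym sE)).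
have em : equatorial e ord_max = 0%N by rewrite /equatorial eqxx.
have el : (\sum_i equatorial e i <= t)%N.
  by apply: leq_trans et; rewrite [leqRHS]sum_equatorial leq_addr.
rewrite sphere_moment_lat /lat_moment -/I0.
have li := @lat_fun_integrable R (\sum_i equatorial e i + p.+1) (e ord_max).
have [_ lE] := Rintegral_lincomb (sphere_moment R p.+2 (equatorial e) / I0) 0 li li.
rewrite [0 * Rintegral _ _ _]mul0r [X in _ = X]addr0 in lE.
transitivity (sphere_moment R p.+2 (equatorial e) / I0 *
  lat_integral R (\sum_i equatorial e i + p.+1) (e ord_max)); last by ring.
apply: (etrans _ lE); apply: eq_Rintegral => r _.
rewrite mul0r addr0 -(rot01_nodes (a * pi * r) us nodes em el) !mulr_suml.
apply: eq_bigr => i _; rewrite /H expr0 expr1 scale1r scaleN1r; ring.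
Qed.

Lemma merid_curve_polyfun (R : realType) p K (a : R) (y : 'I_K.+1 -> 'rV[R]_p.+3)
    (c : 'I_K.+1 -> R) t (sigma : probability (borelRn R p.+3) R) (P : mpoly p.+3 R) :
  uniform_on_sphere sigma -> (forall i, equator (y i)) ->
  (forall e, e ord_max = 0%N -> (\sum_i e i <= t)%N ->
    \sum_i c i / 2 * (mono e (y i) + mono e (- y i)) = sphere_moment R p.+2 e) ->
  (msize P <= t.+1)%N ->
  let f s := polyfun P (merid_curve a y s) * merid_weight a y c s * speed (merid_curve a y) s in
  (@lebesgue_measure R).-integrable `[0, 1] (EFin \o f) /\
  (\int[@lebesgue_measure R]_(s in `[0%R, 1%R]) (f s)%:E =
   \int[sigma]_(x in sphere p.+2) (polyfun P x)%:E)%E.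
Proof.
move=> us ey nodes Pt f.
pose m i := tnth (in_tuple (msupp P)) i.
have mt i : (\sum_j m i j <= t)%N.
  have := msize_mdeg_lt (mem_tnth i (in_tuple (msupp P))).
  by rewrite -mdegE => h; rewrite -ltnS (leq_trans h Pt).
have [fi fE] := @Rintegral_sum R _ _ (@lebesgue_measure R) `[0, 1]%classic _
  (fun i s => mono (m i) (merid_curve a y s) * merid_weight a y c s * speed (merid_curve a y) s)
  (fun i => mcoeff (m i) P) (measurable_itv _)
  (fun i => (merid_curve_moments a us ey nodes (mt i)).1).
have ff : f = fun s => \sum_i mcoeff (m i) P *
    (mono (m i) (merid_curve a y s) * merid_weight a y c s * speed (merid_curve a y) s).
  apply/funext => s; rewrite /f polyfunE big_tnth !mulr_suml.
  by apply: eq_bigr => i _; rewrite !mulrA.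
rewrite -ff in fi fE; split; first exact: fi.
rewrite sphere_integral_polyfun // big_tnth integral_EFin_Rintegral //.
congr EFin; apply: (etrans fE); apply: eq_bigr => i _; congr (_ * _).
exact: (merid_curve_moments a us ey nodes (mt i)).2.
Qed.

Lemma merid_curve_design (R : realType) p K (a : R) (y : 'I_K.+1 -> 'rV[R]_p.+3)
    (c : 'I_K.+1 -> R) t (sigma : probability (borelRn R p.+3) R) :
  uniform_on_sphere sigma -> (forall i, equator (y i)) ->
  (forall i j, y i = y j \/ y i = - y j -> i = j) ->
  (forall e, e ord_max = 0%N -> (\sum_i e i <= t)%N ->
    \sum_i c i / 2 * (mono e (y i) + mono e (- y i)) = sphere_moment R p.+2 e) ->
  strict_weighted_design_curve sigma t (merid_curve a y) (merid_weight a y c).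
Proof.
move=> us ey yinj nodes; split.
- by move=> s s01; apply: glue_range => // k r _; exact: merid_piece_sphere.
- exact: merid_curve_piecewise_smooth.
- exact: merid_curve_closed.
- exact: merid_curve_self_intersections.
- by move=> P Pt; exact: (merid_curve_polyfun a us ey nodes Pt).
Qed.

(** The second moment of the first coordinate is positive, so some node has a component in the plane
    of rotation; this is what lets the twist lengthen the curve. Degree 2 has to be within the
    exactness, hence [2 <= t]. *)
Lemma equatorial_design_nondegenerate (R : realType) p K (y : 'I_K -> 'rV[R]_p.+3)
    (c : 'I_K -> R) t : (2 <= t)%N ->
  (forall e, e ord_max = 0%N -> (\sum_i e i <= t)%N ->
    \sum_i c i / 2 * (mono e (y i) + mono e (- y i)) = sphere_moment R p.+2 e) ->
  exists i, 0 < equatorial_radius2 (y i).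
Proof.
move=> t2 nodes; apply: contrapT => no.
have y0 i : y i 0 ord0 = 0.
  apply/eqP; rewrite -sqrf_eq0 eq_le sqr_ge0 andbT leNgt; apply/negP => h; apply: no.
  by exists i; rewrite ltr_wpDr // sqr_ge0.
pose e (i : 'I_p.+3) : nat := if i == ord0 then 2 else 0.
have se : (\sum_i e i = 2)%N.
  by rewrite (bigD1 ord0) //= /e eqxx big1 // => i /negPf ->.
have := nodes e; rewrite se t2 => /(_ erefl isT).
have m0 (x : 'rV[R]_p.+3) : x 0 ord0 = 0 -> mono e x = 0.
  by move=> x0; rewrite /mono (bigD1 ord0) //= x0 /e eqxx expr0n mul0r.
rewrite big1 => [|i _]; last by rewrite !m0 ?mxE ?y0 ?oppr0 // addr0 mulr0.
apply/eqP; rewrite lt_eqF // /sphere_moment divr_gt0 // ltr0n ?rho_gt0 //.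
by apply: prodn_gt0 => i; rewrite /e; case: eqP.
Qed.

Lemma meridian_design_curves (R : realType) p (sigma : probability (borelRn R p.+3) R) :
  uniform_on_sphere sigma ->
  exists Wd : R, 0 < Wd /\
    forall (t : nat) (W : R), (0 < t)%N -> Wd * t%:R ^+ p.+1 <= W ->
      exists (g : R -> 'rV[R]_p.+3) (w : R -> R),
        [/\ weighted_design_curve sigma t g w, curve_length g = W%:E
          & finite_set [set s : R | 0 <= s <= 1 /\ ~ (0 < w s)]].
Proof.
(* Each untwisted meridian has length [pi]. Their number is at most [2 ((2 t + 1) ^ (p + 1) + 1)],
   which is at most [2 (3 ^ (p + 1) + 1) t ^ (p + 1)] since [2 t + 1 <= 3 t]. *)
move=> us; exists (pi * (3 ^ p.+1).+1.*2%:R); split; first by rewrite mulr_gt0 ?pi_gt0.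
move=> t W t0 tW.
have [[|K] [y [c [//kb ey c0 nodes2 yinj]]]] := @equatorial_design R p.+1 t sigma us.
have nodes e : e ord_max = 0%N -> (\sum_i e i <= t)%N ->
    \sum_i c i / 2 * (mono e (y i) + mono e (- y i)) = sphere_moment R p.+2 e.
  by move=> em et; apply: nodes2 => //; rewrite -addnn (leq_trans et) // leq_addr.
(* The nodes are exact in degree [2 t], so degree 2 is available even for [t = 1]. *)
have t2 : (2 <= t.*2)%N by rewrite -(leq_double 1) in t0.
have [i0 ci0] := equatorial_design_nondegenerate t2 nodes2.
pose r2 (k : 'I_K.+1.*2) := equatorial_radius2 (y (inord k./2)).
have KN : (K.+1.*2 <= (3 ^ p.+1).+1.*2 * t ^ p.+1)%N.
  rewrite -doubleMl leq_double (leq_trans kb) // mulSn addnC -addn1 leq_add ?expn_gt0 ?t0 //.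
  by rewrite -expnMn leq_exp2r // (mulnDl 2 1) mul2n mul1n -addn1 leq_add2l.
have r2W : exists a, \sum_k arc_length a (r2 k) = W.
  apply: arc_length_total.
  - by move=> k; exact: equatorial_radius2_itv.
  - have i2 : (i0.*2 < K.+1.*2)%N by rewrite ltn_double.
    by exists (Ordinal i2); rewrite /r2 /= doubleK inord_val.
  - apply: le_trans tW; rewrite -mulrA ler_wpM2l ?pi_ge0 // -natrX -natrM ler_nat //.
have [a aW] := r2W.
exists (merid_curve a y), (merid_weight a y c); split.
- by left; exact: merid_curve_design.
- have [_ gi gE] := merid_curve_length a ey.
  by rewrite /curve_length integral_EFin_Rintegral //; congr EFin; rewrite -aW; exact: gE.
- exact: merid_weight_positive.
Qed.

Theorem theorem1p2 (R : realType) :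
  (forall (d : nat) (sigma : probability (borelRn R d.+1) R),
    (2 <= d)%N -> uniform_on_sphere sigma ->
    exists Wd : R, 0 < Wd /\
      forall (t : nat) (W : R), (0 < t)%N -> Wd * t%:R ^+ (d - 1) <= W ->
        exists (g : R -> 'rV[R]_d.+1) (w : R -> R),
          [/\ weighted_design_curve sigma t g w,
              curve_length g = W%:E
            & finite_set [set s : R | 0 <= s <= 1 /\ ~ (0 < w s)]])
  /\
  (forall (t : nat) (sigma : probability (borelRn R 3) R),
    (0 < t)%N -> uniform_on_sphere sigma ->
    weighted_design_curve sigma (2 * t - 1) (alpha t)
      (fun s => (speed (alpha t) s)^-1) /\
    curve_length (@alpha R t) = (2 * pi * t%:R)%:E)
  /\
  (forall (t : nat) (sigma : probability (borelRn R 4) R),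
    (0 < t)%N -> uniform_on_sphere sigma ->
    (forall theta : R -> R, admissible_angle theta ->
      weighted_design_curve sigma (4 * t - 1) (gamma t theta)
        (fun s => (speed (gamma t theta) s)^-1) /\
      ((2 * pi * Num.sqrt (4 * t%:R ^+ 4 + 1))%:E <=
         curve_length (gamma t theta))%E) /\
    (exists2 theta : R -> R, admissible_angle theta &
      curve_length (gamma t theta) =
        (2 * pi * Num.sqrt (4 * t%:R ^+ 4 + 1))%:E)).
Proof.
split; [|split].
- move=> [|[|p]] sigma // _ us; rewrite subn1; exact: meridian_design_curves.
- move=> t sigma t0 us; split; first exact: alpha_design.
  by have [] := alpha_length R t0.
move=> t sigma t0 us; split; last exact: gamma_length_eq.
by move=> theta ht; split; [exact: gamma_design|exact: gamma_length_ge].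
Qed.
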